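(* Let $\ell\in(0,+\infty)$ and let $f^\ell_{\rm hom}$ be the homogenized volume integrand (as defined in the context). Then the function $f^\ell_{\rm hom}$ is not $2$-homogeneous.
   Context: Let $n\ge2$ and let $\Omega\subset\mathbb R^n$ be open, bounded, with Lipschitz boundary; $\mathcal A(\Omega)$ is the class of open subsets of $\Omega$. $Q_r:=(-r/2,r/2)^n$, $Q:=Q_1$, $P:=\mathbb R^n\setminus\bigcup_{i\in\mathbb Z^n}(i+\overline{Q_{1/2}})$, and $\varepsilon P$ is its $\varepsilon$-dilation. The weights satisfy $0<\beta_\varepsilon\le1$, $\beta_\varepsilon\searrow0$ as $\varepsilon\to0$, and $\ell:=\lim_{\varepsilon\to0}\beta_\varepsilon/\varepsilon$ exists. $GSBV(U)$ is the set of $u\in L^1(U)$ with $(u\wedge m)\vee(-m)\in SBV(U)$ for all $m\in\mathbb N$; $GSBV^2(U)$ is the set of $u\in GSBV(U)$ with $\nabla u\in L^2(U)$ and $\mathcal H^{n-1}(S_u)<+\infty$. For $u\in L^1(\Omega)$, $U\in\mathcal A(\Omega)$, $$F_\varepsilon(u,U):=\int_U|\nabla u|^2dx+\mathcal H^{n-1}(S_u\cap(U\cap\varepsilon P))+\beta_\varepsilon\mathcal H^{n-1}(S_u\cap(U\setminus\varepsilon P))$$ if $u\in GSBV^2(U)$, and $+\infty$ otherwise. Convergence in $\Omega\cap\varepsilon P$: $u_\varepsilon\to u$ means there is $(\tilde u_\varepsilon)\subset L^1(\Omega)$ with $\tilde u_\varepsilon=u_\varepsilon$ in $\Omega\cap\varepsilon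 P$ and $\tilde u_\varepsilon\to u$ strongly in $L^1(\Omega)$. For a sequence $\varepsilon_k\searrow0$ put $F'(u,U):=\inf\{\liminf_kF_{\varepsilon_k}(u_k,U):u_k\to u\}$ and $F''(u,U):=\inf\{\limsup_kF_{\varepsilon_k}(u_k,U):u_k\to u\}$, with this convergence. Homogenized volume integrand: $(\varepsilon_k)$ is a fixed sequence of positive numbers decreasing to $0$ for which there are a convex function $f^\ell_{\rm hom}\colon\mathbb R^n\to[0,+\infty)$ and a Borel function $g^\ell_{\rm hom}\colon\mathbb R\times\mathbb S^{n-1}\to[0,+\infty)$ with $$F'(u,U)=F''(u,U)=\int_Uf^\ell_{\rm hom}(\nabla u)\,dx+\int_{S_u\cap U}g^\ell_{\rm hom}([u],\nu_u)\,d\mathcal H^{n-1}$$ for all $u\in GSBV^2(\Omega)$, $U\in\mathcal A(\Omega)$, where $[u]=u^+-u^-$ (every sequence decreasing to zero has such a subsequence; $f^\ell_{\rm hom}$ may depend on it). $f$ is $2$-homogeneous if $f(\lambda\xi)=\lambda^2f(\xi)$ for all $\lambda\in\mathbb R$, $\xi\in\mathbb R^n$. *)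

(* Defs.v *)
From HB Require Import structures.
From mathcomp Require Import all_boot all_order all_algebra.
From mathcomp Require Import all_classical all_reals all_analysis.

Set Implicit Arguments.
Unset Strict Implicit.
Unset Printing Implicit Defensive.
Import Order.TTheory GRing.Theory Num.Theory.
Import numFieldNormedType.Exports.
Local Open Scope classical_set_scope.
Local Open Scope ring_scope.

Section euclid.
Context {R : realType} {n : nat}.
Implicit Types x y : 'rV[R]_n.

Definition dot x y : R := \sum_(i < n) x 0 i * y 0 i.

(* The library norm on ['rV[R]_n] is the sup norm; metric notions below use
   this Euclidean norm. *)
Definition enorm x : R := Num.sqrt (dot x x).

Definition eball x (r : R) : set 'rV[R]_n := [set y | enorm (y - x) < r].

Definition sphere : set 'rV[R]_n := [set nu | enorm nu = 1].

Definition basis (i : 'I_n) : 'rV[R]_n := delta_mx 0 i.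

Definition ediam (A : set 'rV[R]_n) : \bar R :=
  ereal_sup [set (enorm (x - y))%:E | x in A & y in A].

End euclid.
Arguments sphere {R n}.

(* Outer measures built from a set function [tau] by coverings: the library's
   [mu_ext] takes covers by measurable sets, so it is used on a copy of [T]
   in which every set is measurable; sets not allowed in the covers get
   [tau] = +oo. *)
Definition all_sets (T : Type) : Type := T.

Section all_sets.
Variable T : pointedType.
Let msets : set (set T) := setT.
Let msets0 : msets set0. Proof. by []. Qed.
Let msetsC A : msets A -> msets (~` A). Proof. by []. Qed.
Let msetsU (F : (set T)^nat) : (forall i, msets (F i)) ->
  msets (\bigcup_i F i). Proof. by []. Qed.
HB.instance Definition _ := Pointed.on (all_sets T).
HB.instance Definition _ := @isMeasurable.Build default_measure_display
  (all_sets T) msets msets0 msetsC msetsU.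
End all_sets.

Definition cover_measure {R : realType} {T : pointedType}
    (tau : set T -> \bar R) : set T -> \bar R :=
  @mu_ext _ (all_sets T) R tau.

Section lebesgue.
Context (R : realType) (n : nat).
Local Open Scope ereal_scope.

Definition box (a b : 'rV[R]_n) : set 'rV[R]_n :=
  [set x | forall i, (a 0 i <= x 0 i < b 0 i)%R].

Definition box_cost (A : set 'rV[R]_n) : \bar R :=
  if A == set0 then 0 else
  ereal_inf [set (\prod_(i < n) (ab.2 0 i - ab.1 0 i)%R)%:E | ab in
    [set ab : 'rV[R]_n * 'rV[R]_n |
      (forall i, (ab.1 0 i <= ab.2 0 i)%R) /\ A = box ab.1 ab.2]].

Lemma box_cost0 : box_cost set0 = 0.
Proof. by rewrite /box_cost eqxx. Qed.

Lemma box_cost_ge0 A : 0 <= box_cost A.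
Proof.
rewrite /box_cost; case: ifP => // _; apply: le_ereal_inf_tmp => _ [ab [ab_le _] <-].
by rewrite lee_fin; apply: prodr_ge0 => i _; rewrite subr_ge0.
Qed.

Definition lebesgue_outer : set 'rV[R]_n -> \bar R := cover_measure box_cost.

HB.instance Definition _ := isOuterMeasure.Build R 'rV[R]_n lebesgue_outer
  (@mu_ext0 _ (all_sets 'rV[R]_n) R _ box_cost0 box_cost_ge0)
  (@mu_ext_ge0 _ (all_sets 'rV[R]_n) R _ box_cost_ge0)
  (@le_mu_ext _ (all_sets 'rV[R]_n) R box_cost)
  (@mu_ext_sigma_subadditive _ (all_sets 'rV[R]_n) R _ box_cost_ge0).

End lebesgue.

Section hausdorff.
Context (R : realType) (n : nat) (s : nat).
Local Open Scope ereal_scope.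

Definition ball_volume (m : nat) : \bar R :=
  lebesgue_outer [set x : 'rV[R]_m | (enorm x <= 1)%R].

Definition diam_cost (delta : R) (A : set 'rV[R]_n) : \bar R :=
  if A == set0 then 0 else
  if ediam A <= delta%:E then
    ball_volume s * ((fine (ediam A) / 2) ^+ s)%:E
  else +oo.

Lemma diam_cost0 delta : diam_cost delta set0 = 0.
Proof. by rewrite /diam_cost eqxx. Qed.

Lemma diam_cost_ge0 delta A : 0 <= diam_cost delta A.
Proof.
rewrite /diam_cost; case: eqVneq => // /set0P[x Ax]; case: ifP => // _.
apply: mule_ge0; first exact: outer_measure_ge0.
rewrite lee_fin exprn_ge0// divr_ge0//; apply: fine_ge0.
apply: le_trans (ereal_sup_ubound _).
  2: by exists x => //; exists x.
by rewrite lee_fin sqrtr_ge0.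
Qed.

Definition hausdorff_pre delta : set 'rV[R]_n -> \bar R :=
  cover_measure (diam_cost delta).

(* The [s]-dimensional Hausdorff measure, normalized so as to agree with
   [s]-dimensional volume. *)
Definition hausdorff_outer (A : set 'rV[R]_n) : \bar R :=
  ereal_sup [set hausdorff_pre delta A | delta in [set d : R | (0 < d)%R]].

Lemma hausdorff_pre_ge0 delta A : 0 <= hausdorff_pre delta A.
Proof. exact: (@mu_ext_ge0 _ (all_sets 'rV[R]_n) R _ (diam_cost_ge0 delta)). Qed.

Lemma hausdorff_outer_ge0 A : 0 <= hausdorff_outer A.
Proof.
apply: le_trans (ereal_sup_ubound _); last by exists 1%R => //=.
exact: hausdorff_pre_ge0.
Qed.

Lemma hausdorff_outer0 : hausdorff_outer set0 = 0.
Proof.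
apply/eqP; rewrite eq_le hausdorff_outer_ge0 andbT.
apply: ge_ereal_sup => _ [d _ <-].
by rewrite /hausdorff_pre /cover_measure
  (@mu_ext0 _ (all_sets 'rV[R]_n) R _ (diam_cost0 d) (diam_cost_ge0 d)).
Qed.

Lemma le_hausdorff_outer : {homo hausdorff_outer : A B / A `<=` B >-> A <= B}.
Proof.
move=> A B AB; apply: ge_ereal_sup => _ [d d0 <-].
apply: le_trans (ereal_sup_ubound _); last by exists d.
exact: (@le_mu_ext _ (all_sets 'rV[R]_n) R).
Qed.

Lemma hausdorff_outer_sigma_subadditive : sigma_subadditive hausdorff_outer.
Proof.
move=> A; apply: ge_ereal_sup => _ [d d0 <-].
apply: le_trans (@mu_ext_sigma_subadditive _ (all_sets 'rV[R]_n) R _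
  (diam_cost_ge0 d) A) _.
apply: lee_nneseries => [k _ _|k _]; first exact: hausdorff_pre_ge0.
by apply: ereal_sup_ubound; exists d.
Qed.

HB.instance Definition _ := isOuterMeasure.Build R 'rV[R]_n hausdorff_outer
  hausdorff_outer0 hausdorff_outer_ge0 le_hausdorff_outer
  hausdorff_outer_sigma_subadditive.

End hausdorff.

(* Integrals are taken with respect to the Caratheodory restrictions of the
   outer measures (for Lebesgue: the Lebesgue sigma-algebra). *)
Definition caratheodory_restr {R : realType} {T : pointedType}
    (mu : {outer_measure set T -> \bar R}) :
    {measure set (caratheodory_type mu) -> \bar R} :=
  (mu : set (caratheodory_type mu) -> \bar R).

Definition leb (R : realType) (n : nat) :=
  caratheodory_restr (@lebesgue_outer R n).

Definition haus (R : realType) (n s : nat) :=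
  caratheodory_restr (@hausdorff_outer R n s).

Section bv.
Context (R : realType) (n : nat).
Implicit Types (u phi : 'rV[R]_n -> R) (U A : set 'rV[R]_n) (x y : 'rV[R]_n).

Definition L1 U u := (leb R n).-integrable U (EFin \o u).

Definition L2 U u :=
  measurable_fun (U : set (caratheodory_type (@lebesgue_outer R n))) u /\
  (\int[leb R n]_(x in U) (u x ^+ 2)%:E < +oo)%E.

Definition partial (i : 'I_n) phi : 'rV[R]_n -> R := 'D_(basis i) phi.

Definition C1c U phi :=
  [/\ forall i x, derivable phi x (basis i),
      forall i, continuous (partial i phi),
      compact (closure [set x | phi x != 0]) &
      closure [set x | phi x != 0] `<=` U].

Definition divergence (Phi : 'rV[R]_n -> 'rV[R]_n) x : R :=
  \sum_(i < n) partial i (fun y => Phi y 0 i) x.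

Definition variation u U : \bar R :=
  ereal_sup [set (\int[leb R n]_(x in U) (u x * divergence Phi x))%:E | Phi in
    [set Phi : 'rV[R]_n -> 'rV[R]_n |
      (forall i, C1c U (fun x => Phi x 0 i)) /\ forall x, enorm (Phi x) <= 1]].

Definition BV U u := L1 U u /\ (variation u U < +oo)%E.

Definition density0 A x :=
  (lebesgue_outer (A `&` eball x r) * (r ^- n)%:E)%E @[r --> 0^'+] --> 0%E.

(* Approximate upper and lower limits of [u] at [x] along [A], with values in
   the extended reals; for [A = setT] these are u^+(x) and u^-(x). *)
Definition ap_limsup A u x : \bar R :=
  ereal_inf [set t%:E | t in [set t | density0 (A `&` [set y | t < u y]) x]].

Definition ap_liminf A u x : \bar R :=
  ereal_sup [set t%:E | t in [set t | density0 (A `&` [set y | u y < t]) x]].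

Definition ap_lim A u x (l : \bar R) :=
  ap_liminf A u x = l /\ ap_limsup A u x = l.

Definition usup u x := ap_limsup setT u x.
Definition uinf u x := ap_liminf setT u x.

Definition disc u : set 'rV[R]_n := [set x | (uinf u x < usup u x)%E].

(* On the negligible part of [disc u] where u^+ or u^- is infinite, this is a
   dummy value. *)
Definition jump u x : R := fine (usup u x - uinf u x)%E.

(* [nu] points towards the side of the larger trace u^+, so [jump u x] is
   positive and [nu] is unique. *)
Definition is_normal u x (nu : 'rV[R]_n) :=
  [/\ sphere nu,
      ap_lim [set y | 0 < dot (y - x) nu] u x (usup u x) &
      ap_lim [set y | dot (y - x) nu < 0] u x (uinf u x)].

Definition normal u x : 'rV[R]_n := xget 0 [set nu | is_normal u x nu].

Definition is_ap_grad u x (xi : 'rV[R]_n) :=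
  exists2 z : R, ap_lim setT u x z%:E &
    forall e : R, 0 < e -> density0
      [set y | `|u y - z - dot xi (y - x)| > e * enorm (y - x)] x.

Definition ap_grad u x : 'rV[R]_n := xget 0 [set xi | is_ap_grad u x xi].

(* u is in BV(U) and Du = \nabla u L^n + [u] \nu_u H^{n-1} restricted to S_u *)
Definition SBV U u :=
  [/\ BV U u,
      forall i, L1 U (fun x => ap_grad u x 0 i),
      (haus R n n.-1).-integrable (disc u `&` U) (EFin \o jump u) &
      forall i phi, C1c U phi ->
        \int[leb R n]_(x in U) (u x * partial i phi x) =
        - (\int[leb R n]_(x in U) (phi x * ap_grad u x 0 i) +
           \int[haus R n n.-1]_(x in disc u `&` U)
             (phi x * (jump u x * normal u x 0 i)))].

Definition truncate (m : R) u x : R := Num.max (Num.min (u x) m) (- m).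

Definition GSBV U u := L1 U u /\ forall m : nat, SBV U (truncate m%:R u).

Definition dirichlet u U : \bar R :=
  (\int[leb R n]_(x in U) (enorm (ap_grad u x) ^+ 2)%:E)%E.

Definition GSBV2 U u :=
  [/\ GSBV U u, forall i, L2 U (fun x => ap_grad u x 0 i) &
      (hausdorff_outer n.-1 (disc u `&` U) < +oo)%E].

End bv.

Section homogenization.
Context (R : realType) (n : nat).
Implicit Types (u : 'rV[R]_n -> R) (U Omega : set 'rV[R]_n).

Definition cube (r : R) : set 'rV[R]_n :=
  [set x | forall i, - (r / 2) < x 0 i < r / 2].

Definition perforated : set 'rV[R]_n :=
  ~` \bigcup_(i in [set: 'rV[int]_n])
       [set map_mx intr i + y | y in closure (cube (1 / 2))].

Definition dilated (eps : R) : set 'rV[R]_n := [set eps *: y | y in perforated].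

(* The set [Omega] is locally a strict epigraph y_n > gamma(y'), the last
   coordinate being taken along the unit vector e and y' being the orthogonal
   projection of y on the hyperplane e^\perp. *)
Definition lipschitz_boundary Omega :=
  forall x, (closure Omega `\` interior Omega) x ->
    exists (e : 'rV[R]_n) (r : R) (gamma : 'rV[R]_n -> R),
      [/\ sphere e, 0 < r, lipschitz gamma &
          Omega `&` eball x r =
          [set y | gamma (y - dot y e *: e) < dot y e] `&` eball x r].

Definition energy (beta : R -> R) (eps : R) u U : \bar R :=
  if `[< GSBV2 U u >] then
    (dirichlet u U
     + hausdorff_outer n.-1 (disc u `&` (U `&` dilated eps))
     + (beta eps)%:E * hausdorff_outer n.-1 (disc u `&` (U `\` dilated eps)))%E
  else +oo%E.

Definition perforated_cvg Omega (eps : nat -> R) (us : nat -> 'rV[R]_n -> R) u :=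
  exists ut : nat -> 'rV[R]_n -> R,
    [/\ forall k, L1 Omega (ut k),
        forall k, {ae leb R n, forall x,
          (Omega `&` dilated (eps k)) x -> ut k x = us k x} &
        (\int[leb R n]_(x in Omega) `|ut k x - u x|%:E)%E @[k --> \oo] --> 0%E].

Definition admissible Omega eps u : set (nat -> 'rV[R]_n -> R) :=
  [set us | (forall k, L1 Omega (us k)) /\ perforated_cvg Omega eps us u].

Definition energy_inf Omega beta (eps : nat -> R) u U : \bar R :=
  ereal_inf [set limn_einf (fun k => energy beta (eps k) (us k) U)
    | us in admissible Omega eps u].

Definition energy_sup Omega beta (eps : nat -> R) u U : \bar R :=
  ereal_inf [set limn_esup (fun k => energy beta (eps k) (us k) U)
    | us in admissible Omega eps u].

Definition hom_energy (f : 'rV[R]_n -> R) (g : R * 'rV[R]_n -> R) u U : \bar R :=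
  (\int[leb R n]_(x in U) (f (ap_grad u x))%:E
   + \int[haus R n n.-1]_(x in disc u `&` U) (g (jump u x, normal u x))%:E)%E.

Definition borel_on_sphere (g : R * 'rV[R]_n -> R) :=
  measurable_fun
    ([set: R] `*` sphere : set (g_sigma_algebraType (@open (R * 'rV[R]_n)%type)))
    (g : g_sigma_algebraType (@open (R * 'rV[R]_n)%type) -> R).

Definition homogenized_densities Omega beta (eps : nat -> R)
    (f : 'rV[R]_n -> R) (g : R * 'rV[R]_n -> R) :=
  [/\ convex_function [set: convex_lmodType 'rV[R]_n] f /\ (forall xi, 0 <= f xi),
      borel_on_sphere g /\ (forall t nu, sphere nu -> 0 <= g (t, nu)) &
      forall u U, GSBV2 Omega u -> open U -> U `<=` Omega ->
        energy_inf Omega beta eps u U = hom_energy f g u U /\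
        energy_sup Omega beta eps u U = hom_energy f g u U].

Definition two_homogeneous (f : 'rV[R]_n -> R) :=
  forall (lambda : R) xi, f (lambda *: xi) = lambda ^+ 2 * f xi.

End homogenization.

(* Main.v *)
Require Import Defs.
From HB Require Import structures.
From mathcomp Require Import all_boot all_order all_algebra.
From mathcomp Require Import all_classical all_reals all_analysis.
From mathcomp Require Import measurable_realfun lra ring zify.
Set Implicit Arguments.
Unset Strict Implicit.
Unset Printing Implicit Defensive.
Import Order.TTheory GRing.Theory Num.Theory.
Import numFieldNormedType.Exports.
Local Open Scope classical_set_scope.
Local Open Scope ring_scope.

(** Assume that [f] is 2-homogeneous and consider [u = sin (2 t (x_0 - a_0)) / 2]
    on a small cube [U] where the cosine is close to 1. As [u] is smooth, its
    homogenized energy on [U] is [f(e_0)] times its Dirichlet energy, which is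
    close to [t^2 |U|].

    For large [t] this gives [f(e_0) < 1]: add to [u] a multiple of order
    [t eps] of [Z(x' / eps) (1/2 - frac (x_0 / eps))], where [Z] is a bump
    function of the other coordinates concentrated inside the inclusions. The
    Dirichlet energy decreases by a quantity of order [t^2 |U|], while the cracks,
    contained in the inclusions, cost at most about [beta_eps / eps |U|], that is
    [l |U|]. The area of these cracks is computed from the isodiametric inequality.

    For small [t] it gives [f(e_0) >= 1 - C t], a contradiction. If the energy of
    [w] close to [u] is at most [t^2 |U|], then its cracks in the inclusions have
    area at most about [t^2 |U| / (l eps)], hence they are covered, up to a small
    area, by finitely many cubes of sides [r] with
    [sum r^(n-1) <= C t^2 |U| / (l eps)]. Start from a field close to [e_0] whose
    divergence vanishes in the inclusions, where [w] and [u] may differ. In each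
    layer of thickness [eps] orthogonal to [e_0] let the part of the flux meeting
    these cubes make a detour outside of the inclusions. The new field vanishes on
    the covered cracks, has the same divergence, and differs from the old one in a
    set of volume at most [C eps sum r^(n-1) <= C t^2 |U| / l]. The cracks outside
    of the inclusions have area at most [t^2 |U|], so integrating [grad w] against
    this field bounds the energy of [w] from below by [t^2 |U| (1 - C t)]. *)

(** * Boxes and Lebesgue measure *)

(** The wave replaces an affine function because it is bounded by 1/2 whatever its slope [t]. The
    upper competitor then stays within [-1, 1], so that its truncations at integer heights are
    trivial, and the competitors in the lower estimate can be truncated at height 1, which bounds
    their jumps by 2 without raising the energy or changing the wave.

    The jump part of a derivative is an integral for the Hausdorff measure, while its boundary terms
    come from Lebesgue integrals over faces of boxes. The two measures must therefore agree exactly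
    on hyperplanes, not only up to a constant; this is what forces the sharp isodiametric
    inequality.

    In the lower estimate the discontinuity set is arbitrary, and no measurability or rectifiability
    of it is used. The test field vanishes pointwise on the covered part, and the remainder is
    estimated by its outer measure. Cutting the set with countably many boxes is enough, as these
    are measurable in the sense of Caratheodory. *)

Section insertion.
Context {R : realType} {n : nat}.
Implicit Types (a b x : 'rV[R]_n.+1) (v : 'rV[R]_n) (i : 'I_n.+1).

(** Slicing identifies R^(n+1) with R x R^n through [ins i] and [del i], for any direction [i]. The
    covering inequality, the divergence theorem and the measure of hyperplanes all go through it. *)
Definition ins i (s : R) v : 'rV[R]_n.+1 := \row_j oapp (v 0) s (unlift i j).

Definition del i x : 'rV[R]_n := \row_j x 0 (lift i j).

Lemma insE i s v : ins i s v 0 i = s.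
Proof. by rewrite mxE unlift_none. Qed.

Lemma ins_lift i s v j : ins i s v 0 (lift i j) = v 0 j.
Proof. by rewrite mxE liftK. Qed.

Lemma delK i x : ins i (x 0 i) (del i x) = x.
Proof.
apply/rowP => j; case: (unliftP i j) => [k ->|->]; last by rewrite insE.
by rewrite ins_lift mxE.
Qed.

Lemma insK i s v : del i (ins i s v) = v.
Proof. by apply/rowP => j; rewrite mxE ins_lift. Qed.

Lemma box_ins i a b s v : box a b (ins i s v) <->
  a 0 i <= s < b 0 i /\ box (del i a) (del i b) v.
Proof.
split=> [ab|[abi ab] j].
  split; first by have := ab i; rewrite insE.
  by move=> j; have := ab (lift i j); rewrite ins_lift !mxE.
case: (unliftP i j) => [k ->|->]; last by rewrite insE.
by have := ab k; rewrite !mxE liftK.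
Qed.

End insertion.

Section volume.
Context {R : realType}.

Definition vol n (a b : 'rV[R]_n) : R := \prod_(i < n) (b 0 i - a 0 i).

Lemma vol_del n (i : 'I_n.+1) (a b : 'rV[R]_n.+1) :
  vol a b = (b 0 i - a 0 i) * vol (del i a) (del i b).
Proof.
by rewrite /vol (bigD1_ord i)//=; congr (_ * _); apply: eq_bigr => j _;
  rewrite !mxE.
Qed.

Lemma vol_ge0 n (a b : 'rV[R]_n) : (forall i, a 0 i <= b 0 i) -> 0 <= vol a b.
Proof. by move=> ab; apply: prodr_ge0 => i _; rewrite subr_ge0. Qed.

(* By induction on the dimension, integrating the inequality over the first
   coordinate. *)
Lemma weighted_box_cover n (a b : 'rV[R]_n) (c : R) (A B : nat -> 'rV[R]_n)
    (w : nat -> R) :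
  (forall i, a 0 i <= b 0 i) -> (forall k i, A k 0 i <= B k 0 i) ->
  (forall k, 0 <= w k) -> 0 <= c ->
  (forall x, box a b x ->
     (c%:E <= \sum_(k <oo) (w k * \1_(box (A k) (B k)) x)%:E)%E) ->
  ((c * vol a b)%:E <= \sum_(k <oo) (w k * vol (A k) (B k))%:E)%E.
Proof.
elim: n a b c A B w => [|n IH] a b c A B w ab AB w0 c0 cw.
  rewrite /vol big_ord0 mulr1; apply: le_trans (cw 0 _) _; first by case.
  apply: lee_nneseries => [k _ _|k _]; first by rewrite lee_fin mulr_ge0.
  by rewrite big_ord0 lee_fin ler_wpM2l// indicE; case: (_ \in _).
pose mu := @lebesgue_measure R.
pose i : 'I_n.+1 := ord0.
(* Weights make the induction possible: whether the slice at height [s] meets the box [k] is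
   absorbed into the weight of its projection. *)
have slice s : s \in `[a 0 i, b 0 i[ -> ((c * vol (del i a) (del i b))%:E <=
    \sum_(k <oo) (w k * vol (del i (A k)) (del i (B k)) *
                   \1_`[A k 0 i, B k 0 i[ s)%:E)%E.
  rewrite in_itv/= => sab.
  have := IH (del i a) (del i b) c (fun k => del i (A k)) (fun k => del i (B k))
    (fun k => w k * \1_`[A k 0 i, B k 0 i[ s).
  under eq_eseriesr do rewrite mulrAC.
  apply => //; [by move=> j; rewrite !mxE|by move=> k j; rewrite !mxE| |].
    by move=> k; rewrite mulr_ge0.
  move=> v vab; apply: le_trans (cw (ins i s v) _) _; first by apply/box_ins.
  apply: lee_nneseries => [k _ _|k _]; first by rewrite lee_fin mulr_ge0.
  rewrite lee_fin -mulrA ler_wpM2l// !indicE -natrM mulnb ler_nat.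
  case: (boolP (_ \in box (A k) (B k))) => // /set_mem/box_ins[sk vk].
  by rewrite !mem_set.
have Im (p q : R) : measurable (`[p, q[ : set R) by exact: measurable_itv.
have w1 k : 0 <= w k * vol (del i (A k)) (del i (B k)).
  by rewrite mulr_ge0// vol_ge0// => j; rewrite !mxE.
have lenI (p q : R) : p <= q -> mu [set` `[p, q[] = (q - p)%:E.
  move=> pq; rewrite /mu lebesgue_measure_itv/= lte_fin.
  by case: ltP => // qp; rewrite (@le_anti _ _ p q) ?pq ?qp// subrr.
pose I0 : set R := [set` `[a 0 i, b 0 i[].
have -> : ((c * vol a b)%:E = \int[mu]_(s in I0)
    (c * vol (del i a) (del i b))%:E)%E.
  rewrite integral_cst//; last exact: Im.
  rewrite [X in (_ = _ * X)%E]lenI// -EFinM (vol_del i) mulrCA.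
  by congr EFin; ring.
have -> : (\sum_(k <oo) (w k * vol (A k) (B k))%:E =
   \int[mu]_s \sum_(k <oo) (w k * vol (del i (A k)) (del i (B k)) *
                   \1_`[A k 0 i, B k 0 i[ s)%:E)%E.
  rewrite integral_nneseries//; last 2 first.
  - by move=> k; apply/measurable_EFinP; apply: measurable_funM => //.
  - by move=> k x _; rewrite lee_fin mulr_ge0.
  apply: eq_eseriesr => k _; under eq_integral do rewrite EFinM.
  rewrite ge0_integralZl_EFin//; last exact/measurable_EFinP.
  by rewrite integral_indic// setIT [X in (_ * X)%E]lenI// -EFinM (vol_del i)
    mulrAC mulrA.
have mser : measurable_fun [set: R] (fun s => \sum_(k <oo)
   (w k * vol (del i (A k)) (del i (B k)) * \1_`[A k 0 i, B k 0 i[ s)%:E)%E.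
  apply: ge0_emeasurable_sum => k.
    by move=> x _ _; rewrite lee_fin mulr_ge0.
  by move=> _; apply/measurable_EFinP; apply: measurable_funM.
apply: le_trans; last first.
  apply: (@ge0_subset_integral _ _ R (@lebesgue_measure R) I0 setT) => //.
    exact: Im.
  by move=> x _; apply: nneseries_ge0 => k _ _; rewrite lee_fin mulr_ge0.
apply: ge0_le_integral => //; first exact: Im.
- by move=> x _; rewrite lee_fin mulr_ge0// vol_ge0// => j; rewrite !mxE.
- exact: measurable_funS mser.
Qed.

(** The cost is an infimum over all ways of writing the set as a box, so the claim amounts to
    monotonicity of the volume under inclusion. This is the covering inequality with a single box of
    weight 1. *)
Lemma box_cost_box n (a b : 'rV[R]_n) : (forall i, a 0 i <= b 0 i) ->
  box_cost (box a b) = (vol a b)%:E.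
Proof.
move=> ab; rewrite /box_cost.
have volE (c d : 'rV[R]_n) : (forall i, c 0 i <= d 0 i) ->
    box a b `<=` box c d -> vol a b <= vol c d.
  move=> cd abcd.
  have /(_ a b 1 (fun=> c) (fun=> d) (fun k => (k == 0%N)%:R)) :=
    @weighted_box_cover n.
  rewrite mul1r.
  rewrite nneseries_recl//; last by move=> k _; rewrite lee_fin mulr_ge0 ?vol_ge0.
  rewrite mul1r [X in (_ + X)%E]eseries0 ?adde0; last first.
    by case=> // k _ _; rewrite mul0r.
  rewrite lee_fin; apply => // x abx.
  rewrite nneseries_recl// indicE mem_set ?mulr1; last exact: abcd.
  by rewrite leeDl// nneseries_ge0// => k _ _; rewrite lee_fin mulr_ge0.
case: eqP => [ab0|_].
  suff -> : vol a b = 0 by [].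
  (* In dimension 0 a box is the whole space, hence not empty. Otherwise an empty box lies in
     [box a a], whose volume is 0. *)
  case: n a b ab volE ab0 => [|n] a b ab volE ab0.
    by have : set0 (0 : 'rV[R]_0) by rewrite -ab0; case.
  apply/eqP; rewrite eq_le vol_ge0// andbT.
  apply: le_trans (volE a a _ _) _ => //; first by rewrite ab0; exact: sub0set.
  by rewrite /vol big_ord_recl subrr mul0r.
apply/eqP; rewrite eq_le; apply/andP; split.
  by apply: ereal_inf_lbound; exists (a, b).
apply: le_ereal_inf_tmp => _ [[c d] [/= cd abcd] <-].
by rewrite lee_fin; apply: volE => //; rewrite abcd.
Qed.

End volume.

Section cover_measure.
Context {R : realType} {T : pointedType} (tau : set T -> \bar R).

Lemma cover_measure_le A (F : (set T)^nat) : A `<=` \bigcup_k F k ->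
  (cover_measure tau A <= \sum_(k <oo) tau (F k))%E.
Proof. by move=> AF; apply: ereal_inf_lbound; exists F. Qed.

Lemma cover_measure_ge A x :
  (forall F : (set T)^nat, A `<=` \bigcup_k F k ->
    (x <= \sum_(k <oo) tau (F k))%E) ->
  (x <= cover_measure tau A)%E.
Proof. by move=> AF; apply: le_ereal_inf_tmp => _ [F [_ FA] <-]; exact: AF. Qed.

Lemma cover_measure_le1 A : tau set0 = 0%E -> (forall B, 0 <= tau B)%E ->
  (cover_measure tau A <= tau A)%E.
Proof.
move=> tau0 tau_ge0.
apply: le_trans (@cover_measure_le A (fun k => if k is 0%N then A else set0) _) _.
  by move=> x Ax; exists 0%N.
rewrite nneseries_recl// eseries0 ?adde0// => -[]//.
Qed.

End cover_measure.


Section lebesgue_boxes.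
Context {R : realType} {n : nat}.
Implicit Types (a b c x : 'rV[R]_n) (A X : set 'rV[R]_n) (i : 'I_n).
Local Open Scope ereal_scope.

Lemma box_costP A : box_cost A != +oo -> A = set0 \/
  exists a b, (forall i, (a 0%R i <= b 0%R i)%R) /\ A = box a b.
Proof.
rewrite /box_cost; have [-> _|A0 H] := eqVneq A set0; first by left.
right; apply: contrapT => nAB; move/negP: H; apply; apply/eqP.
rewrite [X in ereal_inf X](_ : _ = set0) ?ereal_inf0//.
apply/seteqP; split => // _ [[a b] /= [ab AE] _]; apply: nAB.
by exists a, b.
Qed.

Lemma lebesgue_outer_box a b : (forall i, (a 0%R i <= b 0%R i)%R) ->
  lebesgue_outer (box a b) = (vol a b)%:E.
Proof.
move=> ab; apply/eqP; rewrite eq_le; apply/andP; split.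
  rewrite -box_cost_box//; apply: cover_measure_le1; first exact: box_cost0.
  exact: box_cost_ge0.
apply: cover_measure_ge => F abF.
have [[k Fk]|Foo] := pselect (exists k, box_cost (F k) = +oo).
  by rewrite (eseries_pinfty _ _ Fk) ?leey// => k' _;
    rewrite -ltNye (lt_le_trans _ (box_cost_ge0 _)).
(* An empty member of the cover gets weight 0. A degenerate box would not do in dimension 0, where
   every box has volume 1. *)
have /choice[AB FAB] : forall k, exists AB : 'rV[R]_n * 'rV[R]_n * R,
   [/\ (forall i, (AB.1.1 0%R i <= AB.1.2 0%R i)%R), (0 <= AB.2)%R,
    box_cost (F k) = (AB.2 * vol AB.1.1 AB.1.2)%:E &
    forall x, F k x -> (1 <= AB.2 * \1_(box AB.1.1 AB.1.2) x)%R].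
  move=> k; have [|Fk0|[p [q [pq FE]]]] := @box_costP (F k).
  - by apply/eqP => Fk; apply: Foo; exists k.
  - by exists (0%R, 0%R, 0%R); split => //; rewrite Fk0 ?box_cost0 ?mul0r.
  - exists (p, q, 1%R); split => //=; first by rewrite mul1r FE box_cost_box.
    by move=> x; rewrite FE => Fx; rewrite mul1r indicE mem_set.
under eq_eseriesr => k _ do rewrite (let: And4 _ _ H _ := FAB k in H).
rewrite -[vol a b]mul1r; apply: weighted_box_cover => //.
- by move=> k; have [] := FAB k.
- by move=> k; have [] := FAB k.
move=> x /abF[k _ Fkx]; rewrite (@nneseriesD1 _ _ k)//; last first.
  by move=> j _; rewrite lee_fin mulr_ge0//; have [] := FAB j.
apply: le_trans (leeDl _ _); first by rewrite lee_fin; have [_ _ _ ->] := FAB k.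
by apply: nneseries_ge0 => j _ _; rewrite lee_fin mulr_ge0//; have [] := FAB j.
Qed.

Lemma box_eq0 a b i : (b 0%R i <= a 0%R i)%R -> box a b = set0.
Proof.
move=> ba; apply/seteqP; split => // x /(_ i)/andP[ax xb].
by have := lt_le_trans (le_lt_trans ax xb) ba; rewrite ltxx.
Qed.

Definition upd a i (m : R) : 'rV[R]_n := \row_j if j == i then m else a 0%R j.

Lemma vol_upd a b i (m : R) :
  (vol a (upd b i m) + vol (upd a i m) b = vol a b)%R.
Proof.
rewrite /vol (bigD1 i)//= [X in (_ + X)%R](bigD1 i)//= [RHS](bigD1 i)//=.
rewrite !mxE eqxx.
rewrite (eq_bigr (fun j => b 0 j - a 0 j)%R); last first.
  by move=> j /negbTE ji; rewrite mxE ji.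
rewrite [in X in (_ + _ * X)%R](eq_bigr (fun j => b 0 j - a 0 j)%R); last first.
  by move=> j /negbTE ji; rewrite mxE ji.
by rewrite -mulrDl; congr (_ * _)%R; ring.
Qed.

Definition halfspace i (c : R) : set 'rV[R]_n := [set x | (x 0%R i < c)%R].

(** Clamping [c] to the side of the box lets one formula cover the hyperplanes that miss the box as
    well. *)
Lemma box_split a b i (c : R) : (a 0%R i <= b 0%R i)%R ->
  let m := Num.max (a 0%R i) (Num.min (b 0%R i) c) in
  [/\ (a 0%R i <= m <= b 0%R i)%R,
      box a b `&` halfspace i c = box a (upd b i m) &
      box a b `\` halfspace i c = box (upd a i m) b].
Proof.
move=> ab m.
have mE : (a 0%R i <= m <= b 0%R i)%R by rewrite /m le_max lexx ge_max ab ge_min lexx.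
split => //; apply/seteqP; split => x.
- move=> [abx /= xc] j; rewrite mxE; case: eqP => [->|_]; last exact: abx.
  have /andP[-> xb] := abx i; by rewrite /m lt_max lt_min xb xc orbT.
- move=> abx; have /andP[ax xm] := abx i; rewrite mxE eqxx in xm; split.
    move=> j; have := abx j; rewrite mxE; case: eqP => // -> /andP[-> xm'] /=.
    by case/andP: mE => _; apply: lt_le_trans.
  rewrite /halfspace/=; move: xm; rewrite /m lt_max ltNge ax/= lt_min.
  by case/andP.
- move=> [abx /= /negP xc] j; rewrite mxE; case: eqP => [->|_]; last exact: abx.
  have /andP[ax ->] := abx i; rewrite andbT /m ge_max ax/= ge_min.
  by rewrite orbC leNgt xc.
- move=> abx; have /andP[mx xb] := abx i; rewrite mxE eqxx in mx; split.
    move=> j; have := abx j; rewrite mxE; case: eqP => // -> /andP[_ ->].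
    by rewrite andbT (le_trans _ mx)//; case/andP: mE.
  apply/negP; rewrite -leNgt; move: mx; rewrite /m ge_max ge_min => /andP[_].
  by case/orP=> //; rewrite leNgt xb.
Qed.

(** A hyperplane cuts each box of a cover into two boxes whose volumes add up. *)
Lemma halfspace_leb i (c : R) : (@lebesgue_outer R n).-caratheodory (halfspace i c).
Proof.
apply: le_caratheodory_measurable => X; apply: cover_measure_ge => F XF.
apply: (@le_trans _ _ (\sum_(k <oo) (lebesgue_outer (F k `&` halfspace i c) +
    lebesgue_outer (F k `&` ~` halfspace i c)))).
  rewrite nneseriesD; [|by move=> *; exact: outer_measure_ge0..].
  by apply: leeD; apply: le_trans (outer_measure_sigma_subadditive _ _);
    apply: le_outer_measure; rewrite -setI_bigcupl; exact: setSI.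
apply: lee_nneseries => [k _ _|k _].
  by rewrite adde_ge0// outer_measure_ge0.
have [->|] := eqVneq (box_cost (F k)) +oo; first by rewrite leey.
case/box_costP => [->|[a [b [ab ->]]]].
  by rewrite !set0I outer_measure0 adde0 box_cost0.
have := box_split c (ab i); set m := Num.max _ _ => -[/andP[am mb] -> E].
rewrite -setDE E box_cost_box// -(vol_upd _ _ i m) EFinD.
rewrite lebesgue_outer_box ?lebesgue_outer_box// => j; rewrite mxE; case: eqP => // ->//.
Qed.

End lebesgue_boxes.

Section carath_boxes.
Context {R : realType} {n : nat} (mu : {outer_measure set 'rV[R]_n -> \bar R}).
Hypothesis mu_halfspace : forall i c, mu.-caratheodory (@halfspace R n i c).

Lemma halfspace_box (a b : 'rV[R]_n) : mu.-caratheodory (box a b).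
Proof.
suff H (s : seq 'I_n) : mu.-caratheodory
    [set x | forall i, i \in s -> (a 0%R i <= x 0%R i < b 0%R i)%R].
  have := H (enum 'I_n); congr (mu.-caratheodory _).
  by apply/seteqP; split => x abx i; rewrite ?abx ?mem_enum.
elim: s => [|i s IH].
  rewrite [X in mu.-caratheodory X](_ : _ = ~` set0).
    exact/caratheodory_measurable_setC/caratheodory_measurable_set0.
  by apply/seteqP; split => [x _ []|x _ i /=]; rewrite ?in_nil.
rewrite [X in mu.-caratheodory X](_ : _ =
    ((halfspace i (b 0%R i)) `\` (halfspace i (a 0%R i))) `&`
    [set x | forall i, i \in s -> (a 0%R i <= x 0%R i < b 0%R i)%R]).
  apply: caratheodory_measurable_setI => //.
  exact: caratheodory_measurable_setD.
apply/seteqP; split => x /=.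
  move=> abx; split; last by move=> j js; apply: abx; rewrite in_cons js orbT.
  have /andP[ax xb] := abx i (mem_head _ _); split => //=.
  by apply/negP; rewrite -leNgt.
move=> [[xb /negP ax] H] j; rewrite in_cons => /orP[/eqP->|/H//].
by rewrite leNgt ax xb.
Qed.

(** An open set is a countable union of boxes with rational corners. The outer measure is kept
    abstract so that this serves both Lebesgue and Hausdorff measures. *)
Lemma open_caratheodory (U : set 'rV[R]_n) : open U -> mu.-caratheodory U.
Proof.
move=> oU.
pose D (q : 'rV[rat]_n * 'rV[rat]_n) : set 'rV[R]_n :=
  box (map_mx ratr q.1) (map_mx ratr q.2).
pose D' q := if `[< D q `<=` U >] then D q else set0.
have -> : U = \bigcup_k (oapp D' set0 (unpickle k)).
  apply/seteqP; split => [x Ux|x [k _]]; last first.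
    case: unpickle => //= q; rewrite /D'; case: asboolP => // h; exact: h.
  have /nbhs_ballP[e /= e0 eU] : nbhs x U by exact: open_nbhs_nbhs.
  have /choice[f fP] : forall i, exists q : rat * rat,
      (x 0%R i - e < ratr q.1)%R /\ (ratr q.1 <= x 0%R i < ratr q.2)%R /\
      (ratr q.2 < x 0%R i + e)%R.
    move=> i; have [|p] := @rat_in_itvoo R (x 0%R i - e)%R (x 0%R i).
      by rewrite ltrBlDr ltrDl.
    rewrite in_itv/= => /andP[p1 p2].
    have [|q] := @rat_in_itvoo R (x 0%R i) (x 0%R i + e)%R.
      by rewrite ltrDl.
    rewrite in_itv/= => /andP[q1 q2].
    by exists (p, q); rewrite /= p1 (ltW p2) q1 q2.
  pose q := (\row_i (f i).1, \row_i (f i).2) : 'rV[rat]_n * 'rV[rat]_n.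
  exists (pickle q) => //; rewrite pickleK/= /D' asboolT.
    by move=> i; rewrite !mxE; have [_ []] := fP i.
  move=> y Dy; apply: eU; split=> // k i; rewrite (ord1 k).
  have := Dy i; rewrite !mxE => /andP[y1 y2].
  have [x1 [/andP[x2 x3] x4]] := fP i.
  rewrite /ball/= ltr_norml; apply/andP; split; lra.
apply: caratheodory_measurable_bigcup => k.
case: unpickle => [q|] /=; last exact: caratheodory_measurable_set0.
rewrite /D'; case: asboolP => _; last exact: caratheodory_measurable_set0.
exact: halfspace_box.
Qed.

End carath_boxes.

(** * Euclidean norm and balls *)

Section euclidean.
Context {R : realType} {n : nat}.
Implicit Types (x y z : 'rV[R]_n).

Lemma dotC x y : dot x y = dot y x.
Proof. by apply: eq_bigr => i _; rewrite mulrC. Qed.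

Lemma dotDl x y z : dot (x + y) z = dot x z + dot y z.
Proof. by rewrite -big_split; apply: eq_bigr => i _; rewrite mxE mulrDl. Qed.

Lemma dotZl (a : R) x y : dot (a *: x) y = a * dot x y.
Proof. by rewrite /dot mulr_sumr; apply: eq_bigr => i _; rewrite mxE mulrA. Qed.

Lemma dotDr x y z : dot x (y + z) = dot x y + dot x z.
Proof. by rewrite dotC dotDl !(dotC x). Qed.

Lemma dotZr (a : R) x y : dot x (a *: y) = a * dot x y.
Proof. by rewrite dotC dotZl dotC. Qed.

Lemma dotNl x y : dot (- x) y = - dot x y.
Proof. by rewrite -scaleN1r dotZl mulN1r. Qed.

Lemma dotBl x y z : dot (x - y) z = dot x z - dot y z.
Proof. by rewrite dotDl dotNl. Qed.

Lemma dotxx_ge0 x : 0 <= dot x x.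
Proof. by apply: sumr_ge0 => i _; rewrite -expr2 sqr_ge0. Qed.

Lemma dot_basisr x (i : 'I_n) : dot x (Defs.basis i) = x 0 i.
Proof.
rewrite /dot (bigD1 i)//= big1 ?addr0; last first.
  by move=> j ji; rewrite mxE (negbTE ji) andbF mulr0.
by rewrite mxE !eqxx mulr1.
Qed.

Lemma dot_basisl x (i : 'I_n) : dot (Defs.basis i) x = x 0 i.
Proof. by rewrite dotC dot_basisr. Qed.

Lemma enorm_ge0 x : 0 <= enorm x. Proof. exact: sqrtr_ge0. Qed.

Lemma enorm2 x : enorm x ^+ 2 = dot x x.
Proof. by rewrite sqr_sqrtr// dotxx_ge0. Qed.

Lemma coord_le_enorm x (i : 'I_n) : `|x 0 i| <= enorm x.
Proof.
rewrite -sqrtr_sqr /enorm ler_sqrt ?dotxx_ge0// /dot (bigD1 i)//= -expr2 lerDl.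
by apply: sumr_ge0 => j _; rewrite -expr2 sqr_ge0.
Qed.

Lemma enorm_le x (r : R) : (forall i : 'I_n, `|x 0 i| <= r) -> enorm x <= n%:R * r.
Proof.
move=> xr; have [n0|n_gt0] := posnP n.
  move: x xr; rewrite n0 => x _; rewrite mul0r /enorm /dot big_ord0 sqrtr0//.
have r0 : 0 <= r by apply: le_trans (xr (Ordinal n_gt0)).
rewrite -(@ger0_norm _ (n%:R * r)) ?mulr_ge0// -sqrtr_sqr ler_sqrt ?sqr_ge0//.
apply: (@le_trans _ _ (\sum_(i < n) r ^+ 2)).
  by apply: ler_sum => i _; rewrite -expr2 -real_normK ?num_real// lerXn2r ?nnegrE.
rewrite sumr_const card_ord exprMn -[X in X <= _]mulr_natl.
by apply: ler_wpM2r; rewrite ?sqr_ge0// expr2 ler_peMl ?ler0n// ler1n.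
Qed.

Lemma enorm0 : enorm (0 : 'rV[R]_n) = 0.
Proof. by rewrite /enorm /dot big1 ?sqrtr0// => i _; rewrite mxE mul0r. Qed.

Lemma enorm_eq0 x : enorm x = 0 -> x = 0.
Proof.
move=> x0; apply/rowP => i; apply/eqP; rewrite mxE -normr_le0 -x0.
exact: coord_le_enorm.
Qed.

Lemma enormZ (a : R) x : enorm (a *: x) = `|a| * enorm x.
Proof.
by rewrite /enorm dotZl dotZr mulrA -expr2 sqrtrM ?sqr_ge0// sqrtr_sqr.
Qed.

Lemma enormN x : enorm (- x) = enorm x.
Proof. by rewrite -scaleN1r enormZ normrN1 mul1r. Qed.

Lemma enormB x y : enorm (x - y) = enorm (y - x).
Proof. by rewrite -enormN opprB. Qed.

Lemma CauchySchwarz x y : `|dot x y| <= enorm x * enorm y.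
Proof.
have [y0|y0] := eqVneq (enorm y) 0.
  rewrite y0 mulr0 (enorm_eq0 y0) -(scale0r (0 : 'rV[R]_n)) dotZr mul0r normr0//.
have yy : 0 < dot y y by rewrite -enorm2 exprn_gt0// lt_def y0 enorm_ge0.
rewrite -sqrtr_sqr -sqrtrM ?dotxx_ge0// ler_sqrt ?mulr_ge0 ?dotxx_ge0//.
have := dotxx_ge0 (dot y y *: x - dot x y *: y).
rewrite -scaleNr dotDl !dotZl !dotDr !dotZr (dotC y x) => H.
rewrite -(ler_pM2l yy) -subr_ge0; apply: le_trans H _.
by rewrite le_eqVlt; apply/orP; left; apply/eqP; ring.
Qed.

Lemma ler_enormD x y : enorm (x + y) <= enorm x + enorm y.
Proof.
rewrite -(@ler_pXn2r _ 2)// ?nnegrE ?addr_ge0 ?enorm_ge0//.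
rewrite enorm2 dotDl !dotDr sqrrD !enorm2 (dotC y x) addrACA addrA.
have /ler_normlP[_] := CauchySchwarz x y.
rewrite mulr2n; lra.
Qed.

Lemma enorm_sub_continuous x : continuous (fun y : 'rV[R]_n => enorm (y - x)).
Proof.
have dot_continuous : continuous (fun y : 'rV[R]_n => dot y y).
  apply: continuous_big => [|i _ y]; first exact: add_continuous.
  by apply: continuousM; exact: coord_continuous.
have sub_continuous : continuous (fun y : 'rV[R]_n => y - x : 'rV[R]_n).
  by move=> y; apply: continuousB; [move=> A|exact: cst_continuous].
move=> y; apply: (continuous_comp (sub_continuous y)).
by apply: (continuous_comp (dot_continuous _)); exact: sqrt_continuous.
Qed.

Definition cball x (r : R) : set 'rV[R]_n := [set y | enorm (y - x) <= r].

Lemma closed_cball x r : closed (cball x r).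
Proof.
have -> : cball x r = (fun y => enorm (y - x)) @^-1` [set t | t <= r] by [].
apply: closed_comp => [y _|]; last exact: closed_le.
exact: enorm_sub_continuous.
Qed.

Lemma leb_open (U : set 'rV[R]_n) : open U ->
  measurable (U : set (caratheodory_type (@lebesgue_outer R n))).
Proof. move=> oU; exact: (open_caratheodory (@halfspace_leb R n)). Qed.

Lemma leb_closed (U : set 'rV[R]_n) : closed U ->
  measurable (U : set (caratheodory_type (@lebesgue_outer R n))).
Proof.
move=> cU; rewrite -(setCK U); apply: measurableC; apply: leb_open.
exact: closed_openC.
Qed.

Lemma leb_box (a b : 'rV[R]_n) :
  measurable (box a b : set (caratheodory_type (@lebesgue_outer R n))).
Proof. exact: (halfspace_box (@halfspace_leb R n)). Qed.

End euclidean.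

Section affine.
Context {R : realType} {n : nat}.
Local Open Scope ereal_scope.
Implicit Types (A : set 'rV[R]_n) (r : R) (c : 'rV[R]_n).

Let affine_le r c A : (0 < r)%R ->
  lebesgue_outer [set (r *: x + c)%R | x in A] <= (r ^+ n)%:E * lebesgue_outer A.
Proof.
move=> r0; rewrite -lee_pdivrMl ?exprn_gt0//; apply: cover_measure_ge => F AF.
rewrite lee_pdivrMl ?exprn_gt0// -nneseriesZl; last by move=> *; exact: box_cost_ge0.
apply: (@le_trans _ _ (\sum_(k <oo) lebesgue_outer [set (r *: x + c)%R | x in F k])).
  apply: le_trans (outer_measure_sigma_subadditive _ _).
  by apply: le_outer_measure => _ [x /AF[k _ Fkx] <-]; exists k => //; exists x.
apply: lee_nneseries => [k _ _|k _]; first exact: outer_measure_ge0.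
have [->|] := eqVneq (box_cost (F k)) +oo.
  by rewrite gt0_muley ?leey// lte_fin exprn_gt0.
case/box_costP => [->|[a [b [ab ->]]]].
  by rewrite image_set0 outer_measure0 box_cost0 mule0.
have -> : box_cost (box a b) = (vol a b)%:E by rewrite box_cost_box.
apply: (@le_trans _ _ (lebesgue_outer (box (r *: a + c)%R (r *: b + c)%R))).
  apply: le_outer_measure => _ [x abx <-] i; rewrite !mxE lerD2r ltrD2r.
  by rewrite ler_pM2l// ltr_pM2l.
rewrite lebesgue_outer_box; last by move=> i; rewrite !mxE lerD2r ler_pM2l.
rewrite -EFinM lee_fin /vol -[X in (r ^+ X)%R]card_ord -prodr_const -big_split/=.
by rewrite le_eqVlt; apply/orP; left; apply/eqP/eq_bigr => i _; rewrite !mxE; ring.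
Qed.

(** The inequality [affine_le] is applied to the map and to its inverse. *)
Lemma lebesgue_outer_affine r c A : (0 < r)%R ->
  lebesgue_outer [set (r *: x + c)%R | x in A] = (r ^+ n)%:E * lebesgue_outer A.
Proof.
move=> r0; apply/eqP; rewrite eq_le affine_le//=.
rewrite -lee_pdivlMl ?exprn_gt0// -exprVn.
apply: le_trans (affine_le (- (r^-1 *: c))%R _ _); last by rewrite invr_gt0.
apply: le_outer_measure => x Ax; exists (r *: x + c)%R; first by exists x.
by rewrite scalerDr scalerA mulVf ?gt_eqF// scale1r addrK.
Qed.

Lemma lebesgue_cball c r : (0 < r)%R ->
  lebesgue_outer (cball c r) = (r ^+ n)%:E * ball_volume R n.
Proof.
move=> r0; rewrite -(lebesgue_outer_affine c)//; congr lebesgue_outer.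
apply/seteqP; split => [x|_ [x /= x1 <-]].
  rewrite /cball/= => xr; exists (r^-1 *: (x - c))%R => /=.
    by rewrite enormZ gtr0_norm ?invr_gt0// ler_pdivrMl// mulr1.
  by rewrite scalerA divff ?gt_eqF// scale1r subrK.
by rewrite /cball/= addrK enormZ gtr0_norm// ger_pMr.
Qed.

Lemma lebesgue_outer_ltey A (r : R) : (forall x i, A x -> (`|x 0%R i| <= r)%R) ->
  lebesgue_outer A < +oo.
Proof.
move=> Ar; apply: (@le_lt_trans _ _ (lebesgue_outer
    (box (\row__ - (`|r| + 1))%R (\row__ (`|r| + 1))%R))).
  apply: le_outer_measure => x Ax i; rewrite !mxE.
  have := Ar x i Ax; rewrite ler_norml => /andP[xr rx].
  have rn := ler_norm r; apply/andP; split; lra.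
rewrite lebesgue_outer_box ?ltry// => i; rewrite !mxE.
have := normr_ge0 r; lra.
Qed.

Lemma ball_volume_fin_num : ball_volume R n \is a fin_num.
Proof.
rewrite ge0_fin_numE ?outer_measure_ge0//; apply: (@lebesgue_outer_ltey _ 1).
by move=> x i /=; apply: le_trans; exact: coord_le_enorm.
Qed.

Lemma ball_volume_gt0 : 0 < ball_volume R n.
Proof.
pose d : R := (n.+1%:R)^-1%R.
apply: (@lt_le_trans _ _ (lebesgue_outer (box (0 : 'rV[R]_n) (\row__ d)%R))).
  rewrite lebesgue_outer_box; last by move=> i; rewrite !mxE invr_ge0 ler0n.
  by rewrite lte_fin /vol prodr_gt0// => i _; rewrite !mxE subr0 invr_gt0 ltr0n.
apply: le_outer_measure => x x0d /=.
apply: (@le_trans _ _ (n%:R * d)%R).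
  apply: enorm_le => i; have := x0d i; rewrite !mxE => /andP[x0 xd].
  by rewrite ger0_norm// ltW.
by rewrite ler_pdivrMr ?ltr0n// mul1r ler_nat.
Qed.

End affine.

Section outer_measure_aliases.
Context {R : realType} {n : nat}.
Implicit Types A B : set 'rV[R]_n.
Local Open Scope ereal_scope.

Lemma lebesgue_outer_ge0 A : 0 <= lebesgue_outer A.
Proof. exact: outer_measure_ge0. Qed.

Lemma le_lebesgue_outer A B : A `<=` B -> lebesgue_outer A <= lebesgue_outer B.
Proof. exact: le_outer_measure. Qed.

Lemma lebesgue_outerU A B :
  lebesgue_outer (A `|` B) <= lebesgue_outer A + lebesgue_outer B.
Proof. exact: outer_measureU2. Qed.

Lemma lebesgue_outer0 : lebesgue_outer (set0 : set 'rV[R]_n) = 0.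
Proof. exact: outer_measure0. Qed.

Lemma lebesgue_outer_bigcup (F : (set 'rV[R]_n)^nat) :
  lebesgue_outer (\bigcup_k F k) <= \sum_(k <oo) lebesgue_outer (F k).
Proof. exact: outer_measure_sigma_subadditive. Qed.

Lemma lebesgue_outer_cut (A : set 'rV[R]_n) B :
  (@lebesgue_outer R n).-caratheodory A ->
  lebesgue_outer B = lebesgue_outer (B `&` A) + lebesgue_outer (B `&` ~` A).
Proof. by move=> /(_ B). Qed.

End outer_measure_aliases.

(** * Brunn-Minkowski and isodiametric inequalities *)

Section brunn_minkowski.
Context {R : realType} {n : nat}.
Implicit Types (p q : 'rV[R]_n * 'rV[R]_n) (s t : seq ('rV[R]_n * 'rV[R]_n)).
Implicit Types (i : 'I_n) (c : R).

Definition bunion s : set 'rV[R]_n := [set x | exists2 p, p \in s & box p.1 p.2 x].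

Definition nondegenerate p := forall i, p.1 0 i < p.2 0 i.

Definition disjoint_boxes p q := `[< box p.1 p.2 `&` box q.1 q.2 = set0 >].

Definition midset (A B : set 'rV[R]_n) : set 'rV[R]_n :=
  [set 2^-1 *: (x + y) | x in A & y in B].

Lemma bunion_cons p s : bunion (p :: s) = box p.1 p.2 `|` bunion s.
Proof.
apply/seteqP; split => [x [q]|x [px|[q qs qx]]].
- by rewrite in_cons => /orP[/eqP -> px|qs qx]; [left|right; exists q].
- by exists p; rewrite ?mem_head.
- by exists q; rewrite // in_cons qs orbT.
Qed.

Lemma bunion_fin_num s : (forall p, p \in s -> nondegenerate p) ->
  lebesgue_outer (bunion s) \is a fin_num.
Proof.
elim: s => [|p s IH] ps.
  rewrite (_ : bunion _ = set0) ?outer_measure0//.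
  by apply/seteqP; split => // x [].
rewrite bunion_cons ge0_fin_numE ?outer_measure_ge0//.
apply: (le_lt_trans (lebesgue_outerU _ _)).
apply: lte_add_pinfty.
  rewrite lebesgue_outer_box ?ltry// => i; apply/ltW; apply: ps; exact: mem_head.
rewrite -ge0_fin_numE ?outer_measure_ge0//; apply: IH => q qs; apply: ps.
by rewrite in_cons qs orbT.
Qed.

Definition V s : R := fine (lebesgue_outer (bunion s)).

Lemma VE s : (forall p, p \in s -> nondegenerate p) ->
  lebesgue_outer (bunion s) = (V s)%:E.
Proof. by move=> sn; rewrite /V fineK// bunion_fin_num. Qed.

Lemma V_ge0 s : 0 <= V s.
Proof. by rewrite fine_ge0// outer_measure_ge0. Qed.

Lemma vol_gt0 p : nondegenerate p -> 0 < vol p.1 p.2.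
Proof. by move=> pn; apply: prodr_gt0 => i _; rewrite subr_gt0; exact: pn. Qed.

Lemma V_gt0 s : s != [::] -> (forall p, p \in s -> nondegenerate p) -> 0 < V s.
Proof.
case: s => [//|p s] _ sn; rewrite -lte_fin -VE//.
have pn : nondegenerate p by apply: sn; exact: mem_head.
apply: (@lt_le_trans _ _ (lebesgue_outer (box p.1 p.2))).
  by rewrite lebesgue_outer_box ?lte_fin ?vol_gt0// => i; exact/ltW/pn.
by apply: le_outer_measure; rewrite bunion_cons; exact: subsetUl.
Qed.

(** Boxes that miss the chosen side are dropped rather than kept empty. All boxes stay
    nondegenerate, and a separating cut strictly decreases their number. *)
Definition cutl i c s := [seq (p.1, upd p.2 i (Num.min (p.2 0 i) c)) |
  p <- s & p.1 0 i < c].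

Definition cutr i c s := [seq (upd p.1 i (Num.max (p.1 0 i) c), p.2) |
  p <- s & c < p.2 0 i].

Lemma updE (a : 'rV[R]_n) i c : upd a i c 0 i = c.
Proof. by rewrite mxE eqxx. Qed.

Lemma upd_neq (a : 'rV[R]_n) i c j : j != i -> upd a i c 0 j = a 0 j.
Proof. by move=> ji; rewrite mxE (negbTE ji). Qed.

Lemma box_updr (a b : 'rV[R]_n) i c :
  box a (upd b i (Num.min (b 0 i) c)) = box a b `&` halfspace i c.
Proof.
apply/seteqP; split => [x xab|x [xab xc] j].
  split; last by have /andP[_] := xab i; rewrite updE lt_min => /andP[].
  move=> j; have := xab j; have [->|ji] := eqVneq j i; last by rewrite upd_neq.
  by rewrite updE lt_min => /and3P[-> ->].
have [->|ji] := eqVneq j i; last by rewrite upd_neq.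
by rewrite updE lt_min andbA xab.
Qed.

Lemma box_updl (a b : 'rV[R]_n) i c :
  box (upd a i (Num.max (a 0 i) c)) b = box a b `&` ~` halfspace i c.
Proof.
apply/seteqP; split => [x xab|x [xab /negP xc] j].
  split; last first.
    have /andP[] := xab i; rewrite updE ge_max => /andP[_ cx] _.
    by apply/negP; rewrite -leNgt.
  move=> j; have := xab j; have [->|ji] := eqVneq j i; last by rewrite upd_neq.
  by rewrite updE ge_max => /andP[/andP[-> _] ->].
have [->|ji] := eqVneq j i; last by rewrite upd_neq.
by rewrite updE ge_max (leNgt c) xc andbT xab.
Qed.

Lemma bunion_cutl i c s : bunion (cutl i c s) = bunion s `&` halfspace i c.
Proof.
apply/seteqP; split => [x [_ /mapP[p + ->]]|x [[p ps px] xc]].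
  by rewrite mem_filter box_updr => /andP[_ ps] [px xc]; split => //; exists p.
exists (p.1, upd p.2 i (Num.min (p.2 0 i) c)); last by rewrite box_updr.
apply: (map_f (fun p => (p.1, upd p.2 i (Num.min (p.2 0 i) c)))).
rewrite mem_filter ps andbT; have /andP[] := px i; move=> /le_lt_trans + _.
exact.
Qed.

Lemma bunion_cutr i c s : bunion (cutr i c s) = bunion s `&` ~` halfspace i c.
Proof.
apply/seteqP; split => [x [_ /mapP[p + ->]]|x [[p ps px] xc]].
  by rewrite mem_filter box_updl => /andP[_ ps] [px xc]; split => //; exists p.
exists (upd p.1 i (Num.max (p.1 0 i) c), p.2); last by rewrite box_updl.
apply: (map_f (fun p => (upd p.1 i (Num.max (p.1 0 i) c), p.2))).
rewrite mem_filter ps andbT; have /andP[_] := px i; apply: le_lt_trans.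
by rewrite leNgt; apply/negP.
Qed.

Lemma cutl_nondegenerate i c s : (forall p, p \in s -> nondegenerate p) ->
  forall p, p \in cutl i c s -> nondegenerate p.
Proof.
move=> sn _ /mapP[p + ->] j; rewrite mem_filter => /andP[pc /sn pn] /=.
have [->|ji] := eqVneq j i; last by rewrite upd_neq//; exact: pn.
by rewrite updE lt_min pn pc.
Qed.

Lemma cutr_nondegenerate i c s : (forall p, p \in s -> nondegenerate p) ->
  forall p, p \in cutr i c s -> nondegenerate p.
Proof.
move=> sn _ /mapP[p + ->] j; rewrite mem_filter => /andP[pc /sn pn] /=.
have [->|ji] := eqVneq j i; last by rewrite upd_neq//; exact: pn.
by rewrite updE gt_max pn pc.
Qed.

Lemma cutl_disjoint i c s : pairwise disjoint_boxes s ->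
  pairwise disjoint_boxes (cutl i c s).
Proof.
move=> ps; rewrite pairwise_map; apply: sub_pairwise (pairwise_filter _ ps).
move=> p q /asboolP pq; apply/asboolP; apply/seteqP; split => // x.
by rewrite -pq /= !box_updr => -[[px _] [qx _]].
Qed.

Lemma cutr_disjoint i c s : pairwise disjoint_boxes s ->
  pairwise disjoint_boxes (cutr i c s).
Proof.
move=> ps; rewrite pairwise_map; apply: sub_pairwise (pairwise_filter _ ps).
move=> p q /asboolP pq; apply/asboolP; apply/seteqP; split => // x.
by rewrite -pq /= !box_updl => -[[px _] [qx _]].
Qed.

Lemma size_cutl i c s : (size (cutl i c s) <= size s)%N.
Proof. by rewrite size_map size_filter count_size. Qed.

Lemma size_cutr i c s : (size (cutr i c s) <= size s)%N.
Proof. by rewrite size_map size_filter count_size. Qed.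

Lemma V_cut i c s : (forall p, p \in s -> nondegenerate p) ->
  V (cutl i c s) + V (cutr i c s) = V s.
Proof.
move=> sn; apply: EFin_inj; rewrite EFinD -!VE//; last 2 first.
- exact: cutr_nondegenerate.
- exact: cutl_nondegenerate.
by rewrite bunion_cutl bunion_cutr -(lebesgue_outer_cut _ (halfspace_leb i c)).
Qed.

Lemma nonneg_continuous (f : R -> R) (K : R) :
  (forall x y, x <= y -> 0 <= f y - f x <= K * (y - x)) -> continuous f.
Proof.
move=> fK x; apply/cvgrPdist_le => e e0.
have K1 : 0 < `|K| + 1 by rewrite ltr_wpDl.
near=> y.
have xy : `|x - y| < e / (`|K| + 1).
  near: y; exists (e / (`|K| + 1)); first by rewrite /= divr_gt0.
  by move=> y.
have E : (`|K| + 1) * `|x - y| <= e.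
  by rewrite mulrC -ler_pdivlMr// ltW.
apply: le_trans E; have := ler_norm K => KK.
have [xley|yx] := leP x y.
  have /andP[f0 f1] := fK _ _ xley.
  have -> : `|x - y| = y - x by rewrite distrC ger0_norm ?subr_ge0.
  rewrite distrC ger0_norm// (le_trans f1)//.
  by rewrite ler_wpM2r ?subr_ge0//; lra.
have /andP[f0 f1] := fK _ _ (ltW yx).
have -> : `|x - y| = x - y by rewrite ger0_norm// subr_ge0 ltW.
rewrite ger0_norm// (le_trans f1)//.
by rewrite ler_wpM2r ?subr_ge0 1?ltW//; lra.
Unshelve. all: by end_near. Qed.

(** The slab between two cuts meets each box in a volume at most its base times the thickness; the
    constant sums the bases. The resulting continuity provides the cut in a prescribed
    proportion. *)
Lemma V_cutl_lip i s : (forall p, p \in s -> nondegenerate p) ->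
  exists K, forall c c', c <= c' ->
    0 <= V (cutl i c' s) - V (cutl i c s) <= K * (c' - c).
Proof.
move=> sn.
have [K KP] : exists K, forall c c', c <= c' ->
    (lebesgue_outer (bunion s `&` [set x | (c <= x 0%R i < c')%R]) <=
      (K * (c' - c))%:E)%E.
  elim: s sn => [|p s IH] sn.
    exists 0 => c c' _; rewrite (_ : _ `&` _ = set0) ?lebesgue_outer0 ?mul0r//.
    by apply/seteqP; split => // x [[]].
  have pn : nondegenerate p by apply: sn; exact: mem_head.
  have [|K KP] := IH; first by move=> q qs; apply: sn; rewrite in_cons qs orbT.
  exists (\prod_(j < n | j != i) (p.2 0 j - p.1 0 j) + K) => c c' cc'.
  rewrite bunion_cons setIUl mulrDl EFinD.
  apply: le_trans (lebesgue_outerU _ _) (leeD _ (KP _ _ cc')).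
  apply: (@le_trans _ _ (lebesgue_outer (box (upd p.1 i c) (upd p.2 i c')))).
    apply: le_lebesgue_outer => x [px xc] j; have [->|ji] := eqVneq j i.
      by rewrite !updE.
    by rewrite !upd_neq.
  rewrite lebesgue_outer_box; last first.
    move=> j; have [->|ji] := eqVneq j i; first by rewrite !updE.
    by rewrite !upd_neq//; exact/ltW/pn.
  rewrite lee_fin /vol (bigD1 i)//= !updE mulrC.
  by rewrite (eq_bigr (fun j => p.2 0 j - p.1 0 j))// => j ji; rewrite !upd_neq.
exists K => c c' cc'.
have sub : bunion (cutl i c s) `<=` bunion (cutl i c' s).
  by rewrite !bunion_cutl => x [ux xc]; split => //; exact: lt_le_trans cc'.
apply/andP; split.
  rewrite subr_ge0 -lee_fin -!VE; [|exact: cutl_nondegenerate..].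
  exact: le_lebesgue_outer.
rewrite lerBlDr -lee_fin EFinD -!VE; [|exact: cutl_nondegenerate..].
apply: le_trans (leeD (KP _ _ cc') (lexx _)).
apply: le_trans (lebesgue_outerU _ _); apply: le_lebesgue_outer.
rewrite !bunion_cutl => x [ux xc'].
have [xc|cx] := ltP (x 0 i) c; first by right.
by left; split => //=; rewrite cx.
Qed.

Lemma V_cutl_ivt i s v : (forall p, p \in s -> nondegenerate p) ->
  0 <= v <= V s -> exists c, V (cutl i c s) = v.
Proof.
move=> sn /andP[v0 vs].
have [M MP] : exists M, forall p, p \in s -> (- M <= p.1 0 i) && (p.2 0 i <= M).
  elim: s sn {vs} => [|p s IH] sn; first by exists 0.
  have [|M MP] := IH; first by move=> q qs; apply: sn; rewrite in_cons qs orbT.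
  exists (Num.max M (Num.max (- p.1 0 i) (p.2 0 i))) => q.
  rewrite in_cons => /orP[/eqP ->|/MP /andP[q1 q2]].
    by rewrite lerNl !le_max !lexx !orbT.
  by rewrite lerNl !le_max -lerNl q1 q2.
have M0 : s != [::] -> - M <= M.
  case: s sn {vs} MP => // p s sn MP _.
  have /MP/andP[p1 p2] := mem_head p s; apply: le_trans p1 (le_trans _ p2).
  by apply/ltW/sn/mem_head.
have [s0|s0] := eqVneq s [::].
  exists 0; move: vs; rewrite s0 /V (_ : bunion _ = set0) ?lebesgue_outer0/=.
    by move=> v0'; apply/eqP; rewrite eq_le v0 v0'.
  by apply/seteqP; split => // x [].
have [K KP] := V_cutl_lip i sn.
have cont : {within `[- M, M], continuous (fun c => V (cutl i c s))}.
  by apply: continuous_subspaceT; exact: nonneg_continuous KP.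
have VM : V (cutl i M s) = V s.
  rewrite /V bunion_cutl setIidl// => x [p ps px].
  have /andP[_ pM] := MP _ ps; have /andP[_] := px i.
  by move=> /lt_le_trans; apply.
have VN : V (cutl i (- M) s) = 0.
  rewrite /V bunion_cutl (_ : _ `&` _ = set0) ?lebesgue_outer0//.
  apply/seteqP; split => // x [[p ps px]]; rewrite /halfspace/= => xM.
  have /andP[pM _] := MP _ ps; have /andP[p1 _] := px i.
  by have := le_lt_trans (le_trans pM p1) xM; rewrite ltxx.
have [|c _ cv] := IVT (M0 s0) cont (v := v); last by exists c.
by rewrite VM VN ge_min v0/= le_max vs orbT.
Qed.

Lemma separated_boxes p q : nondegenerate p -> nondegenerate q ->
  disjoint_boxes p q -> exists i, (p.2 0 i <= q.1 0 i) \/ (q.2 0 i <= p.1 0 i).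
Proof.
move=> pn qn /asboolP pq; apply: contrapT => /forallNP H.
have : (box p.1 p.2 `&` box q.1 q.2) (\row_i Num.max (p.1 0 i) (q.1 0 i)).
  split=> i; rewrite mxE le_max lexx ?orbT gt_max ?pn ?qn ?andbT//= ltNge.
    by apply/negP => h; apply: (H i); left.
  by apply/negP => h; apply: (H i); right.
by rewrite pq.
Qed.

Lemma bunion1 p : bunion [:: p] = box p.1 p.2.
Proof.
rewrite bunion_cons (_ : bunion [::] = set0) ?setU0//.
by apply/seteqP; split => // x [].
Qed.

(** In this multiplicative form the inequality is, side by side, the one between arithmetic and
    geometric means. *)
Lemma brunn_minkowski_box p q : nondegenerate p -> nondegenerate q ->
  ((Num.sqrt (vol p.1 p.2 * vol q.1 q.2))%:E <=
   lebesgue_outer (midset (box p.1 p.2) (box q.1 q.2)))%E.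
Proof.
move=> pn qn.
pose a := 2^-1 *: (p.1 + q.1); pose b := 2^-1 *: (p.2 + q.2).
have ab i : a 0 i < b 0 i.
  by rewrite !mxE ltr_pM2l ?invr_gt0// ltrD ?pn ?qn.
apply: (@le_trans _ _ (lebesgue_outer (box a b))).
  rewrite lebesgue_outer_box; last by move=> i; exact/ltW.
  have vab : 0 <= vol a b by apply: vol_ge0 => i; exact/ltW.
  rewrite lee_fin -(ger0_norm vab) -sqrtr_sqr ler_sqrt ?sqr_ge0//.
  rewrite /vol expr2 -!big_split/=; apply: ler_prod => i _.
  rewrite mulr_ge0 ?subr_ge0 ?(ltW (pn i)) ?(ltW (qn i))//= !mxE.
  rewrite -subr_ge0 (_ : _ - _ =
    ((p.2 0 i - p.1 0 i) - (q.2 0 i - q.1 0 i)) ^+ 2 / 4); last by field.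
  by rewrite divr_ge0 ?sqr_ge0.
apply: le_lebesgue_outer => z zab.
(* A point of the middle box is the midpoint of the two points having the same relative position
   [th] in both boxes. *)
pose th i := (z 0 i - a 0 i) / (b 0 i - a 0 i).
have th01 i : 0 <= th i < 1.
  have /andP[az zb] := zab i; have := ab i; rewrite -subr_gt0 => ab0.
  rewrite /th ltr_pdivrMr// mul1r ltrD2r zb andbT.
  by rewrite divr_ge0 ?subr_ge0 ?(ltW (ab i)).
exists (\row_i (p.1 0 i + th i * (p.2 0 i - p.1 0 i))).
  move=> i; have /andP[t0 t1] := th01 i; rewrite mxE; have := pn i.
  by rewrite -subr_gt0 => pi; rewrite lerDl mulr_ge0 ?(ltW pi)//= -ltrBrDl gtr_pMl.
exists (\row_i (q.1 0 i + th i * (q.2 0 i - q.1 0 i))).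
  move=> i; have /andP[t0 t1] := th01 i; rewrite mxE; have := qn i.
  by rewrite -subr_gt0 => pi; rewrite lerDl mulr_ge0 ?(ltW pi)//= -ltrBrDl gtr_pMl.
apply/rowP => i; rewrite !mxE.
have E : th i * (b 0 i - a 0 i) = z 0 i - a 0 i.
  by rewrite /th divfK// gt_eqF// subr_gt0.
move: E; rewrite !mxE => E; rewrite -[RHS](subrK (2^-1 * (p.1 0 i + q.1 0 i))) -E.
by field.
Qed.

Lemma midsetC (A B : set 'rV[R]_n) : midset A B = midset B A.
Proof.
by apply/seteqP; split => _ [x Ax [y By <-]]; exists y => //; exists x => //;
  rewrite addrC.
Qed.

(* Hadwiger-Ohmann: a hyperplane separating two boxes of [s], and a parallel one
   cutting [t] in the same proportion, reduce the total number of boxes. *)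
Lemma brunn_minkowski_bunion s t : s != [::] -> t != [::] ->
  (forall p, p \in s -> nondegenerate p) -> (forall p, p \in t -> nondegenerate p) ->
  pairwise disjoint_boxes s -> pairwise disjoint_boxes t ->
  ((Num.sqrt (V s * V t))%:E <= lebesgue_outer (midset (bunion s) (bunion t)))%E.
Proof.
have [N] := ubnP (size s + size t)%N; elim: N s t => // N IH s t sN s0 t0 sn tn ds dt.
have step s' t' : (size s' + size t' <= N)%N -> (1 < size s')%N -> t' != [::] ->
  (forall p, p \in s' -> nondegenerate p) -> (forall p, p \in t' -> nondegenerate p) ->
  pairwise disjoint_boxes s' -> pairwise disjoint_boxes t' ->
  ((Num.sqrt (V s' * V t'))%:E <= lebesgue_outer (midset (bunion s') (bunion t')))%E.
  move=> {s t sN s0 t0 sn tn ds dt} stN s1 t0 sn tn ds dt.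
  have [p [q [ps qs pq]]] : exists p q, [/\ p \in s', q \in s' & disjoint_boxes p q].
    case: s' s1 ds {stN sn} => [|p [|q s']]//= _ /andP[/andP[pq _] _].
    by exists p, q; rewrite !in_cons !eqxx orbT.
  have [i [c [l r]]] : exists i c, has (fun p => ~~ (p.1 0 i < c)) s' /\
      has (fun p => ~~ (c < p.2 0 i)) s'.
    have [i [pqi|pqi]] := separated_boxes (sn _ ps) (sn _ qs) pq; exists i.
    - exists (q.1 0 i); split; apply/hasP; [exists q|exists p] => //.
        by rewrite ltxx.
      by rewrite -leNgt.
    - exists (p.1 0 i); split; apply/hasP; [exists p|exists q] => //.
        by rewrite ltxx.
      by rewrite -leNgt.
  have Vs0 : 0 < V s' by apply: V_gt0 => //; case: (s') s1.
  have Vt0 : 0 < V t' by apply: V_gt0.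
  have lt_filter (a : pred ('rV[R]_n * 'rV[R]_n)) : has (fun p => ~~ a p) s' ->
      (size [seq p <- s' | a p] < size s')%N.
    move=> ha; rewrite size_filter -(count_predC a s').
    by rewrite -[X in (X < _)%N]addn0 ltn_add2l -has_count.
  have szl : (size (cutl i c s') < size s')%N by rewrite size_map; exact: lt_filter.
  have szr : (size (cutr i c s') < size s')%N by rewrite size_map; exact: lt_filter.
  have VC := V_cut i c sn.
  have [c' Vc'] : exists c', V (cutl i c' t') = V (cutl i c s') / V s' * V t'.
    apply: V_cutl_ivt => //; rewrite mulr_ge0 ?divr_ge0 ?V_ge0//=.
    by rewrite ler_piMl ?V_ge0// ler_pdivrMr// mul1r -VC lerDl V_ge0.
  have VC' := V_cut i c' tn.
  set la := V (cutl i c s') / V s' in Vc'.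
  have la01 : 0 <= la <= 1.
    rewrite divr_ge0 ?V_ge0//=.
    by rewrite ler_pdivrMr// mul1r -VC lerDl V_ge0.
  have El : V (cutl i c s') = la * V s' by rewrite /la divfK// gt_eqF.
  have Er : V (cutr i c s') = (1 - la) * V s' by rewrite mulrBl mul1r -El -[X in X - _]VC addrC addKr.
  have Er' : V (cutr i c' t') = (1 - la) * V t' by rewrite mulrBl mul1r -Vc' -[X in X - _]VC' addrC addKr.
  (* Both families being cut in the same proportion [la'], the geometric mean of their volumes is
     multiplied by exactly [la']. The bounds for the two sides therefore add up without loss. *)
  have part la' (s1' t1' : seq ('rV[R]_n * 'rV[R]_n)) : 0 <= la' ->
      V s1' = la' * V s' -> V t1' = la' * V t' ->
      (size s1' < size s')%N -> (size t1' <= size t')%N ->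
      (forall p, p \in s1' -> nondegenerate p) ->
      (forall p, p \in t1' -> nondegenerate p) ->
      pairwise disjoint_boxes s1' -> pairwise disjoint_boxes t1' ->
      ((la' * Num.sqrt (V s' * V t'))%:E <=
        lebesgue_outer (midset (bunion s1') (bunion t1')))%E.
    move=> la0 E1 E2 z1 z2 n1 n2 d1 d2.
    have [->|la0'] := eqVneq la' 0; first by rewrite mul0r lebesgue_outer_ge0.
    have lapos : 0 < la' by rewrite lt_def la0' la0.
    have nn (r' : seq ('rV[R]_n * 'rV[R]_n)) : 0 < V r' -> r' != [::].
      apply: contraTneq => ->; rewrite /V (_ : bunion _ = set0) ?lebesgue_outer0 ?ltxx//.
      by apply/seteqP; split => // x [].
    have := IH s1' t1'; rewrite E1 E2 mulrACA sqrtrM ?mulr_ge0// -expr2.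
    rewrite sqrtr_sqr ger0_norm//; apply => //.
    - by apply: leq_trans stN; rewrite -addSn leq_add.
    - by apply: nn; rewrite E1 mulr_gt0.
    - by apply: nn; rewrite E2 mulr_gt0.
  have /andP[la0 la1] := la01.
  have P1 := part la (cutl i c s') (cutl i c' t') la0 El Vc' szl (size_cutl _ _ _)
    (cutl_nondegenerate sn) (cutl_nondegenerate tn) (cutl_disjoint _ _ ds) (cutl_disjoint _ _ dt).
  have la1' : 0 <= 1 - la by rewrite subr_ge0.
  have P2 := part (1 - la) (cutr i c s') (cutr i c' t') la1' Er Er' szr (size_cutr _ _ _)
    (cutr_nondegenerate sn) (cutr_nondegenerate tn) (cutr_disjoint _ _ ds) (cutr_disjoint _ _ dt).
  (* The hyperplane at the average height [(c + c') / 2] separates the midpoints of the lower parts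
     from those of the upper parts. *)
  rewrite (lebesgue_outer_cut _ (halfspace_leb i (2^-1 * (c + c')))).
  rewrite -[X in X%:E]mul1r -[X in (X * _)%:E](subrKC la) mulrDl EFinD; apply: leeD.
    apply: le_trans P1 _; apply: le_lebesgue_outer => _ [x + [y + <-]].
    rewrite !bunion_cutl => -[xs xc] [yt yc]; split; first by exists x => //; exists y.
    by rewrite /halfspace/= !mxE ltr_pM2l ?invr_gt0// ltrD.
  apply: le_trans P2 _; apply: le_lebesgue_outer => _ [x + [y + <-]].
  rewrite !bunion_cutr => -[xs /negP xc] [yt /negP yc]; split.
    by exists x => //; exists y.
  apply/negP; rewrite -leNgt !mxE ler_pM2l ?invr_gt0// lerD// leNgt//.
have [s1|s1] := ltnP 1 (size s); first exact: step.
have [t1|t1] := ltnP 1 (size t).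
  by rewrite mulrC midsetC; apply: step; rewrite // addnC.
case: s s0 s1 sn {ds sN} => [//|p [|//]] _ _ sn.
case: t t0 t1 tn {dt} => [//|q [|//]] _ _ tn.
have pn : nondegenerate p by apply: sn; exact: mem_head.
have qn : nondegenerate q by apply: tn; exact: mem_head.
rewrite !bunion1 /V !bunion1 !lebesgue_outer_box; last 2 first.
- by move=> i; exact/ltW/qn.
- by move=> i; exact/ltW/pn.
exact: brunn_minkowski_box.
Qed.

End brunn_minkowski.

Section isodiametric.
Context {R : realType} {n : nat}.
Local Open Scope ereal_scope.

Lemma V_sum (s : seq ('rV[R]_n * 'rV[R]_n)) :
  (forall p, p \in s -> nondegenerate p) -> pairwise disjoint_boxes s ->
  V s = (\sum_(p <- s) vol p.1 p.2)%R.
Proof.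
elim: s => [|p s IH] sn ds.
  rewrite big_nil /V (_ : bunion _ = set0) ?lebesgue_outer0//.
  by apply/seteqP; split => // x [].
have sn' q : q \in s -> nondegenerate q by move=> qs; apply: sn; rewrite in_cons qs orbT.
have pn : nondegenerate p by apply: sn; exact: mem_head.
move: ds => /=/andP[/allP ps ds]; rewrite big_cons -IH//.
apply: EFin_inj; rewrite EFinD -!VE// bunion_cons.
rewrite (lebesgue_outer_cut _ (halfspace_box (@halfspace_leb R n) p.1 p.2)).
rewrite -lebesgue_outer_box; last by move=> i; exact/ltW/pn.
congr (_ + _).
  by congr lebesgue_outer; apply/seteqP; split => [x []//|x px]; split => //; left.
congr lebesgue_outer.
apply/seteqP; split => [x [[//|//]]|x [q qs qx]].
split; first by right; exists q.
by move=> px; have /asboolP pq := ps _ qs; have : set0 x by rewrite -pq.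
Qed.

Lemma grid_cover (A : set 'rV[R]_n) (M h : R) : (0 < h)%R ->
  (forall x i, A x -> (`|x 0%R i| <= M)%R) ->
  exists s : seq ('rV[R]_n * 'rV[R]_n),
    [/\ forall p, p \in s -> forall i, (p.2 0%R i = p.1 0%R i + h)%R,
        forall p, p \in s -> box p.1 p.2 `&` A !=set0,
        pairwise disjoint_boxes s & A `<=` bunion s].
Proof.
move=> h0 AM0; pose N : R := Num.max M 0%R.
have AM x i : A x -> (`|x 0%R i| <= N)%R.
  by move=> Ax; rewrite /N le_max AM0.
have M0 : (0 <= N)%R by rewrite /N le_max lexx orbT.
pose K := (Num.truncn (N / h)).+1.
have MK : (N < h * K%:R)%R.
  by rewrite mulrC -ltr_pdivrMr// truncnS_gt// divr_ge0// ltW.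
(* The shift by [K] numbers the grid cubes around the origin by naturals below [2 * K]. *)
pose corner (f : {ffun 'I_n -> 'I_(2 * K)}) : 'rV[R]_n :=
  (\row_i (h * ((f i)%:R - K%:R)))%R.
pose cube f : 'rV[R]_n * 'rV[R]_n := (corner f, (\row_i (corner f 0 i + h))%R).
pose F := [seq f <- enum {ffun 'I_n -> 'I_(2 * K)} |
  `[< box (cube f).1 (cube f).2 `&` A !=set0 >]].
exists (map cube F); split.
- by move=> _ /mapP[f _ ->] i; rewrite !mxE.
- by move=> _ /mapP[f + ->]; rewrite mem_filter => /andP[/asboolP].
- have Funiq : pairwise (fun f g => f != g) F.
    by rewrite -uniq_pairwise filter_uniq// enum_uniq.
  have natint (a b : nat) (r : R) : (a%:R * h <= r < (a%:R + 1) * h)%R ->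
      (b%:R * h <= r < (b%:R + 1) * h)%R -> a = b.
    move=> /andP[ra ra'] /andP[rb rb'].
    have := le_lt_trans ra rb'; have := le_lt_trans rb ra'.
    rewrite !ltr_pM2r// !natr1 !ltr_nat !ltnS => ab ba.
    by apply/eqP; rewrite eqn_leq ab ba.
  rewrite pairwise_map; apply: sub_pairwise Funiq => f g fg; apply/asboolP.
  apply/seteqP; split => // x [xf xg]; case/eqP: fg; apply/ffunP => i.
  apply: val_inj; apply: (natint _ _ (x 0%R i + K%:R * h)%R).
    by have := xf i; rewrite !mxE; move=> /andP[x1 x2]; apply/andP; split; lra.
  by have := xg i; rewrite !mxE; move=> /andP[x1 x2]; apply/andP; split; lra.
- move=> x Ax.
  pose y i := (x 0%R i / h + K%:R)%R.
  have xE i : x 0%R i = ((y i - K%:R) * h)%R by rewrite /y addrK divfK// gt_eqF.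
  have yK i : (0 <= y i < (2 * K)%:R)%R.
    have := AM _ i Ax; rewrite ler_norml xE natrM => /andP[x1 x2].
    have : ((- K%:R) * h < (y i - K%:R) * h)%R by lra.
    have : ((y i - K%:R) * h < K%:R * h)%R by lra.
    rewrite !ltr_pM2r// => ? ?; apply/andP; split; lra.
  have idx i : (Num.truncn (y i) < 2 * K)%N.
    by have /andP[y1 y2] := yK i; rewrite truncn_lt_nat.
  pose f := [ffun i => Ordinal (idx i)].
  have fx : box (cube f).1 (cube f).2 x.
    move=> i; rewrite !mxE ffunE /= xE.
    have /andP[/truncn_itv /andP[y1 y2] _] := yK i.
    move: y2; rewrite -natr1 => y2; rewrite mulrC ler_pM2r// lerD2r y1/=.
    by rewrite -[X in (_ < _ + X)%R]mul1r -mulrDl ltr_pM2r//; lra.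
  exists (cube f) => //; apply: map_f; rewrite mem_filter mem_enum andbT.
  by apply/asboolP; exists x.
Qed.

(* Brunn-Minkowski for grid cubes covering [A] and their reflections: the
   midpoint set lies in a ball of radius [d / 2 + n h]. *)
Lemma isodiametric_grid (A : set 'rV[R]_n) (d h : R) : (0 < h)%R ->
  (forall x y, A x -> A y -> (enorm (x - y) <= d)%R) ->
  lebesgue_outer A <= lebesgue_outer (cball (0 : 'rV[R]_n) (d / 2 + n%:R * h)).
Proof.
move=> h0 Ad.
have [->|/set0P[x0 Ax0]] := eqVneq A set0.
  by rewrite lebesgue_outer0 lebesgue_outer_ge0.
have AM x i : A x -> (`|x 0%R i| <= enorm x0 + d)%R.
  move=> Ax; apply: le_trans (coord_le_enorm _ _) _; rewrite -(subrK x0 x) addrC.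
  by apply: le_trans (ler_enormD _ _) _; rewrite lerD2l Ad.
have [s [sh sA ds As]] := grid_cover h0 AM.
(* Midpoints of [A] and its reflection are half-differences of points of [A], hence of norm at most
   [d / 2]. The half-open boxes of [t] reflect those of [s] only up to faces, but just their volume
   and their position matter. *)
pose refl (p : 'rV[R]_n * 'rV[R]_n) := ((- p.2)%R, (- p.1)%R).
pose t := map refl s.
have sn p : p \in s -> nondegenerate p.
  by move=> ps i; rewrite sh// ltrDl.
have tn p : p \in t -> nondegenerate p.
  by move=> /mapP[q qs ->] i; rewrite !mxE ltrN2 sn.
have dt : pairwise disjoint_boxes t.
  rewrite pairwise_map.
  have : pairwise (fun p q => [&& p \in s, q \in s & disjoint_boxes p q]) s.
    rewrite -(@eq_in_pairwise _ (mem s) disjoint_boxes) ?allss//.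
    by move=> p q ps qs; rewrite ps qs.
  apply: sub_pairwise => p q /and3P[/sn pn /sn qn pq]; apply/asboolP.
  have [i pqi] := separated_boxes pn qn pq.
  apply/seteqP; split => // x [/(_ i) + /(_ i)]; rewrite /= !mxE.
  by move=> /andP[? ?] /andP[? ?]; case: pqi => ?; lra.
have Vst : V s = V t.
  rewrite !V_sum// !big_map; apply: eq_bigr => p _; apply: eq_bigr => i _.
  by rewrite !mxE; lra.
have mid : midset (bunion s) (bunion t) `<=` cball 0%R (d / 2 + n%:R * h)%R.
  move=> _ [x [p ps px] [y [_ /mapP[q qs ->] qy] <-]].
  have [a [pa Aa]] := sA _ ps; have [b [qb Ab]] := sA _ qs.
  rewrite /cball/= subr0 enormZ ger0_norm ?invr_ge0//.
  have xa : (enorm (x - a) <= n%:R * h)%R.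
    apply: enorm_le => i; have := px i; have := pa i; rewrite sh// !mxE.
    move=> /andP[a1 a2] /andP[x1 x2]; rewrite ler_norml; apply/andP; split; lra.
  have yb : (enorm (y + b) <= n%:R * h)%R.
    apply: enorm_le => i; have := qy i; have := qb i; rewrite /refl/= !mxE sh//.
    move=> /andP[a1 a2] /andP[x1 x2]; rewrite ler_norml; apply/andP; split; lra.
  have ab := Ad _ _ Aa Ab.
  have := ler_enormD (x - a + (y + b))%R (a - b)%R.
  have := ler_enormD (x - a)%R (y + b)%R.
  rewrite (_ : (_ + _ + (a - b) = x + y)%R) => [? ?|]; first lra.
  by apply/rowP => i; rewrite !mxE; lra.
have s0 : s != [::].
  have [p] := As _ Ax0; by case: (s).
have t0 : t != [::] by move: s0; rewrite -!size_eq0 !size_map.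
apply: le_trans (le_lebesgue_outer mid).
apply: le_trans (brunn_minkowski_bunion s0 t0 sn tn ds dt).
rewrite -Vst -expr2 sqrtr_sqr ger0_norm ?V_ge0// -VE//.
exact: le_lebesgue_outer.
Qed.

Lemma isodiametric (A : set 'rV[R]_n) (d : R) : (0 < n)%N -> (0 <= d)%R -> ediam A <= d%:E ->
  lebesgue_outer A <= ball_volume R n * ((d / 2) ^+ n)%:E.
Proof.
move=> n_gt0 d0 Ad.
have Adxy x y : A x -> A y -> (enorm (x - y) <= d)%R.
  move=> Ax Ay; rewrite -lee_fin; apply: le_trans Ad.
  by apply: ereal_sup_ubound; exists x => //; exists y.
pose B := fine (ball_volume R n).
have BE : ball_volume R n = B%:E by rewrite fineK// ball_volume_fin_num.
have LA (h : R) : (0 < h)%R ->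
    lebesgue_outer A <= (B * (d / 2 + n%:R * h) ^+ n)%:E.
  move=> h0; apply: le_trans (isodiametric_grid h0 Adxy) _.
  rewrite lebesgue_cball; last first.
    by rewrite ltr_wpDl ?divr_ge0// mulr_gt0// ltr0n.
  by rewrite BE -EFinM mulrC.
have Lfin : lebesgue_outer A \is a fin_num.
  by rewrite ge0_fin_numE ?lebesgue_outer_ge0// (le_lt_trans (LA 1%R _))// ltry.
rewrite BE -EFinM -(fineK Lfin) lee_fin.
have cvgB : (fun k : nat => B * (d / 2 + n%:R * (harmonic k : R)) ^+ n)%R @ \oo -->
    (B * (d / 2 + n%:R * 0) ^+ n)%R.
  apply: cvgM; first exact: cvg_cst.
  have H : (fun k : nat => d / 2 + n%:R * (harmonic k : R))%R @ \oo -->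
      (d / 2 + n%:R * 0)%R.
    apply: cvgD; first exact: cvg_cst.
    by apply: cvgM; [exact: cvg_cst|exact: cvg_harmonic].
  exact: (cvg_comp _ _ H (@exprn_continuous R n _)).
rewrite mulr0 addr0 in cvgB.
rewrite -(cvg_lim _ cvgB)//; apply: limr_ge; first by apply: cvgP cvgB.
by apply: nearW => k; rewrite -lee_fin fineK//; apply: LA; rewrite invr_gt0.
Qed.

End isodiametric.

(** * Hausdorff measure *)

Section hausdorff_metric.
Context {R : realType} {n s : nat}.
Local Open Scope ereal_scope.
Implicit Types (A B : set 'rV[R]_n) (d e : R).
Local Notation H := (@hausdorff_outer R n s).

Lemma ediam_ubound A x y : A x -> A y -> (enorm (x - y))%:E <= ediam A.
Proof. by move=> Ax Ay; apply: ereal_sup_ubound; exists x => //; exists y. Qed.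

Lemma ediam_ge0 A : A !=set0 -> 0 <= ediam A.
Proof.
by case=> x Ax; apply: le_trans (ediam_ubound Ax Ax); rewrite lee_fin enorm_ge0.
Qed.

Lemma diam_cost_le_delta d e A : (d <= e)%R ->
  @diam_cost R n s e A <= diam_cost s d A.
Proof.
move=> de; rewrite /diam_cost; case: eqP => // _.
case: ifPn => [Ae|]; last first.
  rewrite -ltNge => eA; rewrite ifF//; apply/negbTE; rewrite -ltNge.
  by apply: le_lt_trans eA; rewrite lee_fin.
by case: ifPn => // _; rewrite leey.
Qed.

Lemma hausdorff_pre_le_delta d e A : (d <= e)%R ->
  @hausdorff_pre R n s e A <= hausdorff_pre s d A.
Proof.
move=> de; apply: cover_measure_ge => F AF.
apply: le_trans (cover_measure_le _ AF) _.
apply: lee_nneseries => [k _ _|k _]; first exact: diam_cost_ge0.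
exact: diam_cost_le_delta.
Qed.

Lemma hausdorff_pre_le_outer d A : (0 < d)%R -> hausdorff_pre s d A <= H A.
Proof. by move=> d0; apply: ereal_sup_ubound; exists d. Qed.

Lemma hausdorff_outer_le x A e : (0 < e)%R ->
  (forall d, (0 < d)%R -> (d < e)%R -> hausdorff_pre s d A <= x) -> H A <= x.
Proof.
move=> e0 dx; apply: ge_ereal_sup => _ [d /= d0 <-].
apply: le_trans (dx (Num.min d (e / 2))%R _ _).
- by apply: hausdorff_pre_le_delta; rewrite ge_min lexx.
- by rewrite lt_min d0 divr_gt0.
- by rewrite gt_min; apply/orP; right; lra.
Qed.

(** A set of diameter at most [d] cannot meet both [A] and [B], so every cover of the union splits
    into two covers. *)
Lemma hausdorff_preU_separated A B d e : (d < e)%R ->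
  (forall x y, A x -> B y -> (e <= enorm (x - y))%R) ->
  hausdorff_pre s d A + hausdorff_pre s d B <= @hausdorff_pre R n s d (A `|` B).
Proof.
move=> de AB; apply: cover_measure_ge => F ABF.
pose FA k := if `[< F k `&` A !=set0 >] then F k else set0.
pose FB k := if `[< F k `&` B !=set0 >] then F k else set0.
apply: (@le_trans _ _ (\sum_(k <oo) (diam_cost s d (FA k) + diam_cost s d (FB k)))).
  rewrite nneseriesD; [|by move=> *; exact: diam_cost_ge0..].
  apply: leeD; apply: cover_measure_le => x xAB.
    have [|k _ Fx] := ABF x; first by left.
    by exists k => //; rewrite /FA asboolT//; exists x.
  have [|k _ Fx] := ABF x; first by right.
  by exists k => //; rewrite /FB asboolT//; exists x.
apply: lee_nneseries => [k _ _|k _]; first by rewrite adde_ge0// diam_cost_ge0.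
rewrite /FA /FB; case: asboolP => [[x [Fx Ax]]|_]; last first.
  by rewrite diam_cost0 add0e; case: asboolP; rewrite ?diam_cost0 ?diam_cost_ge0.
case: asboolP => [[y [Fy By]]|_]; last by rewrite diam_cost0 adde0.
suff -> : diam_cost s d (F k) = +oo by rewrite leey.
rewrite /diam_cost ifF; last by apply/negbTE/set0P; exists x.
rewrite ifF//; apply/negbTE; rewrite -ltNge.
apply: lt_le_trans (ediam_ubound Fx Fy); rewrite lte_fin.
by apply: lt_le_trans de (AB _ _ Ax By).
Qed.

(** Additivity at each scale passes to the suprema one after the other: the scale of [B] is taken
    smaller than that of [A], and premeasures increase as the scale shrinks. *)
Lemma hausdorff_outerU_separated A B e : (0 < e)%R ->
  (forall x y, A x -> B y -> (e <= enorm (x - y))%R) ->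
  H A + H B <= H (A `|` B).
Proof.
move=> e0 AB.
have [->|ABfin] := eqVneq (H (A `|` B)) +oo; first by rewrite leey.
have fin : H (A `|` B) \is a fin_num.
  by rewrite ge0_fin_numE ?hausdorff_outer_ge0// ltey.
have finB : H B \is a fin_num.
  rewrite ge0_fin_numE ?hausdorff_outer_ge0//.
  apply: (@le_lt_trans _ _ (H (A `|` B))); last by rewrite ltey.
  by apply: le_hausdorff_outer; exact: subsetUr.
have HdB d : (0 < d)%R -> (d < e)%R -> hausdorff_pre s d A + hausdorff_pre s d B <= H (A `|` B).
  move=> d0 de; apply: le_trans (hausdorff_pre_le_outer _ d0).
  exact: hausdorff_preU_separated AB.
have preBfin d : (0 < d)%R -> hausdorff_pre s d B \is a fin_num.
  move=> d0; rewrite ge0_fin_numE ?hausdorff_pre_ge0//.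
  apply: le_lt_trans (hausdorff_pre_le_outer _ d0) _.
  by rewrite -ge0_fin_numE ?hausdorff_outer_ge0.
rewrite -leeBrDr//; apply: (hausdorff_outer_le e0) => d d0 de.
rewrite leeBrDr// addeC -leeBrDr; last first.
  rewrite ge0_fin_numE ?hausdorff_pre_ge0//.
  apply: (@le_lt_trans _ _ (H (A `|` B))); last by rewrite ltey.
  apply: le_trans (hausdorff_pre_le_outer _ d0) _.
  by apply: le_hausdorff_outer; exact: subsetUl.
apply: (hausdorff_outer_le d0) => d' d'0 d'd.
rewrite leeBrDr; last first.
  rewrite ge0_fin_numE ?hausdorff_pre_ge0//.
  apply: (@le_lt_trans _ _ (H (A `|` B))); last by rewrite ltey.
  apply: le_trans (hausdorff_pre_le_outer _ d0) _.
  by apply: le_hausdorff_outer; exact: subsetUl.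
rewrite addeC; apply: le_trans (HdB d' d'0 (lt_trans d'd de)).
by rewrite leeD2r//; apply: hausdorff_pre_le_delta; exact: ltW.
Qed.

Lemma hausdorff_outerU A B : H (A `|` B) <= H A + H B.
Proof. exact: outer_measureU2. Qed.

(* The strips [c - 1/(k+1) <= x_i < c - 1/(k+2)] of equal parity are at positive
   distance from each other, hence the series of their measures converges. *)
Lemma halfspace_haus (i : 'I_n) (c : R) : H.-caratheodory (halfspace i c).
Proof.
apply: le_caratheodory_measurable => X.
change (H (X `&` halfspace i c) + H (X `&` ~` halfspace i c) <= H X).
have [->|Xoo] := eqVneq (H X) +oo; first by rewrite leey.
pose u k : R := (c - k.+1%:R^-1)%R.
have u_incr k l : (k <= l)%N -> (u k <= u l)%R.
  by move=> kl; rewrite lerD2l lerN2 lef_pV2 ?posrE ?ltr0n// ler_nat.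
have u_lt k : (u k < u k.+1)%R.
  by rewrite ltrD2l ltrN2 ltf_pV2 ?posrE ?ltr0n// ltr_nat.
have uc k : (u k < c)%R by rewrite gtrDl oppr_lt0 invr_gt0.
pose Rk k := X `&` [set x | (u k <= x 0%R i < u k.+1)%R].
pose Xk k := X `&` [set x | (x 0%R i < u k)%R].
have sepc (a b : R) (A B : set 'rV[R]_n) : (a < b)%R ->
    (forall x, A x -> (x 0%R i < a)%R) -> (forall x, B x -> (b <= x 0%R i)%R) ->
    H A + H B <= H (A `|` B).
  move=> ab Aa Bb; apply: (@hausdorff_outerU_separated _ _ (b - a)%R).
    by rewrite subr_gt0.
  move=> x y /Aa xa /Bb yb; rewrite enormB.
  apply: le_trans (coord_le_enorm _ i); rewrite !mxE.
  by apply: le_trans (ler_norm _); lra.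
have XH k : H (Xk k) <= H X by apply: le_hausdorff_outer; exact: subIsetl.
have parity b N : \sum_(k < N.+1) H (Rk (2 * k + b)%N) <= H (Xk (2 * N + b).+1).
  elim: N => [|N IH].
    rewrite big_ord1/=; apply: le_hausdorff_outer.
    by move=> x [Xx /andP[_ xb]]; split => //=; rewrite muln0 add0n in xb *.
  rewrite big_ord_recr/=; apply: le_trans (leeD IH (lexx _)) _.
  apply: (@le_trans _ _ (H (Xk (2 * N + b).+1 `|` Rk (2 * N.+1 + b)%N))).
    apply: (sepc (u (2 * N + b).+1) (u (2 * N.+1 + b)%N)).
    - by have -> : (2 * N.+1 + b = (2 * N + b).+2)%N by lia.
    - by move=> x [].
    - by move=> x [_ /andP[]].
  apply: le_hausdorff_outer => x [[Xx xN]|[Xx /andP[_ xN]]]; split => //=.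
  apply: lt_le_trans xN _; apply: u_incr; rewrite ltnS leq_add2r leq_mul2l/=.
  exact: leqnSn.
have ser b : \sum_(k <oo) H (Rk (2 * k + b)%N) < +oo.
  apply: (@le_lt_trans _ _ (H X)); last by rewrite ltey.
  apply: lime_le; first by apply: is_cvg_nneseries => *; exact: hausdorff_outer_ge0.
  apply: nearW => N; rewrite big_mkord; case: N => [|N].
    by rewrite big_ord0 hausdorff_outer_ge0.
  exact: le_trans (parity b N) (XH _).
have tail b : \sum_(N <= k <oo) H (Rk (2 * k + b)%N) @[N --> \oo] --> 0.
  by apply: nneseries_tail_cvg => // k _; exact: hausdorff_outer_ge0.
have XT N : X `&` halfspace i c `<=` Xk (2 * N)%N `|`
    (\bigcup_(k in ~` `I_N) Rk (2 * k + 0)%N `|` \bigcup_(k in ~` `I_N) Rk (2 * k + 1)%N).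
  move=> x [Xx xc]; have [xN|Nx] := ltP (x 0%R i) (u (2 * N)%N); first by left.
  right; rewrite /halfspace/= in xc.
  have cx0 : (0 < c - x 0%R i)%R by rewrite subr_gt0.
  have ux0 : (u 0%N <= x 0%R i)%R by apply: le_trans Nx; exact: u_incr.
  (* The index of the strip containing [x]: [k + 1] is the integer part of [1 / (c - x_i)]. *)
  pose k := (Num.truncn (c - x 0%R i)^-1).-1.
  have t1 : (1 <= Num.truncn (c - x 0%R i)^-1)%N.
    rewrite truncn_ge_nat ?invr_ge0 ?(ltW cx0)// -invr1 lef_pV2 ?posrE//.
    by move: ux0; rewrite /u invr1; lra.
  have kE : k.+1 = Num.truncn (c - x 0%R i)^-1 by rewrite prednK.
  have /andP[k1 k2] : (k.+1%:R <= (c - x 0%R i)^-1 < k.+2%:R)%R.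
    by rewrite kE truncn_itv// invr_ge0 ltW.
  have xk : (u k <= x 0%R i < u k.+1)%R.
    rewrite /u; apply/andP; split.
      by rewrite lerBlDl -lerBlDr -[leLHS]invrK lef_pV2 ?posrE ?invr_gt0// ltr0n.
    by rewrite ltrBrDl -ltrBrDr -[ltRHS]invrK ltf_pV2 ?posrE ?invr_gt0// ltr0n.
  have kN : (2 * N <= k)%N.
    rewrite leqNgt; apply/negP => kN; have /andP[_] := xk.
    by apply/negP; rewrite -leNgt; apply: le_trans Nx; exact: u_incr.
  have Nk : (N <= k./2)%N by rewrite -(doubleK N) half_leq// -mul2n.
  have [ok|ek] := boolP (odd k); [right|left]; exists k./2;
    rewrite /= ?/mkset; try by apply/negP; rewrite -leqNgt.
    by have -> : (2 * k./2 + 1 = k)%N by lia.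
  by have -> : (2 * k./2 + 0 = k)%N by lia.
have key N : H (X `&` halfspace i c) + H (X `&` ~` halfspace i c) <=
    H X + (\sum_(N <= k <oo) H (Rk (2 * k + 0)%N) + \sum_(N <= k <oo) H (Rk (2 * k + 1)%N)).
  have HXT : H (X `&` halfspace i c) <= _ := @le_hausdorff_outer R n s _ _ (XT N).
  apply: le_trans (leeD HXT (lexx _)) _.
  apply: (@le_trans _ _ (H (Xk (2 * N)%N) + H (X `&` ~` halfspace i c) +
    (\sum_(N <= k <oo) H (Rk (2 * k + 0)%N) + \sum_(N <= k <oo) H (Rk (2 * k + 1)%N)))).
    rewrite addeAC leeD2r//.
    apply: le_trans (hausdorff_outerU _ _) _; rewrite leeD2l//.
    apply: le_trans (hausdorff_outerU _ _) _.
    by apply: leeD; exact: outer_measure_sigma_subadditive_tail.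
  rewrite leeD2r//; apply: le_trans (sepc _ _ _ _ (uc (2 * N)%N) _ _) _.
  - by move=> x [].
  - by move=> x [_ /negP]; rewrite -leNgt.
  - by apply: le_hausdorff_outer => x [|] [].
have lim : (H X + (\sum_(N <= k <oo) H (Rk (2 * k + 0)%N) +
    \sum_(N <= k <oo) H (Rk (2 * k + 1)%N))) @[N --> \oo] --> H X + (0 + 0).
  apply: cvgeD; [by rewrite adde0 fin_num_adde_defl|exact: cvg_cst|].
  by apply: cvgeD; [|exact: tail..].
rewrite !adde0 in lim; rewrite -(cvg_lim _ lim)//.
by apply: lime_ge; [apply: cvgP lim|exact: nearW].
Qed.

Lemma box_haus (a b : 'rV[R]_n) : H.-caratheodory (box a b).
Proof. exact: halfspace_box halfspace_haus _ _. Qed.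

Lemma open_haus (U : set 'rV[R]_n) : open U -> H.-caratheodory U.
Proof. exact: open_caratheodory halfspace_haus _. Qed.

End hausdorff_metric.

Section hausdorff_pre_outer_measure.
Context {R : realType} {n s : nat} (d : R).

HB.instance Definition _ := isOuterMeasure.Build R 'rV[R]_n (hausdorff_pre s d)
  (@mu_ext0 _ (all_sets 'rV[R]_n) R _ (@diam_cost0 R n s d) (@diam_cost_ge0 R n s d))
  (@hausdorff_pre_ge0 R n s d)
  (@le_mu_ext _ (all_sets 'rV[R]_n) R (@diam_cost R n s d))
  (@mu_ext_sigma_subadditive _ (all_sets 'rV[R]_n) R _ (@diam_cost_ge0 R n s d)).

Lemma hausdorff_preU (A B : set 'rV[R]_n) :
  (hausdorff_pre s d (A `|` B) <= hausdorff_pre s d A + hausdorff_pre s d B)%E.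
Proof. exact: outer_measureU2. Qed.

Lemma hausdorff_pre_bigcup (F : (set 'rV[R]_n)^nat) :
  (hausdorff_pre s d (\bigcup_k F k) <= \sum_(k <oo) hausdorff_pre s d (F k))%E.
Proof. exact: outer_measure_sigma_subadditive. Qed.

Lemma le_hausdorff_pre (A B : set 'rV[R]_n) : A `<=` B ->
  (hausdorff_pre s d A <= hausdorff_pre s d B)%E.
Proof. exact: le_outer_measure. Qed.

Lemma hausdorff_pre0 : hausdorff_pre s d (set0 : set 'rV[R]_n) = 0%E.
Proof. exact: outer_measure0. Qed.

End hausdorff_pre_outer_measure.

Lemma lee_continuous0 (R : realType) (X : \bar R) (g : R -> R) (c : R) :
  0 < c -> {for 0, continuous g} ->
  (forall h, 0 < h -> h <= c -> (X <= (g h)%:E)%E) -> (X <= (g 0)%:E)%E.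
Proof.
move=> c0 g_cont Xg; case: X Xg => [r| |] Xg; rewrite ?leNye//; last first.
  by have := Xg c c0 (lexx _).
rewrite lee_fin leNgt; apply/negP => gr.
have /cvgrPdist_lt/(_ (r - g 0)) := g_cont; rewrite subr_gt0 => /(_ gr).
move=> [e /= e0 eP].
pose h := Num.min c (e / 2).
have h0 : 0 < h by rewrite lt_min c0 divr_gt0.
have hc : h <= c by rewrite ge_min lexx.
have he : h < e by rewrite gt_min; apply/orP; right; lra.
have := Xg h h0 hc; rewrite lee_fin; apply/negP; rewrite -ltNge.
have /ltr_normlP[] : `|g 0 - g h| < r - g 0.
  by apply: eP; rewrite /= sub0r normrN gtr0_norm.
by move=> ? ?; lra.
Qed.

(** * Hausdorff measure on coordinate hyperplanes *)

Section hyperplane.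
Context {R : realType} {m : nat}.
Hypothesis m_gt0 : (0 < m)%N.
Local Open Scope ereal_scope.
Implicit Types (A : set 'rV[R]_m) (i : 'I_m.+1) (t d k : R).
Local Notation H := (@hausdorff_outer R m.+1 m).
Local Notation bv := (ball_volume R m).

Lemma enorm_ins i t (x y : 'rV[R]_m) : enorm (ins i t x - ins i t y) = enorm (x - y).
Proof.
rewrite /enorm /dot (bigD1_ord i)//= !mxE unlift_none subrr mul0r add0r.
by congr Num.sqrt; apply: eq_bigr => j _; rewrite !mxE liftK.
Qed.

Lemma enorm_del i (x y : 'rV[R]_m.+1) : (enorm (del i x - del i y) <= enorm (x - y))%R.
Proof.
rewrite /enorm ler_sqrt ?dotxx_ge0// /dot [leRHS](bigD1_ord i)//=.
rewrite -[leLHS]add0r lerD//; first by rewrite -expr2 sqr_ge0.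
by apply: ler_sum => j _; rewrite !mxE.
Qed.

(** Forgetting a coordinate does not increase diameters, and by the isodiametric inequality the
    projection of a covering set has measure at most its diameter cost. *)
Lemma lebesgue_le_hausdorff i t A :
  lebesgue_outer A <= H [set ins i t x | x in A].
Proof.
apply: le_trans (@hausdorff_pre_le_outer _ _ _ 1%R _ _) => //.
apply: cover_measure_ge => F AF.
apply: (@le_trans _ _ (\sum_(j <oo) lebesgue_outer [set del i x | x in F j])).
  apply: le_trans (lebesgue_outer_bigcup _); apply: le_lebesgue_outer => x Ax.
  have [j _ Fx] : (\bigcup_j F j) (ins i t x) by apply: AF; exists x.
  by exists j => //; exists (ins i t x) => //; rewrite insK.
apply: lee_nneseries => [j _ _|j _]; first exact: lebesgue_outer_ge0.
rewrite /diam_cost; case: eqP => [->|/eqP/set0P Fj0].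
  by rewrite image_set0 lebesgue_outer0.
case: ifPn => [Fj|]; last by rewrite leey.
have fin : ediam (F j) \is a fin_num.
  by rewrite ge0_fin_numE ?ediam_ge0// (le_lt_trans Fj)// ltry.
apply: isodiametric => //; first by rewrite fine_ge0// ediam_ge0.
rewrite fineK//; apply: ge_ereal_sup => _ [_ [x Fx <-] [_ [y Fy <-] <-]].
by apply: le_trans (ediam_ubound Fx Fy); rewrite lee_fin enorm_del.
Qed.

Lemma ediam_ins i t A : ediam [set ins i t x | x in A] <= ediam A.
Proof.
apply: ge_ereal_sup => _ [_ [x Ax <-] [_ [y Ay <-] <-]].
by rewrite enorm_ins; exact: ediam_ubound.
Qed.

Lemma hausdorff_pre_ins_le i t d e A : (0 <= e)%R -> (e <= d)%R -> ediam A <= e%:E ->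
  hausdorff_pre m d [set ins i t x | x in A] <= bv * ((e / 2) ^+ m)%:E.
Proof.
move=> e0 ed Ae; have bv0 : 0 <= bv by exact: lebesgue_outer_ge0.
apply: le_trans (cover_measure_le1 _ _ _) _; [exact: diam_cost0|exact: diam_cost_ge0|].
rewrite /diam_cost; case: eqP => [_|/eqP/set0P A0].
  by rewrite mule_ge0// lee_fin exprn_ge0// divr_ge0.
have Ae' := le_trans (ediam_ins i t A) Ae.
rewrite ifT; last by apply: le_trans Ae' _; rewrite lee_fin.
apply: lee_wpmul2l => //; rewrite lee_fin lerXn2r ?nnegrE ?divr_ge0//.
  by rewrite fine_ge0// ediam_ge0.
rewrite ler_pM2r// -lee_fin fineK// ge0_fin_numE ?ediam_ge0//.
by apply: le_lt_trans Ae' _; rewrite ltry.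
Qed.

(** The constant [k] compares the premeasure at scale [d] with the volume on small cubes. The
    reverse inequality between the measures amounts to showing that [k = 1] is admissible. *)
Definition cube_bound i t d k := [/\ (0 < k)%R, (0 < d)%R &
  forall (a : 'rV[R]_m) (h : R), (0 < h)%R -> (m%:R * h <= d)%R ->
  hausdorff_pre m d [set ins i t x | x in box a (\row_j (a 0%R j + h)%R)] <=
    (k * h ^+ m)%:E].

(** Arbitrary sets reduce to boxes, and boxes to a grid of side [h], whose cubes lie in the box
    enlarged by [h] on every side; then [h] tends to 0. *)
Lemma cube_bound_le i t d k A : cube_bound i t d k ->
  hausdorff_pre m d [set ins i t x | x in A] <= k%:E * lebesgue_outer A.
Proof.
move=> [k0 d0 kP]; rewrite -lee_pdivrMl//; apply: cover_measure_ge => F AF.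
rewrite lee_pdivrMl// -nneseriesZl; last by move=> *; exact: box_cost_ge0.
apply: (@le_trans _ _ (\sum_(j <oo) hausdorff_pre m d [set ins i t x | x in F j])).
  apply: le_trans (hausdorff_pre_bigcup _ _); apply: le_hausdorff_pre.
  by move=> _ [x /AF[j _ Fx] <-]; exists j => //; exists x.
apply: lee_nneseries => [j _ _|j _]; first exact: hausdorff_pre_ge0.
have [->|] := eqVneq (box_cost (F j)) +oo; first by rewrite gt0_muley ?leey// lte_fin.
case/box_costP => [->|[a [b [ab ->]]]].
  by rewrite image_set0 hausdorff_pre0 box_cost0 mule0.
have -> : box_cost (box a b) = (vol a b)%:E by rewrite box_cost_box.
pose g (h : R) := (k * \prod_(l < m) (b 0%R l - a 0%R l + 2 * h))%R.
rewrite -EFinM (_ : k * vol a b = g 0)%R; last first.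
  by congr (_ * _)%R; apply: eq_bigr => l _; rewrite mulr0 addr0.
have m0 : (0 < m%:R :> R)%R by rewrite ltr0n.
apply: (@lee_continuous0 _ _ g (d / m%:R)%R); first by rewrite divr_gt0.
  have gc : continuous (fun h : R => \prod_(l < m) (b 0%R l - a 0%R l + 2 * h))%R.
    apply: continuous_big => [|l _ h]; first exact: mul_continuous.
    apply: cvgD; first exact: cvg_cst.
    by apply: cvgM; [exact: cvg_cst|exact: cvg_id].
  by apply: cvgM; [exact: cvg_cst|exact: gc].
move=> h h0 hd.
have M x l : box a b x -> (`|x 0%R l| <= \sum_(j < m) (`|a 0%R j| + `|b 0%R j|))%R.
  move=> /(_ l)/andP[ax xb]; rewrite (bigD1 l)//= -[leLHS]addr0 lerD//; last first.
    by apply: sumr_ge0 => j' _; rewrite addr_ge0.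
  have := ler_norm (b 0%R l); have := ler_norm (- a 0%R l); rewrite normrN => ? ?.
  have := normr_ge0 (a 0%R l); have := normr_ge0 (b 0%R l) => ? ?.
  by rewrite ler_norml; apply/andP; split; lra.
have [s [sh sA ds As]] := grid_cover h0 M.
have sn p : p \in s -> nondegenerate p by move=> ps l; rewrite sh// ltrDl.
have hm : (m%:R * h <= d)%R by rewrite mulrC -ler_pdivlMr.
apply: (@le_trans _ _ (k * V s)%:E).
  apply: (@le_trans _ _ (hausdorff_pre m d [set ins i t x | x in bunion s])).
    by apply: le_hausdorff_pre => _ [x xab <-]; exists x => //; exact: As.
  rewrite V_sum//; elim: s sh {sA ds As sn} => [|p s IH] sh.
    rewrite (_ : bunion _ = set0) ?image_set0 ?hausdorff_pre0 ?big_nil ?mulr0//.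
    by apply/seteqP; split => // x [].
  rewrite bunion_cons image_setU big_cons mulrDr EFinD.
  apply: le_trans (hausdorff_preU _ _ _) _; apply: leeD; last first.
    by apply: IH => q qs; apply: sh; rewrite in_cons qs orbT.
  have pE : p.2 = (\row_j (p.1 0%R j + h))%R.
    by apply/rowP => j'; rewrite mxE sh// mem_head.
  rewrite pE; apply: le_trans (kP _ _ h0 hm) _; rewrite lee_fin ler_pM2l// /vol.
  rewrite (eq_bigr (fun=> h)); first by rewrite prodr_const card_ord.
  by move=> l _; rewrite mxE addrAC subrr add0r.
rewrite /g lee_fin ler_pM2l// -lee_fin -VE//.
pose a' := (\row_l (a 0%R l - h))%R; pose b' := (\row_l (b 0%R l + h))%R.
apply: (@le_trans _ _ (lebesgue_outer (box a' b'))).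
  apply: le_lebesgue_outer => x [p ps px] l; have [y [py yab]] := sA _ ps.
  have := px l; have := py l; have := yab l; rewrite sh// !mxE.
  by move=> /andP[? ?] /andP[? ?] /andP[? ?]; apply/andP; split; lra.
rewrite lebesgue_outer_box; last by move=> l; rewrite !mxE; have := ab l; lra.
rewrite lee_fin le_eqVlt; apply/orP; left; apply/eqP/eq_bigr => l _.
by rewrite !mxE; ring.
Qed.

Let B := fine bv.
Let BE : bv = B%:E. Proof. by rewrite fineK// ball_volume_fin_num. Qed.
Let B0 : (0 < B)%R. Proof. by rewrite -lte_fin -BE ball_volume_gt0. Qed.

(** A crude constant to start from: the cube covers itself, with diameter at most [m h]. *)
Lemma cube_bound0 i t d : (0 < d)%R -> cube_bound i t d (B * (m%:R / 2) ^+ m)%R.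
Proof.
move=> d0; split => //; first by rewrite mulr_gt0// exprn_gt0// divr_gt0// ltr0n.
move=> a h h0 hd; have mh0 : (0 <= m%:R * h)%R by rewrite mulr_ge0// ltW.
apply: le_trans (hausdorff_pre_ins_le i t mh0 hd _) _.
  apply: ge_ereal_sup => _ [x xa [y ya <-]]; rewrite lee_fin; apply: enorm_le => l.
  have := xa l; have := ya l; rewrite !mxE => /andP[? ?] /andP[? ?].
  by rewrite ler_norml; apply/andP; split; lra.
have -> : ((m%:R * h / 2) ^+ m = (m%:R / 2) ^+ m * h ^+ m)%R.
  by rewrite -exprMn; congr (_ ^+ _)%R; ring.
by rewrite BE -EFinM mulrA.
Qed.

(* An inscribed ball has exactly the cost [ball_volume * r ^ m]; only the rest of
   the cube is estimated with the constant [k]. *)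
Lemma cube_bound_step i t d k : cube_bound i t d k ->
  cube_bound i t d (B / 4 ^+ m + k * (1 - B / 4 ^+ m))%R.
Proof.
move=> kb; have [k0 d0 kP] := kb.
have ball_le (a : 'rV[R]_m) (h : R) : (0 < h)%R ->
    cball (\row_l (a 0%R l + h / 2))%R (h / 4)%R `<=` box a (\row_l (a 0%R l + h))%R.
  move=> h0 x xB l; have := le_trans (coord_le_enorm _ l) xB.
  by rewrite !mxE ler_norml => /andP[? ?]; apply/andP; split; lra.
have LB (c : 'rV[R]_m) (h : R) : (0 < h)%R ->
    lebesgue_outer (cball c (h / 4)%R) = (B / 4 ^+ m * h ^+ m)%:E.
  by move=> h0; rewrite lebesgue_cball ?divr_gt0// BE -EFinM expr_div_n; congr EFin; ring.
have LQ (a : 'rV[R]_m) (h : R) : (0 < h)%R ->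
    lebesgue_outer (box a (\row_l (a 0%R l + h))%R) = (h ^+ m)%:E.
  move=> h0; rewrite lebesgue_outer_box; last by move=> l; rewrite mxE lerDl ltW.
  congr EFin; rewrite /vol (eq_bigr (fun=> h)); first by rewrite prodr_const card_ord.
  by move=> l _; rewrite mxE addrAC subrr add0r.
have B4 : (B / 4 ^+ m <= 1)%R.
  have := le_lebesgue_outer (@ball_le 0%R 1%R ltr01).
  by rewrite LB// LQ// expr1n mulr1 lee_fin.
split => //.
  have ? : (0 < B / 4 ^+ m)%R by rewrite divr_gt0// exprn_gt0.
  by rewrite ltr_pwDl// mulr_ge0 ?(ltW k0)// subr_ge0.
move=> a h h0 hd.
set Q := box a _; set C := cball (\row_l (a 0%R l + h / 2))%R (h / 4)%R.
have CQ : C `<=` Q by exact: ball_le.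
have -> : Q = C `|` (Q `&` ~` C).
  by rewrite setUIr setUCr setIT; apply/esym/setUidPr.
rewrite image_setU; apply: le_trans (hausdorff_preU _ _ _) _.
have h2d : (h / 2 <= d)%R.
  apply: le_trans hd; have : (1 <= m%:R :> R)%R by rewrite ler1n.
  by move=> m1; apply: (@le_trans _ _ (1 * h)%R); [lra|rewrite ler_pM2r].
have h20 : (0 <= h / 2)%R by rewrite divr_ge0// ltW.
have Cd : ediam C <= (h / 2)%:E.
  apply: ge_ereal_sup => _ [x xC [y yC <-]]; rewrite lee_fin.
  pose c := (\row_l (a 0%R l + h / 2))%R : 'rV[R]_m.
  have -> : (x - y = (x - c) + (c - y))%R by rewrite addrA subrK.
  apply: le_trans (ler_enormD _ _) _; rewrite (enormB c).
  by move: xC yC; rewrite /C /cball/= -/c => ? ?; lra.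
apply: le_trans (leeD (hausdorff_pre_ins_le i t h20 h2d Cd) (cube_bound_le (Q `&` ~` C) kb)) _.
have CF : lebesgue_outer (Q `&` ~` C) = (h ^+ m - B / 4 ^+ m * h ^+ m)%:E.
  have mC : (@lebesgue_outer R m).-caratheodory C.
    apply: leb_closed; exact: closed_cball.
  have := LQ a h h0; rewrite -/Q (lebesgue_outer_cut Q mC).
  rewrite (setIidr CQ) LB// => E.
  have fin : lebesgue_outer (Q `&` ~` C) \is a fin_num.
    rewrite ge0_fin_numE ?lebesgue_outer_ge0//.
    apply: (@le_lt_trans _ _ (lebesgue_outer Q)); last by rewrite LQ// ltry.
    by apply: le_lebesgue_outer; exact: subIsetl.
  by move: E; rewrite -(fineK fin) -EFinD => -[] E; congr EFin; lra.
rewrite CF BE -!EFinM -EFinD lee_fin le_eqVlt; apply/orP; left; apply/eqP.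
have -> : (h / 2 / 2 = h / 4)%R by field.
by rewrite expr_div_n; ring.
Qed.

(** Let [k] be the infimum of the admissible constants. If [k >= 1], then it is itself admissible,
    and the previous step gives the admissible constant [k - th (k - 1)] with [th = B / 4 ^ m > 0].
    Minimality then forces [k = 1]. *)
Lemma cube_bound1 i t d : (0 < d)%R -> cube_bound i t d 1.
Proof.
move=> d0; pose S := [set k | cube_bound i t d k].
have S0 : S !=set0 by exists (B * (m%:R / 2) ^+ m)%R; exact: cube_bound0.
have Slb : has_lbound S by exists 0%R => k [/ltW].
have up k k' : (k <= k')%R -> S k -> S k'.
  move=> kk' [k0 _ kP]; split => //; first exact: lt_le_trans kk'.
  move=> a h h0 hd; apply: le_trans (kP _ _ h0 hd) _.
  by rewrite lee_fin ler_wpM2r// exprn_ge0// ltW.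
have [S1|S1] := ltP (inf S) 1%R.
  have [k Sk k1] := inf_lt S0 S1.
  by apply: up Sk; exact: ltW.
have SI : S (inf S).
  split => //; first exact: lt_le_trans ltr01 S1.
  move=> a h h0 hd; have hm0 : (0 < h ^+ m)%R by rewrite exprn_gt0.
  have [k1 [_ _ k1P]] := S0; have := k1P a h h0 hd.
  set X := hausdorff_pre _ _ _ => Xk1.
  have Xfin : X \is a fin_num.
    by rewrite ge0_fin_numE ?hausdorff_pre_ge0// (le_lt_trans Xk1)// ltry.
  rewrite -(fineK Xfin) lee_fin -ler_pdivrMr//; apply: lb_le_inf => // k [_ _ kP].
  by rewrite ler_pdivrMr// -lee_fin fineK//; exact: kP.
have := inf_lbound Slb (cube_bound_step SI).
have th0 : (0 < B / 4 ^+ m)%R by rewrite divr_gt0// exprn_gt0.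
rewrite mulrBr mulr1 addrCA lerDl subr_ge0 ger_pMl// => S1'.
by have -> : 1%R = inf S by apply/eqP; rewrite eq_le S1 S1'.
Qed.

Theorem hausdorff_hyperplane i t A : H [set ins i t x | x in A] = lebesgue_outer A.
Proof.
apply/eqP; rewrite eq_le lebesgue_le_hausdorff andbT.
apply: ge_ereal_sup => _ [d d0 <-].
by have := cube_bound_le A (cube_bound1 i t d0); rewrite mul1e.
Qed.

End hyperplane.

(** * Functions of class C1 *)

Section continuous_measurable.
Context {R : realType} {n : nat} (mu : {outer_measure set 'rV[R]_n -> \bar R}).
Hypothesis mu_halfspace : forall i c, mu.-caratheodory (@halfspace R n i c).

Lemma continuous_caratheodory (f : 'rV[R]_n -> R) : continuous f ->
  measurable_fun [set: caratheodory_type mu] (f : caratheodory_type mu -> R).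
Proof.
move=> cf; apply: (measurability _ (RGenOpens.measurableE R)).
move=> _ [_ [a [b ->] <-]]; rewrite setTI.
apply: (open_caratheodory mu_halfspace).
by move/continuousP: cf; apply; exact: interval_open.
Qed.

End continuous_measurable.

Section coordinates.
Context {R : realType} {n : nat}.
Implicit Types (f : 'rV[R]_n -> R) (x y : 'rV[R]_n) (K : set 'rV[R]_n).

Lemma nbhs_coord (x : 'rV[R]_n) (A : set 'rV[R]_n) : nbhs x A <->
  exists2 r : R, 0 < r & forall y : 'rV[R]_n, (forall i, `|x 0 i - y 0 i| < r) -> A y.
Proof.
split => [/nbhs_ballP|H]; last apply/nbhs_ballP.
  move=> [r r0 rA]; exists r => //.
  by move=> y xy; apply: rA; split => // i j; rewrite (ord1 i); exact: xy.
case: H => r r0 rA; exists r => // y [_ xy]; apply: rA => i; exact: xy.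
Qed.

Lemma continuous_atP f x : (forall e : R, 0 < e -> exists2 r : R, 0 < r &
    forall y, (forall i, `|x 0 i - y 0 i| < r) -> `|f x - f y| < e) ->
  {for x, continuous f}.
Proof.
move=> H A /nbhs_ballP[e /= e0 eA]; have [r r0 rP] := H e e0.
by apply/nbhs_coord; exists r => // y /rP; exact: eA.
Qed.

Lemma heine f K (e : R) : compact K -> continuous f -> 0 < e ->
  exists2 r : R, 0 < r & forall x y, K x -> (forall i, `|x 0 i - y 0 i| < r) ->
    `|f x - f y| < e.
Proof.
move=> cK cf e0.
pose P (r : R) (x : 'rV[R]_n) := forall y, (forall i, `|x 0 i - y 0 i| < r) ->
  `|f x - f y| < e.
have : \forall r \near 0^'+, K `<=` P r.
  move/compact_near_coveringP : cK; apply => x Kx.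
  have /cvgrPdist_lt/(_ (e / 2)) := cf x; rewrite divr_gt0// => /(_ erefl).
  move=> /nbhs_coord[d d0 dP].
  exists ([set y : 'rV[R]_n | forall i, `|x 0%R i - y 0%R i| < d / 2], [set r | r < d / 2]).
    split; first by apply/nbhs_coord; exists (d / 2); rewrite ?divr_gt0.
    by near=> r => /=; near: r; apply: nbhs_right_lt; rewrite divr_gt0.
  move=> [y r] /= [xy rd] z yz.
  have := dP y; have := dP z => /= Hz Hy.
  rewrite -(subrK (f x) (f y)) -addrA.
  apply: le_lt_trans (ler_normD _ _) _.
  have -> : e = e / 2 + e / 2 by lra.
  apply: ltrD; first by rewrite distrC; apply: Hy => i; have := xy i; lra.
  apply: Hz => i; have := xy i; have := yz i => ? ?.
  have := ler_distD (y 0 i) (x 0 i) (z 0 i); lra.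
move=> [d /= d0 dP].
have d20 : 0 < d / 2 by rewrite divr_gt0.
exists (d / 2) => // x y Kx; apply: (dP (d / 2)) => //=.
by rewrite sub0r normrN gtr0_norm//; lra.
Unshelve. all: by end_near. Qed.

Definition cbox (a b : 'rV[R]_n) : set 'rV[R]_n :=
  [set x | forall i, a 0 i <= x 0 i <= b 0 i].

Lemma box_sub_cbox a b : box a b `<=` cbox a b.
Proof. by move=> x xab i; have /andP[-> /ltW ->] := xab i. Qed.

Lemma compact_cbox a b : compact (cbox a b).
Proof.
rewrite (_ : cbox a b = [set v | forall i, `[a 0 i, b 0 i]%classic (v ord0 i)]).
  by apply: (@rV_compact R n (fun i => `[a 0 i, b 0 i]%classic)) => i; exact: segment_compact.
apply/seteqP; split => x xab i; have := xab i; rewrite /= in_itv//=.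
Qed.

Lemma continuous_cbox_bounded f a b : continuous f ->
  exists2 M, 0 <= M & forall x, cbox a b x -> `|f x| <= M.
Proof.
move=> cf; have [[x0 x0ab]|ab0] := pselect (cbox a b !=set0); last first.
  by exists 0 => // x xab; exfalso; apply: ab0; exists x.
have cnf : {within cbox a b, continuous (fun x => `|f x|)}.
  apply: continuous_subspaceT => x.
  by apply: continuous_comp; [exact: cf|exact: norm_continuous].
have [|c _ cP] := EVT_max_rV _ (@compact_cbox a b) cnf; first by exists x0.
exists `|f c| => // x xab; apply: cP; exact/mem_set.
Qed.

Lemma continuous_box_integrable f a b : continuous f ->
  (leb R n).-integrable (box a b) (EFin \o f).
Proof.
move=> cf; have [M M0 fM] := continuous_cbox_bounded a b cf.
apply: measurable_bounded_integrable.
- exact: leb_box.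
- apply: (@lebesgue_outer_ltey _ _ _ (\sum_i (`|a 0 i| + `|b 0 i|))) => x i xab.
  have /andP[ax xb] := xab i.
  rewrite (bigD1 i)//= -[leLHS]addr0 lerD//; last first.
    by apply: sumr_ge0 => j _; rewrite addr_ge0.
  have := ler_norm (b 0%R i); have := ler_norm (- a 0%R i); rewrite normrN => ? ?.
  have := normr_ge0 (a 0%R i); have := normr_ge0 (b 0%R i) => ? ?.
  by rewrite ler_norml; apply/andP; split; lra.
- apply: measurable_funS (continuous_caratheodory (@halfspace_leb R n) cf) => //.
- exists M; split; first by rewrite num_real.
  move=> N MN x /box_sub_cbox xab; apply: le_trans (fM _ xab) _; exact: ltW.
Qed.

End coordinates.

Section C1_functions.
Context {R : realType} {n : nat}.
Implicit Types (f g : 'rV[R]_n -> R) (df dg : 'I_n -> 'rV[R]_n -> R).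
Implicit Types (x y : 'rV[R]_n).

(** The partial derivatives are part of the data, so that products and compositions produce explicit
    formulas for them, from which bounds and divergences are read off. *)
Definition isC1 f df := (forall i x, is_derive x (Defs.basis i) f (df i x)) /\
  forall i, continuous (df i).

Lemma isC1_cst (c : R) : isC1 (cst c) (fun _ => cst 0).
Proof. by split=> [i x|i x]; [exact: is_derive_cst|exact: cst_continuous]. Qed.

Lemma isC1D f g df dg : isC1 f df -> isC1 g dg ->
  isC1 (fun x => f x + g x) (fun i x => df i x + dg i x).
Proof.
move=> [f1 f2] [g1 g2]; split=> [i x|i x].
  by apply: (is_deriveD (f1 i x) (g1 i x)).
by apply: continuousD; [exact: f2|exact: g2].
Qed.

Lemma isC1M f g df dg : continuous f -> continuous g -> isC1 f df -> isC1 g dg ->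
  isC1 (fun x => f x * g x) (fun i x => f x * dg i x + g x * df i x).
Proof.
move=> cf cg [f1 f2] [g1 g2]; split=> [i x|i x].
  by apply: (is_deriveM (f1 i x) (g1 i x)).
apply: (@continuousD _ _ _ (fun x => f x * dg i x) (fun x => g x * df i x)).
  by apply: continuousM; [exact: cf|exact: g2].
by apply: continuousM; [exact: cg|exact: f2].
Qed.

Lemma is_derive_line (h : 'rV[R]_n -> R) x v (c : R) :
  is_derive x v h c <-> is_derive (0 : R) 1 (fun s : R => h (s *: v + x)) c.
Proof.
have E : 'D_v h x = 'D_1 (fun s : R => h (s *: v + x)) 0.
  suff EE : forall s : R, s^-1 *: ((h \o shift x) (s *: v) - h x) =
      s^-1 *: (((fun s : R => h (s *: v + x)) \o shift 0) (s *: 1) - h (0 *: v + x)).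
    by rewrite /derive (funext EE).
  by move=> s; rewrite /= addr0 [s *: 1]mulr1 scale0r add0r.
split => -[h1 h2]; split.
- exact: (derivable1P h x v).1.
- by rewrite -E.
- exact: (derivable1P h x v).2.
- by rewrite E.
Qed.

Lemma is_derive_comp_outer f (g : R -> R) x v (a b : R) :
  is_derive x v f a -> is_derive (f x) (1 : R) g b ->
  is_derive x v (fun y => g (f y)) (b * a).
Proof.
move=> fa gb; apply/is_derive_line.
apply: (@is_derive1_comp R g (fun s => f (s *: v + x)) 0 b a).
  by rewrite scale0r add0r.
exact/is_derive_line.
Qed.

Lemma isC1_comp f df (g dg1 : R -> R) : continuous f -> isC1 f df ->
  (forall t : R, is_derive t (1 : R) g (dg1 t)) -> continuous dg1 ->
  isC1 (fun x => g (f x)) (fun i x => dg1 (f x) * df i x).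
Proof.
move=> cf [f1 f2] gP cdg; split=> [i x|i x].
  exact: is_derive_comp_outer.
apply: (@continuousM _ _ (fun x => dg1 (f x)) (df i)); last exact: f2.
by apply: continuous_comp; [exact: cf|exact: cdg].
Qed.

Lemma isC1_coord (j : 'I_n) : isC1 (fun x => x 0 j) (fun i => cst (i == j)%:R).
Proof.
split=> [i x|i x]; last exact: cst_continuous.
apply/is_derive_line.
have -> : (fun s : R => (s *: Defs.basis i + x) 0 j) =
    (fun s : R => (i == j)%:R * s + x 0 j).
  by apply/funext => s; rewrite !mxE eqxx/= eq_sym mulrC.
have := is_deriveD (is_deriveZ (i == j)%:R (is_derive_id (0 : R) 1))
  (is_derive_cst (x 0 j) (0 : R) (1 : R)).
by rewrite addr0 [_ *: 1]mulr1.
Qed.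

Lemma MVT_coord f df i x (c : R) : isC1 f df -> exists2 t,
  (Num.min (x 0 i) c <= t <= Num.max (x 0 i) c) &
  f (upd x i c) - f x = df i (upd x i t) * (c - x 0 i).
Proof.
move=> [f1 f2].
pose phi s := f (upd x i s).
have updE' s h : upd x i (h + s) = h *: Defs.basis i + upd x i s.
  apply/rowP => j; rewrite !mxE eqxx/=; case: eqP => _; first by rewrite mulr1.
  by rewrite mulr0 add0r.
have phiP (s : R) : is_derive s (1 : R) phi (df i (upd x i s)).
  have /is_derive_line := f1 i (upd x i s).
  have -> : (fun h : R => f (h *: Defs.basis i + upd x i s)) = (fun h => phi (h + s)).
    by apply/funext => h; rewrite /phi updE'.
  move=> [h1 h2].
  have E : forall h : R, h^-1 *: ((phi \o shift s) (h *: 1) - phi s) =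
      h^-1 *: (((fun h => phi (h + s)) \o shift 0) (h *: 1) - phi (0 + s)).
    by move=> h; rewrite /= addr0 add0r.
  by split; [rewrite /derivable (funext E)|rewrite /derive (funext E)].
have phic : continuous phi.
  move=> s; apply: differentiable_continuous; apply/derivable1_diffP.
  by have [] := phiP s.
have xE : upd x i (x 0 i) = x.
  by apply/rowP => j; rewrite mxE; case: eqP => // ->.
have [xc|cx] := leP (x 0 i) c.
  have [|t tc E] := @MVT_segment R phi (fun s => df i (upd x i s)) _ _ xc.
    exact: continuous_subspaceT.
  by exists t => //; rewrite -{2}xE.
have [|t tc E] := @MVT_segment R phi (fun s => df i (upd x i s)) _ _ (ltW cx).
  exact: continuous_subspaceT.
by exists t => //; rewrite -[in LHS]opprB -{1}xE E; ring.
Qed.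

(* The increment is decomposed along a path changing one coordinate at a time. *)
Lemma isC1_expansion f df x (e : R) : isC1 f df -> 0 < e ->
  exists2 r : R, 0 < r & forall y, (forall i, `|x 0 i - y 0 i| < r) ->
    `|f y - f x - \sum_i df i x * (y 0 i - x 0 i)| <= e * \sum_i `|y 0 i - x 0 i|.
Proof.
move=> fC1 e0; have [_ cdf] := fC1.
have /choice[d dP] : forall i, exists d : R, 0 < d /\ forall y, (forall j, `|x 0 j - y 0 j| < d) -> `|df i x - df i y| < e.
  move=> i; have /cvgrPdist_lt/(_ e e0) := cdf i x.
  by move=> /nbhs_coord[d d0 dP]; exists d.
pose r := \big[Num.min/1]_i d i.
have r0 : 0 < r.
  by rewrite /r; elim/big_ind: _ => // [p q p0 q0|i _]; [rewrite lt_min p0 q0|have [] := dP i].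
have rd i : r <= d i by rewrite /r (bigD1 i)//= ge_min lexx.
exists r => // y xy.
pose z (k : nat) : 'rV[R]_n := \row_j if (j < k)%N then y 0 j else x 0 j.
have z0 : z 0%N = x by apply/rowP => j; rewrite mxE.
have zn : z n = y by apply/rowP => j; rewrite mxE ltn_ord.
have zS (i : 'I_n) : z i.+1 = upd (z i) i (y 0 i).
  apply/rowP => j; rewrite !mxE; have [->|ji] := eqVneq j i; first by rewrite ltnSn.
  have /negbTE ji' : (j : nat) != i by apply: contraNneq ji => /val_inj ->.
  by rewrite ltnS leq_eqVlt ji'.
have zi (i : 'I_n) : z i 0 i = x 0 i by rewrite mxE ltnn.
have -> : f y - f x = \sum_(i < n) (f (z i.+1) - f (z i)).
  by rewrite -(big_mkord xpredT (fun k => f (z k.+1) - f (z k))) telescope_sumr// z0 zn.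
rewrite -sumrB mulr_sumr; apply: le_trans (ler_norm_sum _ _ _) _.
apply: ler_sum => i _; rewrite zS.
have [t tP ->] := MVT_coord i (z i) (y 0 i) fC1.
rewrite zi in tP *; rewrite -mulrBl normrM ler_wpM2r//.
rewrite distrC; apply/ltW; have [_] := dP i; apply => j.
apply: lt_le_trans (rd i); rewrite mxE; case: eqP => [->|_].
  apply: le_lt_trans (xy i); move: tP; case: (leP (x 0 i) (y 0 i)) => h.
    move=> /andP[t1 t2].
    by rewrite distrC ger0_norm ?subr_ge0// distrC ger0_norm ?subr_ge0// lerD2r.
  move=> /andP[t1 t2].
  by rewrite ger0_norm ?subr_ge0// ger0_norm ?subr_ge0 ?lerD2l ?lerN2// ltW.
by rewrite mxE; case: ifP => _; [exact: xy|rewrite subrr normr0].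
Qed.

Lemma isC1_continuous f df : isC1 f df -> continuous f.
Proof.
move=> fC1 x; apply: continuous_atP => e e0.
have [r r0 rP] := isC1_expansion x fC1 ltr01.
pose M := \sum_i `|df i x| + 1.
have M0 : 0 < M by rewrite ltr_wpDl// sumr_ge0.
have nM : 0 < n.+1%:R * M by rewrite mulr_gt0.
exists (Num.min r (e / (n.+1%:R * M))).
  by rewrite lt_min r0 divr_gt0.
move=> y xy.
have xyr i : `|x 0 i - y 0 i| < r by apply: lt_le_trans (xy i) _; rewrite ge_min lexx.
have xye i : `|y 0 i - x 0 i| <= e / (n.+1%:R * M).
  by rewrite distrC; apply/ltW/(lt_le_trans (xy i)); rewrite ge_min lexx orbT.
have := rP y xyr; rewrite mul1r => H.
have S : \sum_i `|y 0 i - x 0 i| <= n%:R * (e / (n.+1%:R * M)).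
  rewrite mulr_natl -[X in _ *+ X]card_ord -sumr_const.
  by apply: ler_sum => i _; exact: xye.
have : `|\sum_i df i x * (y 0 i - x 0 i)| <= (M - 1) * \sum_i `|y 0 i - x 0 i|.
  rewrite /M addrK; apply: le_trans (ler_norm_sum _ _ _) _.
  rewrite mulr_sumr; apply: ler_sum => i _; rewrite normrM ler_wpM2r//.
  by rewrite (bigD1 i)//= lerDl sumr_ge0.
move=> H2; rewrite /= distrC.
have H3 : `|f y - f x| <= M * \sum_i `|y 0 i - x 0 i|.
  rewrite -(subrK (\sum_i df i x * (y 0 i - x 0 i)) (f y - f x)).
  apply: le_trans (ler_normD _ _) _; apply: le_trans (lerD H H2) _.
  by rewrite mulrBl mul1r addrC subrK.
apply: le_lt_trans H3 _.
apply: (@le_lt_trans _ _ (M * (n%:R * (e / (n.+1%:R * M))))).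
  by rewrite ler_pM2l.
have -> : M * (n%:R * (e / (n.+1%:R * M))) = e * (n%:R / n.+1%:R).
  by field; rewrite gt_eqF//= gt_eqF// ltr0n.
by rewrite gtr_pMr// ltr_pdivrMr// mul1r ltr_nat.
Qed.

End C1_functions.

(** * The divergence theorem on boxes *)

Section additive_box_functions.
Context {R : realType} {n : nat}.
Implicit Types (a b c : 'rV[R]_n) (D : 'rV[R]_n -> 'rV[R]_n -> R).

(* The bound for boxes of small sides propagates to twice as large sides, one
   coordinate at a time. *)
Lemma additive_box_eq0 D a b :
  (forall a b l t, (forall j, a 0 j <= b 0 j) -> a 0 l <= t <= b 0 l ->
    D a b = D a (upd b l t) + D (upd a l t) b) ->
  (forall e, 0 < e -> exists2 r : R, 0 < r & forall a' b',
    (forall j, a 0 j <= a' 0 j) -> (forall j, a' 0 j <= b' 0 j) ->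
    (forall j, b' 0 j <= b 0 j) -> (forall j, b' 0 j - a' 0 j < r) ->
    `|D a' b'| <= e * vol a' b') ->
  (forall j, a 0 j <= b 0 j) -> D a b = 0.
Proof.
move=> D_add D_small ab.
suff H (e : R) : 0 < e -> `|D a b| <= e * vol a b.
  apply/eqP; rewrite -normr_le0 leNgt; apply/negP => D0.
  have v0 : 0 <= vol a b by exact: vol_ge0.
  have v1 : 0 < vol a b + 1 by rewrite ltr_wpDl.
  have := H (`|D a b| / 2 / (vol a b + 1)); rewrite !divr_gt0// => /(_ erefl).
  apply/negP; rewrite -ltNge mulrAC ltr_pdivrMr//.
  by rewrite mulrDr mulr1; nra.
move=> e0; have [r r0 rP] := D_small e e0.
pose Q c := forall a' b', (forall j, a 0 j <= a' 0 j) ->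
  (forall j, a' 0 j <= b' 0 j) -> (forall j, b' 0 j <= b 0 j) ->
  (forall j, b' 0 j - a' 0 j < c 0 j) -> `|D a' b'| <= e * vol a' b'.
have Q2 c l : Q c -> Q (upd c l (2 * c 0 l)).
  move=> Qc a' b' aa' a'b' b'b a'b'c.
  pose t := (a' 0 l + b' 0 l) / 2.
  have tab : a' 0 l <= t <= b' 0 l.
    by have := a'b' l; rewrite /t => ?; apply/andP; split; lra.
  have /andP[at_ tb] := tab.
  rewrite (D_add _ _ _ _ a'b' tab) -(vol_upd a' b' l t) mulrDr.
  apply: le_trans (ler_normD _ _) _; apply: lerD; apply: Qc => //.
  - by move=> j; rewrite mxE; case: eqP => [->|].
  - by move=> j; rewrite mxE; case: eqP => [->|//]; apply: le_trans tb _.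
  - move=> j; rewrite mxE; have := a'b'c j; rewrite mxE; case: eqP => [->|//].
    by rewrite /t; lra.
  - by move=> j; rewrite mxE; case: eqP => [->|//]; apply: le_trans at_.
  - by move=> j; rewrite mxE; case: eqP => [->|].
  - move=> j; rewrite mxE; have := a'b'c j; rewrite mxE; case: eqP => [->|//].
    by rewrite /t; lra.
have Qs (s : seq 'I_n) c : uniq s -> Q c ->
    Q (\row_j if j \in s then 2 * c 0 j else c 0 j).
  elim: s => [|l s IH] /=.
    by move=> _; congr Q; apply/rowP => j; rewrite mxE.
  move=> /andP[ls us] Qc; have := Q2 _ l (IH us Qc); congr Q.
  apply/rowP => j; rewrite !mxE in_cons; have [->|jl] //= := eqVneq j l.
  by rewrite (negbTE ls).
have Qk (k : nat) : Q (const_mx (2 ^+ k * r)).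
  elim: k => [|k IH].
    by rewrite mul1r => a' b' ? ? ? h; apply: rP => // j; have := h j; rewrite mxE.
  have := Qs (enum 'I_n) _ (enum_uniq _) IH; congr Q.
  by apply/rowP => j; rewrite !mxE mem_enum exprS mulrA.
pose M := \sum_(j < n) (b 0 j - a 0 j).
have := @Qk (Num.truncn (M / r)).+1; apply => // j; rewrite mxE -ltr_pdivrMr//.
apply: (@le_lt_trans _ _ (M / r)).
  rewrite ler_pM2r ?invr_gt0// /M (bigD1 j)//= lerDl sumr_ge0// => k _.
  by rewrite subr_ge0.
have M0 : 0 <= M / r.
  by rewrite divr_ge0 ?(ltW r0)// sumr_ge0// => k _; rewrite subr_ge0.
apply: (lt_le_trans (truncnS_gt (M / r))).
by rewrite -natrX ler_nat ltnW// ltn_expl.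
Qed.

End additive_box_functions.

Section box_integrals.
Context {R : realType} {n : nat}.
Implicit Types (a b : 'rV[R]_n) (f : 'rV[R]_n -> R).
Local Notation mu := (leb R n).

Lemma Rint_box_split f a b l t : continuous f -> (forall j, a 0 j <= b 0 j) ->
  a 0 l <= t <= b 0 l ->
  \int[mu]_(x in box a b) f x =
  \int[mu]_(x in box a (upd b l t)) f x + \int[mu]_(x in box (upd a l t) b) f x.
Proof.
move=> cf ab tab; have /andP[at_ tb] := tab.
have [_ E1 E2] := box_split t (ab l); rewrite min_r// max_r// in E1 E2.
have E : box a b = box a (upd b l t) `|` box (upd a l t) b.
  by rewrite -E1 -E2 setDE -setIUr setUCr setIT.
rewrite E Rintegral_setU//; [exact: leb_box|exact: leb_box| |].
- by rewrite -E; exact: continuous_box_integrable.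
- by rewrite -E1 -E2; apply/eqP; apply/seteqP; split => // x [[_ h] [_ nh]].
Qed.

Lemma Rint_box_close f a b (c e : R) : continuous f -> (forall j, a 0 j <= b 0 j) ->
  (forall x, box a b x -> `|f x - c| <= e) ->
  `|\int[mu]_(x in box a b) f x - c * vol a b| <= e * vol a b.
Proof.
move=> cf ab fc.
have cst_int (k : R) : mu.-integrable (box a b) (EFin \o cst k).
  by apply: continuous_box_integrable; exact: cst_continuous.
have intf : mu.-integrable (box a b) (EFin \o f) by exact: continuous_box_integrable.
have mB := @leb_box R n a b.
have E (k : R) : \int[mu]_(x in box a b) k = k * vol a b.
  by rewrite Rintegral_cst//; congr (_ * _); rewrite [X in fine X]lebesgue_outer_box.
rewrite -!E -RintegralB//.
2: exact: cst_int.
have intfc : mu.-integrable (box a b) (EFin \o (fun x => f x - c)).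
  apply: continuous_box_integrable => x.
  by apply: continuousB; [exact: cf|exact: cst_continuous].
apply: le_trans (le_normr_Rintegral mB intfc) _.
by apply: le_Rintegral (cst_int e) _ => //; exact: (integrable_norm intfc).
Qed.

End box_integrals.

Section divergence_theorem.
Context {R : realType} {m : nat}.
Implicit Types (a b : 'rV[R]_m.+1) (f : 'rV[R]_m.+1 -> R).

Lemma ins_continuous f (i : 'I_m.+1) t : continuous f ->
  continuous (fun x : 'rV[R]_m => f (ins i t x)).
Proof.
move=> cf x; apply: continuous_atP => e e0.
have /cvgrPdist_lt/(_ e e0)/nbhs_coord[r r0 rP] := cf (ins i t x).
exists r => // y xy; apply: rP => j; case: (unliftP i j) => [k ->|->].
  by rewrite !ins_lift.
by rewrite !insE subrr normr0.
Qed.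

Lemma del_upd_lift i l a t : del i (upd a (lift i l) t) = upd (del i a) l t.
Proof. by apply/rowP => j; rewrite !mxE (inj_eq lift_inj). Qed.

Lemma del_upd i a t : del i (upd a i t) = del i a.
Proof. by apply/rowP => j; rewrite !mxE eq_sym (negbTE (neq_lift _ _)). Qed.

Lemma upd_ins i s t (x : 'rV[R]_m) : upd (ins i s x) i t = ins i t x.
Proof.
apply/rowP => j; rewrite mxE; case: eqP => [->|/eqP ji]; first by rewrite insE.
by case: (unliftP i j) ji => [k -> _|-> /eqP//]; rewrite !ins_lift.
Qed.

(** The difference of the two sides is additive under subdivision of the box. On a small box both
    sides are close to the value of [df i] at a corner times the volume, by uniform continuity and
    the mean value theorem; so the difference is negligible against the volume. *)
Theorem box_divergence (f : 'rV[R]_m.+1 -> R) df i a b : isC1 f df ->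
  (forall j, a 0 j <= b 0 j) ->
  \int[leb R m.+1]_(x in box a b) df i x =
  \int[leb R m]_(x in box (del i a) (del i b)) (f (ins i (b 0 i) x) - f (ins i (a 0 i) x)).
Proof.
move=> fC1 ab; have [_ cdf] := fC1; have cf := isC1_continuous fC1.
have cins t : continuous (fun x : 'rV[R]_m => f (ins i t x)) by exact: ins_continuous.
have cinsB s t : continuous (fun x : 'rV[R]_m => f (ins i s x) - f (ins i t x)).
  by move=> x; apply: continuousB; exact: cins.
apply/eqP; rewrite -subr_eq0; apply/eqP.
pose D a b := \int[leb R m.+1]_(x in box a b) df i x -
  \int[leb R m]_(x in box (del i a) (del i b)) (f (ins i (b 0 i) x) - f (ins i (a 0 i) x)).
rewrite -/(D a b); apply: additive_box_eq0 => //.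
  move=> {ab}a {}b l t ab tab; rewrite /D (Rint_box_split (cdf i) ab tab).
  case: (unliftP i l) tab => [l' ->|->] tab.
    rewrite !del_upd_lift !upd_neq ?neq_lift//.
    rewrite (@Rint_box_split _ _ _ (del i a) (del i b) l' t)//.
    - by ring.
    - by move=> j; rewrite !mxE.
    - by rewrite !mxE.
  rewrite !del_upd !updE.
  have mB := @leb_box R m (del i a) (del i b).
  have int s := continuous_box_integrable (del i a) (del i b) (cins s).
  by rewrite !RintegralB//; ring.
move=> e e0; have e20 : 0 < e / 2 by rewrite divr_gt0.
have [r r0 rP] := heine (@compact_cbox _ _ a b) (cdf i) e20.
exists r => // a' b' aa' a'b' b'b a'b'r.
have K x : cbox a' b' x -> `|df i x - df i a'| <= e / 2.
  move=> xab'; rewrite distrC ltW//; apply: rP.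
    by move=> j; rewrite aa'/= (le_trans (a'b' j)).
  move=> j; apply: le_lt_trans (a'b'r j); have /andP[? ?] := xab' j.
  by rewrite ler_norml; apply/andP; split; lra.
have da'b' j : del i a' 0 j <= del i b' 0 j by rewrite !mxE.
have H1 := Rint_box_close (cdf i) a'b' (fun x xab => K x (box_sub_cbox xab)).
have H2 : `|\int[leb R m]_(x in box (del i a') (del i b'))
     (f (ins i (b' 0 i) x) - f (ins i (a' 0 i) x)) -
     df i a' * (b' 0 i - a' 0 i) * vol (del i a') (del i b')| <=
     e / 2 * (b' 0 i - a' 0 i) * vol (del i a') (del i b').
  apply: Rint_box_close => // x xab.
  have := MVT_coord i (ins i (a' 0 i) x) (b' 0 i) fC1.
  rewrite insE min_l// max_r// => -[t /andP[t1 t2]]; rewrite !upd_ins => ->.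
  rewrite -mulrBl normrM (@ger0_norm _ (b' 0 i - a' 0 i)) ?subr_ge0//.
  rewrite ler_wpM2r ?subr_ge0//; apply: K => j.
  case: (unliftP i j) => [k ->|->]; last by rewrite insE t1.
  by rewrite ins_lift; have /andP[] := xab k; rewrite !mxE => -> /ltW ->.
rewrite -!mulrA -!(vol_del i) in H2.
rewrite /D; set I1 := (X in `|X - _| <= _) in H1 *; set I2 := (X in `|X - _| <= _) in H2 *.
have -> : I1 - I2 = (I1 - df i a' * vol a' b') - (I2 - df i a' * vol a' b') by ring.
apply: le_trans (ler_normB _ _) _; apply: le_trans (lerD H1 H2) _.
lra.
Qed.

End divergence_theorem.

Section hyperplane_integral.
Context {R : realType} {m : nat}.
Hypothesis m_gt0 : (0 < m)%N.
Implicit Types (E : set 'rV[R]_m) (i : 'I_m.+1) (t : R).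
Local Notation L := (caratheodory_type (@lebesgue_outer R m)).
Local Notation HT := (caratheodory_type (@hausdorff_outer R m.+1 m)).

Definition hyperplane i t : set 'rV[R]_m.+1 := [set x | x 0 i = t].

Lemma ins_image_preimage i t (X : set 'rV[R]_m.+1) :
  [set ins i t x | x in ins i t @^-1` X] = X `&` hyperplane i t.
Proof.
apply/seteqP; split => [_ [x Xx <-]|x [Xx /= xt]]; first by split => //; rewrite /hyperplane/= insE.
by exists (del i x); rewrite /= -{1}xt ?delK// -xt delK.
Qed.

Lemma hyperplane_haus i t :
  (@hausdorff_outer R m.+1 m : {outer_measure set _ -> \bar R}).-caratheodory (hyperplane i t).
Proof.
have -> : hyperplane i t =
    ~` (((fun x => x 0 i) @^-1` [set s | s < t]) `|` ((fun x => x 0 i) @^-1` [set s | s > t])).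
  apply/seteqP; split => x /=; first by move=> -> [|]; rewrite ltxx.
  by move=> /not_orP[/negP + /negP]; rewrite -!leNgt => ? ?; apply/eqP; rewrite eq_le; apply/andP.
apply: caratheodory_measurable_setC; apply: caratheodory_measurable_setU.
  by apply: open_haus; apply: open_comp; [move=> ? _; exact: coord_continuous|exact: open_lt].
by apply: open_haus; apply: open_comp; [move=> ? _; exact: coord_continuous|exact: open_gt].
Qed.

(** Both measures agree on images under [ins i t], so the Caratheodory condition for [X], tested on
    such images, is the one for its preimage. *)
Lemma measurable_ins i t : measurable_fun [set: L] (ins i t : L -> HT).
Proof.
move=> _ X mX; rewrite setTI.
suff : (@lebesgue_outer R m : {outer_measure set _ -> \bar R}).-caratheodory (ins i t @^-1` X).
  by [].
move=> E; change (lebesgue_outer E = lebesgue_outer (E `&` ins i t @^-1` X) +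
  lebesgue_outer (E `&` ~` ins i t @^-1` X))%E.
rewrite -!(hausdorff_hyperplane m_gt0 i t) (mX [set ins i t x | x in E]).
congr (_ + _)%E; congr hausdorff_outer.
- apply/seteqP; split => [_ [[x Ex <-] Xx]|_ [x [Ex Xx] <-]]; first by exists x.
  by split => //; exists x.
- apply/seteqP; split => [_ [[x Ex <-] Xx]|_ [x [Ex Xx] <-]]; first by exists x.
  by split => //; exists x.
Qed.

(** On the hyperplane the Hausdorff measure is the image of Lebesgue measure under [ins i t]. *)
Lemma hyperplane_integral i t (D : set 'rV[R]_m.+1) (g : 'rV[R]_m.+1 -> \bar R) :
  measurable (D : set HT) -> measurable_fun [set: HT] g ->
  (leb R m).-integrable (ins i t @^-1` D) (g \o ins i t) ->
  (\int[haus R m.+1 m]_(x in D `&` hyperplane i t) g x =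
   \int[leb R m]_(x in ins i t @^-1` D) g (ins i t x))%E.
Proof.
move=> mD mg ig.
have mH : measurable (D `&` hyperplane i t : set HT).
  by apply: measurableI => //; exact: hyperplane_haus.
have EI : ins i t @^-1` (D `&` hyperplane i t) = ins i t @^-1` D.
  by apply/seteqP; split => [x []//|x Dx]; split => //; rewrite /hyperplane/= insE.
have := integral_pushforward (mu := leb R m) (D := D `&` hyperplane i t) (measurable_ins i t) mg.
rewrite EI => /(_ ig mH) <-; apply: eq_measure_integral; first exact: measurable_ins.
move=> p A mA AD.
change (haus R m.+1 m A = lebesgue_outer (ins i t @^-1` A)).
rewrite -[RHS](hausdorff_hyperplane m_gt0 i t) ins_image_preimage.
by congr hausdorff_outer; apply/esym/setIidl => x /AD[].
Qed.

End hyperplane_integral.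

(** * Approximate limits and gradients *)

Section density.
Context {R : realType} {n : nat}.
Implicit Types (A B : set 'rV[R]_n) (x y d xi : 'rV[R]_n) (u v : 'rV[R]_n -> R).

Lemma density0P A x : density0 A x <-> forall e : R, 0 < e -> exists2 r0 : R, 0 < r0 &
  forall r, 0 < r -> r < r0 -> (lebesgue_outer (A `&` eball x r) <= (e * r ^+ n)%:E)%E.
Proof.
have L0 r := lebesgue_outer_ge0 (A `&` eball x r).
have E (r e : R) : 0 < r ->
    (lebesgue_outer (A `&` eball x r) * (r ^- n)%:E <= e%:E)%E =
    (lebesgue_outer (A `&` eball x r) <= (e * r ^+ n)%:E)%E.
  move=> r0; have rn : 0 < r ^+ n by exact: exprn_gt0.
  have := L0 r; case: (lebesgue_outer _) => [s s0| |]//=.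
    by rewrite -EFinM !lee_fin ler_pdivrMr.
  by rewrite mulyr gtr0_sg ?invr_gt0// mul1e.
split => [/fine_cvgP[Afin /cvgrPdist_le Acvg] e e0|H].
  have := Acvg e e0 => Acvg'.
  have := filterI Afin Acvg' => -[d /= d0 dP]; exists d => // r r0 rd.
  have [|/= f1] := dP r _ r0; first by rewrite /= sub0r normrN gtr0_norm.
  rewrite sub0r normrN => f2; rewrite -E// -(fineK f1) lee_fin.
  exact: le_trans (ler_norm _) f2.
have near_le (e : R) : 0 < e -> \forall r \near 0^'+,
    (0 <= lebesgue_outer (A `&` eball x r) * (r ^- n)%:E <= e%:E)%E.
  move=> e0; have [r0 r00 rP] := H e e0.
  near=> r; have r_gt0 : 0 < r by [].
  have rr0 : r < r0 by near: r; apply: nbhs_right_lt.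
  rewrite E// rP// andbT.
  by rewrite mule_ge0// lee_fin invr_ge0 exprn_ge0// ltW.
apply/fine_cvgP; split.
  near=> r; have /andP[h1 h2] : (0 <= lebesgue_outer (A `&` eball x r) * (r ^- n)%:E <= 1%:E)%E.
    by near: r; exact: near_le.
  by rewrite ge0_fin_numE// (le_lt_trans h2)// ltry.
apply/cvgrPdist_le => e e0; near=> r.
have /andP[h1 h2] : (0 <= lebesgue_outer (A `&` eball x r) * (r ^- n)%:E <= e%:E)%E.
  by near: r; exact: near_le.
rewrite sub0r normrN ger0_norm ?fine_ge0//= -lee_fin fineK//.
by rewrite ge0_fin_numE// (le_lt_trans h2)// ltry.
Unshelve. all: by end_near. Qed.

Lemma density0_local A B x r0 : 0 < r0 -> (forall y, A y -> eball x r0 y -> B y) ->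
  density0 B x -> density0 A x.
Proof.
move=> r00 AB /density0P Bx; apply/density0P => e e0; have [r1 r10 rP] := Bx e e0.
exists (Num.min r0 r1); first by rewrite lt_min r00.
move=> r r_gt0; rewrite lt_min => /andP[rr0 rr1].
apply: le_trans (rP r r_gt0 rr1); apply: le_lebesgue_outer => y [Ay yr].
by split => //; apply: AB => //; exact: lt_trans rr0.
Qed.

Lemma sub_density0 A B x : A `<=` B -> density0 B x -> density0 A x.
Proof. by move=> AB; apply: (density0_local ltr01) => y /AB. Qed.

Lemma density0U A B x : density0 A x -> density0 B x -> density0 (A `|` B) x.
Proof.
move=> /density0P Ax /density0P Bx; apply/density0P => e e0.
have e2 : 0 < e / 2 by rewrite divr_gt0.
have [r1 r10 r1P] := Ax _ e2; have [r2 r20 r2P] := Bx _ e2.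
exists (Num.min r1 r2); first by rewrite lt_min r10.
move=> r r0; rewrite lt_min => /andP[rr1 rr2]; rewrite setIUl.
apply: le_trans (lebesgue_outerU _ _) _.
have -> : e * r ^+ n = e / 2 * r ^+ n + e / 2 * r ^+ n by field.
by rewrite EFinD leeD ?r1P ?r2P.
Qed.

Lemma density0_away A x (r0 : R) : 0 < r0 -> (forall y, A y -> ~ eball x r0 y) ->
  density0 A x.
Proof.
move=> r00 H; apply/density0P => e e0; exists r0 => // r r_gt0 rr0.
rewrite (_ : A `&` _ = set0) ?lebesgue_outer0.
  by rewrite lee_fin mulr_ge0 ?exprn_ge0 ?ltW.
by apply/seteqP; split => // y [Ay xy]; apply: (H y Ay); exact: lt_trans rr0.
Qed.

(** The cubes of centre [x + s d] and side [2 s eta] sweep out a cone with vertex [x], and one of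
    them fills a fixed proportion of each small ball. This is the source of all uniqueness
    statements for approximate limits, gradients and normals. *)
Lemma density0_cone A x d (eta r0 : R) : 0 < eta -> 0 < r0 ->
  (forall (s : R) y, 0 < s -> s < r0 -> (forall i, `|y 0 i - (x 0 i + s * d 0 i)| <= s * eta) ->
    A y) -> ~ density0 A x.
Proof.
move=> eta0 r00 HA /density0P Ax.
(* With [s = r / M] the cube lies in the ball of radius [r]: its points are at distance at most
   [s (enorm d + n eta)] from [x]. *)
pose M := enorm d + n%:R * eta + 1.
have M1 : 1 <= M by rewrite lerDr addr_ge0 ?enorm_ge0// mulr_ge0// ltW.
have M0 : 0 < M by exact: lt_le_trans M1.
pose c : R := (2 * eta / M) ^+ n.
have c0 : 0 < c by rewrite exprn_gt0// divr_gt0// mulr_gt0.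
have [r1 r10 rP] := Ax (c / 2) (divr_gt0 c0 (ltr0Sn _ _)).
pose r := Num.min r0 r1 / 2.
have r_gt0 : 0 < r by rewrite divr_gt0// lt_min r00.
have rm : r < Num.min r0 r1 by rewrite /r gtr_pMr ?lt_min ?r00// invf_lt1// ltr1n.
have [rr0 rr1] : r < r0 /\ r < r1 by move: rm; rewrite lt_min => /andP.
have := rP r r_gt0 rr1; apply/negP; rewrite -ltNge.
pose s := r / M; have s0 : 0 < s by rewrite divr_gt0.
have sr : s <= r by rewrite ler_pdivrMr// ler_peMr// ltW.
pose p : 'rV[R]_n := \row_i (x 0 i + s * d 0 i - s * eta).
pose q : 'rV[R]_n := \row_i (x 0 i + s * d 0 i + s * eta).
have pq i : p 0 i <= q 0 i by rewrite !mxE; have := mulr_gt0 s0 eta0; lra.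
apply: (@lt_le_trans _ _ (lebesgue_outer (box p q))).
  rewrite lebesgue_outer_box// lte_fin /vol.
  rewrite (eq_bigr (fun=> 2 * eta / M * r)); last first.
    by move=> i _; rewrite !mxE /s; field; rewrite gt_eqF.
  rewrite prodr_const card_ord [ltRHS]exprMn -/c ltr_pM2r ?exprn_gt0//.
  by rewrite gtr_pMr// invf_lt1// ltr1n.
apply: le_lebesgue_outer => y ypq.
have yb i : `|y 0 i - (x 0 i + s * d 0 i)| <= s * eta.
  have := ypq i; rewrite !mxE => /andP[y1 y2].
  by rewrite ler_norml; apply/andP; split; lra.
split; first by apply: HA (yb) => //; exact: le_lt_trans rr0.
rewrite /eball /= (_ : y - x = (y - x - s *: d) + s *: d); last by rewrite subrK.
apply: le_lt_trans (ler_enormD _ _) _.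
apply: (@le_lt_trans _ _ (n%:R * (s * eta) + s * enorm d)).
  apply: lerD; last by rewrite enormZ gtr0_norm.
  by apply: enorm_le => i; rewrite !mxE -addrA -opprD.
have -> : r = s * M by rewrite /s mulfVK ?gt_eqF.
rewrite /M; nra.
Qed.

Lemma density0T x : ~ density0 setT x.
Proof. by apply: (@density0_cone _ x 0 1 1). Qed.

(** Along a set of density zero the approximate limits degenerate to infinite values, hence the
    condition on [A]. *)
Lemma ap_lim_near A u x (z : R) : ~ density0 A x ->
  (forall e, 0 < e -> exists2 r : R, 0 < r &
    forall y, A y -> eball x r y -> `|u y - z| < e) ->
  ap_lim A u x z%:E.
Proof.
move=> Ax uz.
have up t : z < t -> density0 (A `&` [set y | t < u y]) x.
  move=> zt; have [|r r0 rP] := uz (t - z); first by rewrite subr_gt0.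
  apply: density0_away r0 _ => y [Ay /= tu] /(rP _ Ay); rewrite ltr_norml => /andP[]; lra.
have dn t : t < z -> density0 (A `&` [set y | u y < t]) x.
  move=> zt; have [|r r0 rP] := uz (z - t); first by rewrite subr_gt0.
  apply: density0_away r0 _ => y [Ay /= tu] /(rP _ Ay); rewrite ltr_norml => /andP[]; lra.
split; apply/eqP; rewrite eq_le; apply/andP; split.
- apply: ge_ereal_sup => _ [t /= tP <-]; rewrite lee_fin leNgt; apply/negP => zt.
  apply: Ax; apply: sub_density0 (density0U tP (up ((z + t) / 2) _)); last by lra.
  by move=> y Ay; have [h|h] := ltP (u y) t; [left|right; split => //=; lra].
- apply/lee_addgt0Pr => e e0; rewrite -leeBlDr//; apply: ereal_sup_ubound.
  by exists (z - e); rewrite ?EFinB//; apply: dn; lra.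
- apply/lee_addgt0Pr => e e0; apply: ereal_inf_lbound.
  by exists (z + e); rewrite ?EFinD//; apply: up; lra.
- apply: le_ereal_inf_tmp => _ [t /= tP <-]; rewrite lee_fin leNgt; apply/negP => zt.
  apply: Ax; apply: sub_density0 (density0U tP (dn ((z + t) / 2) _)); last by lra.
  by move=> y Ay; have [h|h] := ltP t (u y); [left|right; split => //=; lra].
Qed.

Lemma ap_lim_density0 A u x (z e : R) : 0 < e -> ap_lim A u x z%:E ->
  density0 (A `&` [set y | e <= `|u y - z|]) x.
Proof.
move=> e0 [ui us].
have [_ /= [t tP <-] te] : exists2 b, [set t%:E | t in [set t | density0 (A `&` [set y | t < u y]) x]] b &
    (b < (z + e)%:E)%E.
  by apply: ereal_inf_lt; rewrite -/(ap_limsup A u x) us lte_fin ltrDl.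
have [_ /= [s sP <-] se] : exists2 b, [set t%:E | t in [set t | density0 (A `&` [set y | u y < t]) x]] b &
    ((z - e)%:E < b)%E.
  by apply: ereal_sup_gt; rewrite -/(ap_liminf A u x) ui lte_fin gtrBl.
rewrite lte_fin in te; rewrite lte_fin in se.
apply: sub_density0 (density0U tP sP) => y [Ay /= h].
move: h; rewrite lter_normr => /orP[h|h]; [left|right]; split => //=; lra.
Qed.

Lemma density0_dot_cone A x d : d != 0 ->
  (forall y, enorm d / 2 * enorm (y - x) < dot d (y - x) -> A y) -> ~ density0 A x.
Proof.
move=> d0 HA; have dd : 0 < enorm d.
  by rewrite lt_neqAle enorm_ge0 andbT eq_sym; apply: contra_neq d0 => /enorm_eq0.
have eta0 : 0 < enorm d / (8 * n.+1%:R) by rewrite divr_gt0// mulr_gt0.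
apply: (density0_cone eta0 ltr01 (d := d)) => s y s0 s1 yd; apply: HA.
have Ed : enorm (y - x - s *: d) <= s * (enorm d / 8).
  apply: le_trans (@enorm_le _ _ _ (s * (enorm d / (8 * n.+1%:R))) _) _.
    by move=> i; have := yd i; rewrite !mxE opprD addrA.
  have -> : n%:R * (s * (enorm d / (8 * n.+1%:R))) = s * (enorm d / 8) * (n%:R / n.+1%:R).
    by field; rewrite nat1r pnatr_eq0.
  rewrite ler_piMr//; first by rewrite mulr_ge0 ?ltW// divr_gt0.
  by rewrite ler_pdivrMr// mul1r ler_nat.
have yx : enorm (y - x) <= s * enorm d * (9 / 8).
  rewrite -(subrK (s *: d) (y - x)); apply: le_trans (ler_enormD _ _) _.
  by rewrite enormZ (gtr0_norm s0); lra.
have dyx : s * enorm d ^+ 2 * (7 / 8) <= dot d (y - x).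
  rewrite -(subrK (s *: d) (y - x)) dotDr dotZr -enorm2.
  have := CauchySchwarz d (y - x - s *: d); rewrite ler_norml => /andP[h _].
  have := ler_wpM2l (enorm_ge0 d) Ed; lra.
apply: lt_le_trans dyx; apply: le_lt_trans (ler_wpM2l _ yx) _; first by rewrite divr_ge0// ltW.
have : 0 < s * enorm d ^+ 2 by rewrite mulr_gt0// exprn_gt0.
by lra.
Qed.

Lemma ap_grad_unique u x xi xi' : is_ap_grad u x xi -> is_ap_grad u x xi' -> xi = xi'.
Proof.
move=> [z uz uxi] [z' [uz' _] uxi'].
have zz' : z' = z by case: uz => uz _; move: uz'; rewrite uz => -[].
subst z'; apply/eqP; rewrite -subr_eq0; apply/negPn/negP => d0.
pose e := enorm (xi - xi') / 4.
have e0 : 0 < e.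
  rewrite divr_gt0// lt_neqAle enorm_ge0 andbT eq_sym.
  by apply: contra_neq d0 => /enorm_eq0.
apply: (density0_dot_cone d0) (density0U (uxi e e0) (uxi' e e0)) => y.
rewrite dotBl => dyx.
have [h|h] := ltP (e * enorm (y - x)) `|u y - z - dot xi (y - x)|; first by left.
right => /=; rewrite ltNge; apply/negP => h'.
move: h h'; rewrite !ler_norml => /andP[h1 h2] /andP[h3 h4].
have : enorm (xi - xi') / 2 * enorm (y - x) = 2 * (e * enorm (y - x)).
  by rewrite /e; field.
lra.
Qed.

Lemma ap_gradE u x xi : is_ap_grad u x xi -> ap_grad u x = xi.
Proof.
move=> h; apply: (ap_grad_unique _ h).
by apply: (@xgetPex _ 0 (is_ap_grad u x)); exists xi.
Qed.

Lemma ap_grad_cases u x : is_ap_grad u x (ap_grad u x) \/ ap_grad u x = 0.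
Proof.
have [h|h] := pselect (exists xi, is_ap_grad u x xi).
  by left; apply: (@xgetPex _ 0 (is_ap_grad u x)).
by right; apply: xgetPN => xi; apply/forallNP: xi.
Qed.

Lemma is_ap_grad_ext u v x xi : density0 [set y | u y != v y] x ->
  is_ap_grad u x xi -> is_ap_grad v x xi.
Proof.
move=> uv [z [ui us] uxi]; exists z; last first.
  move=> e e0; apply: sub_density0 (density0U (uxi e e0) uv) => y /= h.
  by have [->|//] := eqVneq (u y) (v y); [left|right].
have E (P : R -> Prop) : density0 (setT `&` [set y | P (u y)]) x =
    density0 (setT `&` [set y | P (v y)]) x.
  apply/propext; split => h; apply: sub_density0 (density0U h uv) => y [_ /= Py].
    by have [e|//] := eqVneq (u y) (v y); [left; split => //=; rewrite e|right].
  by have [e|//] := eqVneq (u y) (v y); [left; split => //=; rewrite -e|right].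
split; [rewrite -ui /ap_liminf|rewrite -us /ap_limsup].
  rewrite (_ : [set t | _] = [set t | density0 (setT `&` [set y | u y < t]) x])//.
  by apply/funext => t /=; rewrite (E (fun s => s < t)).
rewrite (_ : [set t | _] = [set t | density0 (setT `&` [set y | t < u y]) x])//.
by apply/funext => t /=; rewrite (E (fun s => t < s)).
Qed.

Lemma isC1_ap_grad u du x : isC1 u du -> is_ap_grad u x (\row_i du i x).
Proof.
move=> uC1; exists (u x).
  apply: ap_lim_near; first exact: density0T.
  move=> e e0; have /cvgrPdist_lt/(_ e e0)/nbhs_coord[r r0 rP] := isC1_continuous uC1 (x := x).
  exists r => // y _ yr; rewrite distrC; apply: rP => i; rewrite distrC.
  by apply: le_lt_trans yr; have := coord_le_enorm (y - x) i; rewrite !mxE.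
move=> e e0; have e'0 : 0 < e / n.+1%:R by rewrite divr_gt0.
have [r r0 rP] := isC1_expansion x uC1 e'0.
apply: density0_away r0 _ => y /= h yr.
have := rP y => /(_ _)/wrap[i|].
  by rewrite distrC; apply: le_lt_trans yr; have := coord_le_enorm (y - x) i; rewrite !mxE.
have -> : \sum_i du i x * (y 0 i - x 0 i) = dot (\row_i du i x) (y - x).
  by apply: eq_bigr => i _; rewrite !mxE.
apply/negP; rewrite -ltNge; apply: le_lt_trans h.
apply: (@le_trans _ _ (e / n.+1%:R * (n%:R * enorm (y - x)))).
  rewrite ler_pM2l// mulr_natl -[X in _ *+ X]card_ord -sumr_const.
  by apply: ler_sum => i _; have := coord_le_enorm (y - x) i; rewrite !mxE.
have -> : e / n.+1%:R * (n%:R * enorm (y - x)) = e * enorm (y - x) * (n%:R / n.+1%:R).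
  by field; rewrite gt_eqF//= ltr0n.
rewrite ler_piMr ?mulr_ge0 ?enorm_ge0 ?ltW// ltr_pdivrMr// mul1r ltr_nat//.
Qed.

End density.

(** * Truncation of functions and of their jumps and gradients *)

Section truncation.
Context {R : realType} {n : nat}.
Implicit Types (x y d xi : 'rV[R]_n) (u v : 'rV[R]_n -> R).

Lemma truncate_bounds (m : R) u x : 0 <= m -> - m <= truncate m u x <= m.
Proof.
by move=> m0; rewrite /truncate le_max lexx orbT/= ge_max ge_min lexx orbT/= ge0_cp.
Qed.

Lemma truncate_id (m : R) u x : - m < truncate m u x < m -> truncate m u x = u x.
Proof.
rewrite /truncate; have [h|h] := leP (u x) m.
  by have [h'|h'] := leP (u x) (- m); lra.
by have [h'|h'] := leP m (- m); lra.
Qed.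

Lemma truncate_le1 u : (forall x, `|u x| <= 1) -> forall m : nat,
  truncate m%:R u = if m == 0%N then cst 0 else u.
Proof.
move=> u1 m; apply/funext => x; have := u1 x; rewrite ler_norml => /andP[h1 h2].
case: eqVneq => [->|m0]; rewrite /truncate.
  rewrite oppr0 /=; have [h|h] := leP (u x) 0; rewrite ?maxxx//; have [h'|h'] := leP (u x) 0; lra.
have m1 : 1 <= m%:R :> R by rewrite ler1n lt0n.
by rewrite min_l ?max_l//; lra.
Qed.

Lemma usup_uinf_bounded u x (M : R) : (forall y, - M <= u y <= M) ->
  [/\ ((- M)%:E <= usup u x)%E, (usup u x <= M%:E)%E,
      ((- M)%:E <= uinf u x)%E & (uinf u x <= M%:E)%E].
Proof.
move=> uM; split.
- apply: le_ereal_inf_tmp => _ [t /= tP <-]; rewrite lee_fin leNgt; apply/negP => tM.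
  apply: (@density0T _ _ x); apply: sub_density0 tP => y _; split => //=.
  by have /andP[h _] := uM y; exact: lt_le_trans h.
- apply: ereal_inf_lbound; exists M => //=; apply: (density0_away ltr01) => y [_ /= h].
  by have /andP[_] := uM y; rewrite leNgt h.
- apply: ereal_sup_ubound; exists (- M) => //=; apply: (density0_away ltr01) => y [_ /= h].
  by have /andP[] := uM y; rewrite leNgt h.
- apply: ge_ereal_sup => _ [t /= tP <-]; rewrite lee_fin leNgt; apply/negP => tM.
  apply: (@density0T _ _ x); apply: sub_density0 tP => y _; split => //=.
  by have /andP[_ h] := uM y; exact: le_lt_trans h tM.
Qed.

Lemma jump_truncate_bound u x (M : R) : (forall y, - M <= u y <= M) ->
  disc u x -> 0 <= jump u x <= 2 * M.
Proof.
move=> uM; rewrite /disc /jump /=; have [] := usup_uinf_bounded x uM.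
case: (usup u x) => [a| |]//; case: (uinf u x) => [b| |]//.
by rewrite !lee_fin /= lte_fin => *; apply/andP; split; lra.
Qed.

(** Two levels [s1 < s2] strictly between the approximate limits of the truncation lie inside
    [(-m, m)], where the truncation and [u] have the same sublevel and superlevel sets. They
    therefore also separate the limits of [u]. *)
Lemma disc_truncate u m : 0 <= m -> disc (truncate m u) `<=` disc u.
Proof.
move=> m0 x; rewrite /disc /= => h; set w := truncate m u in h.
have [] := usup_uinf_bounded x (fun y => truncate_bounds u y m0); rewrite -/w.
case Ea : (usup w x) h => [a| |] //.
case Eb : (uinf w x) => [b| |] //.
rewrite !lee_fin lte_fin => ba ma am mb bm.
pose s1 := (2 * b + a) / 3; pose s2 := (b + 2 * a) / 3.
have s2P : ~ density0 (setT `&` [set y | s2 < w y]) x.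
  move=> s2P; have : (usup w x <= s2%:E)%E by apply: ereal_inf_lbound; exists s2.
  by rewrite Ea lee_fin /s2; lra.
have s1P : ~ density0 (setT `&` [set y | w y < s1]) x.
  move=> s1P; have : (s1%:E <= uinf w x)%E by apply: ereal_sup_ubound; exists s1.
  by rewrite Eb lee_fin /s1; lra.
have wu y s : - m < s < m -> ((s < w y) = (s < u y)) * ((w y < s) = (u y < s)).
  move=> /andP[ms sm]; rewrite /w /truncate lt_max gt_max lt_min gt_min.
  by rewrite (lt_gtF ms) (lt_gtF sm) sm ms !orbF !andbT.
apply: (@le_lt_trans _ _ s1%:E); last apply: (@lt_le_trans _ _ s2%:E).
- apply: ge_ereal_sup => _ [t /= tP <-]; rewrite lee_fin leNgt; apply/negP => st.
  apply: s1P; apply: sub_density0 tP => y [_ /=].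
  by rewrite wu; [split => //=; lra|apply/andP; split; rewrite /s1; lra].
- by rewrite lte_fin /s1 /s2; lra.
- apply: le_ereal_inf_tmp => _ [t /= tP <-]; rewrite lee_fin leNgt; apply/negP => st.
  apply: s2P; apply: sub_density0 tP => y [_ /=].
  by rewrite wu; [split => //=; lra|apply/andP; split; rewrite /s2; lra].
Qed.

(* At a point where the truncation is at the threshold, it is one-sided, so its
   approximate gradient vanishes. *)
Lemma ap_grad_truncate u m x : 0 < m ->
  enorm (ap_grad (truncate m u) x) <= enorm (ap_grad u x).
Proof.
move=> m0; have [|->] := ap_grad_cases (truncate m u) x; last by rewrite enorm0 enorm_ge0.
set w := truncate m u; set xi := ap_grad w x => wxi.
have [->|xi0] := eqVneq xi 0; first by rewrite enorm0 enorm_ge0.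
have wm y : - m <= w y <= m by apply: truncate_bounds; exact: ltW.
have [z [ui us] zP] := wxi.
have [] := usup_uinf_bounded x wm; rewrite /usup us !lee_fin => mz zm _ _.
have e0 : 0 < enorm xi / 2.
  rewrite divr_gt0// lt_neqAle enorm_ge0 andbT eq_sym.
  by apply: contra_neq xi0 => /enorm_eq0.
have z1 : z < m.
  rewrite lt_neqAle zm andbT; apply/eqP => zE.
  apply: (density0_dot_cone xi0) (zP _ e0) => y h /=; apply: (lt_le_trans h).
  by rewrite lter_normr; apply/orP; right; have /andP[] := wm y; lra.
have z2 : - m < z.
  rewrite lt_neqAle mz andbT; apply/eqP => zE.
  have xi0' : - xi != 0 by rewrite oppr_eq0.
  apply: (density0_dot_cone xi0') (zP _ e0) => y; rewrite enormN dotNl => h /=.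
  apply: (lt_le_trans h).
  by rewrite lter_normr; apply/orP; left; have /andP[] := wm y; lra.
rewrite (@ap_gradE _ _ u x xi)//; apply: is_ap_grad_ext wxi.
have e1 : 0 < Num.min (m - z) (m + z) by rewrite lt_min; apply/andP; split; lra.
apply: sub_density0 (ap_lim_density0 e1 (conj ui us)) => y /= wu; split => //=.
have : ~ (- m < w y < m) by move=> /truncate_id wE; rewrite /w wE eqxx in wu.
rewrite ge_min !lter_normr => h; have := wm y => /andP[h1 h2].
have [h3|h3] := ltP (w y) m; last by apply/orP; left; apply/orP; left; lra.
have [h4|h4] := ltP (- m) (w y); last by apply/orP; right; apply/orP; right; lra.
by exfalso; apply: h; rewrite h3 h4.
Qed.

End truncation.

Section integral_tools.
Context {d} {T : measurableType d} {R : realType} (mu : {measure set T -> \bar R}).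
Implicit Types (A B D N : set T).

Lemma eq_integral_patch (f g : T -> \bar R) A B :
  (forall x, A x -> B x -> f x = g x) ->
  (forall x, A x -> ~ B x -> f x = 0%E) -> (forall x, B x -> ~ A x -> g x = 0%E) ->
  (\int[mu]_(x in A) f x = \int[mu]_(x in B) g x)%E.
Proof.
move=> fg f0 g0; rewrite [LHS]integral_mkcond [RHS]integral_mkcond.
congr integral; apply/funext => x; rewrite /patch.
case: ifPn => /asboolP xA; case: ifPn => /asboolP xB //.
- exact: fg.
- exact: f0.
- by rewrite g0.
Qed.

Lemma eq_Rintegral_patch (f g : T -> R) A B :
  (forall x, A x -> B x -> f x = g x) ->
  (forall x, A x -> ~ B x -> f x = 0) -> (forall x, B x -> ~ A x -> g x = 0) ->
  \int[mu]_(x in A) f x = \int[mu]_(x in B) g x.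
Proof.
move=> fg f0 g0; congr fine; apply: eq_integral_patch => x Ax Bx.
- by rewrite fg.
- by rewrite f0.
- by rewrite g0.
Qed.

Lemma integrable_setU2 A B (f : T -> \bar R) : measurable A -> measurable B ->
  [disjoint A & B] -> mu.-integrable A f -> mu.-integrable B f ->
  mu.-integrable (A `|` B) f.
Proof.
move=> mA mB AB /integrableP[mfA iA] /integrableP[mfB iB]; apply/integrableP.
have mf : measurable_fun (A `|` B) f by apply/measurable_funU.
split => //; rewrite ge0_integral_setU//; first exact: lte_add_pinfty.
exact: measurableT_comp.
Qed.

Hypothesis mu_complete : measure_is_complete mu.

(** Measurability of [f] is a conclusion, obtained from completeness. It matters because approximate
    gradients are chosen values, computed only away from a null set. *)
Lemma integrable_null D N (f g : T -> \bar R) : measurable D -> measurable N ->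
  mu N = 0%E -> (forall x, D x -> ~ N x -> f x = g x) -> mu.-integrable D g ->
  mu.-integrable D f /\ (\int[mu]_(x in D) f x = \int[mu]_(x in D) g x)%E.
Proof.
move=> mD mN N0 fg ig; have igN := (negligible_integrable mN mD (measurable_int mu ig) N0).1 ig.
have ifN : mu.-integrable (D `\` N) f.
  apply: eq_integrable igN => //; first exact: measurableD.
  by move=> x /set_mem[Dx Nx]; rewrite fg.
have mf : measurable_fun D f.
  rewrite -(setUIDK D N); apply/measurable_funU; [exact: measurableI|exact: measurableD|].
  split; last exact: measurable_int ifN.
  move=> _ Y mY; apply: mu_complete; exists N; split => // x [[]] //.
have ifD : mu.-integrable D f by apply/(negligible_integrable mN mD mf N0).
split => //.
rewrite (negligible_integral mN mD ifD N0) (negligible_integral mN mD ig N0).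
by apply: eq_integral => x /set_mem[Dx Nx]; exact: fg.
Qed.

End integral_tools.

(** * Jump points and their normals *)

Section two_sided_limits.
Context {R : realType} {n : nat}.
Implicit Types (A B : set 'rV[R]_n) (x y : 'rV[R]_n) (u : 'rV[R]_n -> R).

Lemma ap_limsup_lt A u x (a t : R) : ap_lim A u x a%:E -> a < t ->
  density0 (A `&` [set y | t < u y]) x.
Proof.
move=> ua at0; have ta : 0 < t - a by rewrite subr_gt0.
apply: sub_density0 (ap_lim_density0 ta ua) => y [Ay /= h]; split => //=.
by rewrite lter_normr; apply/orP; left; lra.
Qed.

Lemma ap_liminf_gt A u x (a t : R) : ap_lim A u x a%:E -> t < a ->
  density0 (A `&` [set y | u y < t]) x.
Proof.
move=> ua at0; have ta : 0 < a - t by rewrite subr_gt0.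
apply: sub_density0 (ap_lim_density0 ta ua) => y [Ay /= h]; split => //=.
by rewrite lter_normr; apply/orP; right; lra.
Qed.

Lemma usup_uinf_two_sided A B u x (a b : R) : A `|` B = setT -> b <= a ->
  ap_lim A u x a%:E -> ap_lim B u x b%:E -> usup u x = a%:E /\ uinf u x = b%:E.
Proof.
move=> AB ba ua ub; split; apply/eqP; rewrite eq_le; apply/andP; split.
- apply/lee_addgt0Pr => e e0; apply: ereal_inf_lbound; exists (a + e); rewrite ?EFinD//=.
  rewrite -AB setIUl; apply: density0U; [apply: ap_limsup_lt ua _|apply: ap_limsup_lt ub _]; lra.
- rewrite -ua.2; apply: le_ereal_inf => _ [t /= tP <-]; exists t => //=.
  by apply: sub_density0 tP => y [].
- rewrite -ub.1; apply: ereal_sup_le => _ [t /= tP <-].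
  by exists t => //=; apply: sub_density0 tP => y [].
- apply/lee_addgt0Pr => e e0; rewrite -leeBlDr//; apply: ereal_sup_ubound.
  exists (b - e); rewrite ?EFinB//=.
  rewrite -AB setIUl; apply: density0U; [apply: ap_liminf_gt ua _|apply: ap_liminf_gt ub _]; lra.
Qed.

Lemma ap_grad_disc u x xi : is_ap_grad u x xi -> ~ disc u x.
Proof. by move=> [z [ui us] _]; rewrite /disc/= /uinf /usup ui us ltxx. Qed.

Lemma sphere_basis (i : 'I_n) : sphere (Defs.basis i : 'rV[R]_n).
Proof.
by rewrite /sphere/= /enorm dot_basisr mxE !eqxx sqrtr1.
Qed.

(** If [nu] is not the basis vector, the cone around their difference lies both where [u] is close
    to [a] (on the positive side of [nu]) and where it is close to [b] (on the negative side of the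
    basis vector). Splitting the cone at the level [(a + b) / 2] gives two sets of density zero. *)
Lemma normal_unique u x (i : 'I_n) (a b : R) nu : b < a ->
  usup u x = a%:E -> uinf u x = b%:E ->
  is_normal u x (Defs.basis i) -> is_normal u x nu -> nu = Defs.basis i.
Proof.
move=> ba ua ub [_ _ e2] [nu1 n1 _]; apply/eqP/negPn/negP => nue.
rewrite ua in n1; rewrite ub in e2.
have nui : nu 0 i < 1.
  rewrite ltNge; apply/negP => h; move/eqP: nue; apply.
  apply/eqP; rewrite -subr_eq0; apply/eqP/enorm_eq0/eqP.
  rewrite -(@eqrXn2 _ 2) ?enorm_ge0// expr0n/= enorm2 dotBl dotC dotBl (dotC _ (_ - _)) dotBl.
  rewrite -!enorm2 nu1 !dot_basisl dot_basisr; rewrite -[_ ^+ 2]/(1 * 1)%R.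
  have -> : enorm (Defs.basis i : 'rV[R]_n) = 1 by exact: sphere_basis.
  have /ler_normlP[_] := coord_le_enorm nu i; rewrite nu1; lra.
have eta0 : 0 < (1 - nu 0 i) / (2 * n.+1%:R) by rewrite divr_gt0 ?subr_gt0 ?mulr_gt0.
pose c := (a + b) / 2.
have cP : c < a by rewrite /c; lra.
have D1 := ap_liminf_gt n1 cP.
have D2 : density0 ([set y | dot (y - x) (Defs.basis i) < 0] `&` [set y | c <= u y]) x.
  have ba2 : 0 < c - b by rewrite /c; lra.
  apply: sub_density0 (ap_lim_density0 ba2 e2) => y [h1 /= h2]; split => //=.
  by rewrite lter_normr; apply/orP; left; lra.
apply: (density0_cone eta0 ltr01 (d := nu - Defs.basis i)) (density0U D1 D2).
move=> s y s0 s1 yd.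
have E1 : dot (y - x) (Defs.basis i) < 0.
  rewrite dot_basisr; have := yd i; rewrite !mxE !eqxx/= => /ler_normlP[_ h].
  have : (1 - nu 0 i) / (2 * n.+1%:R) < 1 - nu 0 i.
    rewrite ltr_pdivrMr ?mulr_gt0// ltr_pMr ?subr_gt0//.
    by rewrite -natrM ltr1n mulnS.
  by rewrite -(ltr_pM2l s0) => h'; have := le_lt_trans h h'; lra.
have E2 : 0 < dot (y - x) nu.
  pose w := y - x - s *: (nu - Defs.basis i).
  have Ew : enorm w <= s * ((1 - nu 0 i) / 2).
    apply: le_trans (@enorm_le _ _ _ (s * ((1 - nu 0 i) / (2 * n.+1%:R))) _) _.
      by move=> j; have := yd j; rewrite !mxE opprD addrA.
    have -> : n%:R * (s * ((1 - nu 0 i) / (2 * n.+1%:R))) =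
        s * ((1 - nu 0 i) / 2) * (n%:R / n.+1%:R).
      by field; rewrite nat1r pnatr_eq0.
    rewrite ler_piMr//; first by rewrite mulr_ge0 ?ltW// divr_gt0// subr_gt0.
    by rewrite ler_pdivrMr// mul1r ler_nat.
  rewrite -(subrK (s *: (nu - Defs.basis i)) (y - x)) -/w dotDl dotZl dotBl -enorm2 nu1 dot_basisl.
  have := CauchySchwarz w nu; rewrite nu1 mulr1 ler_norml => /andP[h _].
  have : 0 < s * (1 - nu 0 i) by rewrite mulr_gt0// subr_gt0.
  lra.
by have [h|h] := ltP (u y) c; [left|right].
Qed.

Lemma normalE u x (i : 'I_n) : disc u x -> usup u x \is a fin_num ->
  uinf u x \is a fin_num -> is_normal u x (Defs.basis i) -> normal u x = Defs.basis i.
Proof.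
move=> ux; rewrite /disc/= in ux.
case ua : (usup u x) ux => [a| |]//; case ub : (uinf u x) => [b| |]//.
rewrite lte_fin => ba _ _ h; apply: (normal_unique ba ua ub h).
by apply: (@xgetPex _ 0 (is_normal u x)); exists (Defs.basis i).
Qed.

End two_sided_limits.

(** * Functions of class C1 between parallel cracks *)

Section strips.
Context {R : realType} {m : nat} (m_gt0 : (0 < m)%N).
Implicit Types (x y : 'rV[R]_m.+1) (U : set 'rV[R]_m.+1).
Variables (A e : R) (e_gt0 : 0 < e) (K : nat) (p q : 'rV[R]_m.+1).
Hypotheses (p0 : p 0 0 = A) (q0 : q 0 0 = A + e * K%:R) (pq : forall i, p 0 i <= q 0 i).
Local Notation L := (caratheodory_type (@lebesgue_outer R m.+1)).
Local Notation H := (caratheodory_type (@hausdorff_outer R m.+1 m)).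
Local Notation mu := (leb R m.+1).

Definition strip_index x := Num.floor ((x 0 0 - A) / e).

(** The model of a function with parallel cracks: it equals [v j] in the strip between [level j] and
    [level j.+1]. Below, [v_jump] makes the traces increase across each level, so that wherever
    there is a jump its normal is the basis vector of direction 0. Strips are numbered by integers
    because the number comes from a floor. *)
Definition piecewise (v : int -> 'rV[R]_m.+1 -> R) x := v (strip_index x) x.

Definition level (j : nat) := A + e * j%:R.

Lemma levelS j : level j.+1 = level j + e.
Proof. by rewrite /level -natr1; ring. Qed.

Lemma strip_indexP x (j : nat) : level j <= x 0 0 < level j.+1 -> strip_index x = j.
Proof.
rewrite levelS /level => /andP[h1 h2]; apply/floor_def/andP; split.
  by rewrite ler_pdivlMr// -pmulrn; lra.
by rewrite ltr_pdivrMr// intrD -pmulrn; lra.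
Qed.

Definition strip j := box (upd p 0 (level j)) (upd q 0 (level j.+1)).

Lemma stripP (j : nat) x : strip j x -> strip_index x = j.
Proof. by move=> /(_ 0); rewrite !mxE eqxx => /strip_indexP. Qed.

Lemma level_le i j : (i <= j)%N -> level i <= level j.
Proof. by move=> ij; rewrite lerD2l ler_pM2l// ler_nat. Qed.

Lemma piecewise_box (g : int -> 'rV[R]_m.+1 -> R) : (forall j, continuous (g j)) ->
  mu.-integrable (box p q) (EFin \o piecewise g) /\
  \int[mu]_(x in box p q) piecewise g x = \sum_(j < K) \int[mu]_(x in strip j) g j x.
Proof.
move=> cg; have qE : q = upd q 0 (level K).
  by apply/rowP => j; rewrite mxE; case: eqP => // ->; rewrite q0.
rewrite {1 2}qE; elim: (K) => [|k [IH1 IH2]].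
  rewrite big_ord0 (@box_eq0 _ _ _ _ 0) ?Rintegral_set0; last first.
    by rewrite updE p0 /level mulr0 addr0.
  by split => //; exact: integrable_set0.
have lk : level k <= level k.+1 by exact: level_le.
have pk : p 0 0 <= level k by rewrite p0 -[leLHS]addr0 lerD2l mulr_ge0// ltW.
have pk1 : p 0 0 <= upd q 0 (level k.+1) 0 0 by rewrite updE (le_trans pk).
have [_] := box_split (level k) pk1; rewrite updE min_r// max_r// => E1 E2.
have uu s t : upd (upd q 0 s) 0 t = upd q 0 t :> 'rV[R]_m.+1.
  by apply/rowP => j; rewrite !mxE; case: eqP.
rewrite uu in E1.
have E : box p (upd q 0 (level k.+1)) = box p (upd q 0 (level k)) `|` strip k.
  by rewrite /strip -E1 -E2 setDE -setIUr setUCr setIT.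
have dis : [disjoint box p (upd q 0 (level k)) & strip k].
  rewrite /strip -E1 -E2; apply/eqP; apply/seteqP; split => // x [[_ h] [_ nh]]; exact: nh.
have ib : mu.-integrable (strip k) (EFin \o g k) by exact: continuous_box_integrable.
have ibp : mu.-integrable (strip k) (EFin \o piecewise g).
  apply: eq_integrable ib => //; first exact: leb_box.
  by move=> x /set_mem/stripP xk; rewrite /= /piecewise xk.
have mB1 := @leb_box R m.+1 p (upd q 0 (level k)).
have mB2 : measurable (strip k : set L) by exact: leb_box.
rewrite E; have iU := integrable_setU2 mB1 mB2 dis IH1 ibp.
split=> //; rewrite Rintegral_setU// IH2 big_ord_recr/=; congr (_ + _).
by apply: eq_Rintegral => x /set_mem/stripP xk; rewrite /piecewise xk.
Qed.

Variables (v : int -> 'rV[R]_m.+1 -> R) (dv : int -> 'I_m.+1 -> 'rV[R]_m.+1 -> R).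
Hypothesis vC1 : forall j, isC1 (v j) (dv j).
Hypothesis v_jump : forall (j : nat) x, x 0 0 = level j.+1 -> v j x <= v j.+1 x.
Variable (U : set 'rV[R]_m.+1).
Hypotheses (oU : open U) (Upq : forall x, U x -> forall i, p 0 i < x 0 i < q 0 i).

Let w := piecewise v.
Let vc j : continuous (v j) := isC1_continuous (vC1 j).

Lemma U_box : U `<=` box p q.
Proof. by move=> x Ux i; have /andP[/ltW-> ->] := Upq Ux i. Qed.

Lemma U_strip x : U x -> exists2 j, (j < K)%N & level j <= x 0 0 < level j.+1.
Proof.
move=> /Upq/(_ 0); rewrite p0 q0 => /andP[x1 x2].
have x0 : 0 <= (x 0 0 - A) / e by rewrite divr_ge0 ?ltW// subr_gt0.
have /andP[h1 h2] := truncn_itv x0.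
exists (Num.truncn ((x 0 0 - A) / e)).
  by rewrite -(ltr_nat R) (le_lt_trans h1)// ltr_pdivrMr//; lra.
rewrite ler_pdivlMr// in h1; rewrite ltr_pdivrMr// in h2.
by rewrite levelS /level; rewrite -natr1 in h2; apply/andP; split; lra.
Qed.

Lemma ap_grad_strip x (j : nat) : level j < x 0 0 < level j.+1 ->
  is_ap_grad w x (\row_i dv j i x).
Proof.
move=> /andP[h1 h2]; apply: is_ap_grad_ext (isC1_ap_grad x (vC1 j)).
apply: (@density0_away _ _ _ _ (Num.min (x 0 0 - level j) (level j.+1 - x 0 0))).
  by rewrite lt_min !subr_gt0 h1.
move=> y /= wy; rewrite /eball/= lt_min => /andP[y1 y2].
move/eqP: wy; apply; rewrite /w /piecewise (@strip_indexP y j)//.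
have := coord_le_enorm (y - x) 0; rewrite !mxE ler_norml => /andP[h3 h4].
by apply/andP; split; [apply/ltW|]; lra.
Qed.

(** Here [s] selects the side of the level. The set [B] is only squeezed between half-spaces,
    because the partition of the space uses a half-open pair while the definition of the normal uses
    two open half-spaces. *)
Lemma halfspace_ap_lim (s : bool) x (j : nat) (b : R) : x 0 0 = level j.+1 ->
  b = (if s then v j.+1 x else v j x) ->
  forall B : set 'rV[R]_m.+1,
  (forall y, B y -> if s then x 0 0 <= y 0 0 else y 0 0 < x 0 0) ->
  (forall y, (if s then x 0 0 < y 0 0 else y 0 0 < x 0 0) -> B y) ->
  ap_lim B w x b%:E.
Proof.
move=> xj -> B B1 B2; apply: ap_lim_near.
  apply: (@density0_cone _ _ _ _ ((if s then 1 else -1) *: Defs.basis 0) (1 / 2) 1) => //.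
  move=> t y t0 t1 /(_ 0); rewrite !mxE !eqxx mulr1 ler_norml => /andP[h1 h2].
  by apply: B2 => /=; case: s h1 h2 {B1} => *; lra.
move=> d d0; set k := if s then j.+1 else j.
have /cvgrPdist_lt/(_ d d0)/nbhs_coord[r r0 rP] := @vc k x.
exists (Num.min r e); first by rewrite lt_min r0.
move=> y By; rewrite /eball/= lt_min => /andP[yr ye].
have wy : w y = v k y.
  have := B1 _ By; rewrite /w /piecewise /k => /= hy; congr (v _ y).
  apply: strip_indexP; have := coord_le_enorm (y - x) 0; rewrite !mxE ler_norml => /andP[h3 h4].
  have := levelS j; have := levelS j.+1.
  by case: s hy {B1 B2 k rP} => hy *; apply/andP; split; lra.
rewrite wy (_ : (if s then _ else _) = v k x); last by rewrite /k; case: (s).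
rewrite distrC; apply: rP => i; rewrite distrC.
by apply: le_lt_trans yr; have := coord_le_enorm (y - x) i; rewrite !mxE.
Qed.

Lemma usup_uinf_level x (j : nat) : x 0 0 = level j.+1 ->
  usup w x = (v j.+1 x)%:E /\ uinf w x = (v j x)%:E.
Proof.
move=> xj; apply: (@usup_uinf_two_sided _ _ [set y | x 0 0 <= y 0 0] [set y | y 0 0 < x 0 0]).
- by apply/seteqP; split => // y _; have [h|h] := leP (x 0 0) (y 0 0); [left|right].
- exact: v_jump.
- by apply: (@halfspace_ap_lim true _ j) => // y; exact: ltW.
- by apply: (@halfspace_ap_lim false _ j).
Qed.

Lemma level_normal x (j : nat) : x 0 0 = level j.+1 -> is_normal w x (Defs.basis 0).
Proof.
move=> xj; have [us ui] := usup_uinf_level xj; split; first exact: sphere_basis.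
- rewrite us; apply: (@halfspace_ap_lim true _ j) => // y; rewrite /= dot_basisr !mxE; lra.
- rewrite ui; apply: (@halfspace_ap_lim false _ j) => // y; rewrite /= dot_basisr !mxE; lra.
Qed.

(** Where the two pieces agree on a level there is no discontinuity, so the crack keeps only the
    points with a strict jump. *)
Definition crack (j : nat) := U `&` [set x | v j x < v j.+1 x] `&` hyperplane 0 (level j.+1).

Lemma strip_boundary x : U x -> (exists2 j, (j < K)%N & level j < x 0 0 < level j.+1) \/
  exists2 j, (j.+1 < K)%N & x 0 0 = level j.+1.
Proof.
move=> Ux; have [j jK /andP[]] := U_strip Ux; rewrite le_eqVlt => /orP[/eqP xj h|h1 h2].
  right; case: j jK xj h => [|j] jK xj h; last by exists j.
  by have /andP[] := Upq Ux 0; rewrite p0 -xj /level mulr0 addr0 ltxx.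
by left; exists j => //; rewrite h1.
Qed.

Lemma disc_piecewise : disc w `&` U = \bigcup_(j in `I_K) crack j.
Proof.
apply/seteqP; split => [x [wx Ux]|x [j /= jK [[Ux vx] /= xj]]].
  have [[j jK /ap_grad_strip/ap_grad_disc//]|[j jK xj]] := strip_boundary Ux.
  exists j => /=; first exact: ltnW.
  split => //; split => //=; move: wx; rewrite /disc/=.
  by have [-> ->] := usup_uinf_level xj; rewrite lte_fin.
split => //; rewrite /disc/=; have [-> ->] := usup_uinf_level xj.
by rewrite lte_fin.
Qed.

Lemma jump_normal_crack j x : crack j x ->
  jump w x = v j.+1 x - v j x /\ normal w x = Defs.basis 0.
Proof.
move=> [[Ux vx] /= xj]; have [us ui] := usup_uinf_level xj.
split; first by rewrite /jump us ui.
apply: normalE; rewrite ?us ?ui//; last exact: level_normal xj.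
by rewrite /disc/= us ui lte_fin.
Qed.

Lemma hyperplane_null (c : R) : mu (box p q `&` hyperplane 0 c) = 0%E.
Proof.
apply/eqP; rewrite eq_le measure_ge0 andbT; apply/lee_addgt0Pr => d d0; rewrite add0e.
pose V := vol (del 0 p) (del 0 q).
have V0 : 0 <= V by apply: vol_ge0 => j; rewrite !mxE.
have V1 : 0 < V + 1 by rewrite ltr_wpDl.
apply: (@le_trans _ _ (lebesgue_outer (box (upd p 0 c) (upd q 0 (c + d / (V + 1)))))).
  apply: le_lebesgue_outer => x [xb /= xc] j; rewrite !mxE; case: eqP => [->|_]; last exact: xb.
  by rewrite /hyperplane/= in xc; rewrite xc lexx ltrDl divr_gt0.
rewrite lebesgue_outer_box; last first.
  by move=> j; rewrite !mxE; case: eqP => // _; rewrite lerDl divr_ge0 ?ltW.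
rewrite (vol_del 0) !del_upd !updE -/V lee_fin addrAC subrr add0r mulrAC ler_pdivrMr//.
by rewrite ler_pM2l//; lra.
Qed.

Let N := \bigcup_j (box p q `&` hyperplane 0 (level j)).

Lemma mhyperplane j : measurable (box p q `&` hyperplane 0 (level j) : set L).
Proof.
apply: measurableI; first exact: leb_box.
apply: leb_closed; have -> : hyperplane 0 (level j) =
    (fun x : 'rV[R]_m.+1 => x 0 0) @^-1` [set t | t = level j] by [].
by apply: closed_comp => [x _|]; [exact: coord_continuous|exact: closed_eq].
Qed.

Lemma mN : measurable (N : set L).
Proof. by apply: bigcupT_measurable => j; exact: mhyperplane. Qed.

Lemma N0 : mu N = 0%E.
Proof.
apply/eqP; rewrite eq_le measure_ge0 andbT.
apply: le_trans (lebesgue_outer_bigcup _) _.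
by rewrite eseries0// => j _ _; exact: hyperplane_null.
Qed.

Lemma mU : measurable (U : set L). Proof. exact: leb_open. Qed.

Lemma piecewise_U (g : int -> 'rV[R]_m.+1 -> R) : (forall j, continuous (g j)) ->
  mu.-integrable U (EFin \o piecewise g).
Proof.
move=> cg; apply: integrableS mU U_box (piecewise_box cg).1; exact: leb_box.
Qed.

Lemma ap_grad_piecewise x i : U x -> ~ N x ->
  ap_grad w x 0 i = piecewise (fun j => dv j i) x.
Proof.
move=> Ux Nx; have [[j jK xj]|[j jK xj]] := strip_boundary Ux.
  rewrite (ap_gradE (ap_grad_strip xj)) mxE /piecewise (@strip_indexP x j)//.
  by move: xj => /andP[/ltW -> ->].
by exfalso; apply: Nx; exists j.+1 => //; split; [exact: U_box|].
Qed.

Lemma grad_integral (F : 'rV[R]_m.+1 -> R) (g : int -> 'rV[R]_m.+1 -> R) :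
  (forall j, continuous (g j)) ->
  (forall x, U x -> ~ N x -> F x = piecewise g x) ->
  mu.-integrable U (EFin \o F) /\
  \int[mu]_(x in U) F x = \int[mu]_(x in U) piecewise g x.
Proof.
move=> cg Fg; have [] := @integrable_null _ _ _ mu
  (@measure_is_complete_caratheodory _ _ _) U N (EFin \o F) (EFin \o piecewise g)
  mU mN N0 _ (piecewise_U cg).
  by move=> x Ux Nx; rewrite /= Fg.
by move=> iF EF; split => //; rewrite /Rintegral; congr fine.
Qed.

Let D (j : nat) := U `&` [set x | v j x < v j.+1 x].

Lemma open_D j : open (D j).
Proof.
apply: openI => //; have -> : [set x | v j x < v j.+1 x] =
    (fun x => v j.+1 x - v j x) @^-1` [set t | 0 < t].
  by apply/funext => x /=; rewrite subr_gt0.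
by apply: open_comp => [x _|]; [apply: continuousB; exact: vc|exact: open_gt].
Qed.

Lemma mcrack j : measurable (crack j : set H).
Proof. by apply: measurableI; [exact/open_haus/open_D|exact: hyperplane_haus]. Qed.

Lemma haus_crack j :
  (hausdorff_outer m (crack j) <= (vol (del 0 p) (del 0 q))%:E)%E.
Proof.
rewrite -lebesgue_outer_box; last by move=> i; rewrite !mxE.
rewrite -(hausdorff_hyperplane m_gt0 0 (level j.+1)).
apply: (@le_hausdorff_outer R m.+1 m) => x [[Ux _] /= xj].
exists (del 0 x); last by rewrite -[X in ins _ X]xj delK.
by move=> i; rewrite !mxE; exact: U_box.
Qed.

Lemma crack_integrable j (psi : 'rV[R]_m.+1 -> R) : continuous psi ->
  (haus R m.+1 m).-integrable (crack j) (EFin \o psi).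
Proof.
move=> cpsi; have [M M0 psiM] := continuous_cbox_bounded p q cpsi.
apply: measurable_bounded_integrable; first exact: mcrack.
- exact: le_lt_trans (haus_crack j) (ltry _).
- by apply: measurable_funS (continuous_caratheodory (@halfspace_haus R m.+1 m) cpsi).
- exists M; split; first by rewrite num_real.
  by move=> k Mk x [[/U_box/box_sub_cbox xb _] _]; apply: le_trans (psiM _ xb) _; exact: ltW.
Qed.

Lemma crack_integral j (psi : 'rV[R]_m.+1 -> R) : continuous psi ->
  (forall x, x 0 0 = level j.+1 -> ~ D j x -> psi x = 0) ->
  \int[haus R m.+1 m]_(x in crack j) psi x =
  \int[leb R m]_(x in box (del 0 p) (del 0 q)) psi (ins 0 (level j.+1) x).
Proof.
move=> cpsi psi0; rewrite [LHS](congr1 fine (hyperplane_integral m_gt0 _ _ _)); first last.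
- have cins := ins_continuous (i := 0) (t := level j.+1) cpsi.
  apply: integrableS (continuous_box_integrable (del 0 p) (del 0 q) cins).
  + exact: leb_box.
  + apply: leb_open; apply: open_comp => [x _|]; last exact: open_D.
    move=> B /nbhs_coord[r r0 rB]; apply/nbhs_coord; exists r => // y xy.
    apply: rB => i; case: (unliftP 0 i) => [k ->|->]; rewrite ?ins_lift//.
    by rewrite !insE subrr normr0.
  + by move=> x [/U_box xU _] i; have := xU (lift 0 i); rewrite ins_lift !mxE.
- apply/measurable_EFinP.
  exact: (continuous_caratheodory (@halfspace_haus R m.+1 m) cpsi).
- exact/open_haus/open_D.
rewrite /Rintegral; congr fine; apply: eq_integral_patch => // x.
  move=> [/U_box xU _] nx; exfalso; apply: nx => i.
  by have := xU (lift 0 i); rewrite ins_lift !mxE.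
by move=> _ nx; rewrite psi0// insE.
Qed.

Lemma cracks_integral (F : 'rV[R]_m.+1 -> R) (psi : nat -> 'rV[R]_m.+1 -> R) k :
  (forall j, continuous (psi j)) -> (forall j x, crack j x -> F x = psi j x) ->
  [/\ measurable (\bigcup_(j in `I_k) crack j : set H),
    (haus R m.+1 m).-integrable (\bigcup_(j in `I_k) crack j) (EFin \o F) &
  \int[haus R m.+1 m]_(x in \bigcup_(j in `I_k) crack j) F x =
    \sum_(j < k) \int[haus R m.+1 m]_(x in crack j) psi j x].
Proof.
move=> cpsi Fpsi; elim: k => [|k [IH0 IH1 IH2]].
  rewrite II0 bigcup_set0 big_ord0 Rintegral_set0; split => //; exact: integrable_set0.
have E : \bigcup_(j in `I_k.+1) crack j = \bigcup_(j in `I_k) crack j `|` crack k.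
  apply/seteqP; split => [x [j /= jk xj]|x [[j /= jk xj]|xk]].
  - move: jk; rewrite ltnS leq_eqVlt => /orP[/eqP jk|jk]; first by right; rewrite -jk.
    by left; exists j.
  - by exists j => //=; exact: ltnW.
  - by exists k => /=.
have dis : [disjoint \bigcup_(j in `I_k) crack j & crack k].
  apply/eqP/seteqP; split => // x [[j /= jk [_ /= xj]] [_ /= xk]].
  move: xk; rewrite /hyperplane/= xj => /addrI/(mulfI (lt0r_neq0 e_gt0))/eqP.
  by rewrite eqr_nat eqSS => /eqP jk'; rewrite jk' ltnn in jk.
have iF : (haus R m.+1 m).-integrable (crack k) (EFin \o F).
  apply: eq_integrable (crack_integrable k (cpsi k)); first exact: mcrack.
  by move=> x /set_mem xk; rewrite /= (Fpsi k).
have mk := mcrack k; have iU := integrable_setU2 IH0 mk dis IH1 iF.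
rewrite E; split; [exact: measurableU|exact: iU|].
rewrite Rintegral_setU// IH2 big_ord_recr/=; congr (_ + _).
by apply: eq_Rintegral => x /set_mem/Fpsi.
Qed.

(** The divergence theorem is applied to [v j * phi] in each strip. The boundary terms on a common
    level differ by the jump, which is the integral over the crack; those on the boundary of the box
    vanish, as [phi] is zero outside [U]. *)
Lemma piecewise_parts phi dphi i : isC1 phi dphi ->
  (forall x, ~ U x -> phi x = 0 /\ forall i, dphi i x = 0) ->
  \int[mu]_(x in U) (w x * dphi i x) =
  - (\int[mu]_(x in U) (phi x * ap_grad w x 0 i) +
     \int[haus R m.+1 m]_(x in disc w `&` U) (phi x * (jump w x * normal w x 0 i))).
Proof.
move=> phiC1 phi0; have [_ dphic] := phiC1; have phic := isC1_continuous phiC1.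
have dvc j k : continuous (dv j k) by have [_] := vC1 j.
have cM (f g : 'rV[R]_m.+1 -> R) : continuous f -> continuous g -> continuous (fun x => f x * g x).
  by move=> cf cg x; apply: continuousM; [exact: cf|exact: cg].
have EU (g : int -> 'rV[R]_m.+1 -> R) : (forall j x, ~ U x -> g j x = 0) ->
    \int[mu]_(x in U) piecewise g x = \int[mu]_(x in box p q) piecewise g x.
  move=> g0; apply: eq_Rintegral_patch => // x; first by move=> /U_box.
  by move=> _ Ux; exact: g0.
have E1 : \int[mu]_(x in U) (w x * dphi i x) =
    \sum_(j < K) \int[mu]_(x in strip j) (v j x * dphi i x).
  rewrite -(piecewise_box (fun j => cM _ _ (@vc j) (dphic i))).2.
  by apply: (EU (fun j x => v j x * dphi i x)) => j x /phi0[_ ->]; rewrite mulr0.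
have E2 : \int[mu]_(x in U) (phi x * ap_grad w x 0 i) =
    \sum_(j < K) \int[mu]_(x in strip j) (phi x * dv j i x).
  rewrite -(piecewise_box (fun j => cM _ _ phic (dvc j i))).2.
  rewrite -EU; last by move=> j x /phi0[-> _]; rewrite mul0r.
  have [|_ ->//] := @grad_integral (fun x => phi x * ap_grad w x 0 i) _ (fun j => cM _ _ phic (dvc j i)).
  by move=> x Ux Nx; rewrite ap_grad_piecewise.
have c0 : continuous (cst 0 : 'rV[R]_m.+1 -> R) by exact: cst_continuous.
have cB (j : nat) : continuous (fun x => v j.+1 x - v j x).
  by move=> x; apply: continuousB; exact: vc.
(* [B k j] integrates [v j * phi] over the level [k]. The strip [j] contributes [B j.+1 j - B j j],
   the crack on top of it [B j.+1 j.+1 - B j.+1 j], and the sum telescopes. *)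
pose B (k j : nat) := \int[leb R m]_(x in box (del 0 p) (del 0 q))
  (v j (ins 0 (level k) x) * phi (ins 0 (level k) x)).
have [_ _ E3] : [/\ measurable (\bigcup_(j in `I_K) crack j : set H),
    (haus R m.+1 m).-integrable (\bigcup_(j in `I_K) crack j)
      (EFin \o (fun x => phi x * (jump w x * normal w x 0 i))) &
    \int[haus R m.+1 m]_(x in \bigcup_(j in `I_K) crack j)
     (phi x * (jump w x * normal w x 0 i)) =
    \sum_(j < K) \int[haus R m.+1 m]_(x in crack j)
      (phi x * ((v j.+1 x - v j x) * (0 == i)%:R))].
  apply: (@cracks_integral _ (fun j x => phi x * ((v j.+1 x - v j x) * (0 == i)%:R))).
    by move=> j; apply: (cM) => //; apply: (cM) => // x; exact: cst_continuous.
  by move=> j x /jump_normal_crack[-> ->]; rewrite mxE eqxx/= eq_sym.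
have E4 : \sum_(j < K) \int[haus R m.+1 m]_(x in crack j)
      (phi x * ((v j.+1 x - v j x) * (0 == i)%:R)) =
    \sum_(j < K) (B j.+1 j.+1 - B j.+1 j) * (0 == i)%:R.
  apply: eq_bigr => j _; have cint k k' : (leb R m).-integrable (box (del 0 p) (del 0 q))
      (EFin \o (fun x : 'rV[R]_m => v k (ins 0 (level k') x) * phi (ins 0 (level k') x))).
    apply: continuous_box_integrable.
    exact: (ins_continuous (f := fun x => v k x * phi x) (cM _ _ (@vc k) phic)).
  have mb := @leb_box R m (del 0 p) (del 0 q).
  have iB := integrableB mb (cint j.+1 j.+1) (cint j j.+1).
  rewrite -RintegralB// -RintegralZr//.
  rewrite crack_integral.
  - by apply: eq_Rintegral => x _; ring.
  - by apply: (cM) => //; apply: (cM) => // x; exact: cst_continuous.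
  - move=> x xj /not_andP[/phi0[-> _]|]; first by rewrite mul0r.
    move=> /negP; rewrite -leNgt => vle.
    have -> : v j.+1 x = v j x by apply/eqP; rewrite eq_le vle v_jump.
    by rewrite subrr mul0r mulr0.
have pqj k j : upd p 0 (level k) 0 j <= upd q 0 (level k.+1) 0 j.
  by rewrite !mxE; case: eqP => // _; exact: level_le.
have E5 (j : nat) : \int[mu]_(x in strip j) (v j x * dphi i x) +
    \int[mu]_(x in strip j) (phi x * dv j i x) = (B j.+1 j - B j j) * (0 == i)%:R.
  have ms : measurable (strip j : set L) by exact: leb_box.
  rewrite -RintegralD//; [|by apply: continuous_box_integrable; exact: cM..].
  have := box_divergence i (isC1M (@vc j) phic (vC1 j) phiC1) (pqj j) => /= ->.
  case: (unliftP 0 i) => [i' ->|->]; last first.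
    rewrite eqxx mulr1 !del_upd !updE RintegralB//; first exact: leb_box.
      apply: continuous_box_integrable.
      exact: (ins_continuous (f := fun x => v j x * phi x) (cM _ _ (@vc j) phic)).
    apply: continuous_box_integrable.
    exact: (ins_continuous (f := fun x => v j x * phi x) (cM _ _ (@vc j) phic)).
  rewrite (negbTE (neq_lift _ _)) mulr0.
  (* In the other directions the faces of the strip lie on the boundary of the box, hence outside
     [U]. *)
  have pU s (x : 'rV[R]_m) : s = p 0 (lift 0 i') \/ s = q 0 (lift 0 i') ->
      phi (ins (lift 0 i') s x) = 0.
    move=> sE; have [|->//] := phi0 (ins (lift 0 i') s x).
    by move=> /Upq/(_ (lift 0 i')); rewrite insE; case: sE => ->; rewrite ltxx// andbF.
  apply: (etrans (eq_Rintegral _ (g := cst 0) _)).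
    move=> x _; have ui (c : 'rV[R]_m.+1) t : upd c 0 t 0 (lift 0 i') = c 0 (lift 0 i').
      by rewrite mxE eq_sym (negbTE (neq_lift _ _)).
    by rewrite !ui !pU ?mulr0 ?subrr//; [left|right].
  by rewrite Rintegral_cst ?mul0r//; exact: leb_box.
rewrite (disc_piecewise) E1 E2 E3 E4; apply/eqP; rewrite -subr_eq0 opprK addrA -!big_split/=.
rewrite (eq_bigr (fun j : 'I_K => (B j.+1 j.+1 - B j j) * (0 == i)%:R)); last first.
  by move=> j _; rewrite E5; ring.
rewrite -mulr_suml -(big_mkord xpredT (fun j => B j.+1 j.+1 - B j j)) telescope_sumr//.
have B0 k k' : (k = 0 \/ k = K)%N -> B k k' = 0.
  move=> kE; apply: (etrans (eq_Rintegral _ (g := cst 0) _)).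
    move=> x _; have [|->] := phi0 (ins 0 (level k) x); last by rewrite mulr0.
    move=> /Upq/(_ 0); rewrite insE p0 q0; case: kE => ->; rewrite /level ?ltxx ?andbF//.
    by rewrite mulr0 addr0 ltxx.
  by rewrite Rintegral_cst ?mul0r//; exact: leb_box.
by rewrite !B0 ?subrr ?mul0r//; [left|right].
Qed.

Lemma C1c_isC1 phi : C1c U phi -> isC1 phi (fun i => partial i phi) /\
  (forall x, ~ U x -> phi x = 0 /\ forall i, partial i phi x = 0).
Proof.
move=> [dphi cphi _ phiU]; split; first by split => // i x; apply/derivableP; exact: dphi.
move=> x Ux; have phi0 : \near x, phi x = cst 0 x.
  have : nbhs x (~` closure [set x | phi x != 0]).
    apply: open_nbhs_nbhs; split; last by move=> /phiU.
    by apply: closed_openC; exact: closed_closure.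
  apply: filterS => y yc; apply/eqP/negPn/negP => yphi; apply: yc; exact: subset_closure.
split; first exact: nbhs_singleton phi0.
by move=> i; rewrite /partial (near_eq_derive _ phi0) derive_cst.
Qed.

(** At points without a normal the default value is 0, so the bound holds everywhere. *)
Lemma normal_le1 (u : 'rV[R]_m.+1 -> R) x i : `|normal u x 0 i| <= 1.
Proof.
rewrite /normal; have [h|h] := pselect (exists nu, is_normal u x nu).
  have [nu1 _ _] := @xgetPex _ 0 (is_normal u x) h.
  by rewrite -nu1; exact: coord_le_enorm.
by rewrite xgetPN ?mxE ?normr0// => nu; apply/forallNP: nu.
Qed.

Lemma jump_integrable : (haus R m.+1 m).-integrable (disc w `&` U) (EFin \o jump w).
Proof.
rewrite disc_piecewise; have [||//] := @cracks_integral (jump w) (fun j x => v j.+1 x - v j x) K.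
  by move=> j x; apply: continuousB; exact: vc.
by move=> j x /jump_normal_crack[].
Qed.

Lemma ap_grad_integrable i : L1 U (fun x => ap_grad w x 0 i).
Proof.
have [||//] := @grad_integral (fun x => ap_grad w x 0 i) (fun j => dv j i).
  by move=> j; have [_] := vC1 j.
by move=> x Ux Nx; rewrite ap_grad_piecewise.
Qed.

(** The bound on the variation is read off the integration by parts formula, since components of
    test fields and of normals are at most 1. *)
Lemma piecewise_BV : BV U w.
Proof.
split; first exact: piecewise_U.
pose M := \sum_i (\int[mu]_(x in U) `|ap_grad w x 0 i| +
   \int[haus R m.+1 m]_(x in disc w `&` U) `|jump w x|).
apply: (@le_lt_trans _ _ M%:E); last exact: ltry.
apply: ge_ereal_sup => _ [Phi [PhiC1 Phi1] <-]; rewrite lee_fin.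
have dvc j k : continuous (dv j k) by have [_] := vC1 j.
have cM (f g : 'rV[R]_m.+1 -> R) : continuous f -> continuous g -> continuous (fun x => f x * g x).
  by move=> cf cg x; apply: continuousM; [exact: cf|exact: cg].
have iw i : mu.-integrable U (EFin \o (fun x => w x * partial i (fun y => Phi y 0 i) x)).
  have [[_ cphi] _] := C1c_isC1 (PhiC1 i).
  exact: (piecewise_U (fun j => cM _ _ (@vc j) (cphi i))).
have -> : \int[mu]_(x in U) (w x * divergence Phi x) =
    \sum_i \int[mu]_(x in U) (w x * partial i (fun y => Phi y 0 i) x).
  rewrite /Rintegral.
  have -> : (\int[mu]_(x in U) (w x * divergence Phi x)%:E)%E =
     (\int[mu]_(x in U) (\sum_i (w x * partial i (fun y => Phi y 0 i) x)%:E))%E.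
    by apply: eq_integral => x _; rewrite /divergence mulr_sumr sumEFin.
  rewrite integral_sum//; last exact: mU.
  rewrite -[RHS]/(fine (_%:E)) -sumEFin; congr fine; apply: eq_bigr => i _.
  by rewrite fineK//; apply: integrable_fin_num => //; first [exact: mU|exact: iw].
apply: ler_sum => i _; have [phiC1 phi0] := C1c_isC1 (PhiC1 i).
rewrite (piecewise_parts i phiC1 phi0); set phi := fun x => Phi x 0 i.
have phic : continuous phi := isC1_continuous phiC1.
have phi1 x : `|phi x| <= 1 by apply: le_trans (Phi1 x); exact: coord_le_enorm.
apply: le_trans (ler_norm _) _; rewrite normrN; apply: le_trans (ler_normD _ _) _.
apply: lerD.
  have ig : mu.-integrable U (EFin \o (fun x => phi x * ap_grad w x 0 i)).
    have [|//] := @grad_integral (fun x => phi x * ap_grad w x 0 i) _ (fun j => cM _ _ phic (dvc j i)).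
    by move=> x Ux Nx; rewrite ap_grad_piecewise.
  apply: le_trans (le_normr_Rintegral mU ig) _; apply: le_Rintegral => //.
  - exact: mU.
  - exact: (integrable_norm ig).
  - exact: (integrable_norm (ap_grad_integrable i)).
  - by move=> x _; rewrite normrM ler_piMl.
have [||mD ig _] := @cracks_integral (fun x => phi x * (jump w x * normal w x 0 i))
  (fun j x => phi x * ((v j.+1 x - v j x) * (0 == i)%:R)) K.
- move=> j; apply: (cM) => //; apply: (cM); last exact: cst_continuous.
  by move=> x; apply: continuousB; exact: vc.
- by move=> j x /jump_normal_crack[-> ->]; rewrite mxE eqxx/= eq_sym.
rewrite -disc_piecewise in ig mD.
apply: le_trans (le_normr_Rintegral mD ig) _; apply: le_Rintegral => //.
- exact: (integrable_norm ig).
- exact: (integrable_norm jump_integrable).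
- move=> x _; rewrite 2!normrM mulrCA ler_piMr//.
  by apply: le_trans (ler_pM _ _ (phi1 x) (normal_le1 w x i)) _; rewrite ?mulr1.
Qed.

Theorem piecewise_SBV : SBV U w.
Proof.
split; [exact: piecewise_BV|exact: ap_grad_integrable|exact: jump_integrable|].
by move=> i phi /C1c_isC1[phiC1 phi0]; exact: (piecewise_parts i phiC1 phi0).
Qed.

Lemma piecewise_haus :
  (hausdorff_outer m (disc w `&` U) <= (K%:R * vol (del 0 p) (del 0 q))%:E)%E.
Proof.
rewrite disc_piecewise; elim: (K) => [|k IH].
  by rewrite II0 bigcup_set0 hausdorff_outer0 mul0r.
apply: (@le_trans _ _ (hausdorff_outer m (\bigcup_(j in `I_k) crack j `|` crack k))).
  apply: (@le_hausdorff_outer R m.+1 m) => x [j /= jk xj].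
  move: jk; rewrite ltnS leq_eqVlt => /orP[/eqP jk|jk]; first by right; rewrite -jk.
  by left; exists j.
apply: le_trans (@hausdorff_outerU R m.+1 m _ _) _.
by rewrite -natr1 mulrDl mul1r EFinD leeD// haus_crack.
Qed.

Lemma piecewise_dirichlet : dirichlet w U =
  (\int[mu]_(x in U) (piecewise (fun j x => \sum_i dv j i x ^+ 2) x)%:E)%E.
Proof.
have dvc j k : continuous (dv j k) by have [_] := vC1 j.
have cs j : continuous (fun x => \sum_i dv j i x ^+ 2).
  apply: continuous_big => [|i _ x]; first exact: add_continuous.
  by apply: (@continuousM _ _ (dv j i) (dv j i)); exact: dvc.
have [|_] := @integrable_null _ _ _ mu
  (@measure_is_complete_caratheodory _ _ _) U N
  (EFin \o (fun x => enorm (ap_grad w x) ^+ 2))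
  (EFin \o piecewise (fun j x => \sum_i dv j i x ^+ 2)) mU mN N0 _ (piecewise_U cs).
  move=> x Ux Nx; rewrite /= enorm2 /dot /piecewise; congr EFin.
  by apply: eq_bigr => i _; rewrite -expr2 ap_grad_piecewise.
by [].
Qed.

Lemma ap_grad_L2 i : L2 U (fun x => ap_grad w x 0 i).
Proof.
split; first by apply/measurable_EFinP; exact: measurable_int (ap_grad_integrable i).
have [|//|] := @grad_integral (fun x => ap_grad w x 0 i ^+ 2) (fun j x => dv j i x ^+ 2).
- move=> j x; have [_ dvc] := vC1 j.
  by apply: (@continuousM _ _ (dv j i) (dv j i)); exact: dvc.
- by move=> x Ux Nx; rewrite ap_grad_piecewise.
move=> /integrableP[_ h] _; apply: le_lt_trans h.
rewrite le_eqVlt; apply/orP; left; apply/eqP; apply: eq_integral => x _.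
by rewrite /= ger0_norm// sqr_ge0.
Qed.

(** As [w] is bounded by 1, its truncation at height 0 is the zero function and those at positive
    integers are [w] itself. *)
Theorem piecewise_GSBV2 : (forall x, `|w x| <= 1) -> SBV U (cst 0) -> GSBV2 U w.
Proof.
move=> w1 S0; split; [split; first exact: piecewise_U|exact: ap_grad_L2|].
  by move=> k; rewrite (truncate_le1 w1); case: ifP => _; [exact: S0|exact: piecewise_SBV].
exact: le_lt_trans piecewise_haus (ltry _).
Qed.

End strips.

(** * Smooth steps and staircases *)

Section smooth_step.
Context {R : realType}.
Implicit Types (x y s : R).

Definition pos x : R := Num.max 0 x.

Lemma pos_ge x : 0 <= x -> pos x = x.
Proof. by move=> x0; rewrite /pos max_r. Qed.

Lemma pos_le x : x <= 0 -> pos x = 0.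
Proof. by move=> x0; rewrite /pos max_l. Qed.

Lemma pos_continuous : continuous pos.
Proof.
have -> : pos = (fun x => (x + `|x|) / 2).
  apply/funext => x; have [x0|x0] := leP 0 x.
    by rewrite pos_ge// ger0_norm//; field.
  by rewrite pos_le ?(ltW x0)// ltr0_norm//; field.
move=> x; apply: (@continuousM _ _ (fun x => x + `|x|) (cst 2^-1)); last exact: cst_continuous.
by apply: (@continuousD _ _ _ id (fun x => `|x|)); [exact: cvg_id|exact: norm_continuous].
Qed.

Lemma is_derive_ext (f g : R -> R) x (d : R) : f =1 g ->
  is_derive x (1 : R) f d -> is_derive x (1 : R) g d.
Proof. by move=> /funext ->. Qed.

Lemma is_derive_posX k x :
  is_derive x (1 : R) (fun y => pos y ^+ k.+2) (k.+2%:R * pos x ^+ k.+1).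
Proof.
have [x0|x0|->] := ltgtP x 0.
- have -> : k.+2%:R * pos x ^+ k.+1 = 0 by rewrite pos_le ?ltW// expr0n/= mulr0.
  apply: near_eq_is_derive (is_derive_cst (0 : R) x 1).
  near=> y; rewrite pos_le ?expr0n//; near: y.
  by have := lt_nbhsl x0; apply: filterS => z /ltW.
- have := is_deriveX k.+2 (is_derive_id x (1 : R)).
  rewrite pos_ge ?ltW// [_ *: 1]mulr1 => h; apply: near_eq_is_derive h.
  near=> y; rewrite pos_ge; first by elim: k.+2 => [|l IH]; rewrite ?expr0// exprS [RHS]exprS -IH.
  by near: y; have := lt_nbhsr x0; apply: filterS => z /ltW.
- rewrite pos_ge// expr0n/= mulr0.
  have lim0 : (h^-1 *: ((fun y => pos y ^+ k.+2) (h *: 1 + 0) - pos 0 ^+ k.+2)) @[h --> 0^'] --> 0.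
    apply/cvgrPdist_le => e e0; near=> h.
    rewrite addr0 [h *: 1]mulr1 (pos_ge (lexx 0)) expr0n/= subr0 sub0r normrN.
    have [h0|h0] := leP h 0; first by rewrite pos_le// expr0n/= scaler0 normr0 ltW.
    rewrite (pos_ge (ltW h0)) normrZ normfV gtr0_norm// normrX gtr0_norm// exprS mulrA.
    rewrite mulVf ?gt_eqF// mul1r exprS.
    apply: (@le_trans _ _ (h * 1)); last first.
      by rewrite mulr1 -[leLHS]gtr0_norm//; near: h; exact: dnbhs0_le.
    rewrite ler_pM2l// exprn_ile1// ?ltW//.
    by rewrite -[ltLHS]gtr0_norm//; near: h; exact: dnbhs0_lt.
  by split; [exact: cvgP lim0|exact: cvg_lim lim0].
Unshelve. all: by end_near. Qed.

(** The primitive of the quadratic B-spline with knots 0, 1/3, 2/3 and 1. It rises from 0 to 1 with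
    two continuous derivatives, and its bounds reduce to polynomial inequalities on three intervals.
    Two derivatives are needed because [dstep] itself enters fields that must be of class C1. *)
Definition step x := (pos (3 * x) ^+ 3 - 3 * pos (3 * x - 1) ^+ 3 +
  3 * pos (3 * x - 2) ^+ 3 - pos (3 * x - 3) ^+ 3) / 6.

Definition dstep x := 3 / 2 * (pos (3 * x) ^+ 2 - 3 * pos (3 * x - 1) ^+ 2 +
  3 * pos (3 * x - 2) ^+ 2 - pos (3 * x - 3) ^+ 2).

Definition ddstep x := 9 * (pos (3 * x) - 3 * pos (3 * x - 1) +
  3 * pos (3 * x - 2) - pos (3 * x - 3)).

Lemma is_derive_affine (f : R -> R) (a b x d : R) :
  is_derive (a * x + b) (1 : R) f d -> is_derive x (1 : R) (fun y => f (a * y + b)) (a * d).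
Proof.
move=> fd; rewrite mulrC; apply: (@is_derive1_comp R f (fun y => a * y + b) x d a fd).
have := is_deriveD (is_deriveZ a (is_derive_id x (1 : R))) (is_derive_cst b x (1 : R)).
by rewrite addr0 [_ *: 1]mulr1.
Qed.

Lemma is_derive_posX_affine k (c x : R) :
  is_derive x (1 : R) (fun y => pos (3 * y - c) ^+ k.+2)
    (3 * (k.+2%:R * pos (3 * x - c) ^+ k.+1)).
Proof. exact: (is_derive_affine (is_derive_posX k (3 * x - c))). Qed.

Lemma is_derive_step x : is_derive x (1 : R) step (dstep x).
Proof.
have h c := is_derive_posX_affine 1 c x.
have := is_deriveZ (6^-1) (is_deriveB (is_deriveD (is_deriveB (h 0)
  (is_deriveZ 3 (h 1))) (is_deriveZ 3 (h 2))) (h 3)).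
set d := (X in is_derive _ _ _ X); have -> : d = dstep x.
  change (6^-1 * (3 * (3 * pos (3 * x - 0) ^+ 2) - 3 * (3 * (3 * pos (3 * x - 1) ^+ 2)) +
    3 * (3 * (3 * pos (3 * x - 2) ^+ 2)) - 3 * (3 * pos (3 * x - 3) ^+ 2)) = dstep x).
  by rewrite /dstep subr0; field.
apply: is_derive_ext => y.
change (6^-1 * (pos (3 * y - 0) ^+ 3 - 3 * pos (3 * y - 1) ^+ 3 +
  3 * pos (3 * y - 2) ^+ 3 - pos (3 * y - 3) ^+ 3) = step y).
by rewrite /step subr0 mulrC.
Qed.

Lemma is_derive_dstep x : is_derive x (1 : R) dstep (ddstep x).
Proof.
have h c := is_derive_posX_affine 0 c x.
have := is_deriveZ (3 / 2) (is_deriveB (is_deriveD (is_deriveB (h 0)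
  (is_deriveZ 3 (h 1))) (is_deriveZ 3 (h 2))) (h 3)).
set d := (X in is_derive _ _ _ X); have -> : d = ddstep x.
  change (3 / 2 * (3 * (2 * pos (3 * x - 0)) - 3 * (3 * (2 * pos (3 * x - 1))) +
    3 * (3 * (2 * pos (3 * x - 2))) - 3 * (2 * pos (3 * x - 3))) = ddstep x).
  by rewrite /ddstep subr0; field.
apply: is_derive_ext => y.
change (3 / 2 * (pos (3 * y - 0) ^+ 2 - 3 * pos (3 * y - 1) ^+ 2 +
  3 * pos (3 * y - 2) ^+ 2 - pos (3 * y - 3) ^+ 2) = dstep y).
by rewrite /dstep subr0.
Qed.

Lemma ddstep_continuous : continuous ddstep.
Proof.
have h c : continuous (fun x => pos (3 * x - c)).
  move=> x; apply: (continuous_comp (f := fun x => 3 * x - c)); last exact: pos_continuous.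
  apply: (@continuousB _ _ _ (fun x => 3 * x)); last exact: cst_continuous.
  by apply: continuousM; [exact: cst_continuous|exact: cvg_id].
have h3 c : continuous (fun x => 3 * pos (3 * x - c)).
  by move=> x; apply: (@continuousM _ _ (cst 3) (fun x => pos (3 * x - c))); [exact: cst_continuous|exact: h].
move=> x; apply: (@continuousM _ _ (cst 9) (fun x => pos (3 * x) - 3 * pos (3 * x - 1) +
  3 * pos (3 * x - 2) - pos (3 * x - 3))); first exact: cst_continuous.
apply: (@continuousB _ _ _ _ (fun x => pos (3 * x - 3))); last exact: h.
apply: (@continuousD _ _ _ _ (fun x => 3 * pos (3 * x - 2))); last exact: h3.
apply: (@continuousB _ _ _ (fun x => pos (3 * x)) (fun x => 3 * pos (3 * x - 1))); last exact: h3.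
by have := h 0 x; under eq_fun do rewrite subr0.
Qed.

Lemma step0 x : x <= 0 -> [/\ step x = 0, dstep x = 0 & ddstep x = 0].
Proof.
move=> x0; rewrite /step /dstep /ddstep !pos_le; try lra.
by split; ring.
Qed.

Lemma step1 x : 1 <= x -> [/\ step x = 1, dstep x = 0 & ddstep x = 0].
Proof.
move=> x0; rewrite /step /dstep /ddstep !pos_ge; try lra.
by split; field.
Qed.

Lemma step_bounds x :
  [/\ 0 <= step x <= 1, 0 <= dstep x <= 3 & `|ddstep x| <= 9].
Proof.
have [x0|x0] := leP x 0; first by have [-> -> ->] := step0 x0; rewrite normr0; split; lra.
have [x1|x1] := leP 1 x; first by have [-> -> ->] := step1 x1; rewrite normr0; split; lra.
rewrite /step /dstep /ddstep ler_norml (@pos_le (3 * x - 3)); last lra.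
rewrite (@pos_ge (3 * x)); last lra.
set y := 3 * x; have y0 : 0 < y by rewrite /y; lra.
have y3 : y < 3 by rewrite /y; lra.
have [h|h] := leP y 1.
  rewrite (@pos_le (y - 1)) ?(@pos_le (y - 2)); try lra.
  by split; apply/andP; split; nra.
have [h'|h'] := leP y 2.
  rewrite (@pos_ge (y - 1)) ?(@pos_le (y - 2)); try lra.
  set v := y - 1; have vE : y = v + 1 by rewrite /v; ring.
  have v0 : 0 < v by rewrite /v; lra.
  have v1 : v <= 1 by rewrite /v; lra.
  rewrite vE.
  have v2 : 0 <= v ^+ 2 by rewrite sqr_ge0.
  have v3 : 0 <= v ^+ 2 * (1 - v) by rewrite mulr_ge0 ?subr_ge0.
  have v4 : 0 <= (1 - v) ^+ 2 * (1 + 2 * v) by rewrite mulr_ge0 ?sqr_ge0//; lra.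
  by split; apply/andP; split; nra.
rewrite (@pos_ge (y - 1)) ?(@pos_ge (y - 2)); try lra.
set v := 3 - y; have vE : y = 3 - v by rewrite /v; ring.
have v0 : 0 < v by rewrite /v; lra.
have v1 : v <= 1 by rewrite /v; lra.
have v2 : 0 <= v ^+ 2 by rewrite sqr_ge0.
have v3 : 0 <= v ^+ 2 * (1 - v) by rewrite mulr_ge0 ?subr_ge0.
have v5 : 0 <= v * (1 - v) by rewrite mulr_ge0 ?subr_ge0// ltW.
have v4 : 0 <= v ^+ 3 by rewrite exprn_ge0 ?ltW.
by rewrite vE; split; apply/andP; split; nra.
Qed.

End smooth_step.

Section staircase.
Context {R : realType}.
Implicit Types (x s c : R) (phi dphi : R -> R).

Definition frac s : R := s - (Num.floor s)%:~R.

Lemma frac_itv s : 0 <= frac s < 1.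
Proof.
have := floor_le_tmp s; have := floorD1_gt s; rewrite /frac intrD => h1 h2.
by apply/andP; split; lra.
Qed.

Definition staircase c phi s := c * (Num.floor s)%:~R + phi (frac s).

(* Since [phi] is constant near 0 and near 1, all the pieces fit smoothly. *)
Lemma staircase_near c phi s : (forall x, x <= 1 / 4 -> phi x = 0) ->
  (forall x, 3 / 4 <= x -> phi x = c) ->
  \forall x \near s, staircase c phi x =
    c * (Num.floor s)%:~R + phi (x - (Num.floor s)%:~R).
Proof.
move=> phi0 phic; set j := Num.floor s.
have sj := frac_itv s; rewrite /frac -/j in sj; have /andP[sj0 sj1] := sj.
have floorE x (k : int) : k%:~R <= x < k%:~R + 1 -> Num.floor x = k.
  by move=> h; apply/floor_def; rewrite intrD.
near=> x; rewrite /staircase /frac.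
have xs : `|s - x| < 1 / 4 by near: x; apply: cvgr_dist_lt; [exact: cvg_id|].
move: xs; rewrite ltr_norml => /andP[xs1 xs2].
have [xj|xj] := ltP x (j%:~R).
  rewrite (floorE x (j - 1)); last by rewrite intrB; apply/andP; split; lra.
  rewrite intrB (phi0 (x - j%:~R)); last lra.
  by rewrite phic ?addr0; [ring|lra].
have [xj1|xj1] := ltP x (j%:~R + 1).
  by rewrite (floorE x j)// xj xj1.
rewrite (floorE x (j + 1)); last by rewrite intrD; apply/andP; split; lra.
rewrite intrD (phic (x - j%:~R)); last lra.
by rewrite phi0; [ring|lra].
Unshelve. all: by end_near. Qed.

Lemma staircase_derive c phi dphi s : (forall x, x <= 1 / 4 -> phi x = 0) ->
  (forall x, 3 / 4 <= x -> phi x = c) -> (forall x, is_derive x (1 : R) phi (dphi x)) ->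
  is_derive s (1 : R) (staircase c phi) (staircase 0 dphi s).
Proof.
move=> phi0 phic dphiP; have near_phi := staircase_near s phi0 phic.
apply: (near_eq_is_derive (f := fun x => c * (Num.floor s)%:~R + phi (x - (Num.floor s)%:~R))).
  by apply: filterS near_phi => x ->.
have h := is_derive_affine (a := 1) (b := - (Num.floor s)%:~R) (x := s) (dphiP _).
have := is_deriveD (is_derive_cst (c * (Num.floor s)%:~R) s (1 : R)) h.
rewrite add0r mul1r /staircase mul0r add0r /frac mul1r; congr is_derive.
by apply/funext => x; rewrite -[in RHS](mul1r x).
Qed.

Lemma staircase_continuous phi : (forall x, x <= 1 / 4 -> phi x = 0) ->
  (forall x, 3 / 4 <= x -> phi x = 0) -> continuous phi -> continuous (staircase 0 phi).
Proof.
move=> phi0 phi1 cphi s.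
have near_phi := staircase_near s phi0 phi1.
have h : {for s, continuous (fun x => phi (x - (Num.floor s)%:~R))}.
  apply: (continuous_comp (f := fun x => x - (Num.floor s)%:~R)); last exact: cphi.
  by apply: continuousB; [exact: cvg_id|exact: cst_continuous].
rewrite /prop_for /continuous_at (_ : staircase 0 phi s = phi (s - (Num.floor s)%:~R)).
  by apply: cvg_trans h; apply: near_eq_cvg; apply: filterS near_phi => x; rewrite mul0r add0r => ->.
by rewrite /staircase mul0r add0r.
Qed.

Definition bump_step s : R := step (2 * s - 1 / 2).
Definition dbump_step s : R := 2 * dstep (2 * s - 1 / 2).
Definition ddbump_step s : R := 4 * ddstep (2 * s - 1 / 2).

Definition stair := staircase 1 bump_step.
Definition dstair := staircase 0 dbump_step.
Definition ddstair := staircase 0 ddbump_step.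

Lemma is_derive_stair s : is_derive s (1 : R) stair (dstair s).
Proof.
apply: staircase_derive => x.
- by move=> h; rewrite /bump_step; have [|-> _ _] := @step0 R (2 * x - 1 / 2); lra.
- by move=> h; rewrite /bump_step; have [|-> _ _] := @step1 R (2 * x - 1 / 2); lra.
- exact: (is_derive_affine (is_derive_step (2 * x - 1 / 2))).
Qed.

Lemma is_derive_dstair s : is_derive s (1 : R) dstair (ddstair s).
Proof.
apply: staircase_derive => x.
- by move=> h; rewrite /dbump_step; have [|_ -> _] := @step0 R (2 * x - 1 / 2); lra.
- by move=> h; rewrite /dbump_step; have [|_ -> _] := @step1 R (2 * x - 1 / 2); lra.
- have := is_deriveZ 2 (is_derive_affine (is_derive_dstep (2 * x - 1 / 2))).
  rewrite [_ *: _](_ : _ = ddbump_step x)//.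
  by rewrite /ddbump_step -[LHS]/(2 * (2 * _)); ring.
Qed.

Lemma ddstair_continuous : continuous ddstair.
Proof.
apply: staircase_continuous => x.
- by move=> h; rewrite /ddbump_step; have [|_ _ ->] := @step0 R (2 * x - 1 / 2); lra.
- by move=> h; rewrite /ddbump_step; have [|_ _ ->] := @step1 R (2 * x - 1 / 2); lra.
- apply: (@continuousM _ _ (cst 4) (fun x => ddstep (2 * x - 1 / 2))).
    exact: cst_continuous.
  apply: (continuous_comp (f := fun x => 2 * x - 1 / 2)); last exact: ddstep_continuous.
  apply: (@continuousB _ _ _ (fun x => 2 * x)); last exact: cst_continuous.
  by apply: continuousM; [exact: cst_continuous|exact: cvg_id].
Qed.

Lemma stair_bounds s : [/\ `|stair s - s| <= 1, 0 <= dstair s <= 6 & `|ddstair s| <= 36].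
Proof.
rewrite /stair /dstair /ddstair /staircase !mul0r !add0r mul1r /bump_step /dbump_step /ddbump_step.
have [/andP[a1 a2] /andP[b1 b2] c1] := step_bounds (2 * frac s - 1 / 2).
have /andP[h1 h2] := frac_itv s.
split; [|by apply/andP; split; lra|by rewrite normrM gtr0_norm//; lra].
rewrite (_ : _ - s = step (2 * frac s - 1 / 2) - frac s); last by rewrite /frac; ring.
by rewrite ler_norml; apply/andP; split; lra.
Qed.

Lemma stair_flat (j : int) s : `|s - j%:~R| <= 1 / 4 ->
  [/\ stair s = j%:~R, dstair s = 0 & ddstair s = 0].
Proof.
rewrite ler_norml => /andP[h1 h2].
have floorE (k : int) : k%:~R <= s < k%:~R + 1 -> Num.floor s = k.
  by move=> h; apply/floor_def; rewrite intrD.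
rewrite /stair /dstair /ddstair /staircase /frac /bump_step /dbump_step /ddbump_step.
have [sj|sj] := leP j%:~R s.
  rewrite (floorE j); last by rewrite sj; lra.
  by have [|-> -> ->] := @step0 R (2 * (s - j%:~R) - 1 / 2); [lra|split; ring].
rewrite (floorE (j - 1)); last by rewrite intrB; apply/andP; split; lra.
by rewrite intrB; have [|-> -> ->] := @step1 R (2 * (s - (j%:~R - 1)) - 1 / 2); [lra|split; ring].
Qed.

Lemma dstair_gt0 s : 0 < dstair s -> exists j : int, `|s - j%:~R - 1 / 2| < 1 / 4.
Proof.
have /andP[h1 h2] := frac_itv s; move=> s0; exists (Num.floor s); rewrite -/(frac s).
have sE : s - (Num.floor s)%:~R = frac s by [].
rewrite ltNge ler_normr; apply/negP => h; have : dstair s = 0; last lra.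
case/orP: h => h.
  have [] := @stair_flat (Num.floor s + 1) s; last by [].
  by rewrite intrD ler_norml; apply/andP; split; rewrite /frac in h1 h2 h *; lra.
have [] := @stair_flat (Num.floor s) s; last by [].
by rewrite ler_norml sE; apply/andP; split; lra.
Qed.

Lemma stair_continuous : continuous stair.
Proof.
by move=> s; apply/differentiable_continuous/derivable1_diffP; have [] := is_derive_stair s.
Qed.

Lemma dstair_continuous : continuous dstair.
Proof.
by move=> s; apply/differentiable_continuous/derivable1_diffP; have [] := is_derive_dstair s.
Qed.

End staircase.

Section C1_products.
Context {R : realType} {n : nat}.
Implicit Types (x : 'rV[R]_n).

Lemma isC1_prod (T : eqType) (s : seq T) (f : T -> 'rV[R]_n -> R)
    (df : T -> 'I_n -> 'rV[R]_n -> R) (M : R) : (forall l, isC1 (f l) (df l)) ->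
  (forall l x, 0 <= f l x <= 1) -> (forall l i x, `|df l i x| <= M) ->
  exists d, [/\ isC1 (fun x => \prod_(l <- s) f l x) d,
    forall x, 0 <= \prod_(l <- s) f l x <= 1,
    forall i x, `|d i x| <= (size s)%:R * M &
    forall i, (forall l, l \in s -> forall x, df l i x = 0) -> forall x, d i x = 0].
Proof.
move=> fC1 f01 dfM; elim: s => [|a s [d [dC1 p01 dM d0]]].
  exists (fun _ => cst 0); split => //.
  - have -> : (fun x => \prod_(l <- [::]) f l x) = cst 1.
      by apply/funext => x; rewrite big_nil.
    exact: isC1_cst.
  - by move=> x; rewrite big_nil ler01 lexx.
  - by move=> i x; rewrite normr0 mul0r.
exists (fun i x => f a x * d i x + (\prod_(l <- s) f l x) * df a i x); split.
- have -> : (fun x => \prod_(l <- a :: s) f l x) = (fun x => f a x * \prod_(l <- s) f l x).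
    by apply/funext => x; rewrite big_cons.
  by apply: isC1M => //; [exact: isC1_continuous (fC1 a)|exact: isC1_continuous dC1].
- move=> x; rewrite big_cons; have /andP[a0 a1] := f01 a x; have /andP[b0 b1] := p01 x.
  by rewrite mulr_ge0//= mulr_ile1.
- move=> i x; have /andP[a0 a1] := f01 a x; have /andP[b0 b1] := p01 x.
  apply: le_trans (ler_normD _ _) _; rewrite !normrM (ger0_norm a0) (ger0_norm b0).
  rewrite /= -natr1 mulrDl mul1r; apply: lerD.
    by apply: le_trans (dM i x); rewrite ler_piMl.
  by apply: le_trans (dfM a i x); rewrite ler_piMl.
- move=> i h x; rewrite d0 ?h ?mulr0 ?addr0// ?mem_head// => l ls y.
  by rewrite h// in_cons ls orbT.
Qed.

End C1_products.

Section cell_function.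
Context {R : realType} {m : nat}.
Implicit Types (x : 'rV[R]_m.+1) (e : R).

(** The shift by 1/2 moves the support of the derivative to within [e / 4] of the multiples of [e],
    where the inclusions are. Division by 6, the bound for [dstair], normalizes the values to [0, 1]
    and makes the mean 1/6. *)
Definition cell_bump e (l : 'I_m) x : R := dstair (x 0 (lift 0 l) / e + 1 / 2) / 6.

Definition cell_prod e x : R := \prod_(l <- enum 'I_m) cell_bump e l x.

Lemma isC1_scaled_coord (g dg : R -> R) (a b : R) (j : 'I_m.+1) :
  (forall t : R, is_derive t (1 : R) g (dg t)) -> continuous dg ->
  isC1 (fun x => g (a * x 0 j + b)) (fun i x => a * dg (a * x 0 j + b) * (i == j)%:R).
Proof.
move=> gP cdg.
have := @isC1_comp _ _ _ _ (fun t => g (a * t + b)) (fun t => a * dg (a * t + b))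
  (isC1_continuous (isC1_coord j)) (isC1_coord j); apply.
  by move=> t; exact: is_derive_affine.
move=> t; apply: (@continuousM _ _ (cst a) (fun t => dg (a * t + b))).
  exact: cst_continuous.
apply: (continuous_comp (f := fun t => a * t + b)); last exact: cdg.
apply: (@continuousD _ _ _ (fun t => a * t)); last exact: cst_continuous.
by apply: (@continuousM _ _ (cst a) id); [exact: cst_continuous|exact: cvg_id].
Qed.

Lemma isC1_cell_bump e l : isC1 (cell_bump e l)
  (fun i x => e^-1 * (ddstair (e^-1 * x 0 (lift 0 l) + 1 / 2) / 6) * (i == lift 0 l)%:R).
Proof.
have -> : cell_bump e l = (fun x => dstair (e^-1 * x 0 (lift 0 l) + 1 / 2) / 6).
  by apply/funext => x; rewrite /cell_bump [e^-1 * _]mulrC.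
apply: (@isC1_scaled_coord (fun t => dstair t / 6) (fun t => ddstair t / 6)) => t.
  have := is_deriveZ (6^-1) (is_derive_dstair t).
  rewrite [_ *: _]mulrC; apply: is_derive_ext => s.
  by rewrite [RHS]mulrC.
apply: (@continuousM _ _ ddstair (cst 6^-1)); first exact: ddstair_continuous.
exact: cst_continuous.
Qed.

Lemma cell_bump_bounds e l x : 0 <= cell_bump e l x <= 1.
Proof.
by have [_ /andP[h1 h2] _] := stair_bounds (x 0 (lift 0 l) / e + 1 / 2); rewrite /cell_bump; lra.
Qed.

Lemma isC1_cell_prod e : 0 < e -> exists d, [/\ isC1 (cell_prod e) d,
  forall x, 0 <= cell_prod e x <= 1,
  forall i x, `|d i x| <= m%:R * 6 / e & forall x, d 0 x = 0].
Proof.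
move=> e0; have [||d [d1 d2 d3 d4]] := @isC1_prod R m.+1 _ (enum 'I_m) (cell_bump e) _ (6 / e)
    (isC1_cell_bump e).
- exact: cell_bump_bounds.
- move=> l i x; rewrite !normrM normfV (gtr0_norm e0).
  have [_ _ h] := stair_bounds (e^-1 * x 0 (lift 0 l) + 1 / 2).
  rewrite mulrC (@ger0_norm _ 6^-1)// (@ger0_norm _ (_ == _)%:R)//.
  have : 0 < e^-1 by rewrite invr_gt0.
  set a := `|_| in h *; have : 0 <= a by exact: normr_ge0.
  by case: (_ == _); rewrite ?mulr1n ?mulr0n => *; nra.
exists d; split => //.
- by move=> i x; have := d3 i x; rewrite size_enum_ord mulrA.
- by apply: d4 => l _ x; rewrite (negbTE (neq_lift _ _)) mulr0.
Qed.

Lemma cell_prod_gt0 e x : 0 < e -> 0 < cell_prod e x -> forall l : 'I_m,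
  exists j : int, `|x 0 (lift 0 l) / e - j%:~R| < 1 / 4.
Proof.
move=> e0 x0 l; have : 0 < cell_bump e l x.
  have /andP[h _] := cell_bump_bounds e l x; rewrite lt_neqAle h andbT eq_sym.
  apply: contraTneq x0 => h0; rewrite /cell_prod (big_rem l) ?mem_enum//= h0 mul0r ltxx//.
rewrite /cell_bump pmulr_lgt0 ?invr_gt0// => /dstair_gt0[j].
rewrite (_ : _ - 1 / 2 = x 0 (lift 0 l) / e - j%:~R); last by ring.
by exists j.
Qed.

(* Each factor has mean 1/6, being the derivative of the staircase, which stays at
   bounded distance from the identity. *)
Lemma cell_prod_mean (a b : 'rV[R]_m.+1) : (forall j, a 0 j <= b 0 j) ->
  exists2 C : R, 0 <= C & forall e, 0 < e ->
    6^-1 ^+ m * vol a b - e * C <= \int[leb R m.+1]_(x in box a b) cell_prod e x.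
Proof.
move=> ab; pose P e (s : seq 'I_m) x := \prod_(l <- s) cell_bump e l x.
suff H (s : seq 'I_m) : uniq s -> exists2 C : R, 0 <= C & forall e, 0 < e ->
    6^-1 ^+ (size s) * vol a b - e * C <= \int[leb R m.+1]_(x in box a b) P e s x.
  by have := H _ (enum_uniq 'I_m); rewrite size_enum_ord.
elim: s => [_|l s IH /= /andP[ls us]].
  exists 0 => // e e0; rewrite expr0 mul1r mulr0 subr0.
  rewrite (@eq_Rintegral _ _ _ (leb R m.+1) _ (cst 1)); last by move=> x _; rewrite /P big_nil.
  rewrite Rintegral_cst ?mul1r; last exact: leb_box.
  by rewrite le_eqVlt; apply/orP; left; apply/eqP; rewrite [X in fine X]lebesgue_outer_box.
have [C C0 HC] := IH us.
pose i := lift 0 l; pose W := vol (del i a) (del i b).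
have W0 : 0 <= W by apply: vol_ge0 => j; rewrite !mxE.
(* The induction error [C] is multiplied by the mean 1/6 of the new factor. The antiderivative [G]
   is at most 1/3 in absolute value, so its two boundary terms cost at most 2/3 of the area [W]. *)
exists (C / 6 + W * (2 / 3)); first by rewrite addr_ge0 ?mulr_ge0 ?divr_ge0.
move=> e e0; have [||d [dC1 p01 _ d0]] := @isC1_prod R m.+1 _ s (cell_bump e) _ (6 / e)
    (isC1_cell_bump e).
- exact: cell_bump_bounds.
- move=> k j x; rewrite !normrM normfV (gtr0_norm e0).
  have [_ _ h] := stair_bounds (e^-1 * x 0 (lift 0 k) + 1 / 2).
  rewrite mulrC (@ger0_norm _ 6^-1)// (@ger0_norm _ (_ == _)%:R)//.
  have : 0 < e^-1 by rewrite invr_gt0.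
  set c := `|_| in h *; have : 0 <= c by exact: normr_ge0.
  by case: (_ == _); rewrite ?mulr1n ?mulr0n => *; nra.
have di x : d i x = 0.
  apply: d0 => k ks y; rewrite (inj_eq lift_inj) (_ : (l == k) = false) ?mulr0//.
  by apply/eqP => lk; rewrite lk ks in ls.
(* [G] is an antiderivative of the first factor minus its mean. *)
pose g (t : R) := (stair (t + 1 / 2) - t) / 6; pose dg t := (dstair (t + 1 / 2) - 1) / 6 : R.
have gP t : is_derive t (1 : R) g (dg t).
  have h := is_derive_affine (a := 1) (b := 1 / 2) (x := t) (is_derive_stair _).
  have := is_deriveZ (6^-1) (is_deriveB h (is_derive_id t (1 : R))).
  have -> : dg t = 6^-1 *: (1 * dstair (1 * t + 1 / 2) - 1).
    by rewrite /dg !mul1r [RHS]mulrC.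
  apply: is_derive_ext => s'.
  change (6^-1 * (stair (1 * s' + 1 / 2) - s') = g s').
  by rewrite mul1r mulrC.
have cdg : continuous dg.
  move=> t; apply: (@continuousM _ _ (fun t : R => dstair (t + 1 / 2) - 1) (cst 6^-1)); last exact: cst_continuous.
  apply: (@continuousB _ _ _ (fun t : R => dstair (t + 1 / 2)) (cst 1)); last exact: cst_continuous.
  apply: (continuous_comp (f := fun t : R => t + 1 / 2)); last exact: dstair_continuous.
  by apply: (@continuousD _ _ _ (fun t : R => t) (cst (1 / 2 : R)) t); [exact: cvg_id|exact: cst_continuous].
pose G x := g (e^-1 * x 0 i + 0).
have GC1 := isC1_scaled_coord e^-1 0 i gP cdg; rewrite -/(G) in GC1.
have cG := isC1_continuous GC1; have cP := isC1_continuous dC1.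
have := box_divergence i (isC1M cG cP GC1 dC1) ab => /=.
set I1 := (X in X = _) => E1.
have cb := isC1_continuous (isC1_cell_bump e l).
have cPs : continuous (P e (l :: s)).
  have -> : P e (l :: s) = (fun x => cell_bump e l x * P e s x).
    by apply/funext => x; rewrite /P big_cons.
  by move=> x; apply: continuousM; [exact: cb|exact: cP].
have mb := @leb_box R m.+1 a b.
have iP : (leb R m.+1).-integrable (box a b) (EFin \o P e s) by exact: continuous_box_integrable.
have E2 : e * I1 = \int[leb R m.+1]_(x in box a b) P e (l :: s) x -
    6^-1 * \int[leb R m.+1]_(x in box a b) P e s x.
  rewrite -[X in _ - X](RintegralZl 6^-1 mb iP).
  rewrite -[RHS]RintegralB//.
  - rewrite /I1 -RintegralZl//.
    + apply: eq_Rintegral => x _; rewrite di mulr0 add0r eqxx mulr1 /P big_cons.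
      rewrite -/(P e s x) addr0 /dg /cell_bump -/i [e^-1 * x 0 i]mulrC.
      by field; exact: lt0r_neq0.
    + apply: continuous_box_integrable => x.
      have [_ h] := isC1M cG cP GC1 dC1; exact: (h i).
  - exact: continuous_box_integrable.
  - by apply: (@continuous_box_integrable _ _ (fun x => 6^-1 * P e s x)) => x;
      apply: (@continuousM _ _ (cst 6^-1) (P e s)); [exact: cst_continuous|exact: cP].
have Gb x : `|G x| <= 1 / 3.
  rewrite /G addr0 /g; set t := e^-1 * _; have [h _ _] := stair_bounds (t + 1 / 2).
  by move: h; rewrite !ler_norml => /andP[h1 h2]; apply/andP; split; lra.
have E3 : - (2 / 3 * W) <= I1.
  rewrite E1 (_ : - (2 / 3 * W) = \int[leb R m]_(x in box (del i a) (del i b)) (- (2 / 3))).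
    have mbd := @leb_box R m (del i a) (del i b).
    have cG' t : continuous (fun x : 'rV[R]_m => G (ins i t x) * P e s (ins i t x)).
      exact: (ins_continuous (f := fun x => G x * P e s x) (i := i) (t := t)
        (fun x => continuousM (cG x) (cP x))).
    apply: le_Rintegral => //.
    - by apply: continuous_box_integrable => x; exact: cst_continuous.
    - have cB : continuous (fun x : 'rV[R]_m => G (ins i (b 0 i) x) * P e s (ins i (b 0 i) x) -
          G (ins i (a 0 i) x) * P e s (ins i (a 0 i) x)).
        by move=> x; exact: (continuousB (cG' (b 0 i) x) (cG' (a 0 i) x)).
      exact: (continuous_box_integrable _ _ cB).
    - move=> x _; have [Pb Pa] := (p01 (ins i (b 0 i) x), p01 (ins i (a 0 i) x)).
      have := Gb (ins i (b 0 i) x); have := Gb (ins i (a 0 i) x); rewrite !ler_norml.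
      move: Pa Pb; rewrite -!/(P _ _ _) => /andP[? ?] /andP[? ?] /andP[? ?] /andP[? ?].
      by nra.
  rewrite Rintegral_cst; last exact: leb_box.
  by rewrite [X in fine X]lebesgue_outer_box ?mulNr// => j; rewrite !mxE.
have := HC e e0; rewrite -(ler_pM2l (_ : 0 < 6^-1)) ?invr_gt0// => H.
have : e * - (2 / 3 * W) <= e * I1 by rewrite ler_pM2l.
rewrite E2 exprS /=; lra.
Qed.

End cell_function.

(** * The competitor for large gradients *)

Section competitor.
Context {R : realType} {m : nat} (m_gt0 : (0 < m)%N).
Implicit Types (x : 'rV[R]_m.+1) (t a c e : R) (U : set 'rV[R]_m.+1).
Local Notation mu := (leb R m.+1).

Definition wave t a x : R := sin (2 * t * (x 0 0 - a)) / 2.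

Definition dwave t a (i : 'I_m.+1) x : R := t * cos (2 * t * (x 0 0 - a)) * (i == 0)%:R.

Lemma isC1_wave t a : isC1 (wave t a) (dwave t a).
Proof.
have gP s : is_derive s (1 : R) (fun s => sin s / 2) (cos s / 2).
  have := is_deriveZ (2^-1) (is_derive_sin s).
  rewrite [_ *: _]mulrC; apply: is_derive_ext => r.
  by rewrite [RHS]mulrC.
have cdg : continuous (fun s : R => cos s / 2).
  move=> s; apply: (@continuousM _ _ (@cos R) (cst 2^-1)); last exact: cst_continuous.
  exact: continuous_cos.
have := isC1_scaled_coord (2 * t) (- (2 * t * a)) 0 gP cdg.
rewrite (_ : wave t a = (fun x => sin (2 * t * x 0 0 + - (2 * t * a)) / 2)); last first.
  by apply/funext => x; rewrite /wave mulrBr.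
rewrite (_ : dwave t a = (fun i x => 2 * t * (cos (2 * t * x 0 0 + - (2 * t * a)) / 2) * (i == 0)%:R))//.
by apply/funext => i; apply/funext => x; rewrite /dwave mulrBr; field.
Qed.

Lemma wave_le t a x : `|wave t a x| <= 1 / 2.
Proof.
by rewrite /wave normrM (@ger0_norm _ 2^-1)// ler_pM2r// sin_max.
Qed.

Definition competitor t a c e x : R :=
  wave t a x + c * cell_prod e x * (1 / 2 - frac (x 0 0 / e)).

(** The branch of the sawtooth that is affine in the strip [j]. The integer [J] shifts the numbering
    so that strip 0 is the first one needed. *)
Definition competitor_piece t a c e (J j : int) x : R :=
  wave t a x + c * cell_prod e x * (1 / 2 - (e^-1 * x 0 0 + - (J + j)%:~R)).

Lemma strip_index_frac (J : int) e x : 0 < e ->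
  e^-1 * x 0 0 + - (J + strip_index (e * J%:~R) e x)%:~R = frac (x 0 0 / e).
Proof.
move=> e0; rewrite /frac /strip_index.
rewrite (_ : (x 0 0 - e * J%:~R) / e = x 0 0 / e + (- J)%:~R); last first.
  by rewrite mulrNz; field; exact: lt0r_neq0.
rewrite floorDrz; last exact: intr_int.
by rewrite intrKfloor addrCA subrr addr0 (mulrC e^-1).
Qed.

Lemma competitor_piecewise t a c e J : 0 < e ->
  piecewise (e * J%:~R) e (competitor_piece t a c e J) = competitor t a c e.
Proof.
move=> e0; apply/funext => x.
by rewrite /piecewise /competitor_piece /competitor strip_index_frac.
Qed.

Lemma isC1_competitor_piece t a c e J : 0 < e -> exists d,
  [/\ forall x, 0 <= cell_prod e x <= 1,
  forall i x, `|d i x| <= m%:R * 6 / e, forall x, d 0 x = 0 &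
  forall j, isC1 (competitor_piece t a c e J j) (fun i x => dwave t a i x +
   (c * cell_prod e x * - (e^-1 * 1 * (i == 0)%:R) +
    (1 / 2 - (e^-1 * x 0 0 + - (J + j)%:~R)) * (c * d i x)))].
Proof.
move=> e0; have [d [dC1 p01 dM d0]] := @isC1_cell_prod R m e e0; exists d; split => // j.
have cC1 : isC1 (fun x : 'rV[R]_m.+1 => c * cell_prod e x) (fun i x => c * d i x).
  have := isC1M (@cst_continuous _ _ c) (isC1_continuous dC1) (isC1_cst c) dC1.
  congr isC1; apply/funext => i; apply/funext => x; by rewrite mulr0 addr0.
have gP s : is_derive s (1 : R) (fun s : R => 1 / 2 - s) (- 1).
  by have := is_deriveB (is_derive_cst (1 / 2 : R) s (1 : R)) (is_derive_id s (1 : R)); rewrite sub0r.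
have sC1 := @isC1_scaled_coord R m _ _ e^-1 (- (J + j)%:~R) 0 gP (@cst_continuous _ R (- 1 : R)).
have := isC1D (isC1_wave t a) (isC1M (isC1_continuous cC1) (isC1_continuous sC1) cC1 sC1).
congr isC1; apply/funext => i; apply/funext => x; congr (_ + _).
by congr (_ * _ + _); ring.
Qed.

Lemma cos_near1 (d : R) : 0 < d ->
  exists2 r : R, 0 < r & forall s, `|s| < r -> 1 - d < cos s.
Proof.
move=> d0; have /cvgrPdist_lt/(_ d d0) := @continuous_cos R 0.
rewrite cos0 => /nbhs_ballP[r /= r0 rP]; exists r => // s sr.
have /rP : ball (0 : R) r s by rewrite /ball/= sub0r normrN.
by rewrite /= ltr_norml => /andP[_]; lra.
Qed.

Section strips_of_competitor.
Variables (t a c e : R) (p q : 'rV[R]_m.+1) (U : set 'rV[R]_m.+1).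
Hypotheses (c_ge0 : 0 <= c) (e_gt0 : 0 < e) (oU : open U).
Hypothesis Upq : forall x, U x -> forall i, p 0 i < x 0 i < q 0 i.
Hypothesis pq : forall i, p 0 i <= q 0 i.

(** The strips start at the last multiple of [e] not above [p 0 0], and [K] of them pass [q 0 0].
    Hence [K] exceeds the height divided by [e] by at most 2. *)
Let J := Num.floor (p 0 0 / e).
Let A := e * J%:~R.
Let K := (Num.truncn ((q 0 0 - A) / e)).+1.
Let p' := upd p 0 A.
Let q' := upd q 0 (A + e * K%:R).
Let v := competitor_piece t a c e J.
Let w := competitor t a c e.

Let Ap : A <= p 0 0.
Proof. by rewrite /A mulrC -ler_pdivlMr// floor_le_tmp. Qed.

Let pA : p 0 0 <= A + e.
Proof.
by have := floorD1_gt (p 0 0 / e); rewrite -/J intrD ltr_pdivrMr// => /ltW; rewrite /A mulrDl mul1r mulrC.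
Qed.

Let K_le : K%:R <= (q 0 0 - p 0 0) / e + 2.
Proof.
have h : 0 <= (q 0 0 - A) / e by rewrite divr_ge0 ?subr_ge0 ?(le_trans Ap)//; exact: ltW.
rewrite /K -natr1; have /andP[h1 _] := truncn_itv h.
have : (q 0 0 - A) / e <= (q 0 0 - p 0 0) / e + 1.
  have -> : (q 0 0 - A) / e = (q 0 0 - p 0 0) / e + (p 0 0 - A) / e by ring.
  by rewrite lerD2l ler_pdivrMr//; have := pA; lra.
lra.
Qed.

Let qA : q 0 0 <= A + e * K%:R.
Proof.
rewrite -lerBlDl mulrC -ler_pdivrMr//; apply/ltW; exact: truncnS_gt.
Qed.

Let p'0 : p' 0 0 = A. Proof. by rewrite /p' updE. Qed.
Let q'0 : q' 0 0 = A + e * K%:R. Proof. by rewrite /q' updE. Qed.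
Let p'q' i : p' 0 i <= q' 0 i.
Proof. by rewrite !mxE; case: eqP => // _; rewrite lerDl mulr_ge0// ltW. Qed.

Let Up'q' x : U x -> forall i, p' 0 i < x 0 i < q' 0 i.
Proof.
move=> Ux i; have /andP[h1 h2] := Upq Ux i; rewrite !mxE; case: eqP => [iE|_]; last by rewrite h1.
by rewrite iE in h1 h2 *; rewrite (le_lt_trans Ap)// (lt_le_trans h2).
Qed.

(** Each crossing of a level raises the sawtooth by 1, so the jump is [c * cell_prod e x >= 0]. *)
Let v_jump (j : nat) x : x 0 0 = level A e j.+1 -> v j x <= v j.+1 x.
Proof.
move=> _; have /andP[p0 p1] : 0 <= cell_prod e x <= 1.
  by have [d [_ p01 _ _]] := @isC1_cell_prod R m e e_gt0; exact: p01.
rewrite /v /competitor_piece lerD2l ler_wpM2l ?mulr_ge0//.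
by rewrite !intrD -!pmulrn -natr1; lra.
Qed.

Lemma competitor_integrable : L1 U w.
Proof.
have [d [_ _ _ vC1]] := isC1_competitor_piece t a c J e_gt0.
rewrite /w -(competitor_piecewise t a c J e_gt0).
exact: (piecewise_U e_gt0 p'0 q'0 oU Up'q' (fun j => isC1_continuous (vC1 j))).
Qed.

Lemma competitor_GSBV2 : c <= 1 / 2 -> GSBV2 U w.
Proof.
move=> c1; have [d [p01 _ _ vC1]] := isC1_competitor_piece t a c J e_gt0.
rewrite /w -(competitor_piecewise t a c J e_gt0).
apply: (piecewise_GSBV2 m_gt0 e_gt0 p'0 q'0 p'q' vC1 v_jump oU Up'q').
  move=> x; rewrite competitor_piecewise//; apply: le_trans (ler_normD _ _) _.
  have := wave_le t a x; have /andP[f0 f1] := frac_itv (x 0 0 / e).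
  have /andP[z0 z1] := p01 x; rewrite !normrM (ger0_norm c_ge0) (ger0_norm z0).
  have : `|1 / 2 - frac (x 0 0 / e)| <= 1 by rewrite ler_norml; apply/andP; split; lra.
  set r := `|_ - _|; have : 0 <= r by exact: normr_ge0.
  move=> r0 r1 h; have : c * cell_prod e x * r <= 1 / 2 * 1 * 1 by rewrite !ler_pM// mulr_ge0.
  by lra.
have := @piecewise_SBV R m m_gt0 A e e_gt0 K p' q' p'0 q'0 p'q' (fun _ => cst 0)
  (fun _ _ => cst 0) (fun _ => isC1_cst 0) (fun _ _ _ => lexx 0) U oU Up'q'.
exact.
Qed.

(** On a crack [x_0] is a multiple of [e], and the jump is positive only where the bump is; the
    other coordinates are then within [e / 4] of multiples of [e]. Such a point lies in an
    inclusion. *)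
Lemma competitor_cracks x : (disc w `&` U) x -> ~ dilated e x.
Proof.
have [d [p01 _ _ vC1]] := isC1_competitor_piece t a c J e_gt0.
rewrite /w -(competitor_piecewise t a c J e_gt0).
rewrite (disc_piecewise e_gt0 p'0 q'0 vC1 v_jump Up'q') => -[j _ [[Ux vx] /= xj]].
have z0 : 0 < cell_prod e x.
  move: vx; rewrite /v /competitor_piece /=; have /andP[z0 z1] := p01 x.
  rewrite ltrD2l lt_neqAle => /andP[+ _]; rewrite lt_neqAle z0 andbT.
  by apply: contra_neq => <-; rewrite mulr0 !mul0r.
have /choice[k kP] := cell_prod_gt0 e_gt0 z0.
move=> [y py yx]; apply: py.
have yE i : y 0 i = x 0 i / e by rewrite -yx !mxE mulrAC mulfV ?mul1r ?gt_eqF.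
pose z : 'rV[int]_m.+1 := \row_i oapp k (J + j.+1%:Z) (unlift 0 i).
exists z => //; exists (y - map_mx intr z); last by rewrite addrC subrK.
apply: subset_closure => i; rewrite !mxE yE.
case: (unliftP 0 i) => [l ->|->] /=.
  by have := kP l; rewrite ltr_norml => /andP[h1 h2]; apply/andP; split; lra.
have -> : x 0 0 / e = (J + j.+1%:Z)%:~R.
  rewrite xj /level /A intrD -pmulrn; field; exact: lt0r_neq0.
by rewrite subrr; lra.
Qed.

(** With [Z] the bump, the derivative in direction 0 is [t (cos - kappa Z)]. Expanding its square,
    [cos >= 1/2] makes the cross term at most [- t^2 kappa Z]. Each of the other [m] derivatives is
    at most [3 m t kappa], whence [9 m^3]. *)
Lemma competitor_dirichlet kappa : 0 <= t -> 0 <= kappa -> c = t * kappa * e ->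
  (forall x, U x -> 1 / 2 <= cos (2 * t * (x 0 0 - a))) ->
  (dirichlet w U <= (\int[mu]_(x in U) (dwave t a 0 x ^+ 2) -
     t ^+ 2 * kappa * \int[mu]_(x in U) cell_prod e x +
     t ^+ 2 * kappa ^+ 2 * (1 + 9 * m%:R ^+ 3) * fine (mu U))%:E)%E.
Proof.
move=> t0 k0 cE cosU; have [d [p01 dM d0 vC1]] := isC1_competitor_piece t a c J e_gt0.
rewrite /w -(competitor_piecewise t a c J e_gt0).
rewrite (piecewise_dirichlet e_gt0 p'0 q'0 p'q' vC1 oU Up'q').
set F := (X in piecewise _ _ X).
have cF j : continuous (F j).
  apply: continuous_big => [|i _ x]; first exact: add_continuous.
  by have [_ h] := vC1 j; apply: (@continuousM _ _ _ _ _ (h i x) (h i x)).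
have iF := piecewise_U e_gt0 p'0 q'0 oU Up'q' cF.
have cZ : continuous (cell_prod e : 'rV[R]_m.+1 -> R).
  by have [? [h _ _ _]] := @isC1_cell_prod R m e e_gt0; exact: isC1_continuous h.
have cD : continuous (dwave t a 0) by have [_] := isC1_wave t a; apply.
have mUU : measurable (U : set (caratheodory_type (@lebesgue_outer R m.+1))) by exact: leb_open.
have int (g : 'rV[R]_m.+1 -> R) : continuous g -> mu.-integrable U (EFin \o g).
  move=> cg; apply: integrableS (continuous_box_integrable p q cg) => //; first exact: leb_box.
  by move=> x Ux i; have /andP[/ltW-> ->] := Upq Ux i.
have cM (g h : 'rV[R]_m.+1 -> R) : continuous g -> continuous h -> continuous (fun x => g x * h x).
  by move=> cg ch x; apply: continuousM; [exact: cg|exact: ch].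
have cst_c (r : R) : continuous (cst r : 'rV[R]_m.+1 -> R) by exact: cst_continuous.
rewrite -(fineK (integrable_fin_num _ iF))// lee_fin.
have iD : mu.-integrable U (EFin \o (fun x => dwave t a 0 x ^+ 2)) by apply: int; exact: cM.
have iZ : mu.-integrable U (EFin \o (fun x => t ^+ 2 * kappa * cell_prod e x)).
  by apply: int; apply: (cM (cst _)).
have iC : mu.-integrable U (EFin \o (fun=> t ^+ 2 * kappa ^+ 2 * (1 + 9 * m%:R ^+ 3))).
  exact: (int (cst _) (cst_c _)).
have iB := integrableB mUU iD iZ; have iBC := integrableD mUU iB iC.
rewrite -(RintegralZl _ mUU (int _ cZ)) -(Rintegral_cst mu mUU) -RintegralB// -RintegralD//.
apply: le_Rintegral => // x Ux; rewrite /piecewise /F big_ord_recl strip_index_frac//.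
have o0 : ord0 = 0 :> 'I_m.+1 by exact: val_inj.
rewrite o0.
have /andP[f0 f1] := frac_itv (x 0 0 / e); have /andP[z0 z1] := p01 x.
set s := 1 / 2 - frac _; have s1 : `|s| <= 1 / 2 by rewrite ler_norml; apply/andP; split; rewrite /s; lra.
have ce : c * e^-1 = t * kappa by rewrite cE mulfK ?gt_eqF.
have tk : 0 <= t * kappa by rewrite mulr_ge0.
set T0 := (X in X ^+ 2 + _ <= _).
have -> : T0 = dwave t a 0 x - t * kappa * cell_prod e x by rewrite /T0 d0 eqxx -ce !mulr1; ring.
apply: (@le_trans _ _ ((dwave t a 0 x - t * kappa * cell_prod e x) ^+ 2 +
    \sum_(l < m) (3 * m%:R * (t * kappa)) ^+ 2)).
  rewrite lerD2l; apply: ler_sum => l _.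
  rewrite /dwave eq_sym (negbTE (neq_lift _ _)) !mulr0 oppr0 mulr0 !add0r.
  rewrite -[leLHS]ger0_norm ?sqr_ge0// normrX lerXn2r ?nnegrE//; first by rewrite !mulr_ge0.
  rewrite normrM normrM (ger0_norm c_ge0).
  apply: (@le_trans _ _ (1 / 2 * (c * (m%:R * 6 / e)))).
    by rewrite ler_pM ?mulr_ge0// ler_wpM2l.
  by rewrite le_eqVlt; apply/orP; left; apply/eqP; rewrite -ce; field; exact: lt0r_neq0.
rewrite sumr_const card_ord -[_ *+ m]mulr_natl.
have := cosU x Ux; rewrite /dwave eqxx !mulr1; set C := cos _ => C2.
have : 0 <= (t ^+ 2 * kappa) * (cell_prod e x * (2 * C - 1)).
  by rewrite !mulr_ge0 ?sqr_ge0//; lra.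
have : 0 <= (t * kappa) ^+ 2 * (1 - cell_prod e x ^+ 2).
  by rewrite mulr_ge0 ?sqr_ge0// subr_ge0 exprn_ile1.
lra.
Qed.

(** All cracks lie in the inclusions, so they carry the weight [beta e]; there are at most as many
    as strips, each of area at most the cross-section of the box. *)
Lemma competitor_energy beta kappa : 0 <= t -> 0 <= kappa -> c = t * kappa * e ->
  c <= 1 / 2 -> 0 <= beta e ->
  (forall x, U x -> 1 / 2 <= cos (2 * t * (x 0 0 - a))) ->
  (energy beta e w U <= (\int[mu]_(x in U) (dwave t a 0 x ^+ 2) -
     t ^+ 2 * kappa * \int[mu]_(x in U) cell_prod e x +
     t ^+ 2 * kappa ^+ 2 * (1 + 9 * m%:R ^+ 3) * fine (mu U) +
     beta e * ((q 0 0 - p 0 0) / e + 2) * vol (del 0 p) (del 0 q))%:E)%E.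
Proof.
move=> t0 k0 cE c1 b0 cosU; rewrite /energy asboolT; last exact: competitor_GSBV2.
rewrite [X in (_ + X + _)%E](_ : _ = 0%E); last first.
  rewrite (_ : _ `&` _ = set0) ?hausdorff_outer0//.
  by apply/seteqP; split => // x [xw [Ux xe]]; exact: (@competitor_cracks x).
rewrite adde0 EFinD leeD//; first exact: competitor_dirichlet.
rewrite -mulrA EFinM lee_wpmul2l ?lee_fin//.
have [d [p01 _ _ vC1]] := isC1_competitor_piece t a c J e_gt0.
apply: (@le_trans _ _ (hausdorff_outer m (disc w `&` U))).
  by apply: (@le_hausdorff_outer R m.+1 m) => x [xw [Ux _]].
rewrite /w -(competitor_piecewise t a c J e_gt0).
apply: le_trans (piecewise_haus m_gt0 e_gt0 p'0 q'0 p'q' vC1 v_jump Up'q') _.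
rewrite /p' /q' !del_upd lee_fin; apply: ler_wpM2r K_le.
by apply: vol_ge0 => j; rewrite !mxE; exact: pq.
Qed.

End strips_of_competitor.
End competitor.

Section limits_of_sequences.
Context {R : realType}.
Implicit Types (u : (\bar R)^nat) (c : \bar R).
Local Open Scope ereal_scope.

Lemma limn_esup_le_near u c : (\forall k \near \oo, u k <= c) -> limn_esup u <= c.
Proof.
move=> uc; apply: le_trans (ereal_inf_lbound _) _.
  by exists [set k | u k <= c].
by apply: ge_ereal_sup => _ [k /= uk <-].
Qed.

Lemma limn_einf_ge_near u c : (\forall k \near \oo, c <= u k) -> c <= limn_einf u.
Proof.
move=> uc; rewrite /limn_einf leeNr; apply: limn_esup_le_near.
by apply: filterS uc => k; rewrite leeN2.
Qed.

End limits_of_sequences.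

(** * The homogenized energy of a wave *)

Section wave_energy.
Context {R : realType} {m : nat} (m_gt0 : (0 < m)%N).
Implicit Types (x : 'rV[R]_m.+1) (t a : R) (U Omega : set 'rV[R]_m.+1).
Local Notation mu := (leb R m.+1).

Lemma bounded_setP Omega : bounded_set Omega ->
  exists2 B : R, 0 < B & forall x, Omega x -> forall i, `|x 0 i| < B.
Proof.
move=> [M [_ OM]]; exists (`|M| + 2); first by rewrite ltr_wpDl.
move=> x Ox i; apply: (@le_lt_trans _ _ (`|M| + 1)); last by rewrite ltrD2l ltr1n.
apply: le_trans (OM (`|M| + 1) _ x Ox); last by rewrite ltr_pwDr// ler_norm.
have -> : `|x 0 i| = `|x 0 i|%:nng%:num by [].
rewrite [leRHS]mx_normE; apply: (le_bigmax (0%:nng)%R (fun ij => `|x ij.1 ij.2|%:nng) (0, i)).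
Qed.

(** The wave is the competitor of amplitude 0, so the results on strips apply with jumps equal to
    zero. *)
Lemma wave_GSBV2 t a Omega : open Omega -> bounded_set Omega -> GSBV2 Omega (wave t a).
Proof.
move=> oO /bounded_setP[B B0 OB].
have -> : wave t a = competitor t a 0 1 :> ('rV[R]_m.+1 -> R).
  by apply/funext => x; rewrite /competitor !mul0r addr0.
apply: (@competitor_GSBV2 _ _ m_gt0 t a 0 1 (const_mx (- B)) (const_mx B)) => //.
- by move=> x Ox i; rewrite !mxE; have := OB x Ox i; rewrite ltr_norml.
- by move=> i; rewrite !mxE; lra.
Qed.

Lemma competitor_dist t a (c e : R) x : 0 <= c -> 0 < e ->
  `|competitor t a c e x - wave t a x| <= c.
Proof.
move=> c0 e0; have [d [_ p01 _ _]] := @isC1_cell_prod R m _ e0.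
have /andP[f0 f1] := frac_itv (x 0 0 / e); have /andP[z0 z1] := p01 x.
rewrite /competitor addrAC subrr add0r -mulrA normrM (ger0_norm c0).
rewrite ler_piMr// normrM mulr_ile1// ?(ger0_norm z0)//.
by rewrite ler_norml; apply/andP; split; lra.
Qed.

Lemma wave_ap_grad t a x : ap_grad (wave t a) x = dwave t a 0 x *: Defs.basis 0.
Proof.
rewrite (ap_gradE (isC1_ap_grad x (isC1_wave t a))).
apply/rowP => i; rewrite !mxE /dwave !eqxx/= mulr1.
by case: (i == 0); rewrite ?mulr1 ?mulr0.
Qed.

Lemma wave_disc t a : disc (wave t a) = set0 :> set 'rV[R]_m.+1.
Proof.
apply/seteqP; split => // x; exact: (ap_grad_disc (isC1_ap_grad x (isC1_wave t a))).
Qed.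

Lemma continuous_bounded_integrable U (g : 'rV[R]_m.+1 -> R) : open U -> bounded_set U ->
  continuous g -> mu.-integrable U (EFin \o g).
Proof.
move=> oU /bounded_setP[B _ UB] cg.
apply: integrableS (continuous_box_integrable (const_mx (- B)) (const_mx B) cg).
- exact: leb_box.
- exact: leb_open.
- move=> x Ux i; rewrite !mxE; have := UB x Ux i; rewrite ltr_norml => /andP[h1 h2].
  by rewrite h2 ltW.
Qed.

Lemma dwave2_continuous t a : continuous (fun x : 'rV[R]_m.+1 => dwave t a 0 x ^+ 2).
Proof.
move=> x; have [_ h] := @isC1_wave R m t a.
by apply: (@continuousM _ _ (dwave t a 0) (dwave t a 0)); exact: h.
Qed.

(** The gradient is everywhere a multiple of one vector, so homogeneity reduces the integrand to a
    single value of [f]. *)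
Lemma wave_hom_energy f g t a U : two_homogeneous f -> open U -> bounded_set U ->
  hom_energy f g (wave t a) U =
  (f (Defs.basis 0) * \int[mu]_(x in U) (dwave t a 0 x ^+ 2))%:E.
Proof.
move=> hf oU bU; rewrite /hom_energy wave_disc set0I integral_set0 adde0.
have iD := continuous_bounded_integrable oU bU (@dwave2_continuous t a).
rewrite -RintegralZl//; last exact: leb_open.
rewrite /Rintegral fineK; last first.
  apply: integrable_fin_num; first exact: leb_open.
  apply: (continuous_bounded_integrable (g := fun x => f (Defs.basis 0) * dwave t a 0 x ^+ 2)) => // x.
  apply: (@continuousM _ _ (cst (f (Defs.basis 0))) (fun x => dwave t a 0 x ^+ 2)).
    exact: cst_continuous.
  exact: dwave2_continuous.
by apply: eq_integral => x _; rewrite wave_ap_grad hf mulrC.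
Qed.

End wave_energy.

(** * Strict inequality from large gradients *)

Section upper_bound.
Context (R : realType) (m : nat) (m_gt0 : (0 < m)%N).
Variables (Omega : set 'rV[R]_m.+1) (beta : R -> R) (l : R) (eps : nat -> R).
Variables (f : 'rV[R]_m.+1 -> R) (g : R * 'rV[R]_m.+1 -> R).
Hypotheses (Omega_neq0 : Omega !=set0) (Omega_open : open Omega).
Hypotheses (Omega_bounded : bounded_set Omega).
Hypothesis beta_ge0 : forall e, 0 < e -> 0 <= beta e.
Hypothesis beta_ratio : beta e / e @[e --> 0^'+] --> l.
Hypothesis l_gt0 : 0 < l.
Hypotheses (eps_gt0 : forall k, 0 < eps k) (eps_cvg0 : eps k @[k --> \oo] --> 0).
Hypothesis fg_hom : homogenized_densities Omega beta eps f g.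
Hypothesis f_hom : two_homogeneous f.
Local Notation mu := (leb R m.+1).

Lemma eps_small (d : R) : 0 < d -> \forall k \near \oo, eps k < d.
Proof.
move=> d0; have /cvgrPdist_lt/(_ d d0) := eps_cvg0; apply: filterS => k.
by rewrite sub0r normrN gtr0_norm.
Qed.

Lemma beta_near (d : R) : 0 < d ->
  \forall k \near \oo, `|l - beta (eps k) / eps k| < d.
Proof.
move=> d0; have /cvgrPdist_lt/(_ d d0)[r /= r0 rP] := beta_ratio.
apply: filterS (eps_small r0) => k kr; apply: rP => //=.
by rewrite sub0r normrN gtr0_norm.
Qed.

Lemma small_cube (t d : R) : 0 < t -> 0 < d -> exists (a : 'rV[R]_m.+1) (L : R), [/\ 0 < L, L <= 1,
  forall x : 'rV[R]_m.+1, (forall i, a 0 i <= x 0 i <= a 0 i + L) -> Omega x &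
  forall x : 'rV[R]_m.+1, (forall i, a 0 i <= x 0 i <= a 0 i + L) -> 1 - d < cos (2 * t * (x 0 0 - a 0 0))].
Proof.
move=> t0 d0; have [a Oa] := Omega_neq0.
have /nbhs_coord[r r0 rO] : nbhs a Omega by exact: open_nbhs_nbhs.
have [s s0 sP] := cos_near1 d0.
have s2 : 0 < s / (2 * t) by rewrite divr_gt0// mulr_gt0.
pose M := Num.min (Num.min r 1) (s / (2 * t)).
have M0 : 0 < M by rewrite !lt_min r0 ltr01 s2.
have [Mr M1 Ms] : [/\ M <= r, M <= 1 & M <= s / (2 * t)].
  by rewrite /M !ge_min !lexx !orbT.
exists a, (M / 2); split; [by rewrite divr_gt0|lra| |].
- move=> x ax; apply: rO => i; have := ax i => /andP[? ?].
  by rewrite ltr_norml; apply/andP; split; lra.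
- move=> x ax; apply: sP; have := ax 0 => /andP[h1 h2].
  rewrite normrM ger0_norm ?mulr_ge0 ?ltW//.
  rewrite (ler_pdivlMr M s (mulr_gt0 (ltr0Sn _ 1) t0)) in Ms.
  rewrite ger0_norm ?subr_ge0// mulrC; apply: lt_le_trans Ms.
  by rewrite ltr_pM2r ?mulr_gt0//; lra.
Qed.

Definition open_cube (a : 'rV[R]_m.+1) (L : R) : set 'rV[R]_m.+1 :=
  [set x | forall i, a 0 i < x 0 i < a 0 i + L].

Lemma open_open_cube a L : open (open_cube a L).
Proof.
rewrite openE => x xc.
pose r := \big[Num.min/1]_i (Num.min (x 0 i - a 0 i) (a 0 i + L - x 0 i)).
have r0 : 0 < r.
  rewrite /r; elim/big_ind: _ => // [u v u0 v0|i _]; first by rewrite lt_min u0.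
  by have /andP[h1 h2] := xc i; rewrite lt_min !subr_gt0 h1.
apply/nbhs_coord; exists r => // y xy i.
have : r <= Num.min (x 0 i - a 0 i) (a 0 i + L - x 0 i) by rewrite /r (bigD1 i)//= ge_min lexx.
rewrite le_min => /andP[h1 h2]; have := xy i; rewrite ltr_norml => /andP[h3 h4].
by apply/andP; split; lra.
Qed.

Lemma bounded_setS (U V : set 'rV[R]_m.+1) : U `<=` V -> bounded_set V -> bounded_set U.
Proof. by move=> UV [M [Mr VM]]; exists M; split => // N MN x /UV; exact: VM. Qed.

Lemma cube_volume a L : 0 <= L -> fine (mu (open_cube a L)) <= L ^+ m.+1.
Proof.
move=> L0; pose b := a + const_mx L.
have ab i : a 0 i <= b 0 i by rewrite !mxE lerDl.
have : (mu (open_cube a L) <= (L ^+ m.+1)%:E)%E.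
  apply: (@le_trans _ _ (lebesgue_outer (box a b))).
    by apply: le_lebesgue_outer => x xc i; rewrite !mxE; have /andP[/ltW -> ->] := xc i.
  rewrite lebesgue_outer_box// lee_fin /vol (eq_bigr (fun=> L)).
    by rewrite prodr_const card_ord.
  by move=> i _; rewrite !mxE addrAC subrr add0r.
move=> muL; rewrite -lee_fin fineK// ge0_fin_numE ?measure_ge0//.
exact: le_lt_trans muL (ltry _).
Qed.

(** Means of the bump are known on half-open boxes, while the energies live on open sets. A lower
    bound on this smaller box is enough, at the price of the factor [(1 / 2) ^ m.+1]. *)
Lemma half_box_cube (a : 'rV[R]_m.+1) L : 0 < L ->
  box (a + const_mx (L / 2)) (a + const_mx L) `<=` open_cube a L.
Proof.
move=> L0 x xb i; have := xb i; rewrite !mxE => /andP[h1 h2]; rewrite h2 andbT.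
by apply: lt_le_trans h1; rewrite ltrDl divr_gt0.
Qed.

Lemma half_box_le (a : 'rV[R]_m.+1) L i : 0 < L ->
  (a + const_mx (L / 2)) 0 i <= (a + const_mx L) 0 i.
Proof. by move=> L0; rewrite !mxE lerD2l; lra. Qed.

Lemma half_box_vol (a : 'rV[R]_m.+1) L :
  vol (a + const_mx (L / 2)) (a + const_mx L) = (1 / 2) ^+ m.+1 * L ^+ m.+1.
Proof.
rewrite -exprMn -[in RHS](card_ord m.+1) -prodr_const; apply: eq_bigr => i _.
by rewrite !mxE; field.
Qed.

Lemma ge0_Rintegral_box_cube (a : 'rV[R]_m.+1) L (h : 'rV[R]_m.+1 -> R) : 0 < L ->
  open_cube a L `<=` Omega -> continuous h -> (forall x, 0 <= h x) ->
  \int[mu]_(x in box (a + const_mx (L / 2)) (a + const_mx L)) h x <=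
  \int[mu]_(x in open_cube a L) h x.
Proof.
move=> L0 aO ch h0; have oc := @open_open_cube a L.
have ih : mu.-integrable (open_cube a L) (EFin \o h).
  exact: continuous_bounded_integrable oc (bounded_setS aO Omega_bounded) ch.
have mb := @leb_box R m.+1 (a + const_mx (L / 2)) (a + const_mx L).
have mc := leb_open oc.
have ih' := integrableS mc mb (half_box_cube L0) ih.
apply: fine_le; [exact: integrable_fin_num|exact: integrable_fin_num|].
apply: ge0_subset_integral; [exact: mb|exact: mc|exact: measurable_int ih| |].
  by move=> x _; rewrite lee_fin.
exact: half_box_cube.
Qed.

Lemma upper_bound : exists2 c0 : R, 0 < c0 & f (Defs.basis 0) <= 1 - c0.
Proof.
(* [6^-1 ^+ m] is the mean of the bump; the other factor is the fraction of the cube filled by the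
   half box. *)
pose mu0 : R := 6^-1 ^+ m * (1 / 2) ^+ m.+1.
have mu00 : 0 < mu0 by rewrite mulr_gt0// exprn_gt0// ?invr_gt0.
pose C2 : R := 1 + 9 * m%:R ^+ 3.
have C20 : 0 < C2 by rewrite ltr_pwDl// mulr_ge0// exprn_ge0.
(* The minimizer of [C2 kappa^2 - mu0 kappa]. The minimum is [- kappa mu0 / 2], that is [- 2 c0]
   with the [c0] below: relative to [t^2 V] the bulk gains [2 c0]. *)
pose kappa := mu0 / (2 * C2).
have k0 : 0 < kappa by rewrite divr_gt0// mulr_gt0.
pose c0 := kappa * mu0 / 4.
have c00 : 0 < c0 by rewrite divr_gt0// mulr_gt0.
exists (c0 / 2); first by rewrite divr_gt0.
pose t : R := 1 + 2 * l / c0.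
have t1 : 1 <= t.
  by rewrite /t lerDl; apply/ltW/divr_gt0 => //; apply: mulr_gt0.
have t0 : 0 < t by exact: lt_le_trans t1.
have tl : 2 * l <= c0 * t ^+ 2.
  have -> : 2 * l = c0 * (t - 1) by rewrite /t; field; exact: lt0r_neq0.
  have : c0 * (t - 1) <= c0 * t by rewrite ler_pM2l//; lra.
  by move=> /le_trans; apply; rewrite ler_pM2l// expr2 ler_peMl// ltW.
have kC2 : kappa ^+ 2 * C2 = kappa * mu0 / 2.
  by rewrite /kappa; field; exact: lt0r_neq0.
have c0E : kappa * mu0 = 4 * c0 by rewrite /c0; field.
clearbody t; clearbody c0; clearbody kappa.
have half0 : 0 < 1 / 2 :> R by rewrite divr_gt0.
have [a [L [L0 L_le1 aO acos]]] := small_cube t0 half0.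
pose U := open_cube a L; have oU : open U by exact: open_open_cube.
have UO : U `<=` Omega.
  by move=> x Ux; apply: aO => i; have /andP[/ltW-> /ltW->] := Ux i.
have bU : bounded_set U by exact: bounded_setS UO Omega_bounded.
have mU : measurable (U : set (caratheodory_type (@lebesgue_outer R m.+1))) by exact: leb_open.
have Ucos x : U x -> 1 / 2 <= cos (2 * t * (x 0 0 - a 0 0)).
  move=> Ux; have := acos x _; have : 1 - 1 / 2 = 1 / 2 :> R by lra.
  move=> -> /(_ _)/wrap[i|/ltW//]; by have /andP[/ltW-> /ltW->] := Ux i.
have [B B0 OB] := bounded_setP Omega_bounded.
pose u := wave t (a 0 0) : 'rV[R]_m.+1 -> R.
pose w k := competitor t (a 0 0) (t * kappa * eps k) (eps k) : 'rV[R]_m.+1 -> R.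
have ck0 k : 0 <= t * kappa * eps k by apply/ltW; rewrite !mulr_gt0.
have wL1 k : L1 Omega (w k).
  apply: (@competitor_integrable _ _ t (a 0 0) (t * kappa * eps k) (eps k) (const_mx (- B)) (const_mx B)) => //.
  by move=> x Ox i; rewrite !mxE; have := OB x Ox i; rewrite ltr_norml.
have uG : GSBV2 Omega u by exact: wave_GSBV2.
have adm : admissible Omega eps u w.
  split => //; exists w; split => //.
    by move=> k; apply: aeW => x _.
  have mO := leb_open Omega_open.
  have Ofin : (mu Omega < +oo)%E.
    by apply: (@lebesgue_outer_ltey _ _ _ B) => x i Ox; exact/ltW/OB.
  have Ofin' : mu Omega \is a fin_num by rewrite ge0_fin_numE// measure_ge0.
  have upper k : (\int[mu]_(x in Omega) `|w k x - u x|%:E <= (t * kappa * eps k * fine (mu Omega))%:E)%E.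
    rewrite EFinM fineK// -[leRHS](@integral_cst _ _ _ mu _ mO (t * kappa * eps k)%:E).
    have iwu : mu.-integrable Omega (EFin \o (fun x => w k x - u x)).
      by have [[uL _] _ _] := uG; exact: (integrableB mO (wL1 k) uL).
    apply: ge0_le_integral.
    - exact: mO.
    - by move=> x _; rewrite lee_fin.
    - exact: measurable_int (integrable_norm iwu).
    - exact: measurable_cst.
    - by move=> x _; rewrite /= lee_fin; exact: competitor_dist.
  apply: (@squeeze_cvge _ _ _ _ (cst 0%E) _ (fun k => (t * kappa * eps k * fine (mu Omega))%:E)).
  - by near=> k; rewrite upper andbT integral_ge0.
  - exact: cvg_cst.
  - apply: cvg_EFin; first by near=> k.
    rewrite -[X in _ --> X](mul0r (fine (mu Omega))) -(mulr0 (t * kappa)).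
    by apply: cvgMl; apply: cvgMr.
have [_ _ /(_ u U uG oU UO)[_ supE]] := fg_hom.
pose I := \int[mu]_(x in U) (dwave t (a 0 0) 0 x ^+ 2).
rewrite (wave_hom_energy g t (a 0 0) f_hom oU bU) -/I in supE.
have [C C0 CP] := cell_prod_mean (fun i => half_box_le a i L0).
pose V := L ^+ m.+1.
have V0 : 0 < V by rewrite exprn_gt0.
have bb x : U x -> forall i, a 0 i < x 0 i < (a + const_mx L) 0 i.
  by move=> Ux i; rewrite !mxE; exact: Ux.
have ab i : a 0 i <= (a + const_mx L) 0 i by rewrite !mxE lerDl ltW.
have volE : vol (del 0 a) (del 0 (a + const_mx L)) = L ^+ m.
  rewrite /vol (eq_bigr (fun=> L)); first by rewrite prodr_const card_ord.
  by move=> i _; rewrite !mxE addrAC subrr add0r.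
have IV : I <= t ^+ 2 * V.
  apply: (@le_trans _ _ (t ^+ 2 * fine (mu U))); last first.
    by rewrite ler_wpM2l ?sqr_ge0// cube_volume// ltW.
  rewrite /I -Rintegral_cst//; apply: le_Rintegral => //.
  - exact: continuous_bounded_integrable oU bU (@dwave2_continuous _ _ t (a 0 0)).
  - exact: (continuous_bounded_integrable oU bU (fun x => @cst_continuous _ _ (t ^+ 2) x)).
  - move=> x _; rewrite /dwave eqxx mulr1 exprMn; set y := 2 * t * _.
    by rewrite ler_piMr ?sqr_ge0// -(cos2Dsin2 y) lerDl sqr_ge0.
have I0 : 0 < I.
  apply: (@lt_le_trans _ _ (t ^+ 2 / 4 * ((1 / 2) ^+ m.+1 * V))).
    by rewrite !mulr_gt0// ?exprn_gt0// divr_gt0.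
  apply: le_trans (ge0_Rintegral_box_cube L0 UO (@dwave2_continuous _ _ t (a 0 0)) (fun x => sqr_ge0 _)).
  have mb := @leb_box R m.+1 (a + const_mx (L / 2)) (a + const_mx L).
  rewrite /V -(half_box_vol a); have -> : vol (a + const_mx (L / 2)) (a + const_mx L) =
      fine (mu (box (a + const_mx (L / 2)) (a + const_mx L))).
    by rewrite [X in fine X]lebesgue_outer_box// => i; exact: half_box_le.
  rewrite -Rintegral_cst//; apply: le_Rintegral => //.
  - by apply: (@continuous_box_integrable _ _ (cst (t ^+ 2 / 4))) => x; exact: cst_continuous.
  - by apply: continuous_box_integrable; exact: dwave2_continuous.
  - move=> x xb; rewrite /dwave eqxx mulr1; have := Ucos x (half_box_cube L0 xb).
    set cc := cos _ => hc; have : 0 <= t ^+ 2 * (cc - 1 / 2) * (cc + 1 / 2).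
      by rewrite !mulr_ge0 ?sqr_ge0//; lra.
    by lra.
(* As [I <= t^2 V], a gain proportional to [t^2 V] is also a gain proportional to [I]. *)
suff H : f (Defs.basis 0) * I <= I - c0 / 2 * (t ^+ 2 * V).
  have : f (Defs.basis 0) * I <= (1 - c0 / 2) * I.
    by apply: le_trans H _; rewrite mulrBl mul1r lerD2l lerN2 ler_wpM2l// divr_ge0// ltW.
  by rewrite ler_pM2r.
rewrite -lee_fin -supE; apply: (@le_trans _ _ (limn_esup (fun k => energy beta (eps k) (w k) U))).
  by apply: ereal_inf_lbound; exists w.
apply: limn_esup_le_near.
(* [D] collects the coefficients of [eps k] in the error terms; the summand 1 keeps it positive. *)
pose D := t ^+ 2 * kappa * C + 4 * l * L ^+ m + 1.
have D0 : 0 < D.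
  by rewrite ltr_wpDl// addr_ge0// !mulr_ge0 ?exprn_ge0// ltW.
have small : 0 < c0 / 2 * (t ^+ 2 * V) / D by rewrite divr_gt0// mulr_gt0 ?divr_gt0// mulr_gt0// exprn_gt0.
have small2 : 0 < 1 / 2 / (t * kappa) by rewrite !divr_gt0// mulr_gt0.
near=> k.
have ek : eps k < c0 / 2 * (t ^+ 2 * V) / D by near: k; exact: eps_small.
have ek2 : eps k < 1 / 2 / (t * kappa) by near: k; exact: eps_small.
have bk : `|l - beta (eps k) / eps k| < l by near: k; exact: beta_near.
have ckh : t * kappa * eps k <= 1 / 2.
  by move: ek2; rewrite ltr_pdivlMr ?mulr_gt0// mulrC => /ltW.
apply: le_trans (competitor_energy m_gt0 (ck0 k) (eps_gt0 k) oU bb ab (ltW t0) (ltW k0) (erefl _) ckh (beta_ge0 (eps_gt0 k)) Ucos) _.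
rewrite -/I volE lee_fin.
have Z1 : 6^-1 ^+ m * ((1 / 2) ^+ m.+1 * V) - eps k * C <= \int[mu]_(x in U) cell_prod (eps k) x.
  rewrite /V -(half_box_vol a); apply: le_trans (CP _ (eps_gt0 k)) _.
  have [d [dC1 p01 _ _]] := @isC1_cell_prod R m _ (eps_gt0 k).
  apply: ge0_Rintegral_box_cube => //; first exact: isC1_continuous dC1.
  by move=> x; have /andP[] := p01 x.
have Z2 : t ^+ 2 * kappa * (mu0 * V - eps k * C) <= t ^+ 2 * kappa * \int[mu]_(x in U) cell_prod (eps k) x.
  by rewrite ler_pM2l ?mulr_gt0 ?exprn_gt0// /mu0 -mulrA.
have Z3 : t ^+ 2 * kappa ^+ 2 * C2 * fine (mu U) <= t ^+ 2 * kappa ^+ 2 * C2 * V.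
  by rewrite ler_wpM2l ?cube_volume ?(ltW L0)// !mulr_ge0 ?sqr_ge0// ltW.
have Z4 : beta (eps k) * (((a + const_mx L) 0 0 - a 0 0) / eps k + 2) <= 2 * l * (L + 2 * eps k).
  rewrite !mxE addrAC subrr add0r.
  have -> : beta (eps k) * (L / eps k + 2) = beta (eps k) / eps k * (L + 2 * eps k).
    by field; rewrite gt_eqF.
  rewrite ler_wpM2r ?addr_ge0 ?mulr_ge0 ?(ltW L0) ?(ltW (eps_gt0 k))//.
  by move: bk; rewrite ltr_norml => /andP[]; lra.
have Z5 : beta (eps k) * (((a + const_mx L) 0 0 - a 0 0) / eps k + 2) * L ^+ m <= 2 * l * V + 4 * l * L ^+ m * eps k.
  apply: le_trans (ler_wpM2r _ Z4) _; first by rewrite exprn_ge0// ltW.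
  by rewrite le_eqVlt; apply/orP; left; apply/eqP; rewrite /V exprS; ring.
have Z6 : eps k * D <= c0 / 2 * (t ^+ 2 * V) by rewrite -ler_pdivlMr// ltW.
have Z7 : 2 * l * V <= c0 * t ^+ 2 * V by rewrite ler_pM2r.
have Z8 : t ^+ 2 * kappa ^+ 2 * C2 * V = t ^+ 2 * V * (2 * c0).
  by rewrite -(mulrA (t ^+ 2)) kC2 c0E; field.
have Z9 : t ^+ 2 * kappa * (mu0 * V - eps k * C) = t ^+ 2 * V * (4 * c0) - eps k * (t ^+ 2 * kappa * C).
  have -> : t ^+ 2 * kappa * (mu0 * V - eps k * C) = t ^+ 2 * V * (kappa * mu0) - eps k * (t ^+ 2 * kappa * C) by ring.
  by rewrite c0E.
have Z10 : 0 <= eps k * (t ^+ 2 * kappa * C) by rewrite !mulr_ge0 ?sqr_ge0// ltW.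
have Z6' : eps k * (t ^+ 2 * kappa * C) + eps k * (4 * l * L ^+ m) <= c0 / 2 * (t ^+ 2 * V).
  by apply: le_trans Z6; rewrite /D -mulrDr ler_wpM2l ?lerDl// (ltW (eps_gt0 k)).
rewrite Z8 in Z3; rewrite Z9 in Z2; rewrite -/C2.
set X1 := \int[mu]_(x in U) _ in Z2 *.
set X2 := beta (eps k) * _ * _ in Z5 *.
set X3 := eps k * _ in Z2 Z6' *.
set X4 := fine (mu U) in Z3 *.
clearbody X1 X2 X3 X4; move: Z2 Z3 Z5 Z6' Z7; clear; lra.
Unshelve. all: by end_near. Qed.

End upper_bound.

(** * Integrals against outer measures and coverings *)

Section outer_integral.
Import HBNNSimple.
Context {R : realType} {T : pointedType} (nu : {outer_measure set T -> \bar R}).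
Implicit Types (D X : set T).
Local Notation mu := (caratheodory_restr nu).
Local Open Scope ereal_scope.

(* No measurability of the integrand is assumed: every simple function below it
   is supported in a measurable subset of [X]. *)
Lemma ge0_integral_le_outer D X (h : T -> \bar R) (M : R) : (0 <= M)%R ->
  (forall x, D x -> 0 <= h x <= M%:E) -> (forall x, D x -> ~ X x -> h x = 0) ->
  \int[mu]_(x in D) h x <= M%:E * nu X.
Proof.
move=> M0 hM hX; rewrite ge0_integralE; last by move=> x /hM/andP[].
apply: ge_ereal_sup => _ [s /= sh <-].
have s0 x : (0 <= s x)%R by exact: fun_ge0.
have sM x : (s x <= M)%R.
  rewrite -lee_fin; apply: le_trans (sh x) _; rewrite patchE.
  by case: ifPn => [/set_mem/hM/andP[]//|_]; rewrite lee_fin.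
pose A : set T := [set x | s x != 0%R].
have AX : A `<=` X.
  move=> x /= sx; apply: contrapT => nX; move/negP: sx; apply.
  rewrite eq_le s0 andbT -lee_fin; apply: le_trans (sh x) _; rewrite patchE.
  by case: ifPn => [/set_mem Dx|//]; rewrite (hX _ Dx).
have mA : measurable (A : set (caratheodory_type nu)).
  have -> : A = ~` (s @^-1` [set 0%R]).
    by apply/seteqP; split => x /=; [move/eqP|move=> /eqP].
  by apply: measurableC; exact: measurable_funPTI.
rewrite -integralT_nnsfun.
apply: (@le_trans _ _ (\int[mu]_x (M%:E * (\1_A x)%:E))).
  apply: ge0_le_integral => //.
  - by move=> x _; rewrite lee_fin.
  - by apply/measurable_EFinP; exact: measurable_funPT.
  - by apply: measurable_funeM; apply/measurable_EFinP; exact: measurable_indic.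
  - move=> x _; rewrite -EFinM lee_fin indicE; have [xA|xA] := boolP (x \in A).
      by rewrite mulr1.
    rewrite mulr0; move: xA; rewrite notin_setE /= => /negP; rewrite negbK => /eqP ->//.
rewrite ge0_integralZl//; last by apply/measurable_EFinP; exact: measurable_indic.
rewrite integral_indic// setIT; apply: lee_wpmul2l => //.
exact: le_outer_measure.
Qed.

Lemma Rintegral_le_outer D X (h : T -> R) (M : R) : (0 <= M)%R -> nu X < +oo ->
  (forall x, D x -> `|h x| <= M)%R -> (forall x, D x -> ~ X x -> h x = 0%R) ->
  (`|\int[mu]_(x in D) h x| <= M * fine (nu X))%R.
Proof.
move=> M0 Xfin hM hX; rewrite /Rintegral integralE.
have nuX0 : 0 <= nu X by exact: outer_measure_ge0.
have Xn : nu X \is a fin_num by rewrite ge0_fin_numE.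
have hp : 0 <= \int[mu]_(x in D) (EFin \o h)^\+ x <= M%:E * nu X.
  rewrite integral_ge0//=; apply: ge0_integral_le_outer => // x Dx.
    rewrite funeposE le_max lexx orbT/= ge_max !lee_fin M0 andbT.
    exact: le_trans (ler_norm _) (hM x Dx).
  by move=> nX; rewrite funeposE /= hX// maxxx.
have hn : 0 <= \int[mu]_(x in D) (EFin \o h)^\- x <= M%:E * nu X.
  rewrite integral_ge0//=; apply: ge0_integral_le_outer => // x Dx.
    rewrite funenegE le_max lexx orbT/= ge_max !lee_fin M0 andbT.
    by apply: le_trans (hM x Dx); rewrite -normrN ler_norm.
  by move=> nX; rewrite funenegE /= hX// oppr0 maxxx.
move: hp hn; rewrite -(fineK Xn) -EFinM.
move: (\int[mu]_(x in D) _) (\int[mu]_(x in D) _) => [a| |] [b| |]; rewrite /= ?lee_fin ?leNgt ?ltry ?andbF// -?leNgt.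
move=> /andP[a0 aM] /andP[b0 bM]; rewrite ler_norml; apply/andP; split; lra.
Qed.

End outer_integral.

Section covers.
Context {R : realType} {m : nat}.
Local Notation H := (@hausdorff_outer R m.+1 m).
Implicit Types (S : set 'rV[R]_m.+1).

(** Continuity from below for a set [X] that need not be measurable: only the sets cutting it are.
    If a remainder larger than [e] persisted, the disjoint pieces of [X] would have total measure at
    most [nu X - e], against countable subadditivity. *)
Lemma outer_measure_tail {T : pointedType} (nu : {outer_measure set T -> \bar R})
    (C : (set T)^nat) (X : set T) (e : R) : (forall k, nu.-caratheodory (C k)) ->
  (nu X < +oo)%E -> X `<=` \bigcup_k C k -> 0 < e ->
  exists N, (nu (X `\` \big[setU/set0]_(k < N) C k) <= e%:E)%E.
Proof.
move=> mC Xfin XC e0; pose A := seqDU C.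
have mA k : nu.-caratheodory (A k).
  by apply: caratheodory_measurable_setD => //; exact: caratheodory_measurable_bigsetU.
have tA : trivIset setT A by exact: trivIset_seqDU.
have X0 : (0 <= nu X)%E by exact: outer_measure_ge0.
have Xn : nu X \is a fin_num by rewrite ge0_fin_numE.
apply: contrapT => /forallNP h.
have part N : (nu X = nu (X `&` \big[setU/set0]_(k < N) C k) +
    nu (X `\` \big[setU/set0]_(k < N) C k))%E.
  by rewrite setDE; exact: (caratheodory_measurable_bigsetU mC N X).
have partial N : (\sum_(0 <= k < N) nu (X `&` A k) <= nu X - e%:E)%E.
  rewrite big_mkord -(caratheodory_additive mA tA) -bigsetU_seqDU.
  rewrite leeBrDr// [leRHS](part N); apply: leeD2l.
  by apply/ltW; rewrite ltNge; apply/negP; exact: h.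
have : (nu X <= nu X - e%:E)%E.
  apply: (@le_trans _ _ (\sum_(k <oo) nu (X `&` A k))%E); last first.
    apply: lime_le; last by apply: nearW.
    by apply: is_cvg_nneseries => k _ _; exact: outer_measure_ge0.
  apply: le_trans (outer_measure_sigma_subadditive nu (fun k => X `&` A k)).
  apply: le_outer_measure; rewrite -setI_bigcupr => x Xx; split => //.
  by rewrite -seqDU_bigcup_eq; exact: XC.
by rewrite -(fineK Xn) -EFinB lee_fin; lra.
Qed.

(** A nearly optimal cover by sets of small diameter is turned into one by cubes centred in [S].
    Their radii are slightly larger than the diameters [D], and the factor [2 ^ m / b] converts the
    cost [b (D / 2)^m] into [D^m]. Measurability of the cubes then allows a finite selection. *)
Lemma hausdorff_cover : (0 < m)%N -> exists2 K : R, 0 < K &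
  forall S (d e : R), (H S < +oo)%E -> 0 < d -> 0 < e ->
  exists B : seq ('rV[R]_m.+1 * R), [/\ forall c, c \in B -> S c.1 /\ 0 < c.2 <= d,
    \sum_(c <- B) c.2 ^+ m <= K * (fine (H S) + 1) &
    (H (S `\` [set x | exists2 c, c \in B &
       box (c.1 - const_mx c.2) (c.1 + const_mx c.2) x]) <= e%:E)%E].
Proof.
move=> m0; pose b := fine (ball_volume R m).
have bE : ball_volume R m = b%:E by rewrite fineK// ball_volume_fin_num.
have b0 : 0 < b by rewrite -lte_fin -bE ball_volume_gt0.
exists (1 + 2 ^+ m / b); first by rewrite ltr_wpDr// divr_ge0// ltW.
move=> S d e Sfin d0 e0.
have [->|/set0P[p0 Sp0]] := eqVneq S set0.
  exists [::]; split => //.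
    by rewrite big_nil outer_measure0/= add0r mulr1 addr_ge0// divr_ge0// ltW.
  by rewrite set0D outer_measure0 lee_fin ltW.
have Sn : H S \is a fin_num by rewrite ge0_fin_numE// hausdorff_outer_ge0.
have d20 : 0 < d / 2 by rewrite divr_gt0.
have : (hausdorff_pre m (d / 2) S < (fine (H S) + 1)%:E)%E.
  apply: le_lt_trans (hausdorff_pre_le_outer S d20) _.
  by rewrite -[ltLHS](fineK Sn) lte_fin ltrDl.
move=> /ereal_inf_lt[_ [A [_ SA] <-]] Alt.
have cost0 k : (0 <= diam_cost m (d / 2) (A k))%E by exact: diam_cost_ge0.
have costsum N : (\sum_(0 <= k < N) diam_cost m (d / 2) (A k) <= (fine (H S) + 1)%:E)%E.
  apply: le_trans (ltW Alt).
  exact: (@nneseries_lim_ge R _ predT).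
have costfin k : diam_cost m (d / 2) (A k) \is a fin_num.
  rewrite ge0_fin_numE//; apply: le_lt_trans (ltry (fine (H S) + 1)).
  apply: le_trans (costsum k.+1); rewrite big_nat_recr//= leeDr//.
  by apply: sume_ge0.
have /choice[c cP] : forall k, exists c : 'rV[R]_m.+1 * R,
    [/\ S c.1, 0 < c.2 <= d,
     c.2 ^+ m <= 2 ^+ m / b * fine (diam_cost m (d / 2) (A k)) + (1 / 2) ^+ k.+1 &
     S `&` A k `<=` box (c.1 - const_mx c.2) (c.1 + const_mx c.2)].
  move=> k.
  (* The radius exceeds [D] strictly, since the cubes are half-open and must not degenerate when
     [D = 0]. The allowed excesses [(1 / 2) ^ k.+1] have sum at most 1. *)
  have radius (D : R) : 0 <= D -> D <= d / 2 -> exists r : R,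
      [/\ D < r, r <= d & r ^+ m <= D ^+ m + (1 / 2) ^+ k.+1].
    move=> D0 Dd; have h0 : 0 < (1 / 2) ^+ k.+1 :> R by rewrite exprn_gt0// divr_gt0.
    have /cvgrPdist_lt/(_ _ h0)[r /= r0 rP] := @exprn_continuous R m D.
    exists (D + Num.min (r / 2) (d / 2)).
    have M0 : 0 < Num.min (r / 2) (d / 2) by rewrite lt_min d20 divr_gt0.
    have Mr : Num.min (r / 2) (d / 2) <= r / 2 by rewrite ge_min lexx.
    have Md : Num.min (r / 2) (d / 2) <= d / 2 by rewrite ge_min lexx orbT.
    split; [by rewrite ltrDl|lra|].
    have := rP (D + Num.min (r / 2) (d / 2)); rewrite /ball_/= => /(_ _)/wrap[|].
      by rewrite opprD addrA subrr sub0r normrN gtr0_norm//; lra.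
    by rewrite ltr_norml => /andP[+ _]; lra.
  have [SA0|/set0P[p [Sp Ap]]] := eqVneq (S `&` A k) set0.
    (* A covering set that misses [S] gets a dummy cube, centred at [p0] so that all centres remain
       in [S]. *)
    have [r [r1 r2 r3]] := radius 0 (lexx 0) (ltW d20).
    exists (p0, r); split; rewrite //= ?r1//; last by rewrite SA0.
    apply: le_trans r3 _; rewrite lerD2r.
    have h : 0 <= fine (diam_cost m (d / 2) (A k)) by rewrite fine_ge0.
    by rewrite expr0n (gtn_eqF m0) mulr_ge0// divr_ge0// ltW.
  have Ane : A k !=set0 by exists p.
  have := costfin k; rewrite /diam_cost; move/set0P/negbTE : (Ane) => ->.
  case: ifPn => [Ad _|//].
  have fe : ediam (A k) \is a fin_num.
    by rewrite ge0_fin_numE ?ediam_ge0// (le_lt_trans Ad)// ltry.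
  have D0 : 0 <= fine (ediam (A k)) by rewrite fine_ge0// ediam_ge0.
  have [||r [r1 r2 r3]] := radius (fine (ediam (A k))) => //.
    by rewrite -lee_fin fineK.
  exists (p, r); split => //=.
  - by rewrite r2 andbT (le_lt_trans D0).
  - apply: le_trans r3 _; rewrite lerD2r bE /= expr_div_n le_eqVlt; apply/orP; left.
    apply/eqP; set D := _ ^+ m; have h2 : 2 ^+ m != 0 :> R by rewrite expf_neq0.
    by rewrite mulrA divfK ?(gt_eqF b0)// mulrCA divff// mulr1.
  - move=> x [_ Ax] i; have : `|x 0 i - p 0 i| < r.
      apply: le_lt_trans r1; rewrite -lee_fin fineK//.
      apply: le_trans (ediam_ubound Ax Ap); rewrite lee_fin.
      by have := coord_le_enorm (x - p) i; rewrite !mxE.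
    by rewrite !mxE ltr_norml => /andP[h1 h2]; apply/andP; split; lra.
pose C k := box ((c k).1 - const_mx (c k).2) ((c k).1 + const_mx (c k).2).
have [||N NP] := @outer_measure_tail _ (@hausdorff_outer R m.+1 m) C S e _ Sfin _ e0.
- by move=> k; exact: box_haus.
- move=> x Sx; have [k _ Akx] := SA _ Sx; exists k => //.
  by have [_ _ _ h] := cP k; apply: h.
exists [seq c k | k <- iota 0 N]; split.
- by move=> _ /mapP[k _ ->]; have [] := cP k.
- rewrite big_map; apply: (@le_trans _ _ (\sum_(k <- iota 0 N)
    (2 ^+ m / b * fine (diam_cost m (d / 2) (A k)) + (1 / 2) ^+ k.+1))).
    by apply: ler_sum => k _; have [] := cP k.
  rewrite big_split/= -mulr_sumr [X in _ <= X](_ : _ = 2 ^+ m / b * (fine (H S) + 1) + (fine (H S) + 1)); last by ring.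
  apply: lerD.
    rewrite ler_wpM2l ?divr_ge0 ?(ltW b0)//.
    rewrite -lee_fin; apply: le_trans (costsum N); rewrite -sumEFin.
    by rewrite /index_iota subn0; apply: lee_sum => k _; rewrite fineK.
  have geo : \sum_(k <- iota 0 N) (1 / 2) ^+ k.+1 = 1 - (1 / 2) ^+ N :> R.
    elim: (N) => [|n IH]; first by rewrite big_nil expr0 subrr.
    by rewrite -addn1 iotaD big_cat IH/= big_seq1 add0n addn1 !exprS; field.
  rewrite geo; have : 0 <= (1 / 2) ^+ N :> R by rewrite exprn_ge0.
  have : 0 <= fine (H S) by rewrite fine_ge0// hausdorff_outer_ge0.
  by lra.
- apply: le_trans NP; apply: le_hausdorff_outer => x [Sx nx]; split => //.
  apply: contra_not nx; rewrite -bigcup_mkord => -[k /= kN Ckx].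
  by exists (c k) => //; apply: map_f; rewrite mem_iota.
Qed.

End covers.

(** * Divergence free detours *)

Section plateau.
Context {R : realType}.
Implicit Types (k c p s : R).

(** A cutoff around [p]: equal to 1 up to distance [(c - 1) / k], and to 0 from distance [c / k]
    on. *)
Definition plateau k c p s : R := step (k * s + (c - k * p)) * step (- k * s + (c + k * p)).

Definition dplateau k c p s : R :=
  step (k * s + (c - k * p)) * (- k * dstep (- k * s + (c + k * p))) +
  step (- k * s + (c + k * p)) * (k * dstep (k * s + (c - k * p))).

Definition ddplateau k c p s : R :=
  (step (k * s + (c - k * p)) * (- k * (- k * ddstep (- k * s + (c + k * p)))) +
   - k * dstep (- k * s + (c + k * p)) * (k * dstep (k * s + (c - k * p)))) +
  (step (- k * s + (c + k * p)) * (k * (k * ddstep (k * s + (c - k * p)))) +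
   k * dstep (k * s + (c - k * p)) * (- k * dstep (- k * s + (c + k * p)))).

Lemma is_derive_plateau k c p s : is_derive s (1 : R) (plateau k c p) (dplateau k c p s).
Proof.
exact: (is_deriveM (is_derive_affine (is_derive_step (k * s + (c - k * p))))
  (is_derive_affine (is_derive_step (- k * s + (c + k * p))))).
Qed.

Lemma is_derive_dplateau k c p s : is_derive s (1 : R) (dplateau k c p) (ddplateau k c p s).
Proof.
have h1 := is_derive_affine (is_derive_step (k * s + (c - k * p))).
have h2 := is_derive_affine (is_derive_step (- k * s + (c + k * p))).
have h3 := is_deriveZ k (is_derive_affine (is_derive_dstep (k * s + (c - k * p)))).
have h4 := is_deriveZ (- k) (is_derive_affine (is_derive_dstep (- k * s + (c + k * p)))).
exact: (is_deriveD (is_deriveM h1 h4) (is_deriveM h2 h3)).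
Qed.

Lemma ddplateau_continuous k c p : continuous (ddplateau k c p).
Proof.
have aff a b : continuous (fun s : R => a * s + b).
  move=> s; apply: (@continuousD _ _ _ (fun s : R => a * s) (cst (b : R))); last exact: cst_continuous.
  by apply: (@continuousM _ _ (cst (a : R)) (fun s : R => s)); [exact: cst_continuous|exact: cvg_id].
have cs a b : continuous (fun s : R => step (a * s + b)).
  move=> s; apply: (continuous_comp (f := fun s : R => a * s + b)); first exact: aff.
  by apply/differentiable_continuous/derivable1_diffP; have [] := is_derive_step (a * s + b).
have cd a b : continuous (fun s : R => a * dstep (a * s + b)).
  move=> s; apply: (@continuousM _ _ (cst (a : R)) (fun s : R => dstep (a * s + b))); first exact: cst_continuous.
  apply: (continuous_comp (f := fun s : R => a * s + b)); first exact: aff.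
  by apply/differentiable_continuous/derivable1_diffP; have [] := is_derive_dstep (a * s + b).
have cdd a b : continuous (fun s : R => a * (a * ddstep (a * s + b))).
  move=> s; apply: (@continuousM _ _ (cst (a : R)) (fun s : R => a * ddstep (a * s + b))); first exact: cst_continuous.
  apply: (@continuousM _ _ (cst (a : R)) (fun s : R => ddstep (a * s + b))); first exact: cst_continuous.
  apply: (continuous_comp (f := fun s : R => a * s + b)); first exact: aff.
  exact: ddstep_continuous.
move=> s; exact: (continuousD
  (continuousD (continuousM (cs k (c - k * p) s) (cdd (- k) (c + k * p) s))
     (continuousM (cd (- k) (c + k * p) s) (cd k (c - k * p) s)))
  (continuousD (continuousM (cs (- k) (c + k * p) s) (cdd k (c - k * p) s))
     (continuousM (cd k (c - k * p) s) (cd (- k) (c + k * p) s)))).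
Qed.

Lemma dplateau_continuous k c p : continuous (dplateau k c p).
Proof.
by move=> s; apply/differentiable_continuous/derivable1_diffP; have [] := is_derive_dplateau k c p s.
Qed.

Lemma plateau_bounds k c p s : 0 <= plateau k c p s <= 1.
Proof.
have [/andP[a1 a2] _ _] := step_bounds (k * s + (c - k * p)).
have [/andP[b1 b2] _ _] := step_bounds (- k * s + (c + k * p)).
by rewrite /plateau mulr_ge0//= mulr_ile1.
Qed.

(** The two terms of the derivative have opposite signs, so the bound is [3 k] and not [6 k]. *)
Lemma dplateau_bound k c p s : 0 <= k -> `|dplateau k c p s| <= 3 * k.
Proof.
move=> k0; rewrite /dplateau.
have [/andP[a1 a2] /andP[a3 a4] _] := step_bounds (k * s + (c - k * p)).
have [/andP[b1 b2] /andP[b3 b4] _] := step_bounds (- k * s + (c + k * p)).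
move: a1 a2 a3 a4 b1 b2 b3 b4; set A := step _; set B := step _; set A' := dstep _; set B' := dstep _.
clearbody A B A' B' => a1 a2 a3 a4 b1 b2 b3 b4; rewrite ler_norml; apply/andP; split.
  have : 0 <= B * (k * A') by rewrite !mulr_ge0.
  suff : A * (k * B') <= 3 * k by rewrite !mulNr mulrN; lra.
  by rewrite mulrCA [leRHS]mulrC ler_wpM2l//; apply: le_trans (_ : B' <= _); rewrite // ler_piMl.
have : 0 <= A * (k * B') by rewrite !mulr_ge0.
suff : B * (k * A') <= 3 * k by rewrite !mulNr mulrN; lra.
by rewrite mulrCA [leRHS]mulrC ler_wpM2l//; apply: le_trans (_ : A' <= _); rewrite // ler_piMl.
Qed.

Lemma plateau1 k c p s : 0 <= k -> k * `|s - p| <= c - 1 ->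
  plateau k c p s = 1 /\ dplateau k c p s = 0.
Proof.
move=> k0; rewrite -{1}(ger0_norm k0) -normrM ler_norml => /andP[h1 h2].
rewrite /plateau /dplateau.
have [|-> -> _] := @step1 R (k * s + (c - k * p)); first by lra.
have [|-> -> _] := @step1 R (- k * s + (c + k * p)); first by lra.
by rewrite !mulr0 mulr1 addr0.
Qed.

Lemma plateau0 k c p s : 0 <= k -> c <= k * `|s - p| ->
  plateau k c p s = 0 /\ dplateau k c p s = 0.
Proof.
move=> k0; rewrite -{1}(ger0_norm k0) -normrM ler_normr => /orP[] h; rewrite /plateau /dplateau.
  have [|-> -> _] := @step0 R (- k * s + (c + k * p)); first by lra.
  by rewrite !mulr0 mul0r addr0.
have [|-> -> _] := @step0 R (k * s + (c - k * p)); first by lra.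
by rewrite !mulr0 !mul0r addr0.
Qed.

End plateau.

Section transport.
Context {R : realType} {m : nat} (l0 : 'I_m).
Implicit Types (x : 'rV[R]_m.+1) (k q : R -> R) (F : 'rV[R]_m.+1 -> R).

(* The field [F * (e_0 + k (x_0) e_1)] is then divergence free, [e_1] being the
   direction of [l0]. *)
Definition transported k F := exists dF, isC1 F dF /\
  forall x, dF 0 x + k (x 0 0) * dF (lift 0 l0) x = 0.

Lemma transported_cst k (c : R) : transported k (cst c).
Proof.
exists (fun _ => cst 0); split; first exact: isC1_cst.
by move=> x; rewrite mulr0 addr0.
Qed.

Lemma transportedD k F G : transported k F -> transported k G ->
  transported k (fun x => F x + G x).
Proof.
move=> [dF [F1 F2]] [dG [G1 G2]]; eexists; split; first exact: (isC1D F1 G1).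
by move=> x /=; rewrite mulrDr addrACA F2 G2 addr0.
Qed.

Lemma transportedM k F G : transported k F -> transported k G ->
  transported k (fun x => F x * G x).
Proof.
move=> [dF [F1 F2]] [dG [G1 G2]]; eexists; split.
  exact: (isC1M (isC1_continuous F1) (isC1_continuous G1) F1 G1).
move=> x /=; transitivity (F x * (dG 0 x + k (x 0 0) * dG (lift 0 l0) x) +
  G x * (dF 0 x + k (x 0 0) * dF (lift 0 l0) x)); first by ring.
by rewrite F2 G2 !mulr0 addr0.
Qed.

Lemma transported_comp k F (g dg : R -> R) : transported k F ->
  (forall t : R, is_derive t (1 : R) g (dg t)) -> continuous dg ->
  transported k (fun x => g (F x)).
Proof.
move=> [dF [F1 F2]] gP cdg; eexists; split.
  exact: (isC1_comp (isC1_continuous F1) F1 gP cdg).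
by move=> x /=; rewrite mulrCA -mulrDr F2 mulr0.
Qed.

Lemma transported_prod k (T : Type) (s : seq T) (F : T -> 'rV[R]_m.+1 -> R) :
  (forall l, transported k (F l)) -> transported k (fun x => \prod_(l <- s) F l x).
Proof.
move=> FP; elim: s => [|l s IH].
  rewrite (_ : (fun x => _) = cst 1); first exact: transported_cst.
  by apply/funext => x; rewrite big_nil.
rewrite (_ : (fun x => _) = (fun x => F l x * \prod_(l <- s) F l x)).
  exact: transportedM.
by apply/funext => x; rewrite big_cons.
Qed.

(** These coordinates are constant along the curves on which [x_l0 - q (x_0)] and the remaining
    coordinates other than [x_0] are fixed. Every smooth function of them is therefore transported
    with slope [dq]. *)
Definition shifted q (l : 'I_m) x : R := x 0 (lift 0 l) - (l == l0)%:R * q (x 0 0).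

Lemma transported_shifted q dq l : (forall t : R, is_derive t (1 : R) q (dq t)) -> continuous dq ->
  transported dq (shifted q l).
Proof.
move=> qP cdq; have c0 := @isC1_coord R m.+1 0.
have cl := @isC1_coord R m.+1 (lift 0 l).
have qC1 := isC1_comp (isC1_continuous c0) c0 qP cdq.
have zC1 := isC1M (@cst_continuous _ _ (- (l == l0)%:R : R)) (isC1_continuous qC1)
  (isC1_cst (- (l == l0)%:R)) qC1.
have := isC1D cl zC1; set d := (X in isC1 _ X) => dC1.
exists d; split.
  by rewrite (_ : shifted q l = (fun x => x 0 (lift 0 l) + - (l == l0)%:R * q (x 0 0)))//;
    apply/funext => x; rewrite /shifted mulNr.
move=> x; rewrite /d /= !mulr0 !addr0 !mulr1.
rewrite (inj_eq lift_inj) eq_sym.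
by case: (l0 == l); rewrite /= ?mulr0n ?mulr1n; ring.
Qed.

End transport.

Section gaps.
Context {R : realType} {T : eqType} (sg : T -> bool).
Implicit Types (b : T -> R) (B : seq T) (s : bool).

Fixpoint gap b B : R := if B is c :: B' then (1 - b c) * gap b B' else 1.

(* Together with the gap, the parts of the two signs form a partition of unity:
   each element takes its share of what the elements after it leave. *)
Fixpoint part b s B : R :=
  if B is c :: B' then part b s B' + (sg c == s)%:R * b c * gap b B' else 0.

Lemma gap_bounds b B : (forall c, 0 <= b c <= 1) -> 0 <= gap b B <= 1.
Proof.
move=> b01; elim: B => [|c B /andP[h1 h2]] /=; first by rewrite ler01 lexx.
have /andP[b0 b1] := b01 c; have c0 : 0 <= 1 - b c by lra.
by rewrite mulr_ge0//= mulr_ile1//; lra.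
Qed.

Lemma gap_eq0 b B c : c \in B -> b c = 1 -> gap b B = 0.
Proof.
elim: B => //= c' B IH; rewrite in_cons => /orP[/eqP <- ->|cB bc].
  by rewrite subrr mul0r.
by rewrite IH// mulr0.
Qed.

Lemma part_ge0 b s B : (forall c, 0 <= b c <= 1) -> 0 <= part b s B.
Proof.
move=> b01; elim: B => //= c B h; have /andP[b0 _] := b01 c.
by have /andP[g0 _] := gap_bounds B b01; rewrite addr_ge0// !mulr_ge0.
Qed.

Lemma part_sum b B : part b true B + part b false B + gap b B = 1.
Proof.
elim: B => [|c B IH] /=; first by rewrite !add0r.
rewrite (_ : _ + _ = part b true B + part b false B + gap b B -
  (1 - (sg c == true)%:R - (sg c == false)%:R) * b c * gap b B); last by ring.
by rewrite IH; case: (sg c) => /=; rewrite !(mulr1n, mulr0n); ring.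
Qed.

Lemma part_le1 b B : (forall c, 0 <= b c <= 1) -> part b true B + part b false B <= 1.
Proof.
by move=> b01; have := part_sum b B; have /andP[g0 _] := gap_bounds B b01; lra.
Qed.

Lemma part_le_sum b s B : (forall c, 0 <= b c <= 1) ->
  part b s B <= \sum_(c <- B) (sg c == s)%:R * b c.
Proof.
move=> b01; elim: B => [|c B h] /=; first by rewrite big_nil.
rewrite big_cons addrC lerD//; have /andP[b0 _] := b01 c.
by have /andP[_ g1] := gap_bounds B b01; rewrite ler_piMr// mulr_ge0.
Qed.

Lemma part_eq0 b s B : (forall c, c \in B -> sg c = s -> b c = 0) -> part b s B = 0.
Proof.
elim: B => //= c B IH b0; rewrite IH ?add0r; last first.
  by move=> c' c'B; apply: b0; rewrite in_cons c'B orbT.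
by case: eqVneq => [sc|]; rewrite ?mul0r// (b0 c) ?mem_head// mulr0 mul0r.
Qed.

End gaps.

Section transport_gaps.
Context {R : realType} {m : nat} (l0 : 'I_m) {T : eqType} (sg : T -> bool).
Implicit Types (b : T -> 'rV[R]_m.+1 -> R) (k : R -> R).

Lemma transported_gap k b B : (forall c, transported l0 k (b c)) ->
  transported l0 k (fun x => gap (b ^~ x) B).
Proof.
move=> bP; elim: B => [|c B IH] /=; first exact: transported_cst.
apply: transportedM => //; apply: (transportedD (transported_cst l0 k 1)).
rewrite (_ : (fun x => - b c x) = (fun x => -1 * b c x)).
  by apply: transportedM => //; exact: transported_cst.
by apply/funext => x; rewrite mulN1r.
Qed.

Lemma transported_part k b s B : (forall c, transported l0 k (b c)) ->
  transported l0 k (fun x => part sg (b ^~ x) s B).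
Proof.
move=> bP; elim: B => [|c B IH] /=; first exact: transported_cst.
apply: transportedD => //; apply: transportedM; last exact: transported_gap.
by apply: transportedM => //; exact: transported_cst.
Qed.

End transport_gaps.

(** In units of the period, [p] lies in the right half of an inclusion when its fractional part is
    at most 1/2, and in the left half otherwise. Moving it outwards by 3/8 places it between 3/8 and
    5/8 from the centre, at distance 1/8 from all inclusions. The clearance 1/16 that is kept is the
    half-width of the bump of a cell of radius at most 1/32. *)
Lemma detour_number {R : realType} (p y : R) (k k' : int) : `|p - k'%:~R| <= 1 / 4 ->
  `|y - k%:~R| <= 1 / 4 ->
  16^-1 <= `|y - (if frac p <= 1 / 2 then 3 / 8 else - (3 / 8)) - p|.
Proof.
have := frac_itv p; rewrite /frac; set n := Num.floor p; clearbody n.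
move=> /andP[w1 w2]; rewrite !ler_norml => /andP[u1 u2] /andP[v1 v2].
have E (z : int) : (z + 1)%:~R = z%:~R + 1 :> R by rewrite intrD.
have I1 (z1 z2 : int) : z1%:~R < z2%:~R + 1 :> R -> (z1 <= z2)%R.
  by rewrite -E ltr_int ltzD1.
have I2 (z1 z2 : int) : (z1 <= z2)%R -> z1%:~R <= z2%:~R :> R by rewrite ler_int.
have nk : (n <= k')%R by apply: I1; lra.
rewrite leNgt; apply/negP; rewrite ltr_norml; case: ifP => [g|/negbT]; last rewrite -ltNge => g.
  have kn : (k' <= n)%R by apply: I1; lra.
  have nE : n%:~R = k'%:~R :> R by congr (_%:~R); apply/eqP; rewrite eq_le nk.
  move=> /andP[h1 h2]; have [/I2|] := leP k n; first by lra.
  by rewrite -lezD1 => /I2; rewrite E; lra.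
have kn : (n + 1 <= k')%R.
  by rewrite lezD1 ltNge; apply/negP => /I2; lra.
have kn' : (k' <= n + 1)%R by apply: I1; rewrite E; lra.
have nE : n%:~R + 1 = k'%:~R :> R by rewrite -E; congr (_%:~R); apply/eqP; rewrite eq_le kn.
move=> /andP[h1 h2]; have [/I2|] := leP k n; first by lra.
by rewrite -lezD1 => /I2; rewrite E; lra.
Qed.

(** * Rerouting the flux in one layer *)

Section layer.
Context {R : realType} {m : nat} (l0 : 'I_m).
Local Notation cell := ('rV[R]_m.+1 * R)%type.
Local Notation mu := (leb R m.+1).
Implicit Types (x a : 'rV[R]_m.+1) (e d L : R) (j : int) (c : cell) (B : seq cell) (s : bool).
Implicit Types (q dq : R -> R).

Definition offset e s : R := (if s then 3 / 8 else - (3 / 8)) * e.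

(* In the layer [|x_0 - e j| <= e / 2] the flux avoiding a crack is translated by
   3/8 of a period, into the part of the layer outside the inclusions. *)
Definition detour e j s (t : R) : R := offset e s * plateau (4 / e) 2 (e * j%:~R) t.
Definition ddetour e j s (t : R) : R := offset e s * dplateau (4 / e) 2 (e * j%:~R) t.
Definition dddetour e j s (t : R) : R := offset e s * ddplateau (4 / e) 2 (e * j%:~R) t.

Definition rightward e c : bool := frac (c.1 0 (lift 0 l0) / e) <= 1 / 2.

(** A cutoff in the coordinates other than [x_0], displaced by [q]: it is 1 up to the radius of the
    cell and 0 beyond twice that radius. It extends as a tube through all values of [x_0]. *)
Definition bump q c x : R :=
  \prod_(l <- enum 'I_m) plateau c.2^-1 2 (c.1 0 (lift 0 l)) (shifted l0 q l x).

Definition window a L d q x : R :=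
  \prod_(l <- enum 'I_m) plateau d^-1 (L / (2 * d) - 1) (a 0 (lift 0 l) + L / 2) (shifted l0 q l x).

(** The share of the flux assigned to the cells that move to the side [s], following the
    displacement [q]. The displacement [cst 0] gives the straight flux that is to be removed. *)
Definition flux a L d e B s q x : R :=
  part (rightward e) (bump q ^~ x) s B * window a L d q x.

(* The components along [0] and [l0] of the divergence free field that moves the
   flux through the cells of [B] along the detours: in the middle of the layer it
   cancels the field [window * e_0] on these cells. *)
Definition layer0 a L d e j B x : R :=
  flux a L d e B true (detour e j true) x + flux a L d e B false (detour e j false) x -
  (flux a L d e B true (cst 0) x + flux a L d e B false (cst 0) x).

Definition layer1 a L d e j B x : R :=
  flux a L d e B true (detour e j true) x * ddetour e j true (x 0 0) +
  flux a L d e B false (detour e j false) x * ddetour e j false (x 0 0).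

Definition bump_cost e j c x : R := bump (detour e j (rightward e c)) c x + bump (cst 0) c x.

Lemma plateau_prod_bounds (k w : R) (p : 'I_m -> R) q x :
  0 <= \prod_(l <- enum 'I_m) plateau k w (p l) (shifted l0 q l x) <= 1.
Proof.
elim: (enum 'I_m) => [|l t /andP[h1 h2]]; first by rewrite big_nil ler01 lexx.
have /andP[p0 p1] := plateau_bounds k w (p l) (shifted l0 q l x).
by rewrite big_cons mulr_ge0//= mulr_ile1.
Qed.

Lemma bump_bounds q c x : 0 <= bump q c x <= 1. Proof. exact: plateau_prod_bounds. Qed.

Lemma window_bounds a L d q x : 0 <= window a L d q x <= 1.
Proof. exact: plateau_prod_bounds. Qed.

Lemma bump_neq0 q c x : 0 < c.2 -> bump q c x != 0 ->
  forall l, `|shifted l0 q l x - c.1 0 (lift 0 l)| < 2 * c.2.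
Proof.
move=> r0; rewrite /bump => bx l; rewrite ltNge; apply/negP => h; move/negP: bx; apply.
apply/eqP; rewrite (big_rem l) ?mem_enum//= (plateau0 _ _).1 ?mul0r// ?invr_ge0 ?(ltW r0)//.
by rewrite ler_pdivlMl// mulrC.
Qed.

Lemma bump1 q c x : 0 < c.2 ->
  (forall l, `|shifted l0 q l x - c.1 0 (lift 0 l)| <= c.2) -> bump q c x = 1.
Proof.
move=> r0 h; rewrite /bump; apply: big1_seq => l _; apply: (plateau1 _ _).1.
  by rewrite invr_ge0 ltW.
by rewrite ler_pdivrMl//; have := h l; lra.
Qed.

Lemma window_neq0 a L d q x : 0 < d -> window a L d q x != 0 ->
  forall l, a 0 (lift 0 l) + d < shifted l0 q l x < a 0 (lift 0 l) + L - d.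
Proof.
move=> d0; rewrite /window => bx l.
have : `|shifted l0 q l x - (a 0 (lift 0 l) + L / 2)| < L / 2 - d.
  rewrite ltNge; apply/negP => h; move/negP: bx; apply.
  apply/eqP; rewrite (big_rem l) ?mem_enum//= (plateau0 _ _).1 ?mul0r// ?invr_ge0 ?(ltW d0)//.
  rewrite ler_pdivlMl// (_ : d * _ = L / 2 - d)//; field; exact: lt0r_neq0.
by rewrite ltr_norml => /andP[h1 h2]; apply/andP; split; lra.
Qed.

Lemma window1 a L d q x : 0 < d ->
  (forall l, a 0 (lift 0 l) + 2 * d <= shifted l0 q l x <= a 0 (lift 0 l) + L - 2 * d) ->
  window a L d q x = 1.
Proof.
move=> d0 h; rewrite /window; apply: big1_seq => l _; apply: (plateau1 _ _).1.
  by rewrite invr_ge0 ltW.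
rewrite ler_pdivrMl// (_ : d * _ = L / 2 - 2 * d); last by field; exact: lt0r_neq0.
by have /andP[h1 h2] := h l; rewrite ler_norml; apply/andP; split; lra.
Qed.

Lemma is_derive_scale (r : R) (f df : R -> R) (t : R) : is_derive t (1 : R) f (df t) ->
  is_derive t (1 : R) (fun t => r * f t) (r * df t).
Proof. exact: is_deriveZ. Qed.

Lemma continuous_scale (r : R) (f : R -> R) : continuous f -> continuous (fun t => r * f t).
Proof.
move=> cf t; apply: (@continuousM _ _ (cst (r : R)) f); [exact: cst_continuous|exact: cf].
Qed.

Lemma is_derive_detour e j s t : is_derive t (1 : R) (detour e j s) (ddetour e j s t).
Proof. exact: is_derive_scale (is_derive_plateau _ _ _ _). Qed.

Lemma is_derive_ddetour e j s t : is_derive t (1 : R) (ddetour e j s) (dddetour e j s t).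
Proof. exact: is_derive_scale (is_derive_dplateau _ _ _ _). Qed.

Lemma ddetour_continuous e j s : continuous (ddetour e j s).
Proof. by apply: continuous_scale; exact: dplateau_continuous. Qed.

Lemma dddetour_continuous e j s : continuous (dddetour e j s).
Proof. by apply: continuous_scale; exact: ddplateau_continuous. Qed.

Lemma detour_bound e j s t : 0 < e -> `|detour e j s t| <= 3 / 8 * e /\ `|ddetour e j s t| <= 9 / 2.
Proof.
move=> e0; rewrite /detour /ddetour !(normrM (offset e s)).
have -> : `|offset e s| = 3 / 8 * e.
  by rewrite /offset normrM (gtr0_norm e0); case: s; rewrite ?normrN ger0_norm.
have /andP[p0 p1] := plateau_bounds (4 / e) 2 (e * j%:~R) t.
have e4 : 0 <= 4 / e by rewrite divr_ge0// ltW.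
have dp := dplateau_bound 2 (e * j%:~R) t e4.
split; first by rewrite ler_piMr ?(ger0_norm p0)// mulr_ge0// ltW.
have h : 0 <= 3 / 8 * e by rewrite mulr_ge0// ltW.
apply: le_trans (ler_wpM2l h dp) _.
by rewrite le_eqVlt; apply/orP; left; apply/eqP; field; exact: lt0r_neq0.
Qed.

Lemma detour_out e j s t : 0 < e -> e / 2 <= `|t - e * j%:~R| ->
  detour e j s t = 0 /\ ddetour e j s t = 0.
Proof.
move=> e0 h; have e4 : 0 <= 4 / e by rewrite divr_ge0// ltW.
have [|p dp] := @plateau0 R (4 / e) 2 (e * j%:~R) t e4.
  apply: (@le_trans _ _ (4 / e * (e / 2))); last by rewrite ler_wpM2l.
  by rewrite (_ : _ * _ = 2)//; field; exact: lt0r_neq0.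
by rewrite /detour /ddetour p dp !mulr0.
Qed.

Lemma detour_mid e j s t : 0 < e -> `|t - e * j%:~R| <= e / 4 ->
  detour e j s t = offset e s /\ ddetour e j s t = 0.
Proof.
move=> e0 h; have e4 : 0 <= 4 / e by rewrite divr_ge0// ltW.
have [|p dp] := @plateau1 R (4 / e) 2 (e * j%:~R) t e4.
  apply: (@le_trans _ _ (4 / e * (e / 4))); first by rewrite ler_wpM2l.
  by rewrite le_eqVlt; apply/orP; left; apply/eqP; field; exact: lt0r_neq0.
by rewrite /detour /ddetour p dp mulr0 mulr1.
Qed.

Lemma transported_plateau_prod (k w : R) (p : 'I_m -> R) q dq :
  (forall t : R, is_derive t (1 : R) q (dq t)) -> continuous dq ->
  transported l0 dq (fun x => \prod_(l <- enum 'I_m) plateau k w (p l) (shifted l0 q l x)).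
Proof.
move=> qP cdq; apply: transported_prod => l.
apply: transported_comp; first exact: transported_shifted.
  by move=> t; exact: is_derive_plateau.
exact: dplateau_continuous.
Qed.

Lemma transported_flux a L d e B s q dq :
  (forall t : R, is_derive t (1 : R) q (dq t)) -> continuous dq ->
  transported l0 dq (flux a L d e B s q).
Proof.
move=> qP cdq; apply: transportedM; last exact: transported_plateau_prod.
by apply: transported_part => c; exact: transported_plateau_prod.
Qed.

Lemma layer_isC1 a L d e j B : exists (d0 d1 : 'I_m.+1 -> 'rV[R]_m.+1 -> R), [/\ isC1 (layer0 a L d e j B) d0,
  isC1 (layer1 a L d e j B) d1 & forall x, d0 0 x + d1 (lift 0 l0) x = 0].
Proof.
have /choice[dF dFP] s := transported_flux a L d e B s (is_derive_detour e j s)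
  (@ddetour_continuous e j s).
have cst0 (t : R) : is_derive t (1 : R) (cst (0 : R)) (cst (0 : R) t) by exact: is_derive_cst.
have /choice[dZ dZP] s := transported_flux a L d e B s cst0 (@cst_continuous _ _ (0 : R)).
have c0 := @isC1_coord R m.+1 0.
have dC1 s := isC1_comp (isC1_continuous c0) c0 (is_derive_ddetour e j s) (@dddetour_continuous e j s).
have mC1 s := isC1M (isC1_continuous (dFP s).1) (isC1_continuous (dC1 s)) (dFP s).1 (dC1 s).
have zC1 := isC1D (dZP true).1 (dZP false).1.
have nC1 := isC1M (@cst_continuous _ _ (-1 : R)) (isC1_continuous zC1) (isC1_cst (-1)) zC1.
have E0 := isC1D (isC1D (dFP true).1 (dFP false).1) nC1.
have E1 := isC1D (mC1 true) (mC1 false).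
eexists; eexists; split; [|exact: E1|].
  rewrite (_ : layer0 a L d e j B = (fun x => flux a L d e B true (detour e j true) x +
     flux a L d e B false (detour e j false) x + cst (-1) x *
     (flux a L d e B true (cst 0) x + flux a L d e B false (cst 0) x))); first exact: E0.
  by apply/funext => x; rewrite /layer0 /cst mulN1r.
move=> x /=.
have [_ /(_ x) t1] := dFP true; have [_ /(_ x) t2] := dFP false.
have [_ /(_ x) z1] := dZP true; have [_ /(_ x) z2] := dZP false.
rewrite /= !mul0r !addr0 in z1 z2.
rewrite z1 z2 !mulr0 !addr0.
transitivity ((dF true 0 x + ddetour e j true (x 0 0) * dF true (lift 0 l0) x) +
  (dF false 0 x + ddetour e j false (x 0 0) * dF false (lift 0 l0) x)).
  by ring.
by rewrite t1 t2 addr0.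
Qed.

Lemma flux_bounds a L d e B s q x : 0 <= flux a L d e B s q x /\
  flux a L d e B true q x + flux a L d e B false q x <= 1.
Proof.
have b01 c := bump_bounds q c x; have /andP[w0 w1] := window_bounds a L d q x.
split; first by rewrite mulr_ge0//; exact: part_ge0.
rewrite /flux -mulrDl; have := part_le1 (rightward e) B b01.
set S := (_ + _)%R => S1; have S0 : 0 <= S by rewrite addr_ge0//; exact: part_ge0.
by rewrite mulr_ile1.
Qed.

Lemma flux_le a L d e B s q x :
  flux a L d e B s q x <= \sum_(c <- B) (rightward e c == s)%:R * bump q c x.
Proof.
have b01 c := bump_bounds q c x; have /andP[w0 w1] := window_bounds a L d q x.
apply: le_trans (part_le_sum (rightward e) s B b01).
by rewrite ler_piMr//; exact: part_ge0.
Qed.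

(** Detours vanish there, so the displaced fluxes coincide with the straight ones and cancel. *)
Lemma layer_out a L d e j B x : 0 < e -> e / 2 <= `|x 0 0 - e * j%:~R| ->
  layer0 a L d e j B x = 0 /\ layer1 a L d e j B x = 0.
Proof.
move=> e0 h; have z s := detour_out s e0 h.
rewrite /layer1 (z true).2 (z false).2 !mulr0 addr0; split => //.
have sh s l : shifted l0 (detour e j s) l x = shifted l0 (cst 0) l x.
  by rewrite /shifted (z s).1.
have fE s s' : flux a L d e B s (detour e j s') x = flux a L d e B s (cst 0) x.
  rewrite /flux; congr (part _ _ _ _ * _).
    by apply/funext => c; apply: eq_bigr => l _; rewrite sh.
  by apply: eq_bigr => l _; rewrite sh.
by rewrite /layer0 !fE subrr.
Qed.

Lemma layer_bounds a L d e j B x : 0 < e ->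
  `|layer0 a L d e j B x| <= 9 /\ `|layer1 a L d e j B x| <= 9.
Proof.
move=> e0; rewrite /layer0 /layer1.
have F1 s s' := flux_bounds a L d e B s (detour e j s') x.
have F0 s := flux_bounds a L d e B s (cst 0) x.
have D s := (detour_bound j s (x 0 0) e0).2.
have [[a1 b1] [a2 b2]] := (F1 true true, F1 false true).
have [[a3 b3] [a4 b4]] := (F1 true false, F1 false false).
have [[a5 b5] [a6 b6]] := (F0 true, F0 false).
split; first by rewrite ler_norml; apply/andP; split; lra.
apply: le_trans (ler_normD _ _) _.
rewrite (normrM (flux _ _ _ _ _ true _ _)) (normrM (flux _ _ _ _ _ false _ _)).
rewrite (_ : 9 = 9 / 2 + 9 / 2); last by field.
have p1 : flux a L d e B true (detour e j true) x <= 1 by lra.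
have p2 : flux a L d e B false (detour e j false) x <= 1 by lra.
rewrite (ger0_norm a1) (ger0_norm a4).
apply: lerD.
  by apply: le_trans (D true); exact: ler_piMl.
by apply: le_trans (D false); exact: ler_piMl.
Qed.

Lemma layer_le_cost a L d e j B x : 0 < e ->
  `|layer0 a L d e j B x| <= 9 * \sum_(c <- B) bump_cost e j c x /\
  `|layer1 a L d e j B x| <= 9 * \sum_(c <- B) bump_cost e j c x.
Proof.
move=> e0; rewrite /layer0 /layer1 big_split/=.
have D s := (detour_bound j s (x 0 0) e0).2.
have F1 := flux_le a L d e B true (detour e j true) x.
have F2 := flux_le a L d e B false (detour e j false) x.
have F3 := flux_le a L d e B true (cst 0) x.
have F4 := flux_le a L d e B false (cst 0) x.
have [G1 _] := flux_bounds a L d e B true (detour e j true) x.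
have [G2 _] := flux_bounds a L d e B false (detour e j false) x.
have [G3 _] := flux_bounds a L d e B true (cst 0) x.
have [G4 _] := flux_bounds a L d e B false (cst 0) x.
have S1 : \sum_(c <- B) (rightward e c == true)%:R * bump (detour e j true) c x +
    \sum_(c <- B) (rightward e c == false)%:R * bump (detour e j false) c x =
    \sum_(c <- B) bump (detour e j (rightward e c)) c x.
  rewrite -big_split/=; apply: eq_bigr => c _.
  by case: (rightward e c); rewrite /= ?mulr1n ?mulr0n !(mul1r, mul0r) ?addr0 ?add0r.
have S2 : \sum_(c <- B) (rightward e c == true)%:R * bump (cst 0) c x +
    \sum_(c <- B) (rightward e c == false)%:R * bump (cst 0) c x =
    \sum_(c <- B) bump (cst 0) c x.
  rewrite -big_split/=; apply: eq_bigr => c _.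
  by case: (rightward e c); rewrite /= ?mulr1n ?mulr0n !(mul1r, mul0r) ?addr0 ?add0r.
split; first by rewrite ler_norml; apply/andP; split; lra.
apply: le_trans (ler_normD _ _) _.
rewrite (normrM (flux _ _ _ _ _ true _ _)) (normrM (flux _ _ _ _ _ false _ _)).
rewrite (ger0_norm G1) (ger0_norm G2).
have H1 := ler_wpM2l G1 (D true); have H2 := ler_wpM2l G2 (D false).
lra.
Qed.

(** Two facts meet at a point of an inclusion lying over a cell of [B]. The displaced bumps vanish
    there by [detour_number], and the gap of the partition of unity is 0 because the bump of [c0] is
    1; so the straight shares removed add up to the whole window. *)
Lemma layer_crack a L d e j B x (c0 : cell) : 0 < e -> `|x 0 0 - e * j%:~R| <= e / 4 ->
  c0 \in B -> (forall l, `|x 0 (lift 0 l) - c0.1 0 (lift 0 l)| <= c0.2) ->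
  (forall c, c \in B -> 0 < c.2 <= e / 32 /\
     exists k : int, `|c.1 0 (lift 0 l0) - e * k%:~R| <= e / 4) ->
  (exists k : int, `|x 0 (lift 0 l0) - e * k%:~R| <= e / 4) ->
  layer0 a L d e j B x = - window a L d (cst 0) x /\ layer1 a L d e j B x = 0.
Proof.
move=> e0 xj c0B xc0 BP [k kx].
have z s := detour_mid s e0 xj.
rewrite /layer1 (z true).2 (z false).2 !mulr0 addr0; split => //.
have F0 s : flux a L d e B s (detour e j s) x = 0.
  rewrite /flux (_ : part _ _ _ _ = 0) ?mul0r//; apply: part_eq0 => c cB cs.
  have [/andP[r0 r1] [k' kc]] := BP c cB.
  apply/eqP; apply: contraT => /(bump_neq0 r0) /(_ l0).
  rewrite /shifted eqxx mul1r (z s).1 -{}cs /offset /rightward.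
  set X := x 0 _ in kx *; set P := c.1 0 _ in kc *.
  have PE : P = e * (P / e) by rewrite mulrC divfK// gt_eqF.
  have XE : X = e * (X / e) by rewrite mulrC divfK// gt_eqF.
  have e32 : 2 * c.2 <= e * 16^-1 by lra.
  move=> /lt_le_trans/(_ e32) h.
  have k1 : `|P / e - k'%:~R| <= 1 / 4.
    rewrite -(ler_pM2l e0) -{1}(gtr0_norm e0) -normrM mulrBr -PE.
    by apply: le_trans kc _; lra.
  have k2 : `|X / e - k%:~R| <= 1 / 4.
    rewrite -(ler_pM2l e0) -{1}(gtr0_norm e0) -normrM mulrBr -XE.
    by apply: le_trans kx _; lra.
  set p := P / e in k1 h PE *; set y := X / e in k2 XE *.
  have := detour_number k1 k2; rewrite leNgt => /negP[].
  rewrite -(ltr_pM2l e0) -{1}(gtr0_norm e0) -normrM.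
  by apply: le_lt_trans h; rewrite PE XE !mulrBr [e * (if _ then _ else _)]mulrC -!XE -!PE.
have -> : layer0 a L d e j B x =
  0 + 0 - (flux a L d e B true (cst 0) x + flux a L d e B false (cst 0) x).
  by rewrite /layer0 !F0.
rewrite addr0 sub0r /flux -mulrDl.
have := part_sum (rightward e) (bump (cst 0) ^~ x) B.
rewrite (@gap_eq0 _ _ _ _ c0)//.
  by rewrite addr0 => ->; rewrite mul1r.
have [/andP[r0 _] _] := BP c0 c0B.
by apply: bump1 => // l; rewrite /shifted mulr0 subr0.
Qed.

End layer.

Section bump_volume.
Context {R : realType} {m : nat} (l0 : 'I_m).
Local Notation cell := ('rV[R]_m.+1 * R)%type.
Implicit Types (x : 'rV[R]_m.+1) (e : R) (j : int) (c : cell).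

(** This box contains the bump of the cell within its layer, straight or displaced: the support has
    half-width [2 * c.2] and the displacement is at most [3 / 8 * e]. *)
Definition layer_lo e j c : 'rV[R]_m.+1 :=
  ins 0 (e * j%:~R - e / 2) (del 0 c.1 - const_mx (2 * c.2 + 3 / 8 * e)).
Definition layer_hi e j c : 'rV[R]_m.+1 :=
  ins 0 (e * j%:~R + e / 2) (del 0 c.1 + const_mx (2 * c.2 + 3 / 8 * e)).

Lemma layer_lo_le e j c i : 0 < e -> 0 < c.2 -> layer_lo e j c 0 i <= layer_hi e j c 0 i.
Proof.
move=> e0 r0; case: (unliftP 0 i) => [l ->|->]; rewrite /layer_lo /layer_hi.
  by rewrite !ins_lift !mxE; lra.
by rewrite !insE; lra.
Qed.

(** Displacement along [q] is a shear, so it preserves the mass of the bump. This follows from the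
    divergence theorem for [x_0 - T] times the transported field, whose divergence is the bump: it
    vanishes on the top face by the choice of [T] and on the faces in direction [l0] because of the
    supports, and on the bottom face [q = 0]. *)
Lemma bump_integral e j c (q dq ddq : R -> R) : 0 < e -> 0 < c.2 ->
  (forall t, is_derive t (1 : R) q (dq t)) -> (forall t, is_derive t (1 : R) dq (ddq t)) ->
  continuous ddq -> (forall t, `|q t| <= 3 / 8 * e) ->
  (forall t, e / 2 <= `|t - e * j%:~R| -> q t = 0) ->
  \int[leb R m.+1]_(x in box (layer_lo e j c) (layer_hi e j c)) bump l0 q c x <=
    e * (4 * c.2) ^+ m.
Proof.
move=> e0 r0 qP dqP cddq qb q0.
set lo := layer_lo e j c; set hi := layer_hi e j c.
have lohi i : lo 0 i <= hi 0 i by exact: layer_lo_le.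
have cdq : continuous dq.
  by move=> t; apply/differentiable_continuous/derivable1_diffP; have [] := dqP t.
have [dF [FC1 Ft]] : transported l0 dq (bump l0 q c) by exact: transported_plateau_prod.
pose T := hi 0 0.
have c0 := @isC1_coord R m.+1 0.
have cc0 := isC1_continuous c0.
have aC1 := isC1D c0 (isC1_cst (- T)).
have ca := isC1_continuous aC1; have cF := isC1_continuous FC1.
have f0C1 := isC1M ca cF aC1 FC1.
have dC1 := isC1_comp cc0 c0 dqP cddq.
have f1C1 := isC1M (isC1_continuous dC1) (isC1_continuous f0C1) dC1 f0C1.
have D0 := box_divergence 0 f0C1 lohi.
have D1 := box_divergence (lift 0 l0) f1C1 lohi.
have mD := @leb_box R m.+1 lo hi.
have -> : \int[leb R m.+1]_(x in box lo hi) bump l0 q c x = e * \int[leb R m]_(x in box (del 0 lo) (del 0 hi)) bump l0 q c (ins 0 (lo 0 0) x).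
  transitivity (\int[leb R m]_(x in box (del 0 lo) (del 0 hi)) (e * bump l0 q c (ins 0 (lo 0 0) x)) + 0); last first.
    rewrite addr0 RintegralZl//; first exact: leb_box.
    exact: (continuous_box_integrable _ _ (ins_continuous cF)).
  have <- : \int[leb R m]_(x in box (del (lift 0 l0) lo) (del (lift 0 l0) hi)) 0 = 0 :> R.
    by rewrite Rintegral_cst ?mul0r//; exact: leb_box.
  have F0 t (x : 'rV[R]_m) : `|t - c.1 0 (lift 0 l0)| = 2 * c.2 + 3 / 8 * e -> bump l0 q c (ins (lift 0 l0) t x) = 0.
    move=> tE; apply/eqP; apply: contraT => /(bump_neq0 r0) /(_ l0).
    rewrite /shifted eqxx mul1r insE; set y := q _ => h.
    have yb : `|y| <= 3 / 8 * e by exact: qb.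
    suff : 2 * c.2 + 3 / 8 * e < 2 * c.2 + 3 / 8 * e by rewrite ltxx.
    rewrite -{1}tE (_ : t - _ = (t - y - c.1 0 (lift 0 l0)) + y); last by ring.
    by apply: le_lt_trans (ler_normD _ _) _; rewrite ltr_leD.
  have -> : \int[leb R m]_(x in box (del (lift 0 l0) lo) (del (lift 0 l0) hi)) 0 =
      \int[leb R m]_(x in box (del (lift 0 l0) lo) (del (lift 0 l0) hi))
        (dq (ins (lift 0 l0) (hi 0 (lift 0 l0)) x 0 0) *
          ((ins (lift 0 l0) (hi 0 (lift 0 l0)) x 0 0 - T) * bump l0 q c (ins (lift 0 l0) (hi 0 (lift 0 l0)) x)) -
         dq (ins (lift 0 l0) (lo 0 (lift 0 l0)) x 0 0) *
          ((ins (lift 0 l0) (lo 0 (lift 0 l0)) x 0 0 - T) * bump l0 q c (ins (lift 0 l0) (lo 0 (lift 0 l0)) x))) :> R.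
    apply: eq_Rintegral => x _; rewrite !F0 ?mulr0 ?subr0//.
      rewrite /lo /layer_lo ins_lift !mxE addrAC subrr sub0r normrN ger0_norm//.
      by rewrite addr_ge0// mulr_ge0// ltW.
    rewrite /hi /layer_hi ins_lift !mxE addrAC subrr add0r ger0_norm//.
    by rewrite addr_ge0// mulr_ge0// ltW.
  rewrite -[X in _ = _ + X]D1.
  have -> : \int[leb R m]_(x in box (del 0 lo) (del 0 hi)) (e * bump l0 q c (ins 0 (lo 0 0) x)) =
    \int[leb R m]_(x in box (del 0 lo) (del 0 hi))
      ((ins 0 (hi 0 0) x 0 0 - T) * bump l0 q c (ins 0 (hi 0 0) x) -
       (ins 0 (lo 0 0) x 0 0 - T) * bump l0 q c (ins 0 (lo 0 0) x)).
    have eE : e = T - lo 0 0 by rewrite /T /hi /lo /layer_hi /layer_lo !insE; lra.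
    apply: eq_Rintegral => x _; rewrite (insE 0 (hi 0 0)) (insE 0 (lo 0 0)) -/T.
    by rewrite {1}eE; ring.
  rewrite -[X in _ = X + _]D0 -RintegralD//; first last.
  - by apply: continuous_box_integrable; exact: (f1C1.2 (lift 0 l0)).
  - by apply: continuous_box_integrable; exact: (f0C1.2 0).
  apply: eq_Rintegral => x _ /=; rewrite /cst.
  have := Ft x; rewrite /= !mulr0 !addr0 !mulr1 mulr0 addr0 => E.
  transitivity (bump l0 q c x + (x 0 0 - T) * (dF 0 x + dq (x 0 0) * dF (lift 0 l0) x)); last by ring.
  by rewrite E mulr0 addr0.
rewrite ler_pM2l//.
have qlo : q (lo 0 0) = 0.
  by apply: q0; rewrite /lo insE addrAC subrr sub0r normrN ger0_norm// divr_ge0// ltW.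
pose p := del 0 c.1 - const_mx (2 * c.2); pose p' := del 0 c.1 + const_mx (2 * c.2).
have pp' i : p 0 i <= p' 0 i by rewrite !mxE; lra.
have cG : continuous (fun x : 'rV[R]_m => bump l0 q c (ins 0 (lo 0 0) x)) by exact: ins_continuous.
have -> : \int[leb R m]_(x in box (del 0 lo) (del 0 hi)) bump l0 q c (ins 0 (lo 0 0) x) =
    \int[leb R m]_(x in box p p') bump l0 q c (ins 0 (lo 0 0) x).
  apply: eq_Rintegral_patch => // x.
    move=> _ nx; apply/eqP; apply: contraT => /(bump_neq0 r0) h; exfalso; apply: nx => i.
    have := h i; rewrite /shifted insE qlo mulr0 subr0 ins_lift !mxE ltr_norml => /andP[h1 h2].
    by apply/andP; split; lra.
  move=> xp nx; exfalso; apply: nx => i; have := xp i; rewrite /lo /hi /layer_lo /layer_hi.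
  by rewrite ![del _ (ins _ _ _) 0 i]mxE !ins_lift !mxE => /andP[h1 h2]; apply/andP; split; lra.
apply: (@le_trans _ _ (\int[leb R m]_(x in box p p') 1)).
  apply: le_Rintegral.
  - exact: leb_box.
  - exact: continuous_box_integrable.
  - by apply: (@continuous_box_integrable _ _ (cst 1)) => x; exact: cst_continuous.
  - by move=> x _; have /andP[] := bump_bounds l0 q c (ins 0 (lo 0 0) x).
rewrite Rintegral_cst ?mul1r; last exact: leb_box.
rewrite [X in fine X]lebesgue_outer_box//= /vol (eq_bigr (fun=> 4 * c.2)).
  by rewrite prodr_const card_ord.
by move=> i _; rewrite !mxE; lra.
Qed.

Lemma bump_cost_continuous e j c : continuous (bump_cost l0 e j c).
Proof.
have cst0 (t : R) : is_derive t (1 : R) (cst (0 : R)) (cst (0 : R) t) by exact: is_derive_cst.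
have [dF [FC1 _]] : transported l0 (ddetour e j (rightward l0 e c)) (bump l0 (detour e j (rightward l0 e c)) c).
  by apply: transported_plateau_prod; [move=> t; exact: is_derive_detour|exact: ddetour_continuous].
have [dG [GC1 _]] : transported l0 (cst 0) (bump l0 (cst 0) c).
  by apply: transported_plateau_prod => // t; exact: cst_continuous.
by move=> x; exact: (continuousD (isC1_continuous FC1 (x := x)) (isC1_continuous GC1 (x := x))).
Qed.

Lemma bump_cost_integral e j c : 0 < e -> 0 < c.2 ->
  \int[leb R m.+1]_(x in box (layer_lo e j c) (layer_hi e j c)) bump_cost l0 e j c x <=
    2 * e * (4 * c.2) ^+ m.
Proof.
move=> e0 r0; have mD := @leb_box R m.+1 (layer_lo e j c) (layer_hi e j c).
have cst0 (t : R) : is_derive t (1 : R) (cst (0 : R)) (cst (0 : R) t) by exact: is_derive_cst.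
have [dF [FC1 _]] : transported l0 (ddetour e j (rightward l0 e c)) (bump l0 (detour e j (rightward l0 e c)) c).
  by apply: transported_plateau_prod; [move=> t; exact: is_derive_detour|exact: ddetour_continuous].
have [dG [GC1 _]] : transported l0 (cst 0) (bump l0 (cst 0) c).
  by apply: transported_plateau_prod => // t; exact: cst_continuous.
rewrite RintegralD//; first last.
- by apply: continuous_box_integrable; exact: isC1_continuous GC1.
- by apply: continuous_box_integrable; exact: isC1_continuous FC1.
rewrite (_ : 2 * e * _ = e * (4 * c.2) ^+ m + e * (4 * c.2) ^+ m); last by ring.
apply: lerD.
  apply: (bump_integral e0 r0 (is_derive_detour e j _) (is_derive_ddetour e j _)).
  - exact: dddetour_continuous.
  - by move=> t; exact: (detour_bound _ _ _ e0).1.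
  - by move=> t h; exact: (detour_out _ e0 h).1.
apply: (bump_integral (ddq := cst 0) e0 r0 cst0 cst0) => //.
- exact: cst_continuous.
- by move=> t; rewrite normr0 mulr_ge0// ltW.
Qed.

End bump_volume.

Section compact_support.
Context {R : realType} {n : nat}.

Lemma C1c_cbox (U : set 'rV[R]_n.+1) phi d (a b : 'rV[R]_n.+1) : isC1 phi d -> cbox a b `<=` U ->
  (forall x, phi x != 0 -> cbox a b x) -> C1c U phi /\ (fun i => partial i phi) = d.
Proof.
move=> phiC1 abU phi0; have [dphi cd] := phiC1.
have dE : (fun i => partial i phi) = d.
  by apply/funext => i; apply/funext => x; have [_ h] := dphi i x; exact: h.
have cab : closed (cbox a b) by apply: compact_closed; [exact: norm_hausdorff|exact: compact_cbox].
have sub : closure [set x | phi x != 0] `<=` cbox a b.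
  by rewrite [X in _ `<=` X]((closure_id _).1 cab); apply: closureS => x; exact: phi0.
split => //; split.
- by move=> i x; have [] := dphi i x.
- by move=> i; rewrite (congr1 (@^~ i) dE); exact: cd.
- by apply: subclosed_compact sub; [exact: closed_closure|exact: compact_cbox].
- by move=> x /sub/abU.
Qed.

End compact_support.

Section perforations.
Context {R : realType} {n : nat}.
Implicit Types (x : 'rV[R]_n.+1) (e : R).

Definition inclusion e x := exists k : 'I_n.+1 -> int, forall i, `|x 0 i - e * (k i)%:~R| <= e / 4.

Lemma not_dilated e x : 0 < e -> ~ dilated e x -> inclusion e x.
Proof.
move=> e0 nx; pose y := e^-1 *: x.
have xy : x = e *: y by rewrite scalerA divff ?scale1r// gt_eqF.
have : ~ perforated y by move=> py; apply: nx; exists y.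
move=> /contrapT[k _ [z zc zy]]; exists (k 0) => i.
have cz : cbox (const_mx (- (1 / 4))) (const_mx (1 / 4)) z.
  have cc : closed (cbox (const_mx (- (1 / 4))) (const_mx (1 / 4) : 'rV[R]_n.+1)).
    by apply: compact_closed; [exact: norm_hausdorff|exact: compact_cbox].
  rewrite ((closure_id _).1 cc); apply: closureS zc => t tc j.
  by rewrite !mxE; have /andP[h1 h2] := tc j; apply/andP; split; lra.
rewrite xy mxE -zy !mxE mulrDr addrAC subrr add0r normrM (gtr0_norm e0) ler_pM2l//.
by have := cz i; rewrite !mxE -ler_norml => h; apply: le_trans h _; lra.
Qed.

(** Hence the divergence of the test field lives in the perforated set, the only place where
    convergence gives information. *)
Lemma dstair_dilated e x : 0 < e -> dstair (x 0 0 / e) != 0 -> dilated e x.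
Proof.
move=> e0 sx; apply: contrapT => /(not_dilated e0)[k kx]; move/negP: sx; apply; apply/eqP.
have [] := @stair_flat R (k 0) (x 0 0 / e); last by [].
rewrite -(ler_pM2l e0) -{1}(gtr0_norm e0) -normrM mulrBr mulrC divfK ?gt_eqF//.
by apply: le_trans (kx 0) _; lra.
Qed.

End perforations.

(** * The test field on a whole cube *)

Section total_field.
Context {R : realType} {m : nat} (l0 : 'I_m).
Local Notation cell := ('rV[R]_m.+1 * R)%type.
Context (a : 'rV[R]_m.+1) (L d e : R) (B : seq cell).
Hypotheses (d_gt0 : 0 < d) (e_gt0 : 0 < e) (ed : e <= d / 2).
Hypothesis BP : forall c, c \in B -> 0 < c.2 <= e / 32 /\ inclusion e c.1.
Implicit Types (x : 'rV[R]_m.+1) (j : int) (c : cell).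

(** Rounding to the nearest integer. The cells of one layer share one partition of unity. *)
Definition cell_layer c : int := Num.floor (c.1 0 0 / e + 1 / 2).
Definition layer_cells j := [seq c <- B | cell_layer c == j].
Definition layers := undup [seq cell_layer c | c <- B].

Definition cutoff (t : R) : R := plateau d^-1 (L / (2 * d) - 1) (a 0 0 + L / 2) t.
Definition dcutoff (t : R) : R := dplateau d^-1 (L / (2 * d) - 1) (a 0 0 + L / 2) t.

(* The staircase keeps the divergence of this field away from the inclusions. *)
Definition sigma0 x : R := cutoff (e * stair (e^-1 * x 0 0)) * window l0 a L d (cst 0) x.
Definition divsigma x : R := dcutoff (e * stair (e^-1 * x 0 0)) * dstair (e^-1 * x 0 0) *
  window l0 a L d (cst 0) x.

Definition psi0 x : R := \sum_(j <- layers) cutoff (e * j%:~R) * layer0 l0 a L d e j (layer_cells j) x.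
Definition psi1 x : R := \sum_(j <- layers) cutoff (e * j%:~R) * layer1 l0 a L d e j (layer_cells j) x.

(** The indicator is needed because the straight bump is a tube crossing every layer, while the cell
    affects the field in its own layer only. *)
Definition cell_cost c x : R :=
  (x \in box (layer_lo e (cell_layer c) c) (layer_hi e (cell_layer c) c))%:R *
  bump_cost l0 e (cell_layer c) c x.

Lemma cutoff_bounds t : 0 <= cutoff t <= 1. Proof. exact: plateau_bounds. Qed.

Lemma cutoff_neq0 t : cutoff t != 0 -> a 0 0 + d < t < a 0 0 + L - d.
Proof.
rewrite /cutoff => bx.
have : `|t - (a 0 0 + L / 2)| < L / 2 - d.
  rewrite ltNge; apply/negP => h; move/negP: bx; apply.
  apply/eqP; rewrite (plateau0 _ _).1 ?mul0r// ?invr_ge0 ?(ltW d_gt0)//.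
  rewrite ler_pdivlMl// (_ : d * _ = L / 2 - d)//; field; exact: lt0r_neq0.
by rewrite ltr_norml => /andP[h1 h2]; apply/andP; split; lra.
Qed.

Lemma cutoff1 t : a 0 0 + 2 * d <= t <= a 0 0 + L - 2 * d -> cutoff t = 1.
Proof.
move=> /andP[h1 h2]; rewrite /cutoff (plateau1 _ _).1 ?invr_ge0 ?(ltW d_gt0)//.
rewrite ler_pdivrMl// (_ : d * _ = L / 2 - 2 * d); last by field; exact: lt0r_neq0.
by rewrite ler_norml; apply/andP; split; lra.
Qed.

Lemma field_isC1 : exists (d0 d1 : 'I_m.+1 -> 'rV[R]_m.+1 -> R),
  [/\ isC1 (fun x => sigma0 x + psi0 x) d0, isC1 psi1 d1 &
   forall x, d0 0 x + d1 (lift 0 l0) x = divsigma x].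
Proof.
have cst0 (t : R) : is_derive t (1 : R) (cst (0 : R)) (cst (0 : R) t) by exact: is_derive_cst.
have [dW [WC1 W0]] : transported l0 (cst 0) (window l0 a L d (cst 0)).
  by apply: transported_plateau_prod => // t; exact: cst_continuous.
have gP (t : R) : is_derive t (1 : R) (fun t => cutoff (e * stair t)) (dcutoff (e * stair t) * (e * dstair t)).
  apply: (@is_derive1_comp R cutoff (fun t => e * stair t)).
    exact: is_derive_plateau.
  exact: is_derive_scale (is_derive_stair t).
have cdg : continuous (fun t => dcutoff (e * stair t) * (e * dstair t)).
  move=> t; apply: (@continuousM _ _ (fun t => dcutoff (e * stair t)) (fun t => e * dstair t)).
    apply: (continuous_comp (f := fun t => e * stair t)); last exact: dplateau_continuous.
    by apply: continuous_scale; exact: stair_continuous.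
  by apply: continuous_scale; exact: dstair_continuous.
have sC1 := @isC1_scaled_coord R m _ _ e^-1 0 0 gP cdg.
have s0C1 := isC1M (isC1_continuous sC1) (isC1_continuous WC1) sC1 WC1.
have [p0 [p1 [p0C1 p1C1 pE]]] : exists (d0 d1 : 'I_m.+1 -> 'rV[R]_m.+1 -> R),
    [/\ isC1 psi0 d0, isC1 psi1 d1 & forall x, d0 0 x + d1 (lift 0 l0) x = 0].
  rewrite /psi0 /psi1; elim: layers => [|j s [p0 [p1 [p0C1 p1C1 pE]]]].
    exists (fun _ => cst 0), (fun _ => cst 0); split; last by move=> x; rewrite addr0.
      by rewrite (_ : (fun x => _) = cst 0); [exact: isC1_cst|apply/funext => x; rewrite big_nil].
    by rewrite (_ : (fun x => _) = cst 0); [exact: isC1_cst|apply/funext => x; rewrite big_nil].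
  have [y0 [y1 [y0C1 y1C1 yE]]] := layer_isC1 l0 a L d e j (layer_cells j).
  pose k := cutoff (e * j%:~R).
  have z0C1 := isC1M (@cst_continuous _ _ k) (isC1_continuous y0C1) (isC1_cst k) y0C1.
  have z1C1 := isC1M (@cst_continuous _ _ k) (isC1_continuous y1C1) (isC1_cst k) y1C1.
  eexists; eexists; split.
  - rewrite (_ : (fun x => _) = (fun x => cst k x * layer0 l0 a L d e j (layer_cells j) x +
      \sum_(j <- s) cutoff (e * j%:~R) * layer0 l0 a L d e j (layer_cells j) x)).
      exact: isC1D z0C1 p0C1.
    by apply/funext => x; rewrite big_cons.
  - rewrite (_ : (fun x => _) = (fun x => cst k x * layer1 l0 a L d e j (layer_cells j) x +
      \sum_(j <- s) cutoff (e * j%:~R) * layer1 l0 a L d e j (layer_cells j) x)).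
      exact: isC1D z1C1 p1C1.
    by apply/funext => x; rewrite big_cons.
  - move=> x /=; rewrite !mulr0 !addr0 addrACA -mulrDr yE pE mulr0 addr0//.
eexists; exists p1; split; [|exact: p1C1|].
  rewrite (_ : (fun x => _) = (fun x => cutoff (e * stair (e^-1 * x 0 0 + 0)) *
    window l0 a L d (cst 0) x + psi0 x)); first exact: isC1D s0C1 p0C1.
  by apply/funext => x; rewrite addr0.
move=> x /=; rewrite -addrA pE !addr0 mulr1.
have := W0 x; rewrite mul0r addr0 => ->.
by rewrite mulr0 add0r /divsigma; field; exact: lt0r_neq0.
Qed.

Lemma sum_single (s : seq int) (F : int -> R) j : uniq s -> (forall i, i != j -> F i = 0) ->
  \sum_(i <- s) F i = if j \in s then F j else 0.
Proof.
move=> us F0; case: ifPn => js.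
  by rewrite (bigD1_seq j)//= big1 ?addr0.
by rewrite big1_seq// => i /andP[_ is_]; apply: F0; apply: contraNneq js => <-.
Qed.

Lemma layer_far j x : j != Num.floor (x 0 0 / e + 1 / 2) -> e / 2 <= `|x 0 0 - e * j%:~R|.
Proof.
move=> jx; rewrite leNgt; apply/negP => h; move/negP: jx; apply; apply/eqP/esym/floor_def.
have : `|x 0 0 / e - j%:~R| < 1 / 2.
  rewrite -(ltr_pM2l e_gt0) -{1}(gtr0_norm e_gt0) -normrM mulrBr mulrC divfK ?gt_eqF//.
  by apply: lt_le_trans h _; lra.
by rewrite intrD ltr_norml => /andP[h1 h2]; apply/andP; split; lra.
Qed.

(** At each point at most the nearest layer is active, so bounds for one layer hold for the sum. *)
Lemma psiE x (j := Num.floor (x 0 0 / e + 1 / 2)) :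
  psi0 x = (if j \in layers then cutoff (e * j%:~R) * layer0 l0 a L d e j (layer_cells j) x else 0) /\
  psi1 x = (if j \in layers then cutoff (e * j%:~R) * layer1 l0 a L d e j (layer_cells j) x else 0).
Proof.
split; apply: sum_single; rewrite ?undup_uniq// => i ij.
  by rewrite (layer_out l0 a L d (layer_cells i) e_gt0 (layer_far ij)).1 mulr0.
by rewrite (layer_out l0 a L d (layer_cells i) e_gt0 (layer_far ij)).2 mulr0.
Qed.

Lemma psi_bounds x : `|psi0 x| <= 9 /\ `|psi1 x| <= 9.
Proof.
have [-> ->] := psiE x; set j := Num.floor _; case: ifP => _; last by rewrite normr0.
have [b0 b1] := layer_bounds l0 a L d j (layer_cells j) x e_gt0.
have /andP[k0 k1] := cutoff_bounds (e * j%:~R).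
by split; rewrite normrM (ger0_norm k0); [apply: le_trans b0|apply: le_trans b1]; rewrite ler_piMl.
Qed.

Lemma cell_cost_ge0 c x : 0 <= cell_cost c x.
Proof.
rewrite /cell_cost mulr_ge0// /bump_cost.
have /andP[h _] := bump_bounds l0 (detour e (cell_layer c) (rightward l0 e c)) c x.
by have /andP[h' _] := bump_bounds l0 (cst 0) c x; rewrite addr_ge0.
Qed.

Lemma strip_mem x (j := Num.floor (x 0 0 / e + 1 / 2)) :
  e * j%:~R - e / 2 <= x 0 0 < e * j%:~R + e / 2.
Proof.
have := floor_le_tmp (x 0 0 / e + 1 / 2); have := floorD1_gt (x 0 0 / e + 1 / 2).
rewrite -/j intrD => h1 h2.
have -> : x 0 0 = e * (x 0 0 / e) by rewrite mulrC divfK// gt_eqF.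
have h1' : e * (x 0 0 / e + 1 / 2) < e * (j%:~R + 1) by rewrite ltr_pM2l.
have h2' : e * j%:~R <= e * (x 0 0 / e + 1 / 2) by rewrite ler_pM2l.
by move: h1' h2'; rewrite !mulrDr mulr1 => h1' h2'; apply/andP; split; lra.
Qed.

Lemma cell_costE c x : 0 < c.2 -> cell_layer c = Num.floor (x 0 0 / e + 1 / 2) ->
  cell_cost c x = bump_cost l0 e (cell_layer c) c x.
Proof.
move=> r0 cx; rewrite /cell_cost; case: (boolP (x \in _)) => [_|xD]; first by rewrite mul1r.
rewrite mul0r /bump_cost.
have z q : (forall t, `|q t| <= 3 / 8 * e) -> bump l0 q c x = 0.
  move=> qb; apply/eqP; apply: contraNT xD => /(bump_neq0 r0) h; apply/mem_set => i.
  case: (unliftP 0 i) => [l ->|->]; rewrite /layer_lo /layer_hi; last first.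
    by rewrite !insE cx; exact: strip_mem.
  rewrite !ins_lift !mxE.
  have := h l; rewrite /shifted ltr_norml => /andP[h1 h2]; have := qb (x 0 0).
  rewrite ler_norml => /andP[q1 q2]; move: h1 h2.
  by case: (l == l0); rewrite /= ?mulr1n ?mulr0n ?mul1r ?mul0r => h1 h2; apply/andP; split; lra.
rewrite !z ?addr0// => t; first by rewrite normr0 mulr_ge0// ltW.
exact: (detour_bound _ _ _ e_gt0).1.
Qed.

Lemma psi_le_cost x : `|psi0 x| <= 9 * \sum_(c <- B) cell_cost c x /\
  `|psi1 x| <= 9 * \sum_(c <- B) cell_cost c x.
Proof.
have S0 : 0 <= 9 * \sum_(c <- B) cell_cost c x.
  by rewrite mulr_ge0// sumr_ge0// => c _; exact: cell_cost_ge0.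
have [-> ->] := psiE x; set j := Num.floor _; case: ifP => _; last by rewrite normr0.
have [b0 b1] := layer_le_cost l0 a L d j (layer_cells j) x e_gt0.
have /andP[k0 k1] := cutoff_bounds (e * j%:~R).
have rowE : \sum_(c <- layer_cells j) bump_cost l0 e j c x <= \sum_(c <- B) cell_cost c x.
  rewrite /layer_cells big_filter [leLHS]big_mkcond [leLHS]big_seq [leRHS]big_seq.
  apply: ler_sum => c cB; case: eqP => [cj|_]; last exact: cell_cost_ge0.
  have [/andP[r0 _] _] := BP cB.
  by rewrite cell_costE// cj.
split; rewrite normrM (ger0_norm k0).
  apply: (@le_trans _ _ `|layer0 l0 a L d e j (layer_cells j) x|); first by rewrite ler_piMl.
  by apply: le_trans b0 _; rewrite ler_pM2l.
apply: (@le_trans _ _ `|layer1 l0 a L d e j (layer_cells j) x|); first by rewrite ler_piMl.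
by apply: le_trans b1 _; rewrite ler_pM2l.
Qed.

Lemma sigma0_bounds x : 0 <= sigma0 x <= 1.
Proof.
have /andP[h1 h2] := cutoff_bounds (e * stair (e^-1 * x 0 0)).
have /andP[h3 h4] := window_bounds l0 a L d (cst 0) x.
by rewrite /sigma0 mulr_ge0//= mulr_ile1.
Qed.

Lemma stair_dist x : `|e * stair (e^-1 * x 0 0) - x 0 0| <= e.
Proof.
have [h _ _] := stair_bounds (e^-1 * x 0 0).
have {2}-> : x 0 0 = e * (e^-1 * x 0 0) by rewrite mulrA divff ?mul1r// gt_eqF.
by rewrite -mulrBr normrM (gtr0_norm e_gt0) ler_piMr// ltW.
Qed.

(** The cutoffs need a margin [2 * d]; a further [d] compensates the shift of [x_0] by the
    staircase, which is at most [e]. *)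
Lemma sigma0_eq1 x : (forall i, a 0 i + 3 * d <= x 0 i <= a 0 i + L - 3 * d) -> sigma0 x = 1.
Proof.
have [d0 e0 ed'] := And3 d_gt0 e_gt0 ed; move=> h; rewrite /sigma0 cutoff1 ?window1 ?mulr1// => [l|].
  by rewrite /shifted mulr0 subr0; have /andP[h1 h2] := h (lift 0 l); apply/andP; split; lra.
have := stair_dist x; rewrite ler_norml => /andP[h1 h2]; have /andP[h3 h4] := h 0.
by apply/andP; split; lra.
Qed.

(** The cutoffs leave a margin [d], of which displacements, staircase and layer thickness use at
    most [e <= d / 2]. *)
Lemma field_support x : (sigma0 x + psi0 x != 0) || (psi1 x != 0) ->
  cbox (a + const_mx (d / 2)) (a + const_mx (L - d / 2)) x.
Proof.
have [d0 e0 ed'] := And3 d_gt0 e_gt0 ed.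
have W q : `|q (x 0 0)| <= 3 / 8 * e -> window l0 a L d q x != 0 ->
    forall l, a 0 (lift 0 l) + d / 2 <= x 0 (lift 0 l) <= a 0 (lift 0 l) + L - d / 2.
  move=> qb /(window_neq0 d_gt0) h l; have := h l; rewrite /shifted.
  move: qb; rewrite ler_norml => /andP[q1 q2] /andP[].
  by case: (l == l0); rewrite /= ?mulr1n ?mulr0n ?mul1r ?mul0r => h1 h2; apply/andP; split; lra.
have C0 : a 0 0 + d / 2 <= x 0 0 <= a 0 0 + L - d / 2 ->
   (forall l, a 0 (lift 0 l) + d / 2 <= x 0 (lift 0 l) <= a 0 (lift 0 l) + L - d / 2) ->
   cbox (a + const_mx (d / 2)) (a + const_mx (L - d / 2)) x.
  move=> h0 hl i; rewrite !mxE; case: (unliftP 0 i) => [l ->|->]; last by rewrite addrA.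
  by rewrite addrA.
have e38 : 0 <= 3 / 8 * e by rewrite mulr_ge0// ltW.
have [s0|s0] := eqVneq (sigma0 x) 0; last first.
  move=> _; move: s0; rewrite /sigma0 mulf_eq0 negb_or => /andP[/cutoff_neq0 c0 /W w0].
  apply: C0; last by apply: w0; rewrite normr0.
  have := stair_dist x; rewrite ler_norml => /andP[h1 h2]; move/andP: c0 => [h3 h4].
  by apply/andP; split; lra.
rewrite s0 add0r; have [-> ->] := psiE x; set j := Num.floor _; case: ifP => _; last by rewrite eqxx.
have [k0|k0] := eqVneq (cutoff (e * j%:~R)) 0; first by rewrite k0 !mul0r eqxx.
move=> h; apply: C0.
  move/cutoff_neq0/andP : k0 => [h1 h2]; have /andP[h3 h4] := strip_mem x.
  by rewrite -/j in h3 h4; apply/andP; split; lra.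
have [w|] := pselect (exists q, `|q (x 0 0)| <= 3 / 8 * e /\ window l0 a L d q x != 0).
  by case: w => q [qb] /W; apply.
move=> /forallNP nw; exfalso.
have z q : `|q (x 0 0)| <= 3 / 8 * e -> window l0 a L d q x = 0.
  by move=> qb; have [//|w] := eqVneq (window l0 a L d q x) 0; case: (nw q).
have zd s : window l0 a L d (detour e j s) x = 0 by apply: z; exact: (detour_bound _ _ _ e_gt0).1.
have z0 : window l0 a L d (cst 0) x = 0 by apply: z; rewrite normr0.
by move: h; rewrite /layer0 /layer1 /flux !zd !z0 !mulr0 !mul0r !addr0 subr0 mulr0 eqxx.
Qed.

(** In the middle of the layer [j] the staircase is constant, so [sigma0] equals [cutoff (e j)]
    times the window exactly. The layer fields carry the same constant factor, and the cancellation
    is exact. *)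
Lemma field_crack x c : c \in B -> inclusion e x ->
  box (c.1 - const_mx c.2) (c.1 + const_mx c.2) x ->
  sigma0 x + psi0 x = 0 /\ psi1 x = 0.
Proof.
move=> cB [k kx] xc; have [/andP[r0 r1] [k' k'c]] := BP cB.
have xci i : `|x 0 i - c.1 0 i| <= c.2.
  by have := xc i; rewrite !mxE ler_norml => /andP[h1 h2]; apply/andP; split; lra.
have near (z : R) i : `|z - e * i%:~R| < e / 2 -> Num.floor (z / e + 1 / 2) = i.
  move=> h; apply/floor_def; have : `|z / e - i%:~R| < 1 / 2.
    rewrite -(ltr_pM2l e_gt0) -{1}(gtr0_norm e_gt0) -normrM mulrBr mulrC divfK ?gt_eqF//.
    by apply: lt_le_trans h _; lra.
  by rewrite intrD ltr_norml => /andP[h1 h2]; apply/andP; split; lra.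
have jx : Num.floor (x 0 0 / e + 1 / 2) = k 0.
  by apply: near; apply: le_lt_trans (kx 0) _; lra.
have jc : cell_layer c = k 0.
  apply: near; have := kx 0; have := xci 0; rewrite !ler_norml ltr_norml => /andP[h1 h2] /andP[h3 h4].
  by apply/andP; split; lra.
have kl : k 0 \in layers by rewrite mem_undup -jc map_f.
have [-> ->] := psiE x; rewrite jx kl.
have cr : c \in layer_cells (k 0) by rewrite mem_filter jc eqxx.
have [] := @layer_crack R m l0 a L d e (k 0) (layer_cells (k 0)) x c e_gt0 (kx 0) cr.
- by move=> l; exact: xci.
- move=> c'; rewrite mem_filter => /andP[_ c'B]; have [h [k'' k''P]] := BP c'B.
  by split => //; exists (k'' (lift 0 l0)).
- by exists (k (lift 0 l0)).
move=> -> ->; rewrite mulr0; split => //; rewrite /sigma0.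
have [|-> _ _] := @stair_flat R (k 0) (e^-1 * x 0 0).
  rewrite -(ler_pM2l e_gt0) -{1}(gtr0_norm e_gt0) -normrM mulrBr mulrA divff ?gt_eqF// !mul1r.
  by apply: le_trans (kx 0) _; lra.
by rewrite mulrN subrr.
Qed.

End total_field.

(** * The energy estimate for small gradients *)

Section energy_estimate.
Context {R : realType} {m : nat} (l0 : 'I_m).
Local Notation cell := ('rV[R]_m.+1 * R)%type.
Local Notation mu := (leb R m.+1).
Local Notation hm := (haus R m.+1 m).
Local Notation H := (@hausdorff_outer R m.+1 m).
Implicit Types (x : 'rV[R]_m.+1) (v w : 'rV[R]_m.+1 -> R).

Lemma integrable_continuousM (U : set 'rV[R]_m.+1) v (g : 'rV[R]_m.+1 -> R) : open U -> bounded_set U ->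
  mu.-integrable U (EFin \o v) -> continuous g ->
  mu.-integrable U (EFin \o (fun x => v x * g x)).
Proof.
move=> oU bU iv cg; have [b b0 Ub] := bounded_setP bU.
have [M M0 gM] := continuous_cbox_bounded (const_mx (- b)) (const_mx b) cg.
have mg : measurable_fun (U : set (caratheodory_type (@lebesgue_outer R m.+1))) g.
  by apply/measurable_EFinP; exact: measurable_int (continuous_bounded_integrable oU bU cg).
apply: (@integrableMl _ _ _ mu U (leb_open oU) (EFin \o v) g iv mg).
exists M; split; first exact: num_real.
move=> M' MM' x Ux /=; apply: le_trans (ltW MM'); apply: gM => i; rewrite !mxE.
by have := Ub x Ux i; rewrite ltr_norml => /andP[/ltW-> /ltW->].
Qed.

Context (a : 'rV[R]_m.+1) (L d e : R) (B : seq cell).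
Hypotheses (d_gt0 : 0 < d) (e_gt0 : 0 < e) (ed : e <= d / 2).
Hypothesis BP : forall c, c \in B -> 0 < c.2 <= e / 32 /\ inclusion e c.1.
Let U := open_cube a L.
Hypothesis bU : bounded_set U.
Let oU : open U. Proof. exact: open_open_cube. Qed.
Let mU : measurable (U : set (caratheodory_type (@lebesgue_outer R m.+1))).
Proof. exact: leb_open. Qed.

Local Notation sigma := (sigma0 l0 a L d e).
Local Notation dsigma := (divsigma l0 a L d e).
Local Notation ps0 := (psi0 l0 a L d e B).
Local Notation ps1 := (psi1 l0 a L d e B).
Local Notation phi0 := (fun x => sigma x + ps0 x).

Definition jump_flux (phi : 'rV[R]_m.+1 -> R) w i : R :=
  \int[hm]_(x in disc w `&` U) (phi x * (jump w x * normal w x 0 i)).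

Lemma cbox_open_cube : cbox (a + const_mx (d / 2)) (a + const_mx (L - d / 2)) `<=` U.
Proof.
have d0 := d_gt0; move=> x xc i; have := xc i; rewrite !mxE => /andP[h1 h2].
by apply/andP; split; lra.
Qed.

(** Integration by parts for the two components of the field. Their sum involves only the
    divergence, which does not depend on the cells in [B]. *)
Lemma field_identity w : SBV U w ->
  \int[mu]_(x in U) (w x * dsigma x) =
  - (\int[mu]_(x in U) (phi0 x * ap_grad w x 0 0) +
     \int[mu]_(x in U) (ps1 x * ap_grad w x 0 (lift 0 l0))) -
  (jump_flux phi0 w 0 + jump_flux ps1 w (lift 0 l0)).
Proof.
move=> [[wL1 _] gL1 _ parts].
have [d0 [d1 [C0 C1 dE]]] := field_isC1 l0 a L d B e_gt0.
have supp := @field_support _ _ l0 a L d e B d_gt0 e_gt0 ed.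
have [c0 p0] : C1c U phi0 /\ (fun i => partial i phi0) = d0.
  by apply: (C1c_cbox C0 cbox_open_cube) => x h; apply: supp; rewrite h.
have [c1 p1] : C1c U ps1 /\ (fun i => partial i ps1) = d1.
  by apply: (C1c_cbox C1 cbox_open_cube) => x h; apply: supp; rewrite h orbT.
have E0 := parts 0 _ c0; have E1 := parts (lift 0 l0) _ c1.
rewrite (congr1 (@^~ 0) p0) in E0; rewrite (congr1 (@^~ (lift 0 l0)) p1) in E1.
rewrite /jump_flux; transitivity (\int[mu]_(x in U) (w x * d0 0 x) +
   \int[mu]_(x in U) (w x * d1 (lift 0 l0) x)); last first.
  by rewrite E0 E1; ring.
rewrite -RintegralD//.
- by apply: eq_Rintegral => x _; rewrite -mulrDr dE.
- by apply: integrable_continuousM => //; exact: (C0.2 0).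
- by apply: integrable_continuousM => //; exact: (C1.2 (lift 0 l0)).
Qed.

Lemma phi0_bound x : `|phi0 x| <= 10.
Proof.
have [h _] := psi_bounds l0 a L d B e_gt0 x; have /andP[s0 s1] := sigma0_bounds l0 a L d e x.
by apply: le_trans (ler_normD _ _) _; rewrite (ger0_norm s0); lra.
Qed.

(** The part of the discontinuity set where the field need not vanish. *)
Definition uncovered w := (disc w `&` (U `&` dilated e)) `|`
  ((disc w `&` (U `\` dilated e)) `\` [set x | exists2 c, c \in B &
       box (c.1 - const_mx c.2) (c.1 + const_mx c.2) x]).

(** The field is at most 10 and the jump at most 2, whence the factor 20. *)
Lemma jump_flux_bound w : (forall x, -1 <= w x <= 1) -> (H (uncovered w) < +oo)%E ->
  `|jump_flux phi0 w 0| <= 20 * fine (H (uncovered w)) /\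
  `|jump_flux ps1 w (lift 0 l0)| <= 20 * fine (H (uncovered w)).
Proof.
move=> w1 fin.
have Z x : (disc w `&` U) x -> ~ uncovered w x -> phi0 x = 0 /\ ps1 x = 0.
  move=> [dx Ux] nX.
  have nP : ~ dilated e x by move=> Px; apply: nX; left.
  have [[c cB cx]|nc] := pselect (exists2 c, c \in B & box (c.1 - const_mx c.2) (c.1 + const_mx c.2) x).
    exact: (field_crack l0 a L d e_gt0 BP cB (not_dilated e_gt0 nP) cx).
  by exfalso; apply: nX; right.
have J x i : (disc w `&` U) x -> `|jump w x * normal w x 0 i| <= 2.
  move=> [dx _]; rewrite normrM; have /andP[j0 j1] := jump_truncate_bound w1 dx.
  rewrite (ger0_norm j0); have := normal_le1 w x i; set r := `|_|.
  by move=> r1; apply: (@le_trans _ _ (jump w x)); [rewrite ler_piMr|lra].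
split; apply: Rintegral_le_outer => // x Dx.
- rewrite normrM (_ : 20 = 10 * 2); last by ring.
  by apply: ler_pM => //; [exact: phi0_bound|exact: J].
- by move=> /(Z x Dx)[-> _]; rewrite mul0r.
- rewrite normrM (_ : 20 = 10 * 2); last by ring.
  apply: ler_pM => //; last exact: J.
  by have [_ h] := psi_bounds l0 a L d B e_gt0 x; lra.
- by move=> /(Z x Dx)[_ ->]; rewrite mul0r.
Qed.

Lemma cell_cost_integrable c : mu.-integrable U (EFin \o cell_cost l0 e c).
Proof.
have mD := @leb_box R m.+1 (layer_lo e (cell_layer e c) c) (layer_hi e (cell_layer e c) c).
have iG := continuous_bounded_integrable oU bU (@bump_cost_continuous _ _ l0 e (cell_layer e c) c).
apply: le_integrable (iG) => //.
- apply/measurable_EFinP; apply: measurable_funM.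
    exact: (measurable_indic (mD)).
  by apply/measurable_EFinP; exact: measurable_int iG.
- move=> x _; rewrite /= lee_fin normrM ler_piMl//.
  by case: (_ \in _); rewrite ?normr1 ?normr0.
Qed.

Lemma cell_cost_integral c : c \in B ->
  \int[mu]_(x in U) cell_cost l0 e c x <= 2 * e * (4 * c.2) ^+ m.
Proof.
move=> cB; have [/andP[r0 _] _] := BP cB.
apply: le_trans (bump_cost_integral l0 (cell_layer e c) e_gt0 r0).
set D := box _ _; have mD : measurable (D : set (caratheodory_type (@lebesgue_outer R m.+1))) by exact: leb_box.
have iG : mu.-integrable D (EFin \o bump_cost l0 e (cell_layer e c) c).
  by apply: continuous_box_integrable; exact: bump_cost_continuous.
have b0 x : 0 <= bump_cost l0 e (cell_layer e c) c x.
  rewrite /bump_cost.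
  have /andP[h _] := bump_bounds l0 (detour e (cell_layer e c) (rightward l0 e c)) c x.
  by have /andP[h' _] := bump_bounds l0 (cst 0) c x; rewrite addr_ge0.
apply: fine_le.
- by apply: integrable_fin_num => //; exact: cell_cost_integrable.
- exact: integrable_fin_num.
have -> : (\int[mu]_(x in U) (cell_cost l0 e c x)%:E = \int[mu]_(x in U `&` D) (bump_cost l0 e (cell_layer e c) c x)%:E)%E.
  apply: eq_integral_patch => x.
  - by move=> Ux [_ Dx]; rewrite /cell_cost -/D (mem_set Dx) mul1r.
  - move=> Ux nD; rewrite /cell_cost -/D memNset ?mul0r// => Dx; exact: nD.
  - by move=> [].
apply: ge0_subset_integral.
- by apply: measurableI; [exact: mU|exact: mD].
- exact: mD.
- exact: measurable_int iG.
- by move=> x _; rewrite lee_fin.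
- exact: subIsetr.
Qed.

(** Young's inequality with two weights. The straight part is compared with the slope,
    [2 t sigma g <= g^2 + t^2]. The correction is of order 1 but supported on a small set, so it is
    split as [2 t psi g <= t (g^2 + psi^2)]; each [psi^2] is at most 81 times the cost, which gives
    162 for two components. *)
Lemma young_field (t : R) (g : 'rV[R]_m.+1) x : 0 < t ->
  2 * t * (phi0 x * g 0 0 + ps1 x * g 0 (lift 0 l0)) <=
  (1 + t) * enorm g ^+ 2 + t ^+ 2 + 162 * t * \sum_(c <- B) cell_cost l0 e c x.
Proof.
move=> t0; have /andP[s0 s1] := sigma0_bounds l0 a L d e x.
have [b0 b1] := psi_bounds l0 a L d B e_gt0 x.
have [c0 c1] := psi_le_cost l0 a L d e_gt0 BP x.
have g2 : g 0 0 ^+ 2 + g 0 (lift 0 l0) ^+ 2 <= enorm g ^+ 2.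
  rewrite enorm2 /dot (bigD1 0)//= (bigD1 (lift 0 l0))//= addrA -!expr2 lerDl.
  by apply: sumr_ge0 => i _; rewrite -expr2 sqr_ge0.
have sq (p : R) : `|p| <= 9 -> `|p| <= 9 * \sum_(c <- B) cell_cost l0 e c x ->
    p ^+ 2 <= 81 * \sum_(c <- B) cell_cost l0 e c x.
  move=> p1 p2; rewrite -[p ^+ 2]real_normK ?num_real// expr2 (_ : 81 = 9 * 9); last by ring.
  by rewrite -mulrA; apply: ler_pM.
have q0 := sq _ b0 c0; have q1 := sq _ b1 c1.
set S := \sum_(c <- B) _ in q0 q1 *; set P0 := ps0 x in q0 *; set P1 := ps1 x in q1 *.
set s := sigma x in s0 s1 *; set g0 := g 0 0 in g2 *; set g1 := g 0 _ in g2 *; set E := enorm g ^+ 2 in g2 *.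
clearbody S P0 P1 s g0 g1 E.
have A1 : 2 * t * (s * g0) <= g0 ^+ 2 + t ^+ 2.
  have : 0 <= (g0 - t * s) ^+ 2 by exact: sqr_ge0.
  have : t ^+ 2 * s ^+ 2 <= t ^+ 2 by rewrite ler_piMr ?sqr_ge0// expr_le1.
  by lra.
have A2 : 2 * (P0 * g0) <= g0 ^+ 2 + P0 ^+ 2 by have : 0 <= (g0 - P0) ^+ 2 by [exact: sqr_ge0]; lra.
have A3 : 2 * (P1 * g1) <= g1 ^+ 2 + P1 ^+ 2 by have : 0 <= (g1 - P1) ^+ 2 by [exact: sqr_ge0]; lra.
have A4 : t * (2 * (P0 * g0) + 2 * (P1 * g1)) <= t * (E + 162 * S).
  by rewrite ler_pM2l//; lra.
have g1s : 0 <= g1 ^+ 2 by exact: sqr_ge0.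
by lra.
Qed.

End energy_estimate.

Section key_estimate.
Context {R : realType} {m : nat} (l0 : 'I_m).
Local Notation cell := ('rV[R]_m.+1 * R)%type.
Local Notation mu := (leb R m.+1).
Local Notation H := (@hausdorff_outer R m.+1 m).
Implicit Types (x : 'rV[R]_m.+1) (v w : 'rV[R]_m.+1 -> R).

Lemma enorm_grad_measurable (U : set 'rV[R]_m.+1) w :
  (forall i, measurable_fun (U : set (caratheodory_type (@lebesgue_outer R m.+1)))
     (fun x => ap_grad w x 0 i)) ->
  measurable_fun (U : set (caratheodory_type (@lebesgue_outer R m.+1)))
    (fun x => enorm (ap_grad w x) ^+ 2).
Proof.
move=> mg; rewrite (_ : (fun x => _) = (fun x => \sum_i ap_grad w x 0 i ^+ 2)); last first.
  by apply/funext => x; rewrite enorm2 /dot; apply: eq_bigr => i _; rewrite expr2.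
by apply: measurable_sum => i; apply: measurable_funX; exact: mg.
Qed.

Lemma divsigma_bound (a : 'rV[R]_m.+1) (L d e : R) x : 0 < d ->
  `|divsigma l0 a L d e x| <= 18 / d.
Proof.
move=> d0; rewrite /divsigma /dcutoff.
have [_ /andP[s0 s1] _] := stair_bounds (e^-1 * x 0 0).
have /andP[w0 w1] := window_bounds l0 a L d (cst 0) x.
have d0' : 0 <= d^-1 by rewrite invr_ge0 ltW.
have := dplateau_bound (L / (2 * d) - 1) (a 0 0 + L / 2) (e * stair (e^-1 * x 0 0)) d0'.
set D := dplateau _ _ _ _; set S := dstair _ in s0 s1 *; set W := window _ _ _ _ _ _ in w0 w1 *.
clearbody D S W; move=> Db; rewrite (normrM (D * S)) normrM (ger0_norm s0) (ger0_norm w0).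
rewrite (_ : 18 / d = 3 * d^-1 * 6 * 1); last by ring.
by rewrite !ler_pM// ?mulr_ge0.
Qed.

Lemma divsigma_continuous (a : 'rV[R]_m.+1) (L d e : R) : 0 < e -> continuous (divsigma l0 a L d e).
Proof.
move=> e0; have [d0 [d1 [C0 C1 dE]]] := field_isC1 l0 a L d [::] e0.
have -> : divsigma l0 a L d e = (fun x => d0 0 x + d1 (lift 0 l0) x) by apply/funext => x; rewrite dE.
by move=> x; exact: (continuousD (C0.2 0 x) (C1.2 (lift 0 l0) x)).
Qed.

Context (a : 'rV[R]_m.+1) (L d e : R) (B : seq cell).
Hypotheses (d_gt0 : 0 < d) (e_gt0 : 0 < e) (ed : e <= d / 2).
Hypothesis BP : forall c, c \in B -> 0 < c.2 <= e / 32 /\ inclusion e c.1.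
Let U := open_cube a L.
Hypothesis bU : bounded_set U.
Let oU : open U. Proof. exact: open_open_cube. Qed.
Let mU : measurable (U : set (caratheodory_type (@lebesgue_outer R m.+1))).
Proof. exact: leb_open. Qed.

Local Notation sigma := (sigma0 l0 a L d e).
Local Notation dsigma := (divsigma l0 a L d e).
Local Notation ps0 := (psi0 l0 a L d e B).
Local Notation ps1 := (psi1 l0 a L d e B).
Local Notation phi0 := (fun x => sigma x + ps0 x).

Lemma cost_sum (s : seq cell) : {subset s <= B} ->
  mu.-integrable U (EFin \o (fun x => \sum_(c <- s) cell_cost l0 e c x)) /\
  \int[mu]_(x in U) (\sum_(c <- s) cell_cost l0 e c x) <= \sum_(c <- s) 2 * e * (4 * c.2) ^+ m.
Proof.
elim: s => [_|c s IH sB].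
  have -> : (fun x : 'rV[R]_m.+1 => \sum_(c <- [::]) cell_cost l0 e c x) = cst 0.
    by apply/funext => x; rewrite big_nil.
  split; first by apply: (continuous_bounded_integrable oU bU (g := cst 0)) => x; exact: cst_continuous.
  by rewrite Rintegral_cst// mul0r big_nil.
have -> : (fun x : 'rV[R]_m.+1 => \sum_(c <- c :: s) cell_cost l0 e c x) =
    (fun x => cell_cost l0 e c x + \sum_(c <- s) cell_cost l0 e c x).
  by apply/funext => x; rewrite big_cons.
have [|i1 i2] := IH; first by move=> c' c's; apply: sB; rewrite in_cons c's orbT.
have i0 := cell_cost_integrable l0 e bU c.
split; first exact: (integrableD mU i0 i1).
rewrite RintegralD// big_cons lerD//.
by apply: (cell_cost_integral l0 e_gt0 BP bU); apply: sB; exact: mem_head.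
Qed.

Lemma wave_SBV t : SBV U (wave t (a 0 0)).
Proof.
have m0 : (0 < m)%N by exact: leq_ltn_trans (leq0n _) (ltn_ord l0).
have [[_ /(_ 1%N)]] := wave_GSBV2 m0 t (a 0 0) oU bU.
rewrite truncate_le1// => x; apply: le_trans (wave_le t (a 0 0) x) _; lra.
Qed.

(** With no cells the field is straight and has the same divergence as the rerouted one. *)
Lemma wave_identity t : \int[mu]_(x in U) (wave t (a 0 0) x * dsigma x) =
  - \int[mu]_(x in U) (sigma x * dwave t (a 0 0) 0 x).
Proof.
rewrite (field_identity l0 [::] d_gt0 e_gt0 ed bU (wave_SBV t)) /jump_flux.
rewrite wave_disc set0I !Rintegral_set0 addr0 subr0; congr (- _).
rewrite [X in _ + X](_ : _ = 0) ?addr0.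
  by apply: eq_Rintegral => x _; rewrite wave_ap_grad /psi0 big_nil addr0 !mxE !eqxx mulr1.
rewrite [LHS](@eq_Rintegral _ _ _ mu _ (cst 0)) ?Rintegral_cst ?mul0r// => x _.
by rewrite /psi1 big_nil mul0r.
Qed.

(** The divergences of the straight and the rerouted field coincide, so closeness of [w] to the wave
    against this divergence bounds the straight pairing with the wave by the rerouted pairing with
    the gradient of [w], up to jumps. The factor 80 is [2 (20 + 20)]. *)
Lemma field_energy (t D h rho : R) w : 0 < t -> SBV U w -> (forall x, -1 <= w x <= 1) ->
  (dirichlet w U <= D%:E)%E -> (H (uncovered a L e B w) <= h%:E)%E ->
  `|\int[mu]_(x in U) (w x * dsigma x) - \int[mu]_(x in U) (wave t (a 0 0) x * dsigma x)| <= rho ->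
  2 * t * \int[mu]_(x in U) (sigma x * dwave t (a 0 0) 0 x) <=
  (1 + t) * D + t ^+ 2 * fine (mu U) + 162 * t * (\sum_(c <- B) 2 * e * (4 * c.2) ^+ m) +
  2 * t * rho + 80 * t * h.
Proof.
move=> t0 wS w1 wD wh wrho.
have [_ gL1 _ _] := wS.
have hfin : (H (uncovered a L e B w) < +oo)%E by exact: le_lt_trans wh (ltry _).
have h0 : fine (H (uncovered a L e B w)) <= h.
  by rewrite -lee_fin fineK// ge0_fin_numE// hausdorff_outer_ge0.
have [J0 J1] := jump_flux_bound l0 d e_gt0 BP w1 hfin.
have id := field_identity l0 B d_gt0 e_gt0 ed bU wS.
rewrite wave_identity in wrho.
have [d0 [d1 [C0 C1 _]]] := field_isC1 l0 a L d B e_gt0.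
have i0 : mu.-integrable U (EFin \o (fun x => phi0 x * ap_grad w x 0 0)).
  rewrite (_ : (fun x => _) = (fun x => ap_grad w x 0 0 * phi0 x)); last by apply/funext => x; rewrite mulrC.
  exact: (integrable_continuousM oU bU (gL1 0) (isC1_continuous C0)).
have i1 : mu.-integrable U (EFin \o (fun x => ps1 x * ap_grad w x 0 (lift 0 l0))).
  rewrite (_ : (fun x => _) = (fun x => ap_grad w x 0 (lift 0 l0) * ps1 x)); last by apply/funext => x; rewrite mulrC.
  exact: (integrable_continuousM oU bU (gL1 _) (isC1_continuous C1)).
have i2 : mu.-integrable U (EFin \o (fun x => enorm (ap_grad w x) ^+ 2)).
  apply/integrableP; split.
    apply/measurable_EFinP; apply: enorm_grad_measurable => i.
    by apply/measurable_EFinP; exact: measurable_int (gL1 i).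
  apply: le_lt_trans (ltry D); apply: le_trans wD.
  rewrite le_eqVlt; apply/orP; left; apply/eqP; apply: eq_integral => x _.
  by rewrite /= ger0_norm// sqr_ge0.
have [|i3 cost] := @cost_sum B; first by [].
have i4 : mu.-integrable U (EFin \o cst (t ^+ 2)).
  by apply: (continuous_bounded_integrable oU bU (g := cst (t ^+ 2))) => x; exact: cst_continuous.
have scale (k : R) v : mu.-integrable U (EFin \o v) -> mu.-integrable U (EFin \o (fun x => k * v x)).
  by move=> iv; exact: (integrableZl mU k iv).
have Dle : \int[mu]_(x in U) enorm (ap_grad w x) ^+ 2 <= D.
  by rewrite -lee_fin fineK//; exact: integrable_fin_num.
have A1 : 2 * t * (\int[mu]_(x in U) (phi0 x * ap_grad w x 0 0) +
    \int[mu]_(x in U) (ps1 x * ap_grad w x 0 (lift 0 l0))) <=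
    (1 + t) * D + t ^+ 2 * fine (mu U) + 162 * t * (\sum_(c <- B) 2 * e * (4 * c.2) ^+ m).
  rewrite -RintegralD// -RintegralZl//; last exact: (integrableD mU i0 i1).
  apply: (@le_trans _ _ (\int[mu]_(x in U) ((1 + t) * enorm (ap_grad w x) ^+ 2 + t ^+ 2 +
       162 * t * \sum_(c <- B) cell_cost l0 e c x))).
    apply: le_Rintegral => //.
    - exact: (scale (2 * t) _ (integrableD mU i0 i1)).
    - exact: (integrableD mU (integrableD mU (scale (1 + t) _ i2) i4) (scale (162 * t) _ i3)).
    - by move=> x _; exact: young_field.
  rewrite RintegralD//; [|exact: (integrableD mU (scale (1 + t) _ i2) i4)|exact: (scale (162 * t) _ i3)].
  rewrite RintegralD//; [|exact: (scale (1 + t) _ i2)].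
  rewrite RintegralZl// RintegralZl// Rintegral_cst//.
  apply: lerD; last by rewrite ler_pM2l// mulr_gt0.
  by rewrite lerD2r ler_pM2l// ltr_wpDl.
set I0 := \int[mu]_(x in U) (phi0 x * _) in A1 id; set I1 := \int[mu]_(x in U) (ps1 x * _) in A1 id.
set W := \int[mu]_(x in U) (w x * dsigma x) in id wrho; set S := \int[mu]_(x in U) (sigma x * _) in wrho *.
move: A1 J0 J1 wrho id; rewrite opprK; set A := _ + _ + 162 * t * _.
set j0 := jump_flux _ _ _ _ _; set j1 := jump_flux _ _ _ _ _; set hh := fine _ in h0 *.
clearbody A j0 j1 hh S W I0 I1.
rewrite !ler_norml => A1 /andP[a1 a2] /andP[a3 a4] /andP[a5 a6] id.
have : S <= I0 + I1 + rho + 40 * h by lra.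
move=> Sle; have : 2 * t * S <= 2 * t * (I0 + I1 + rho + 40 * h) by rewrite ler_pM2l// mulr_gt0.
by lra.
Qed.

Lemma truncate_lip (c : R) v w x : `|truncate c v x - truncate c w x| <= `|v x - w x|.
Proof.
rewrite /truncate; set p := v x; set q := w x.
have lip (f : R -> R -> R) y : (forall s s', s <= s' -> 0 <= f s' y - f s y <= s' - s) ->
    forall s s', `|f s y - f s' y| <= `|s - s'|.
  move=> fP s s'; have [ss|ss] := leP s s'.
    rewrite distrC [leRHS]distrC; have /andP[h1 h2] := fP _ _ ss.
    by rewrite !ger0_norm// subr_ge0.
  have /andP[h1 h2] := fP _ _ (ltW ss).
  by rewrite !ger0_norm// subr_ge0 ltW.
apply: (le_trans (lip Num.max _ _ _ _)).
  move=> s s' ss; case: (leP s (- c)); case: (leP s' (- c)) => h1 h2; apply/andP; split; lra.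
apply: lip => s s' ss; case: (leP s c); case: (leP s' c) => h1 h2; apply/andP; split; lra.
Qed.

(** The divergence is supported in the perforated set, where [us] agrees almost everywhere with the
    convergent [ut]. Truncation at 1 is 1-Lipschitz and fixes the wave. *)
Lemma field_error (Omega : set 'rV[R]_m.+1) (t r : R) (us ut : 'rV[R]_m.+1 -> R) :
  open Omega -> U `<=` Omega -> L1 U us -> L1 Omega ut ->
  mu.-integrable U (EFin \o truncate 1 us) -> mu.-integrable Omega (EFin \o wave t (a 0 0)) ->
  {ae mu, forall x, (Omega `&` dilated e) x -> ut x = us x} ->
  (\int[mu]_(x in Omega) `|ut x - wave t (a 0 0) x|%:E <= r%:E)%E ->
  `|\int[mu]_(x in U) (truncate 1 us x * dsigma x) -
    \int[mu]_(x in U) (wave t (a 0 0) x * dsigma x)| <= 18 / d * r.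
Proof.
move=> oO UO usL utL iw iu uae ur.
have cd := @divsigma_continuous a L d e e_gt0.
have iuU : mu.-integrable U (EFin \o wave t (a 0 0)) by exact: integrableS (leb_open oO) mU UO iu.
have j1 := integrable_continuousM oU bU iw cd; have j2 := integrable_continuousM oU bU iuU cd.
rewrite -RintegralB//.
have ij := integrableB mU j1 j2.
apply: le_trans (le_normr_Rintegral mU ij) _.
have itu := integrableB (leb_open oO) utL iu.
have ituU := integrableS (leb_open oO) mU UO itu.
have d18 : 0 <= 18 / d by rewrite divr_ge0// ltW.
rewrite -lee_fin fineK; last by apply: integrable_fin_num => //; exact: (integrable_norm ij).
apply: (@le_trans _ _ (\int[mu]_(x in U) ((18 / d)%:E * `|ut x - wave t (a 0 0) x|%:E))%E).
  apply: ae_ge0_le_integral.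
  - exact: mU.
  - by move=> x _; rewrite lee_fin.
  - exact: measurable_int (integrable_norm ij).
  - by move=> x _; rewrite -EFinM lee_fin mulr_ge0.
  - by apply: measurable_funeM; exact: measurable_int (integrable_norm ituU).
  case: uae => N [mN N0 sN]; exists N; split => // x nx; apply: sN => xe; apply: nx => Ux.
  rewrite -EFinM lee_fin /= -mulrBl normrM mulrC.
  have [->|ne] := eqVneq (dsigma x) 0; first by rewrite normr0 mul0r mulr_ge0.
  have Px : dilated e x.
    apply: dstair_dilated => //; apply: contra_neq ne; rewrite mulrC => h.
    by rewrite /divsigma h mulr0 mul0r.
  apply: ler_pM => //; first exact: divsigma_bound.
  have -> : truncate 1 us x = truncate 1 ut x by rewrite /truncate (xe (conj (UO _ Ux) Px)).
  have {1}-> : wave t (a 0 0) x = truncate 1 (wave t (a 0 0)) x.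
    by rewrite (@truncate_le1 _ _ (wave t (a 0 0)) _ 1%N)// => y; apply: le_trans (wave_le _ _ _) _; lra.
  exact: truncate_lip.
have mtu := measurable_int mu (integrable_norm ituU).
have n0 x : U x -> (0 <= `|ut x - wave t (a 0%R 0%R) x|%:E)%E by rewrite lee_fin.
rewrite (@ge0_integralZl_EFin _ _ _ mu U mU _ n0 mtu (18 / d) d18) (EFinM (18 / d) r).
apply: lee_wpmul2l; first by rewrite lee_fin.
apply: le_trans ur; apply: ge0_subset_integral.
- exact: mU.
- exact: leb_open.
- exact: measurable_int (integrable_norm itu).
- by move=> x _; rewrite lee_fin.
- exact: UO.
Qed.

End key_estimate.

(** The bookkeeping of constants, [M] standing for [4 ^ m]: 324 is [162 * 2], 648 is twice that
    through [e * hI <= 2 / l * c], and 36 is [2 * 18] from the bound on the divergence. *)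
Lemma energy_balance {R : realType} (t K M l D h z c e tau rho d I0 S0 X Y u d' hI : R) :
  0 < t -> 0 < K -> 0 < l -> 0 < M -> 0 < d -> 0 <= D -> 0 <= h -> 0 <= z -> D + h + z < c ->
  t * (1 - d') * Y <= I0 ->
  2 * t * I0 <= (1 + t) * D + t ^+ 2 * u + 162 * t * S0 + 2 * t * (18 / d * rho) +
    80 * t * (h + tau) ->
  S0 <= 2 * M * K * (e * hI) + 2 * M * K * e -> u <= X -> e * hI <= 2 / l * c ->
  2 * t * (t * (1 - d') * Y) <= c + t ^+ 2 * X + t * c * (80 + 648 * M * K / l) +
    324 * M * K * t * e + 36 / d * t * rho + 80 * t * tau.
Proof.
move=> t0 K0 l1 M0 d0 D0 h0 z0 Ec low FE Sle uX ehI.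
have F1 : 2 * t * (t * (1 - d') * Y) <= 2 * t * I0 by rewrite ler_pM2l// mulr_gt0.
have F2 : 162 * t * S0 <= 162 * t * (2 * M * K * (2 / l * c) + 2 * M * K * e).
  rewrite ler_pM2l ?mulr_gt0//; apply: le_trans Sle _; rewrite lerD2r ler_pM2l// !mulr_gt0//.
have F3 : t ^+ 2 * u <= t ^+ 2 * X by rewrite ler_wpM2l// sqr_ge0.
have F4 : (1 + t) * D + 80 * t * h <= c + 80 * t * c.
  have h1 : t * D + t * h <= t * c by rewrite -mulrDr ler_pM2l//; lra.
  have h2 : 0 <= t * D by rewrite mulr_ge0// ltW.
  by lra.
have F5 : 162 * t * (2 * M * K * (2 / l * c) + 2 * M * K * e) =
    t * c * (648 * M * K / l) + 324 * M * K * t * e by field; exact: lt0r_neq0.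
have F6 : 2 * t * (18 / d * rho) = 36 / d * t * rho by field; exact: lt0r_neq0.
by rewrite F5 in F2; rewrite F6 in FE; rewrite (mulrDr (t * c)); lra.
Qed.

(** * Lower estimate for a single competitor *)

Section lower_bound.
Context (R : realType) (m : nat) (m_gt0 : (0 < m)%N).
Local Notation cell := ('rV[R]_m.+1 * R)%type.
Local Notation mu := (leb R m.+1).
Local Notation H := (@hausdorff_outer R m.+1 m).

Lemma bernoulli (x : R) n : 0 <= x <= 1 -> 1 - n%:R * x <= (1 - x) ^+ n.
Proof.
move=> /andP[x0 x1]; elim: n => [|n IH]; first by rewrite mul0r subr0 expr0.
rewrite exprS -natr1 mulrDl mul1r.
have h : (1 - x) * (1 - n%:R * x) <= (1 - x) * (1 - x) ^+ n by rewrite ler_wpM2l// subr_ge0.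
have : 0 <= x * (n%:R * x) by rewrite !mulr_ge0.
by lra.
Qed.

(** On the inner cube of side [L - 6 d] the straight field is 1; elsewhere the integrand is
    nonnegative. *)
Lemma sigma_wave_integral (l0 : 'I_m) (a : 'rV[R]_m.+1) (L d e t d' : R) :
  0 < d -> 0 < e -> e <= d / 2 -> 6 * d <= L -> 0 < t -> d' <= 1 ->
  bounded_set (open_cube a L) ->
  (forall x : 'rV[R]_m.+1, open_cube a L x -> 1 - d' <= cos (2 * t * (x 0 0 - a 0 0))) ->
  t * (1 - d') * (L - 6 * d) ^+ m.+1 <=
  \int[mu]_(x in open_cube a L) (sigma0 l0 a L d e x * dwave t (a 0 0) 0 x).
Proof.
move=> d0 e0 ed dL t0 d'1 bU cosU; have oU := @open_open_cube R m a L.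
have [s0 [s1 [C0 _ _]]] := field_isC1 l0 a L d [::] e0.
have cs : continuous (sigma0 l0 a L d e).
  rewrite (_ : sigma0 l0 a L d e = (fun x => sigma0 l0 a L d e x + psi0 l0 a L d e [::] x)).
    exact: isC1_continuous C0.
  by apply/funext => x; rewrite /psi0 big_nil addr0.
have [_ cdw] := @isC1_wave R m t (a 0 0).
have cF : continuous (fun x => sigma0 l0 a L d e x * dwave t (a 0 0) 0 x).
  by move=> x; exact: (continuousM (cs x) (cdw 0 x)).
pose p := a + const_mx (3 * d); pose q := a + const_mx (L - 3 * d).
have pq i : p 0 i <= q 0 i by rewrite !mxE; lra.
have sub : box p q `<=` open_cube a L.
  by move=> x xpq i; have := xpq i; rewrite !mxE => /andP[h1 h2]; apply/andP; split; lra.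
have mb := @leb_box R m.+1 p q.
have iF := continuous_bounded_integrable oU bU cF.
have iF' := integrableS (leb_open oU) mb sub iF.
apply: (@le_trans _ _ (\int[mu]_(x in box p q) (sigma0 l0 a L d e x * dwave t (a 0 0) 0 x))); last first.
  apply: fine_le; [exact: integrable_fin_num|by apply: integrable_fin_num => //; exact: leb_open|].
  apply: ge0_subset_integral; [exact: mb|exact: leb_open|exact: measurable_int iF| |exact: sub].
  move=> x Ux; rewrite lee_fin mulr_ge0//.
    by have /andP[] := sigma0_bounds l0 a L d e x.
  rewrite /dwave eqxx mulr1 mulr_ge0 ?(ltW t0)//.
  by apply: le_trans (cosU x Ux); rewrite subr_ge0.
have -> : t * (1 - d') * (L - 6 * d) ^+ m.+1 = \int[mu]_(x in box p q) (t * (1 - d')).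
  rewrite Rintegral_cst// [X in _ * fine X]lebesgue_outer_box// /= /vol (eq_bigr (fun=> L - 6 * d)).
    by rewrite prodr_const card_ord.
  by move=> i _; rewrite !mxE; ring.
apply: le_Rintegral => //.
- by apply: (@continuous_box_integrable _ _ (cst (t * (1 - d')))) => x; exact: cst_continuous.
- move=> x xpq; rewrite (sigma0_eq1 l0 d0 e0 ed) ?mul1r; last first.
    by move=> i; have := xpq i; rewrite !mxE => /andP[h1 h2]; apply/andP; split; lra.
  by rewrite /dwave eqxx mulr1 ler_pM2l//; apply: cosU; exact: sub.
Qed.

Variables (K : R).
Hypothesis K_gt0 : 0 < K.
Hypothesis cover : forall (S : set 'rV[R]_m.+1) (d e : R), (H S < +oo)%E -> 0 < d -> 0 < e ->
  exists B : seq cell, [/\ forall c, c \in B -> S c.1 /\ 0 < c.2 <= d,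
    \sum_(c <- B) c.2 ^+ m <= K * (fine (H S) + 1) &
    (H (S `\` [set x | exists2 c, c \in B &
       box (c.1 - const_mx c.2) (c.1 + const_mx c.2) x]) <= e%:E)%E].

Lemma energy_lt_parts (x y z : \bar R) (b c : R) : 0 < b -> (0 <= x)%E -> (0 <= y)%E -> (0 <= z)%E ->
  (x + y + b%:E * z < c%:E)%E ->
  exists x' y' z' : R, [/\ x = x'%:E, y = y'%:E, z = z'%:E, [/\ 0 <= x', 0 <= y' & 0 <= z'] &
    x' + y' + b * z' < c].
Proof.
move=> b0; case: x => [x| |]//; case: y => [y| |]//; case: z => [z| |]//.
  rewrite !lee_fin => x0 y0 z0; rewrite -EFinM -!EFinD lte_fin => h.
  by exists x, y, z; split.
all: by rewrite ?gt0_muley ?lte_fin//.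
Qed.

(** The competitor is truncated at 1, which increases neither gradients nor cracks. The energy bound
    [c] and [beta e >= l e / 2] give [e * hI <= 2 c / l] for the area [hI] of the cracks in the
    inclusions, so the detours spoil a volume of order [c / l]. The pairing with the field then
    costs only [t] times that. *)
Lemma energy_estimate (Omega : set 'rV[R]_m.+1) (beta : R -> R) (a : 'rV[R]_m.+1)
    (L d e t d' r tau c l : R) (us ut : 'rV[R]_m.+1 -> R) (U := open_cube a L) :
  open Omega -> bounded_set Omega -> U `<=` Omega ->
  0 < d -> 0 < e -> e <= d / 2 -> 6 * d <= L -> 0 < t -> d' <= 1 -> 0 < tau -> 0 < l ->
  l / 2 * e <= beta e -> 0 <= c ->
  (forall x : 'rV[R]_m.+1, U x -> 1 - d' <= cos (2 * t * (x 0 0 - a 0 0))) ->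
  L1 Omega us -> L1 Omega ut ->
  {ae mu, forall x, (Omega `&` dilated e) x -> ut x = us x} ->
  (\int[mu]_(x in Omega) `|ut x - wave t (a 0 0) x|%:E <= r%:E)%E ->
  (energy beta e us U < c%:E)%E ->
  2 * t * (t * (1 - d') * (L - 6 * d) ^+ m.+1) <=
    c + t ^+ 2 * L ^+ m.+1 + t * c * (80 + 648 * 4 ^+ m * K / l) +
    324 * 4 ^+ m * K * t * e + 36 / d * t * r + 80 * t * tau.
Proof.
move=> oO bO UO d0 e0 ed dL t0 d'1 tau0 l1 be c0 cosU usL utL uae ur.
have oU : open U by exact: open_open_cube.
have bU : bounded_set U by exact: bounded_setS UO bO.
have L0 : 0 <= L by lra.
rewrite /energy; case: asboolP => [[[usU trunc] grad2 Hfin]|_]; last by rewrite ltNge leey.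
have b0 : 0 < beta e by apply: lt_le_trans be; rewrite mulr_gt0// divr_gt0.
have dir0 : (0 <= dirichlet us U)%E.
  by apply: integral_ge0 => x _; rewrite lee_fin sqr_ge0.
move=> /(energy_lt_parts b0 dir0 (hausdorff_outer_ge0 _ _) (hausdorff_outer_ge0 _ _)).
move=> [D [hP [hI [DE hPE hIE [D0 hP0 hI0] Ec]]]].
pose w := truncate 1 us; have wS : SBV U w by have := trunc 1%N.
have w1 x : -1 <= w x <= 1 by exact: truncate_bounds.
have [[wL _] gL1 _ _] := wS.
have dw : disc w `<=` disc us by exact: disc_truncate.
have wD : (dirichlet w U <= D%:E)%E.
  rewrite -DE; apply: ge0_le_integral.
  - exact: leb_open.
  - by move=> x _; rewrite lee_fin sqr_ge0.
  - apply/measurable_EFinP; apply: enorm_grad_measurable => i.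
    by apply/measurable_EFinP; exact: measurable_int (gL1 i).
  - by apply/measurable_EFinP; apply: enorm_grad_measurable => i; have [] := grad2 i.
  - move=> x _; rewrite lee_fin.
    by apply: lerXn2r; [exact: enorm_ge0|exact: enorm_ge0|exact: ap_grad_truncate].
pose S := disc w `&` (U `\` dilated e).
have HS : (H S <= hI%:E)%E.
  rewrite -hIE; apply: (@le_hausdorff_outer R m.+1 m) => x [dx Ux]; split => //; exact: dw.
have HSfin : (H S < +oo)%E by exact: le_lt_trans HS (ltry _).
have e32 : 0 < e / 32 by rewrite divr_gt0.
(* Cells of radius at most [e / 32] have bumps that fit in the clearance of the detours. *)
have [B [BS Bsum Btail]] := cover HSfin e32 tau0.
have BP c' : c' \in B -> 0 < c'.2 <= e / 32 /\ inclusion e c'.1.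
  by move=> /BS[[_ [_ nP]] h]; split => //; exact: not_dilated.
have unc : (H (uncovered a L e B w) <= (hP + tau)%:E)%E.
  apply: le_trans (@hausdorff_outerU R m.+1 m _ _) _; rewrite EFinD; apply: leeD => //.
  rewrite -hPE; apply: (@le_hausdorff_outer R m.+1 m) => x [dx Ux]; split => //; exact: dw.
pose l0 : 'I_m := Ordinal m_gt0.
have usU' : mu.-integrable U (EFin \o us) by exact: usU.
have iu : mu.-integrable Omega (EFin \o wave t (a 0 0)).
  by apply: continuous_bounded_integrable => //; exact: (isC1_continuous (isC1_wave t (a 0 0))).
have err := field_error l0 d0 e0 bU oO UO usU' utL wL iu uae ur.
have FE := field_energy d0 e0 ed BP bU t0 wS w1 wD unc err.
have low := sigma_wave_integral l0 d0 e0 ed dL t0 d'1 bU cosU.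
have Sle : \sum_(c <- B) 2 * e * (4 * c.2) ^+ m <= 2 * 4 ^+ m * K * (e * hI) + 2 * 4 ^+ m * K * e.
  rewrite (eq_bigr (fun c => 2 * e * 4 ^+ m * c.2 ^+ m)); last first.
    by move=> c' _; rewrite exprMn mulrA.
  rewrite -mulr_sumr (_ : _ + _ = 2 * e * 4 ^+ m * (K * (hI + 1))); last by ring.
  rewrite ler_pM2l ?mulr_gt0 ?exprn_gt0//; apply: le_trans Bsum _; rewrite ler_pM2l// lerD2r.
  by rewrite -lee_fin fineK// ge0_fin_numE// hausdorff_outer_ge0.
have muU : fine (mu U) <= L ^+ m.+1 by exact: cube_volume.
have ehI : e * hI <= 2 / l * c.
  have bhI : l / 2 * e * hI <= c.
    apply: (@le_trans _ _ (beta e * hI)); first by rewrite ler_wpM2r.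
    by apply: le_trans (ltW Ec); rewrite lerDr addr_ge0.
  have := ler_wpM2l (_ : 0 <= 2 / l) bhI; rewrite divr_ge0 ?(ltW l1)// => /(_ isT).
  by rewrite (_ : 2 / l * (l / 2 * e * hI) = e * hI)//; field; exact: lt0r_neq0.
set M := 4 ^+ m in Sle *; have M0 : 0 < M by rewrite exprn_gt0.
apply: energy_balance t0 K_gt0 l1 M0 d0 D0 hP0 _ Ec low FE Sle muU ehI.
by rewrite mulr_ge0// ltW.
Qed.

End lower_bound.

(** * Conclusion *)

(** With [T = t^2 V] the left-hand side is at most [(2 - s + 5 s / 16) T] and the right-hand side at
    least [(2 - s / 4) T]. *)
Lemma small_balance {R : realType} (s t G V Y X : R) : 0 < s -> s <= 1 -> 0 < t -> 0 <= G -> 0 < V ->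
  t * (81 + G) = s / 8 -> (1 - s / 16) * V <= Y -> X <= s / 16 * (t ^+ 2 * V) ->
  (1 - s) * (t ^+ 2 * V) + t ^+ 2 * V + t * ((1 - s) * (t ^+ 2 * V)) * (80 + G) + X +
    s / 16 * (t ^+ 2 * V) + s / 16 * (t ^+ 2 * V) < 2 * t * (t * (1 - s / 16) * Y).
Proof.
move=> s0 s1 t0 G0 V0 tG VY XT.
have T0 : 0 < t ^+ 2 * V by rewrite mulr_gt0// exprn_gt0.
have h : 0 <= 2 * t * (t * (1 - s / 16)) by rewrite !mulr_ge0//; lra.
have E5 := ler_wpM2l h VY.
have E6 : t * ((1 - s) * (t ^+ 2 * V)) * (80 + G) <= s / 8 * (t ^+ 2 * V).
  have : t * (80 + G) * (1 - s) <= s / 8 * 1.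
    apply: ler_pM; [| |rewrite -tG ler_pM2l//|]; try lra.
    by rewrite mulr_ge0//; lra.
  by rewrite mulr1 -(ler_pM2r T0); lra.
have sT : s ^+ 2 * (t ^+ 2 * V) >= 0 by rewrite mulr_ge0 ?sqr_ge0// ltW.
have s1T : 0 < s * (t ^+ 2 * V) by rewrite mulr_gt0.
lra.
Qed.

(** * The lower bound from small gradients *)

Section small_gradients.
Context (R : realType) (m : nat) (m_gt0 : (0 < m)%N).
Variables (Omega : set 'rV[R]_m.+1) (beta : R -> R) (l : R) (eps : nat -> R).
Variables (f : 'rV[R]_m.+1 -> R) (g : R * 'rV[R]_m.+1 -> R).
Hypotheses (Omega_neq0 : Omega !=set0) (Omega_open : open Omega).
Hypotheses (Omega_bounded : bounded_set Omega).
Hypothesis beta_ratio : beta e / e @[e --> 0^'+] --> l.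
Hypothesis l_gt0 : 0 < l.
Hypotheses (eps_gt0 : forall k, 0 < eps k) (eps_cvg0 : eps k @[k --> \oo] --> 0).
Hypothesis fg_hom : homogenized_densities Omega beta eps f g.
Hypothesis f_hom : two_homogeneous f.
Local Notation mu := (leb R m.+1).

(** If the energy dropped below [c1 t^2 V] at some small [eps k], the estimate would give
    [2 t^2 V <= (1 + c1 + small) t^2 V]. Homogeneity lets [t] be as small as the gap [1 - c1]
    requires. *)
Lemma lower_bound (c1 : R) : 0 < c1 < 1 -> c1 <= f (Defs.basis 0).
Proof.
move=> /andP[c10 c11]; pose s := 1 - c1; have s0 : 0 < s by rewrite subr_gt0.
have s1 : s <= 1 by rewrite /s; lra.
have c1E : c1 = 1 - s by rewrite /s; ring.
have [K K0 cover] := @hausdorff_cover R m m_gt0.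
pose G := 648 * 4 ^+ m * K / l.
have M0 : 0 < 4 ^+ m :> R by exact: exprn_gt0.
have n648 : 0 < 648 :> R by rewrite ltr0n.
have n324 : 0 < 324 :> R by rewrite ltr0n.
have G0 : 0 < G by exact (divr_gt0 (mulr_gt0 (mulr_gt0 n648 M0) K0) l_gt0).
(* [G] is the coefficient produced by the detours, 80 that of the uncovered cracks; [t] keeps their
   joint contribution below [s / 8] of [T]. *)
pose t := s / (8 * (81 + G)).
have t0 : 0 < t by rewrite divr_gt0// mulr_gt0// ltr_wpDl// ltW.
have tG : t * (81 + G) = s / 8 by rewrite /t; field; lra.
have s16 : 0 < s / 16 by rewrite divr_gt0.
have s161 : s / 16 <= 1 by rewrite ler_pdivrMr// mul1r; apply: le_trans s1 _; rewrite ler1n.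
have [a [L [L0 L_le1 aO acos]]] := small_cube Omega_neq0 Omega_open t0 s16.
pose U := open_cube a L; have oU : open U by exact: open_open_cube.
have UO : U `<=` Omega.
  by move=> x Ux; apply: aO => i; have /andP[/ltW-> /ltW->] := Ux i.
have bU : bounded_set U by exact: bounded_setS UO Omega_bounded.
have Ucos x : U x -> 1 - s / 16 <= cos (2 * t * (x 0 0 - a 0 0)).
  by move=> Ux; apply/ltW/acos => i; have /andP[/ltW-> /ltW->] := Ux i.
pose V := L ^+ m.+1; have V0 : 0 < V by rewrite exprn_gt0.
pose T := t ^+ 2 * V; have T0 : 0 < T by rewrite mulr_gt0// exprn_gt0.
pose n1 : R := m.+1%:R; have n10 : 0 < n1 by rewrite ltr0n.
have n11 : 1 <= n1 by rewrite ler1n.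
(* By Bernoulli's inequality this margin loses at most the fraction [s / 16] of the volume. *)
pose z := s / (16 * n1); have z0 : 0 < z by rewrite divr_gt0// mulr_gt0.
have z1 : z <= 1.
  by rewrite ler_pdivrMr ?mulr_gt0// mul1r; apply: le_trans s1 _; rewrite mulr_ege1// ler1n.
pose d := z * L / 6; have d0 : 0 < d by rewrite divr_gt0// mulr_gt0.
have d6 : 6 * d = z * L by rewrite /d; field.
have dL : 6 * d <= L by rewrite d6 ler_piMl// ltW.
have low : (1 - s / 16) * V <= (L - 6 * d) ^+ m.+1.
  rewrite d6 (_ : L - z * L = (1 - z) * L); last by ring.
  rewrite exprMn ler_pM2r//.
  apply: le_trans (bernoulli m.+1 _); last by rewrite (ltW z0) z1.
  rewrite (_ : m.+1%:R * z = s / 16)// /z -/n1; field; exact: lt0r_neq0.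
have [_ _ /(_ (wave t (a 0 0)) U (wave_GSBV2 m_gt0 t (a 0 0) Omega_open Omega_bounded) oU UO)[infE _]] := fg_hom.
have [[_ f0] _ _] := fg_hom.
rewrite (wave_hom_energy g t (a 0 0) f_hom oU bU) in infE.
set I := \int[mu]_(x in U) _ in infE.
have IT : I <= T.
  apply: (@le_trans _ _ (t ^+ 2 * fine (mu U))); last first.
    by rewrite ler_wpM2l ?sqr_ge0// cube_volume// ltW.
  have mU : measurable (U : set (caratheodory_type (@lebesgue_outer R m.+1))) by exact: leb_open.
  rewrite /I -Rintegral_cst//; apply: le_Rintegral => //.
  - exact: continuous_bounded_integrable oU bU (@dwave2_continuous _ _ t (a 0 0)).
  - exact: (continuous_bounded_integrable oU bU (fun x => @cst_continuous _ _ (t ^+ 2) x)).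
  - move=> x _; rewrite /dwave eqxx mulr1 exprMn; set y := 2 * t * _.
    by rewrite ler_piMr ?sqr_ge0// -(cos2Dsin2 y) lerDl sqr_ge0.
pose u := wave t (a 0 0) : 'rV[R]_m.+1 -> R.
suff H : ((c1 * T)%:E <= energy_inf Omega beta eps u U)%E.
  rewrite /u infE lee_fin in H; rewrite -(ler_pM2r T0); apply: le_trans H _.
  by rewrite ler_wpM2l.
apply: le_ereal_inf_tmp => _ [us [usL [ut [utL uae ucvg]]] <-].
apply: limn_einf_ge_near.
have sT0 : 0 < s / 16 * T by exact: mulr_gt0.
(* [tau], [r] and [e1] make the remaining three error terms at most [s / 16 * T] each. *)
pose tau := s / 16 * T / (80 * t).
have tau0 : 0 < tau by rewrite divr_gt0// mulr_gt0.
pose r := s / 16 * T / (36 / d * t).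
have r0 : 0 < r by apply: divr_gt0 => //; apply: mulr_gt0 => //; exact: divr_gt0.
pose e1 := s / 16 * T / (324 * 4 ^+ m * K * t).
have N0 : 0 < 324 * 4 ^+ m * K * t by exact (mulr_gt0 (mulr_gt0 (mulr_gt0 n324 M0) K0) t0).
have e10 : 0 < e1 by exact: divr_gt0.
have d2 : 0 < d / 2 by rewrite divr_gt0.
have l2 : 0 < l / 2 by rewrite divr_gt0.
near=> k.
have ek1 : eps k < e1 by near: k; exact: eps_small.
have ek2 : eps k < d / 2 by near: k; exact: eps_small.
have bk : `|l - beta (eps k) / eps k| < l / 2 by near: k; exact: beta_near.
have be : l / 2 * eps k <= beta (eps k).
  by rewrite -ler_pdivlMr//; move: bk; rewrite ltr_norml => /andP[_]; rewrite ltrBlDr -ltrBlDl {1}(splitr l) addrK => /ltW.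
have ur : (\int[mu]_(x in Omega) `|ut k x - u x|%:E <= r%:E)%E.
  near: k; move/fine_cvgP : ucvg => [fin /cvgrPdist_lt/(_ r r0)].
  apply: filterS2 fin => k kfin; rewrite sub0r normrN /= => kr.
  by rewrite -(fineK kfin) lee_fin; apply: le_trans (ler_norm _) (ltW kr).
rewrite leNgt; apply/negP => Elt.
have c1T : 0 <= c1 * T by rewrite mulr_ge0// ltW.
have := energy_estimate m_gt0 K0 cover Omega_open Omega_bounded UO d0 (eps_gt0 k) (ltW ek2) dL t0
  s161 tau0 l_gt0 be c1T Ucos (usL k) (utL k) (uae k) ur Elt.
have E1 : 324 * 4 ^+ m * K * t * eps k <= s / 16 * T.
  by move: ek1; rewrite (ltr_pdivlMr _ _ N0) mulrC => /ltW.
have E2 : 36 / d * t * r = s / 16 * T.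
  by rewrite /r; field; rewrite !gt_eqF.
have E3 : 80 * t * tau = s / 16 * T.
  by rewrite /tau; field; rewrite !gt_eqF.
rewrite -/G -/V -/T E2 E3 c1E leNgt => /negP; apply.
exact: small_balance s0 s1 t0 (ltW G0) V0 tG low E1.
Unshelve. all: by end_near. Qed.

End small_gradients.

Theorem corollary6p11 (R : realType) (n : nat) (n_ge2 : (2 <= n)%N)
  (Omega : set 'rV[R]_n)
  (Omega_neq0 : Omega !=set0) (Omega_open : open Omega)
  (Omega_bounded : bounded_set Omega) (Omega_lip : lipschitz_boundary Omega)
  (beta : R -> R) (l : R)
  (beta_bounds : forall e, 0 < e -> 0 < beta e <= 1)
  (beta_mono : forall e1 e2, 0 < e1 -> e1 <= e2 -> beta e1 <= beta e2)
  (beta_cvg0 : beta e @[e --> 0^'+] --> 0)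
  (beta_ratio : beta e / e @[e --> 0^'+] --> l)
  (l_gt0 : 0 < l)
  (eps : nat -> R) (eps_gt0 : forall k, 0 < eps k)
  (eps_decr : nonincreasing_seq eps) (eps_cvg0 : eps k @[k --> \oo] --> 0)
  (f : 'rV[R]_n -> R) (g : R * 'rV[R]_n -> R)
  (fg_hom : homogenized_densities Omega beta eps f g) :
  ~ two_homogeneous f.
Proof.
move=> f_hom; case: n n_ge2 Omega Omega_neq0 Omega_open Omega_bounded Omega_lip f g fg_hom f_hom => [//|m].
rewrite ltnS => m_gt0 Omega O0 oO bO _ f g fg_hom f_hom.
have beta_ge0 e : 0 < e -> 0 <= beta e by move=> /beta_bounds/andP[/ltW].
have [c c0 fc] := upper_bound m_gt0 O0 oO bO beta_ge0 beta_ratio l_gt0 eps_gt0 eps_cvg0 fg_hom f_hom.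
(* With [f <= 1 - c] this gives [c <= 1], so [1 - c / 2] lies strictly between 0 and 1 and the lower
   bound applies to it. *)
have f0 : 0 <= f (Defs.basis 0) by have [[_ h] _ _] := fg_hom; exact: h.
have : 1 - c / 2 <= f (Defs.basis 0).
  by apply: (lower_bound m_gt0 O0 oO bO beta_ratio l_gt0 eps_gt0 eps_cvg0 fg_hom f_hom); apply/andP; split; lra.
by lra.
Qed.
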